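(* For each real $\beta>1$, the function $F_\beta(s)=\sum_{n=1}^\infty d_\beta(n)n^{-s}$ has a meromorphic continuation to the half-plane $\Re(s)>0$, with a double pole at $s=1$ with Laurent expansion \[ F_\beta(s) = \frac{\beta - 1}{2\log \beta}(s-1)^{-2} + \biggl(\frac{\beta-1}{2\log \beta} \log(2\pi) - \frac{\beta+1}{4}\biggr) (s-1)^{-1} +O(1) \] and simple poles at $s=1+2\pi i m/\log \beta$ for $m\in\mathbb{Z}$, $m\neq 0$, with residue \[ \operatorname{Res}\Bigl(F_\beta(s),s=1+\tfrac{2\pi i m}{\log \beta}\Bigr) = -\frac{\beta-1}{2\pi i m}\,\zeta\Bigl(\tfrac{2\pi i m}{\log \beta} \Bigr). \]
   Context: $\zeta$ is the Riemann zeta function. For real $\beta>1$ define coefficients $c_\beta(k)=-\frac{\beta-1}{2\pi i k}\bigl(1+\frac{2\pi i k}{\log\beta}\bigr)^{-1}\zeta\bigl(\frac{2\pi i k}{\log\beta}\bigr)$ for $k\in\mathbb{Z}\setminus\{0\}$ and $c_\beta(0)=\frac{\beta-1}{2\log\beta}(\log 2\pi-1)-\frac{\beta+1}{4}$, and the function $h_\beta(x)=\sum_{k=-\infty}^\infty c_\beta(k)e^{2\pi i k x}$ for $x\in\mathbb{R}$ (this series converges absolutely). For positive integers $n$ define $S_\beta(n)=\frac{\beta-1}{2\log\beta}n\log n + h_\beta\bigl(\frac{\log n}{\log\beta}\bigr)n$ and $d_\beta(n)=S_\beta(n+1)-S_\beta(n)$. (For integer $\beta=b\geq 2$ these agree with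 the cumulative base-$b$ digit sum $\sum_{m=1}^{n-1}(\text{digit sum of } m)$ and the base-$b$ digit sum, respectively.) *)

(* Defs.v *)
From Stdlib Require Import Reals ZArith ClassicalEpsilon.
From Coquelicot Require Import Coquelicot.
Open Scope R_scope.

Definition Cexp (z : C) : C :=
  (exp (Re z) * cos (Im z), exp (Re z) * sin (Im z)).

(* n^s for n >= 1, with the real logarithm of n. *)
Definition nat_cpow (n : nat) (s : C) : C := Cexp (s * ln (INR n))%C.

(* The Dirichlet series of a at s sums to l.  The term of index n of the
   series is a (n+1) (n+1)^(-s), so the value a 0 plays no role. *)
Definition is_dirichlet_series (a : nat -> C) (s l : C) : Prop :=
  is_series (K := C_AbsRing) (V := C_NormedModule)
    (fun n : nat => (a (n + 1)%nat * nat_cpow (n + 1) (- s))%C) l.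

Definition C_differentiable (f : C -> C) (z : C) : Prop :=
  ex_derive (K := C_AbsRing) (V := C_NormedModule) f z.

Definition holomorphic_at (f : C -> C) (z : C) : Prop :=
  locally z (C_differentiable f).

(* Pole of order exactly n; the value of f at z0 itself is irrelevant. *)
Definition pole_of_order (f : C -> C) (z0 : C) (n : nat) : Prop :=
  (0 < n)%nat /\
  exists g : C -> C,
    holomorphic_at g z0 /\ g z0 <> RtoC 0 /\
    locally' z0 (fun s : C => f s = (g s / (s - z0) ^ n)%C).

Definition is_pole (f : C -> C) (z0 : C) : Prop :=
  exists n : nat, pole_of_order f z0 n.

Definition meromorphic_on (D : C -> Prop) (f : C -> C) : Prop :=
  forall z : C, D z -> holomorphic_at f z \/ is_pole f z.

(* The coefficient of (s - z0)^(-1) in the Laurent expansion at z0 with finite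
   principal part: a j is the coefficient of (s - z0)^(-(j+1)). *)
Definition is_residue (f : C -> C) (z0 r : C) : Prop :=
  exists (n : nat) (a : nat -> C) (g : C -> C),
    holomorphic_at g z0 /\ a 0%nat = r /\
    locally' z0 (fun s : C =>
      f s = (sum_n (fun j : nat => a j / (s - z0) ^ (j + 1)) n + g s)%C).

Definition is_riemann_zeta (Z : C -> C) : Prop :=
  (forall s : C, 1 < Re s ->
     is_dirichlet_series (fun _ : nat => RtoC 1) s (Z s)) /\
  (forall s : C, s <> RtoC 1 -> C_differentiable Z s).

(* The analytic continuation of sum n^(-s) to C \ {1}, which is unique by the
   identity theorem.  The value at s = 1 is unspecified. *)
Definition riemann_zeta : C -> C :=
  epsilon (inhabits (fun _ : C => RtoC 0)) is_riemann_zeta.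

(* Sum of a convergent complex series. *)
Definition CSeries (a : nat -> C) : C :=
  (Series (fun n : nat => Re (a n)), Series (fun n : nat => Im (a n))).

(* Sum over all integers: nonnegative indices, then -1, -2, ... *)
Definition ZSeries (a : Z -> C) : C :=
  (CSeries (fun n : nat => a (Z.of_nat n)) +
   CSeries (fun n : nat => a (- Z.of_nat (n + 1))%Z))%C.

(* 2 pi i k / log beta *)
Definition tau (beta : R) (k : Z) : C :=
  (2 * PI * Ci * IZR k / ln beta)%C.

Definition c_beta (beta : R) (k : Z) : C :=
  if Z.eq_dec k 0 then
    RtoC ((beta - 1) / (2 * ln beta) * (ln (2 * PI) - 1) - (beta + 1) / 4)
  else
    (- ((beta - 1) / (2 * PI * Ci * IZR k)) * / (1 + tau beta k)
     * riemann_zeta (tau beta k))%C.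

Definition h_beta (beta x : R) : C :=
  ZSeries (fun k : Z => (c_beta beta k * Cexp (2 * PI * Ci * IZR k * x))%C).

Definition S_beta (beta : R) (n : nat) : C :=
  (((beta - 1) / (2 * ln beta) * INR n * ln (INR n))%R
   + h_beta beta (ln (INR n) / ln beta) * INR n)%C.

Definition d_beta (beta : R) (n : nat) : C :=
  (S_beta beta (n + 1) - S_beta beta n)%C.

(* Main.v *)
Require Import Defs.
From Stdlib Require Import Reals ZArith Znumtheory Lra Lia Psatz Classical ClassicalEpsilon.
From Coquelicot Require Import Coquelicot.
Open Scope R_scope.

(** The Fourier series [h_beta] is summed in closed form.  With [saw2] the periodic primitive of the
    sawtooth, the function [x -> sum_j saw2 (b^(x+j)) / b^(x+j)], corrected by an elementary term, is
    1-periodic and Hoelder of every exponent below 1; by Stirling's formula and the Euler-Maclaurin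
    expression of zeta its Fourier coefficients are the [c_beta b k], so by Dini's criterion it is
    [h_beta].  Thus [S_beta b n] is the restriction to the integers of a function [S] of a real
    variable with [S (x + 1) - S x = O(x^e)] for every [e > 0].  Abel summation gives
    [F s = - S 1 + s * G s + s * int_1^oo S x * x^(-s-1) dx], where [G] is holomorphic for [0 < Re s];
    by periodicity the integral equals
    [A / (s - 1)^2 + log b * int_0^1 h_beta u * b^(u(1-s)) du / (1 - b^(1-s))].
    At the zero [1 + 2 pi i m / log b] of the denominator the numerator is the Fourier coefficient
    [c_beta b m], whence the residues.  The poles with [m <> 0] are genuine because zeta has no zero on
    the imaginary axis, which follows from [3 + 4 cos + cos 2 >= 0] on the line [Re s = 1] and the
    functional equation. *)

(** Unfolding suggests the closed form: with x = b^(u + j), the integrals over [0, 1] of the terms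
    of the sum against a character of frequency k are consecutive pieces of one integral of [saw2 x]
    times x^(-2 - [tau b k]) over [1, oo), the one in the Euler-Maclaurin formula for zeta at
    [tau b k]. Identifying [h_beta] in this direction asks for no bound on zeta along the imaginary
    axis. Regularity also fixes the half-plane: a Hoelder exponent 1 - e of the sum gives increments
    of size x^e, hence a Mellin integral that converges for Re s > e, and e is any positive number.
    The other obstacle is that [riemann_zeta] is merely chosen by a specification. A solution on the
    whole punctured plane must be built before anything is known about the chosen function, and an
    identity theorem must compare the two; since [tau b k] is never real for k <> 0, non-real
    arguments suffice. Cauchy's theorem on rectangles is developed for this comparison, for the
    holomorphic difference quotients at the poles, and for carrying the functional equation across a
    strip. *)

(** * Complex numbers and the complex exponential *)

Lemma C_ext (z w : C) : Re z = Re w -> Im z = Im w -> z = w.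
Proof. destruct z, w; simpl; intros -> ->; reflexivity. Qed.

Lemma re_minus (a b : C) : Re (a - b) = Re a - Re b.
Proof. reflexivity. Qed.

Lemma im_minus (a b : C) : Im (a - b) = Im a - Im b.
Proof. reflexivity. Qed.

Lemma im_le_Cmod (c : C) : Rabs (Im c) <= Cmod c.
Proof. eapply Rle_trans; [ apply Rmax_r | apply Rmax_Cmod ]. Qed.

Lemma Cmod_le_ReIm (c : C) : Cmod c <= Rabs (Re c) + Rabs (Im c).
Proof.
  replace c with (RtoC (Re c) + Ci * RtoC (Im c))%C at 1
    by (apply C_ext; simpl; ring).
  eapply Rle_trans; [ apply Cmod_triangle | ].
  rewrite Cmod_mult, Cmod_Ci, !Cmod_R; lra.
Qed.

Lemma Cminus_0_r (z : C) : (z - 0)%C = z.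
Proof. ring. Qed.

Lemma Cmod_sub_sym (a b : C) : Cmod (a - b) = Cmod (b - a).
Proof. rewrite <- Cmod_opp; f_equal; ring. Qed.

Lemma Cmod_sub_le (a b : C) : Cmod (a - b) <= Cmod a + Cmod b.
Proof. unfold Cminus; rewrite <- (Cmod_opp b); apply Cmod_triangle. Qed.

Lemma Cmod_sub_triangle (a b c : C) : Cmod (a - c) <= Cmod (a - b) + Cmod (b - c).
Proof.
  replace (a - c)%C with ((a - b) + (b - c))%C by ring; apply Cmod_triangle.
Qed.

Lemma Cmod_triangle_rev (a b : C) : Cmod a - Cmod b <= Cmod (a - b).
Proof.
  pose proof (Cmod_triangle (a - b) b) as H.
  replace (a - b + b)%C with a in H by ring; lra.
Qed.

Lemma Cmod_pos_sub (a b : C) : a <> b -> 0 < Cmod (a - b).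
Proof. intros H; apply Cmod_gt_0, Cminus_eq_contra, H. Qed.

Lemma Cmod_small_eq (z w : C) : (forall e, 0 < e -> Cmod (z - w) <= e) -> z = w.
Proof.
  intros H; apply Ceq_minus, Cmod_eq_0.
  apply Rle_antisym; [ | apply Cmod_ge_0 ].
  apply Rnot_lt_le; intros H0.
  specialize (H (Cmod (z - w) / 2) ltac:(lra)); lra.
Qed.

Lemma Cexp_plus (a b : C) : Cexp (a + b) = (Cexp a * Cexp b)%C.
Proof.
  unfold Cexp; apply C_ext; unfold Re, Im; simpl; rewrite exp_plus, ?cos_plus, ?sin_plus; ring.
Qed.

Lemma Cexp_0 : Cexp 0 = RtoC 1.
Proof. unfold Cexp; apply C_ext; simpl; rewrite exp_0, ?cos_0, ?sin_0; ring. Qed.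

Lemma Cexp_opp_mult (a : C) : (Cexp a * Cexp (- a))%C = RtoC 1.
Proof. rewrite <- Cexp_plus, Cplus_opp_r; apply Cexp_0. Qed.

Lemma Cexp_neq_0 (a : C) : Cexp a <> RtoC 0.
Proof.
  intros H; pose proof (Cexp_opp_mult a) as H1; rewrite H, Cmult_0_l in H1.
  injection H1; lra.
Qed.

Lemma Cexp_opp (a : C) : Cexp (- a) = (/ Cexp a)%C.
Proof.
  pose proof (Cexp_neq_0 a); pose proof (Cexp_opp_mult a) as H1.
  replace (Cexp (- a)) with ((Cexp a * Cexp (- a)) * / Cexp a)%C by (field; auto).
  rewrite H1; ring.
Qed.

Lemma Cexp_RtoC (x : R) : Cexp x = RtoC (exp x).
Proof. unfold Cexp; apply C_ext; simpl; rewrite ?cos_0, ?sin_0; ring. Qed.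

Lemma Cmod_Cexp (a : C) : Cmod (Cexp a) = exp (Re a).
Proof.
  unfold Cexp, Cmod; simpl.
  pose proof (sin2_cos2 (Im a)) as H; unfold Rsqr in H.
  replace (_ + _) with (exp (Re a) * exp (Re a)) by
    (transitivity (exp (Re a) * exp (Re a) * (sin (Im a) * sin (Im a) + cos (Im a) * cos (Im a)));
     [ rewrite H; ring | ring ]).
  apply sqrt_square, Rlt_le, exp_pos.
Qed.

(** * Complex-valued functions of a real variable *)

(** Componentwise, like the integral and the derivative below, so that each rule follows from the
    rule for real functions. *)
Definition ccont (f : R -> C) (x : R) : Prop :=
  continuous (fun t => Re (f t)) x /\ continuous (fun t => Im (f t)) x.

Lemma ccont_ext (f g : R -> C) (x : R) :
  (forall t, f t = g t) -> ccont f x -> ccont g x.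
Proof.
  intros H [H1 H2]; split;
    [ eapply continuous_ext; [ | exact H1 ] | eapply continuous_ext; [ | exact H2 ] ];
    intros t; simpl; rewrite H; reflexivity.
Qed.

Lemma ccont_const (c : C) (x : R) : ccont (fun _ => c) x.
Proof. split; apply continuous_const. Qed.

Lemma ccont_RtoC (f : R -> R) (x : R) : continuous f x -> ccont (fun t => RtoC (f t)) x.
Proof. intros H; split; simpl; [ exact H | apply continuous_const ]. Qed.

Lemma ccont_plus (f g : R -> C) (x : R) :
  ccont f x -> ccont g x -> ccont (fun t => f t + g t)%C x.
Proof.
  intros [H1 H2] [H3 H4]; split; simpl.
  - apply (continuous_plus (fun t => Re (f t)) (fun t => Re (g t))); assumption.
  - apply (continuous_plus (fun t => Im (f t)) (fun t => Im (g t))); assumption.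
Qed.

Lemma ccont_opp (f : R -> C) (x : R) : ccont f x -> ccont (fun t => - f t)%C x.
Proof.
  intros [H1 H2]; split; simpl.
  - apply (continuous_opp (fun t => Re (f t))); assumption.
  - apply (continuous_opp (fun t => Im (f t))); assumption.
Qed.

Lemma ccont_minus (f g : R -> C) (x : R) :
  ccont f x -> ccont g x -> ccont (fun t => f t - g t)%C x.
Proof. intros H1 H2; apply ccont_plus; [ | apply ccont_opp ]; assumption. Qed.

Lemma ccont_mult (f g : R -> C) (x : R) :
  ccont f x -> ccont g x -> ccont (fun t => f t * g t)%C x.
Proof.
  intros [H1 H2] [H3 H4]; split; simpl.
  - apply (continuous_minus (fun t => Re (f t) * Re (g t)) (fun t => Im (f t) * Im (g t)));
      apply (continuous_mult (K := R_AbsRing)); assumption.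
  - apply (continuous_plus (fun t => Re (f t) * Im (g t)) (fun t => Im (f t) * Re (g t)));
      apply (continuous_mult (K := R_AbsRing)); assumption.
Qed.

Lemma ccont_Cexp (f : R -> C) (x : R) : ccont f x -> ccont (fun t => Cexp (f t)) x.
Proof.
  intros [H1 H2]; split; simpl;
    (apply (continuous_mult (K := R_AbsRing));
     [ apply (continuous_comp (fun t => Re (f t)) exp); [ exact H1 | apply continuous_exp ] | ]).
  - apply (continuous_comp (fun t => Im (f t)) cos); [ exact H2 | apply continuous_cos ].
  - apply (continuous_comp (fun t => Im (f t)) sin); [ exact H2 | apply continuous_sin ].
Qed.

Lemma ccont_comp (f : R -> C) (u : R -> R) (x : R) :
  continuous u x -> ccont f (u x) -> ccont (fun t => f (u t)) x.
Proof.
  intros H [H1 H2]; split.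
  - apply (continuous_comp u (fun t => Re (f t))); assumption.
  - apply (continuous_comp u (fun t => Im (f t))); assumption.
Qed.

(** * Integrals and derivatives along the real line *)

Definition CInt (f : R -> C) (a b : R) : C :=
  (RInt (fun t => Re (f t)) a b, RInt (fun t => Im (f t)) a b).

Definition ex_CInt (f : R -> C) (a b : R) : Prop :=
  ex_RInt (fun t => Re (f t)) a b /\ ex_RInt (fun t => Im (f t)) a b.

Lemma ex_CInt_cont (f : R -> C) (a b : R) :
  a <= b -> (forall x, a <= x <= b -> ccont f x) -> ex_CInt f a b.
Proof.
  intros Hab H; split; apply (ex_RInt_continuous (V := R_CompleteNormedModule));
    rewrite Rmin_left, Rmax_right by assumption; intros z Hz; apply (H z Hz).
Qed.

Lemma CInt_ext (f g : R -> C) (a b : R) :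
  a <= b -> (forall x, a < x < b -> f x = g x) -> CInt f a b = CInt g a b.
Proof.
  intros Hab H; unfold CInt; f_equal; apply RInt_ext; rewrite Rmin_left, Rmax_right by assumption;
    intros x Hx; rewrite H by assumption; reflexivity.
Qed.

Lemma ex_CInt_ext (f g : R -> C) (a b : R) :
  a <= b -> (forall x, a < x < b -> f x = g x) -> ex_CInt f a b -> ex_CInt g a b.
Proof.
  intros Hab H [H1 H2]; split;
    [ eapply ex_RInt_ext; [ | exact H1 ] | eapply ex_RInt_ext; [ | exact H2 ] ];
    rewrite Rmin_left, Rmax_right by assumption;
    intros x Hx; simpl; rewrite H by assumption; reflexivity.
Qed.

Lemma CInt_plus (f g : R -> C) (a b : R) :
  ex_CInt f a b -> ex_CInt g a b ->
  CInt (fun t => f t + g t)%C a b = (CInt f a b + CInt g a b)%C.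
Proof.
  intros [H1 H2] [H3 H4]; unfold CInt, Cplus; simpl; f_equal.
  - apply (RInt_plus (V := R_CompleteNormedModule) (fun t => Re (f t)) (fun t => Re (g t))); assumption.
  - apply (RInt_plus (V := R_CompleteNormedModule) (fun t => Im (f t)) (fun t => Im (g t))); assumption.
Qed.

Lemma ex_CInt_plus (f g : R -> C) (a b : R) :
  ex_CInt f a b -> ex_CInt g a b -> ex_CInt (fun t => f t + g t)%C a b.
Proof.
  intros [H1 H2] [H3 H4]; split; simpl.
  - apply (ex_RInt_plus (V := R_NormedModule) (fun t => Re (f t)) (fun t => Re (g t))); assumption.
  - apply (ex_RInt_plus (V := R_NormedModule) (fun t => Im (f t)) (fun t => Im (g t))); assumption.
Qed.

Lemma is_CInt_scal (c : C) (f : R -> C) (a b : R) :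
  ex_CInt f a b ->
  ex_CInt (fun t => c * f t)%C a b /\ CInt (fun t => c * f t)%C a b = (c * CInt f a b)%C.
Proof.
  intros [H1 H2].
  assert (HR : is_RInt (fun t => Re (c * f t)%C) a b (Re (c * CInt f a b)%C)).
  { simpl; apply (is_RInt_minus (V := R_NormedModule)
      (fun t => Re c * Re (f t)) (fun t => Im c * Im (f t)));
    apply (is_RInt_scal (V := R_NormedModule)); apply (RInt_correct (V := R_CompleteNormedModule)); assumption. }
  assert (HI : is_RInt (fun t => Im (c * f t)%C) a b (Im (c * CInt f a b)%C)).
  { simpl; apply (is_RInt_plus (V := R_NormedModule)
      (fun t => Re c * Im (f t)) (fun t => Im c * Re (f t)));
    apply (is_RInt_scal (V := R_NormedModule)); apply (RInt_correct (V := R_CompleteNormedModule)); assumption. }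
  split.
  - split; eexists; [ exact HR | exact HI ].
  - apply C_ext; unfold CInt at 1; cbn [Re Im fst snd];
      apply (is_RInt_unique (V := R_CompleteNormedModule)); [ exact HR | exact HI ].
Qed.

Lemma CInt_scal (c : C) (f : R -> C) (a b : R) :
  ex_CInt f a b -> CInt (fun t => c * f t)%C a b = (c * CInt f a b)%C.
Proof. intros H; apply is_CInt_scal, H. Qed.

Lemma ex_CInt_scal (c : C) (f : R -> C) (a b : R) :
  ex_CInt f a b -> ex_CInt (fun t => c * f t)%C a b.
Proof. intros H; apply is_CInt_scal, H. Qed.

Lemma ex_CInt_minus (f g : R -> C) (a b : R) :
  a <= b -> ex_CInt f a b -> ex_CInt g a b -> ex_CInt (fun t => f t - g t)%C a b.
Proof.
  intros Hab H1 H2.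
  apply (ex_CInt_ext (fun t => f t + (- RtoC 1) * g t)%C); [ exact Hab | intros; ring | ].
  apply ex_CInt_plus; [ exact H1 | apply ex_CInt_scal, H2 ].
Qed.

Lemma CInt_minus (f g : R -> C) (a b : R) :
  a <= b -> ex_CInt f a b -> ex_CInt g a b ->
  CInt (fun t => f t - g t)%C a b = (CInt f a b - CInt g a b)%C.
Proof.
  intros Hab H1 H2.
  rewrite (CInt_ext _ (fun t => f t + (- RtoC 1) * g t)%C) by (try assumption; intros; ring).
  rewrite CInt_plus, CInt_scal by (try assumption; apply ex_CInt_scal, H2); ring.
Qed.

Lemma CInt_Chasles (f : R -> C) (a b c : R) :
  ex_CInt f a b -> ex_CInt f b c -> CInt f a c = (CInt f a b + CInt f b c)%C.
Proof.
  intros [H1 H2] [H3 H4]; unfold CInt, Cplus; simpl; f_equal; symmetry;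
    apply (RInt_Chasles (V := R_CompleteNormedModule)); assumption.
Qed.

Lemma CInt_RtoC (f : R -> R) (a b : R) : CInt (fun t => RtoC (f t)) a b = RtoC (RInt f a b).
Proof.
  unfold CInt; simpl; unfold RtoC; f_equal.
  rewrite RInt_const; apply Rmult_0_r.
Qed.

Lemma CInt_const (c : C) (a b : R) : CInt (fun _ => c) a b = (RtoC (b - a) * c)%C.
Proof.
  unfold CInt; rewrite !RInt_const; apply C_ext; unfold Re, Im; simpl;
  unfold scal; simpl; unfold mult; simpl; ring.
Qed.

(** The integral I is rotated onto the real axis: |I|^2 is the real part of the integral of
    [Cconj I * f], whose integrand is at most |I| times g. *)
Lemma CInt_norm_le (f : R -> C) (g : R -> R) (a b : R) :
  a <= b -> ex_CInt f a b -> ex_RInt g a b ->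
  (forall x, a < x < b -> Cmod (f x) <= g x) -> Cmod (CInt f a b) <= RInt g a b.
Proof.
  intros Hab Hf Hg H.
  set (I := CInt f a b).
  destruct (Req_dec (Cmod I) 0) as [H0|H0].
  { rewrite H0; apply RInt_ge_0; try assumption.
    intros x Hx; eapply Rle_trans; [ apply Cmod_ge_0 | apply H, Hx ]. }
  pose proof (Cmod_ge_0 I) as HI.
  apply (Rmult_le_reg_l (Cmod I)); [ lra | ].
  destruct (is_CInt_scal (Cconj I) f a b Hf) as [[E1 _] E2]; fold I in E2.
  replace (Cmod I * Cmod I) with (RInt (fun t => Re (Cconj I * f t)%C) a b).
  - rewrite <- (RInt_scal (V := R_CompleteNormedModule)) by assumption.
    apply RInt_le; try assumption.
    + apply (ex_RInt_scal (V := R_NormedModule)), Hg.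
    + intros x Hx.
      eapply Rle_trans; [ apply Rle_abs | ].
      eapply Rle_trans; [ apply re_le_Cmod | ].
      rewrite Cmod_mult, Cmod_conj; apply Rmult_le_compat_l; [ lra | apply H, Hx ].
  - change (Re (CInt (fun t => Cconj I * f t)%C a b) = Cmod I * Cmod I).
    rewrite E2, Cmult_comm.
    replace (Cmod I * Cmod I) with (Cmod I ^ 2) by ring.
    rewrite <- (re_RtoC (Cmod I ^ 2)), Cmod2_conj; reflexivity.
Qed.

Lemma CInt_norm_le_const (f : R -> C) (M : R) (a b : R) :
  a <= b -> ex_CInt f a b ->
  (forall x, a < x < b -> Cmod (f x) <= M) -> Cmod (CInt f a b) <= (b - a) * M.
Proof.
  intros Hab Hf H.
  eapply Rle_trans; [ apply (CInt_norm_le f (fun _ => M)); try assumption | ].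
  - apply ex_RInt_const.
  - rewrite RInt_const; apply Rle_refl.
Qed.

Definition cderiv (f : R -> C) (x : R) (l : C) : Prop :=
  is_derive (fun t => Re (f t)) x (Re l) /\ is_derive (fun t => Im (f t)) x (Im l).

Lemma CInt_FTC (F f : R -> C) (a b : R) :
  a <= b -> (forall x, a <= x <= b -> cderiv F x (f x)) ->
  (forall x, a <= x <= b -> ccont f x) -> CInt f a b = (F b - F a)%C.
Proof.
  intros Hab HF Hf; apply C_ext; cbn [CInt Re Im fst snd Cminus Cplus Copp];
    apply (is_RInt_unique (V := R_CompleteNormedModule)).
  - apply (is_RInt_derive (V := R_CompleteNormedModule) (fun t => Re (F t)) (fun t => Re (f t)));
      rewrite Rmin_left, Rmax_right by assumption; intros x Hx; [ apply HF | apply Hf ]; exact Hx.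
  - apply (is_RInt_derive (V := R_CompleteNormedModule) (fun t => Im (F t)) (fun t => Im (f t)));
      rewrite Rmin_left, Rmax_right by assumption; intros x Hx; [ apply HF | apply Hf ]; exact Hx.
Qed.

Lemma cderiv_eq (f : R -> C) (x : R) (l l' : C) : cderiv f x l -> l = l' -> cderiv f x l'.
Proof. intros H <-; exact H. Qed.

Lemma cderiv_ccont (f : R -> C) (x : R) (l : C) : cderiv f x l -> ccont f x.
Proof.
  intros [H1 H2]; split; apply (ex_derive_continuous (V := R_NormedModule)); eexists; eassumption.
Qed.

Lemma cderiv_const (c : C) (x : R) : cderiv (fun _ => c) x 0.
Proof. split; simpl; apply (is_derive_const (V := R_NormedModule)). Qed.

Lemma cderiv_RtoC (f : R -> R) (x l : R) : is_derive f x l -> cderiv (fun t => RtoC (f t)) x (RtoC l).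
Proof. intros H; split; simpl; [ exact H | apply (is_derive_const (V := R_NormedModule)) ]. Qed.

Lemma cderiv_plus (f g : R -> C) (x : R) (l m : C) :
  cderiv f x l -> cderiv g x m -> cderiv (fun t => f t + g t)%C x (l + m)%C.
Proof.
  intros [H1 H2] [H3 H4]; split; simpl.
  - apply (is_derive_plus (V := R_NormedModule) (fun t => Re (f t)) (fun t => Re (g t))); assumption.
  - apply (is_derive_plus (V := R_NormedModule) (fun t => Im (f t)) (fun t => Im (g t))); assumption.
Qed.

Lemma cderiv_mult (f g : R -> C) (x : R) (l m : C) :
  cderiv f x l -> cderiv g x m -> cderiv (fun t => f t * g t)%C x (l * g x + f x * m)%C.
Proof.
  intros [H1 H2] [H3 H4]; split; simpl.
  - match goal with |- is_derive _ _ ?v => replace v with ((Re l * Re (g x) + Re (f x) * Re m) - (Im l * Im (g x) + Im (f x) * Im m))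
      by (unfold Re, Im; simpl; ring) end.
    apply (is_derive_minus (V := R_NormedModule) (fun t => Re (f t) * Re (g t)) (fun t => Im (f t) * Im (g t))).
    + apply (is_derive_mult (fun t => Re (f t)) (fun t => Re (g t))); [ exact H1 | exact H3 | apply Rmult_comm ].
    + apply (is_derive_mult (fun t => Im (f t)) (fun t => Im (g t))); [ exact H2 | exact H4 | apply Rmult_comm ].
  - match goal with |- is_derive _ _ ?v => replace v with ((Re l * Im (g x) + Re (f x) * Im m) + (Im l * Re (g x) + Im (f x) * Re m))
      by (unfold Re, Im; simpl; ring) end.
    apply (is_derive_plus (V := R_NormedModule) (fun t => Re (f t) * Im (g t)) (fun t => Im (f t) * Re (g t))).
    + apply (is_derive_mult (fun t => Re (f t)) (fun t => Im (g t))); [ exact H1 | exact H4 | apply Rmult_comm ].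
    + apply (is_derive_mult (fun t => Im (f t)) (fun t => Re (g t))); [ exact H2 | exact H3 | apply Rmult_comm ].
Qed.

Lemma cderiv_scal (c : C) (f : R -> C) (x : R) (l : C) :
  cderiv f x l -> cderiv (fun t => c * f t)%C x (c * l)%C.
Proof.
  intros H; eapply cderiv_eq; [ apply (cderiv_mult (fun _ => c) f x 0 l (cderiv_const c x) H) | ring ].
Qed.

Lemma cderiv_Cexp (f : R -> C) (x : R) (l : C) :
  cderiv f x l -> cderiv (fun t => Cexp (f t)) x (l * Cexp (f x))%C.
Proof.
  intros [H1 H2].
  assert (He : is_derive (fun t => exp (Re (f t))) x (Re l * exp (Re (f x)))).
  { apply (is_derive_comp exp (fun t => Re (f t))); [ apply is_derive_exp | exact H1 ]. }
  split; simpl.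
  - match goal with |- is_derive _ _ ?v => replace v with ((Re l * exp (Re (f x))) * cos (Im (f x)) + exp (Re (f x)) * (Im l * - sin (Im (f x))))
      by (unfold Re, Im; simpl; ring) end.
    apply (is_derive_mult (fun t => exp (Re (f t))) (fun t => cos (Im (f t)))); [ exact He | | apply Rmult_comm ].
    apply (is_derive_comp cos (fun t => Im (f t))); [ apply is_derive_cos | exact H2 ].
  - match goal with |- is_derive _ _ ?v => replace v with ((Re l * exp (Re (f x))) * sin (Im (f x)) + exp (Re (f x)) * (Im l * cos (Im (f x))))
      by (unfold Re, Im; simpl; ring) end.
    apply (is_derive_mult (fun t => exp (Re (f t))) (fun t => sin (Im (f t)))); [ exact He | | apply Rmult_comm ].
    apply (is_derive_comp sin (fun t => Im (f t))); [ apply is_derive_sin | exact H2 ].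
Qed.

Lemma cderiv_id_scal (w : C) (x : R) : cderiv (fun t => RtoC t * w)%C x w.
Proof.
  eapply cderiv_eq.
  - apply (cderiv_mult (fun t => RtoC t) (fun _ => w)); [ | apply cderiv_const ].
    apply (cderiv_RtoC (fun t => t)), (is_derive_id (K := R_AbsRing)).
  - change (RtoC 1 * w + RtoC x * 0 = w)%C; ring.
Qed.

(** The fundamental theorem along the segment from 0 to w. The factor w in front gives the
    first-order bound, the orthogonality of characters, and later the simple zeros of the
    denominator. *)
Lemma Cexp_sub1_int (w : C) :
  (Cexp w - 1)%C = (w * CInt (fun t => Cexp (RtoC t * w)) 0 1)%C.
Proof.
  assert (Hc : forall x, ccont (fun t => Cexp (RtoC t * w)) x).
  { intros x; apply ccont_Cexp; apply (cderiv_ccont _ _ _ (cderiv_id_scal w x)). }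
  rewrite <- CInt_scal by (apply ex_CInt_cont; [ lra | intros; apply Hc ]).
  rewrite (CInt_FTC (fun t => Cexp (RtoC t * w)) (fun t => w * Cexp (RtoC t * w))%C).
  - rewrite Cmult_1_l, Cmult_0_l, Cexp_0; reflexivity.
  - lra.
  - intros x _; apply cderiv_Cexp, cderiv_id_scal.
  - intros x _; apply ccont_mult; [ apply ccont_const | apply Hc ].
Qed.

Lemma Cmod_Cexp_le (w : C) : Cmod (Cexp w) <= exp (Cmod w).
Proof.
  rewrite Cmod_Cexp; pose proof (re_le_Cmod w); pose proof (Rle_abs (Re w)).
  destruct (Req_dec (Re w) (Cmod w)) as [->|]; [ lra | apply Rlt_le, exp_increasing; lra ].
Qed.

Lemma exp_le (x y : R) : x <= y -> exp x <= exp y.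
Proof. intros [H| ->]; [ apply Rlt_le, exp_increasing, H | lra ]. Qed.

Lemma Cexp_sub1_le (w : C) : Cmod (Cexp w - 1) <= Cmod w * exp (Cmod w).
Proof.
  rewrite Cexp_sub1_int, Cmod_mult; apply Rmult_le_compat_l; [ apply Cmod_ge_0 | ].
  rewrite <- (Rmult_1_l (exp _)); replace 1 with (1 - 0) at 2 by ring.
  apply CInt_norm_le_const; [ lra | | ].
  - apply ex_CInt_cont; [ lra | intros x _ ].
    apply ccont_Cexp, (cderiv_ccont _ _ _ (cderiv_id_scal w x)).
  - intros x Hx; eapply Rle_trans; [ apply Cmod_Cexp_le | apply exp_le ].
    rewrite Cmod_mult, Cmod_R, Rabs_right by lra; pose proof (Cmod_ge_0 w); nra.
Qed.

(** The first-order bound inserted under the integral. It is the quadratic remainder in every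
    differentiation with respect to an exponent. *)
Lemma Cexp_sub1_sub_le (w : C) : Cmod (Cexp w - 1 - w) <= Cmod w ^ 2 * exp (Cmod w).
Proof.
  assert (Hc : forall x, ccont (fun t => Cexp (RtoC t * w)) x).
  { intros x; apply ccont_Cexp; apply (cderiv_ccont _ _ _ (cderiv_id_scal w x)). }
  assert (He : ex_CInt (fun t => Cexp (RtoC t * w)) 0 1)
    by (apply ex_CInt_cont; [ lra | intros; apply Hc ]).
  assert (H1 : ex_CInt (fun _ : R => RtoC 1) 0 1)
    by (apply ex_CInt_cont; [ lra | intros; apply ccont_const ]).
  replace (Cexp w - 1 - w)%C with (w * CInt (fun t => Cexp (RtoC t * w) - 1) 0 1)%C.
  - rewrite Cmod_mult; replace (Cmod w ^ 2 * exp (Cmod w)) with (Cmod w * ((1 - 0) * (Cmod w * exp (Cmod w)))) by ring.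
    apply Rmult_le_compat_l; [ apply Cmod_ge_0 | ].
    apply CInt_norm_le_const; [ lra | apply ex_CInt_minus; try assumption; lra | ].
    intros x Hx; eapply Rle_trans; [ apply Cexp_sub1_le | ].
    pose proof (Cmod_ge_0 w).
    rewrite Cmod_mult, Cmod_R, Rabs_right by lra.
    apply Rmult_le_compat; try nra; [ apply Rlt_le, exp_pos | apply exp_le; nra ].
  - rewrite CInt_minus, CInt_const by (try assumption; lra).
    rewrite Cexp_sub1_int, Rminus_0_r; ring.
Qed.

(** * Continuity and differentiability of functions of a complex variable *)

Definition ccts (f : C -> C) (z : C) : Prop :=
  forall e, 0 < e -> exists d, 0 < d /\ forall w, Cmod (w - z) < d -> Cmod (f w - f z) < e.

(* Caratheodory's form of complex differentiability: the difference quotient extends continuously. *)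
Definition cdiff (f : C -> C) (z : C) : Prop :=
  exists phi, ccts phi z /\
    exists d, 0 < d /\ forall w, Cmod (w - z) < d -> f w = (f z + (w - z) * phi w)%C.

Lemma ccts_const (c z : C) : ccts (fun _ => c) z.
Proof.
  intros e He; exists 1; split; [ lra | intros w _ ].
  unfold Cminus; rewrite Cplus_opp_r, Cmod_0; exact He.
Qed.

Lemma ccts_id (z : C) : ccts (fun w => w) z.
Proof. intros e He; exists e; split; [ lra | intros w H; exact H ]. Qed.

Lemma ccts_ext_loc (f g : C -> C) (z : C) (d : R) :
  0 < d -> (forall w, Cmod (w - z) < d -> f w = g w) -> ccts f z -> ccts g z.
Proof.
  intros Hd H Hf e He; destruct (Hf e He) as [d' [Hd' H']].
  exists (Rmin d d'); split; [ apply Rmin_pos; assumption | intros w Hw ].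
  assert (Hz : Cmod (z - z) < d) by (unfold Cminus; rewrite Cplus_opp_r, Cmod_0; exact Hd).
  rewrite <- (H w), <- (H z) by (assumption || (eapply Rlt_le_trans; [ exact Hw | apply Rmin_l ])).
  apply H'; eapply Rlt_le_trans; [ exact Hw | apply Rmin_r ].
Qed.

Lemma ccts_ext (f g : C -> C) (z : C) : (forall w, f w = g w) -> ccts f z -> ccts g z.
Proof. intros H; apply (ccts_ext_loc f g z 1); [ lra | intros; apply H ]. Qed.

Lemma ccts_bounded (f : C -> C) (z : C) :
  ccts f z -> exists d, 0 < d /\ forall w, Cmod (w - z) < d -> Cmod (f w) <= Cmod (f z) + 1.
Proof.
  intros H; destruct (H 1 Rlt_0_1) as [d [Hd Hw]]; exists d; split; [ exact Hd | intros w Hw' ].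
  pose proof (Cmod_triangle_rev (f w) (f z)); specialize (Hw w Hw'); lra.
Qed.

Lemma ccts_plus (f g : C -> C) (z : C) : ccts f z -> ccts g z -> ccts (fun w => f w + g w)%C z.
Proof.
  intros Hf Hg e He.
  destruct (Hf (e / 2)) as [d [Hd H]]; [ lra | ].
  destruct (Hg (e / 2)) as [d' [Hd' H']]; [ lra | ].
  exists (Rmin d d'); split; [ apply Rmin_pos; assumption | intros w Hw ].
  replace (f w + g w - (f z + g z))%C with ((f w - f z) + (g w - g z))%C by ring.
  eapply Rle_lt_trans; [ apply Cmod_triangle | ].
  specialize (H w (Rlt_le_trans _ _ _ Hw (Rmin_l _ _))).
  specialize (H' w (Rlt_le_trans _ _ _ Hw (Rmin_r _ _))); lra.
Qed.

Lemma ccts_mult (f g : C -> C) (z : C) : ccts f z -> ccts g z -> ccts (fun w => f w * g w)%C z.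
Proof.
  intros Hf Hg e He.
  destruct (ccts_bounded g z Hg) as [d0 [Hd0 H0]].
  pose proof (Cmod_ge_0 (f z)) as Fz; pose proof (Cmod_ge_0 (g z)) as Gz.
  set (B := Cmod (f z) + Cmod (g z) + 1).
  assert (HB : 0 < B) by (unfold B; lra).
  destruct (Hf (e / (2 * B))) as [d [Hd H]]; [ apply Rdiv_lt_0_compat; lra | ].
  destruct (Hg (e / (2 * B))) as [d' [Hd' H']]; [ apply Rdiv_lt_0_compat; lra | ].
  exists (Rmin d0 (Rmin d d')); split; [ repeat apply Rmin_pos; assumption | intros w Hw ].
  replace (f w * g w - f z * g z)%C with ((f w - f z) * g w + f z * (g w - g z))%C by ring.
  eapply Rle_lt_trans; [ apply Cmod_triangle | rewrite !Cmod_mult ].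
  specialize (H0 w (Rlt_le_trans _ _ _ Hw (Rmin_l _ _))).
  pose proof (Rlt_le_trans _ _ _ Hw (Rmin_r _ _)) as Hw'.
  specialize (H w (Rlt_le_trans _ _ _ Hw' (Rmin_l _ _))).
  specialize (H' w (Rlt_le_trans _ _ _ Hw' (Rmin_r _ _))).
  pose proof (Cmod_ge_0 (f w - f z)); pose proof (Cmod_ge_0 (g w - g z)).
  assert (E : e = e / (2 * B) * B + B * (e / (2 * B))) by (field; lra).
  rewrite E at 1.
  assert (Hgw : Cmod (g w) <= B) by (unfold B; lra).
  assert (Hfz : Cmod (f z) <= B) by (unfold B; lra).
  pose proof (Cmod_ge_0 (g w)).
  assert (0 < e / (2 * B)) by (apply Rdiv_lt_0_compat; lra).
  assert (Cmod (f w - f z) * Cmod (g w) <= Cmod (f w - f z) * B) by (apply Rmult_le_compat_l; lra).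
  assert (Cmod (f w - f z) * B < e / (2 * B) * B) by (apply Rmult_lt_compat_r; lra).
  assert (Cmod (f z) * Cmod (g w - g z) <= B * Cmod (g w - g z)) by (apply Rmult_le_compat_r; lra).
  assert (B * Cmod (g w - g z) < B * (e / (2 * B))) by (apply Rmult_lt_compat_l; lra).
  lra.
Qed.

Lemma ccts_comp (f g : C -> C) (z : C) : ccts f z -> ccts g (f z) -> ccts (fun w => g (f w)) z.
Proof.
  intros Hf Hg e He; destruct (Hg e He) as [d [Hd H]]; destruct (Hf d Hd) as [d' [Hd' H']].
  exists d'; split; [ exact Hd' | intros w Hw; apply H, H', Hw ].
Qed.

Lemma ccts_neq_0 (f : C -> C) (z : C) :
  ccts f z -> f z <> RtoC 0 ->
  exists d, 0 < d /\ forall w, Cmod (w - z) < d -> Cmod (f z) / 2 <= Cmod (f w) /\ f w <> RtoC 0.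
Proof.
  intros Hf H0; assert (Hp := proj1 (Cmod_gt_0 _) H0).
  destruct (Hf (Cmod (f z) / 2)) as [d [Hd H]]; [ lra | ].
  exists d; split; [ exact Hd | intros w Hw ].
  specialize (H w Hw); pose proof (Cmod_triangle_rev (f z) (f w)) as Ht; rewrite Cmod_sub_sym in Ht.
  split; [ lra | intros E; rewrite E, Cmod_0 in Ht; rewrite E in H; lra ].
Qed.

Lemma ccts_inv (f : C -> C) (z : C) : ccts f z -> f z <> RtoC 0 -> ccts (fun w => / f w)%C z.
Proof.
  intros Hf H0 e He.
  destruct (ccts_neq_0 f z Hf H0) as [d [Hd H]].
  assert (Hp := proj1 (Cmod_gt_0 _) H0).
  destruct (Hf (e * (Cmod (f z) ^ 2 / 2))) as [d' [Hd' H']]; [ apply Rmult_lt_0_compat; [ lra | nra ] | ].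
  exists (Rmin d d'); split; [ apply Rmin_pos; assumption | intros w Hw ].
  destruct (H w (Rlt_le_trans _ _ _ Hw (Rmin_l _ _))) as [H1 H2].
  specialize (H' w (Rlt_le_trans _ _ _ Hw (Rmin_r _ _))).
  replace (/ f w - / f z)%C with (- ((f w - f z) / (f w * f z)))%C by (field; split; assumption).
  rewrite Cmod_opp, Cmod_div, Cmod_mult by (apply Cmult_neq_0; assumption).
  assert (0 < Cmod (f w)) by (apply Cmod_gt_0; assumption).
  apply (Rmult_lt_reg_r (Cmod (f w) * Cmod (f z))); [ nra | ].
  unfold Rdiv; rewrite Rmult_assoc, Rinv_l, Rmult_1_r by nra.
  eapply Rlt_le_trans; [ exact H' | ].
  apply Rmult_le_compat_l; [ lra | nra ].
Qed.

Lemma cdiff_ccts (f : C -> C) (z : C) : cdiff f z -> ccts f z.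
Proof.
  intros [phi [Hphi [d [Hd H]]]].
  apply (ccts_ext_loc (fun w => f z + (w - z) * phi w)%C f z d Hd);
    [ intros w Hw; symmetry; apply H, Hw | ].
  apply ccts_plus; [ apply ccts_const | apply ccts_mult; [ | exact Hphi ] ].
  apply ccts_plus; [ apply ccts_id | apply ccts_const ].
Qed.

Lemma cdiff_ext_loc (f g : C -> C) (z : C) (d : R) :
  0 < d -> (forall w, Cmod (w - z) < d -> f w = g w) -> cdiff f z -> cdiff g z.
Proof.
  intros Hd H [phi [Hphi [d' [Hd' H']]]]; exists phi; split; [ exact Hphi | ].
  exists (Rmin d d'); split; [ apply Rmin_pos; assumption | intros w Hw ].
  assert (Hz : Cmod (z - z) < d) by (unfold Cminus; rewrite Cplus_opp_r, Cmod_0; exact Hd).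
  rewrite <- (H w), <- (H z) by (assumption || (eapply Rlt_le_trans; [ exact Hw | apply Rmin_l ])).
  apply H'; eapply Rlt_le_trans; [ exact Hw | apply Rmin_r ].
Qed.

Lemma cdiff_ext (f g : C -> C) (z : C) : (forall w, f w = g w) -> cdiff f z -> cdiff g z.
Proof. intros H; apply (cdiff_ext_loc f g z 1); [ lra | intros; apply H ]. Qed.

Lemma cdiff_const (c z : C) : cdiff (fun _ => c) z.
Proof.
  exists (fun _ => RtoC 0); split; [ apply ccts_const | exists 1; split; [ lra | intros; ring ] ].
Qed.

Lemma cdiff_id (z : C) : cdiff (fun w => w) z.
Proof.
  exists (fun _ => RtoC 1); split; [ apply ccts_const | exists 1; split; [ lra | intros; ring ] ].
Qed.

Lemma cdiff_plus (f g : C -> C) (z : C) : cdiff f z -> cdiff g z -> cdiff (fun w => f w + g w)%C z.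
Proof.
  intros [p [Hp [d [Hd H]]]] [q [Hq [d' [Hd' H']]]].
  exists (fun w => p w + q w)%C; split; [ apply ccts_plus; assumption | ].
  exists (Rmin d d'); split; [ apply Rmin_pos; assumption | intros w Hw ].
  rewrite (H w (Rlt_le_trans _ _ _ Hw (Rmin_l _ _))), (H' w (Rlt_le_trans _ _ _ Hw (Rmin_r _ _))); ring.
Qed.

Lemma cdiff_mult (f g : C -> C) (z : C) : cdiff f z -> cdiff g z -> cdiff (fun w => f w * g w)%C z.
Proof.
  intros Hf Hg; assert (Cg := cdiff_ccts g z Hg); revert Hf Hg.
  intros [p [Hp [d [Hd H]]]] [q [Hq [d' [Hd' H']]]].
  exists (fun w => p w * g w + f z * q w)%C; split.
  { apply ccts_plus; apply ccts_mult; try assumption; apply ccts_const. }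
  exists (Rmin d d'); split; [ apply Rmin_pos; assumption | intros w Hw ].
  rewrite (H w (Rlt_le_trans _ _ _ Hw (Rmin_l _ _))), (H' w (Rlt_le_trans _ _ _ Hw (Rmin_r _ _))); ring.
Qed.

Lemma cdiff_opp (f : C -> C) (z : C) : cdiff f z -> cdiff (fun w => - f w)%C z.
Proof.
  intros H; apply (cdiff_ext (fun w => - RtoC 1 * f w)%C); [ intros; ring | ].
  apply cdiff_mult; [ apply cdiff_const | exact H ].
Qed.

Lemma cdiff_minus (f g : C -> C) (z : C) : cdiff f z -> cdiff g z -> cdiff (fun w => f w - g w)%C z.
Proof. intros Hf Hg; apply cdiff_plus; [ | apply cdiff_opp ]; assumption. Qed.

Lemma cdiff_comp (f g : C -> C) (z : C) : cdiff f z -> cdiff g (f z) -> cdiff (fun w => g (f w)) z.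
Proof.
  intros Hf; assert (Cf := cdiff_ccts f z Hf); revert Hf.
  intros [p [Hp [d [Hd H]]]] [q [Hq [d' [Hd' H']]]].
  exists (fun w => p w * q (f w))%C; split.
  { apply ccts_mult; [ exact Hp | apply (ccts_comp f q); assumption ]. }
  destruct (Cf d' Hd') as [d'' [Hd'' H'']].
  exists (Rmin d d''); split; [ apply Rmin_pos; assumption | intros w Hw ].
  rewrite (H' (f w)) by (apply H'', (Rlt_le_trans _ _ _ Hw), Rmin_r).
  pose proof (H w (Rlt_le_trans _ _ _ Hw (Rmin_l _ _))) as E.
  replace (f w - f z)%C with ((w - z) * p w)%C by (rewrite E; ring); ring.
Qed.

Lemma cdiff_inv (f : C -> C) (z : C) : cdiff f z -> f z <> RtoC 0 -> cdiff (fun w => / f w)%C z.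
Proof.
  intros Hf H0; assert (Cf := cdiff_ccts f z Hf); revert Hf.
  intros [p [Hp [d [Hd H]]]].
  exists (fun w => - (p w * (/ f w * / f z)))%C; split.
  { apply (ccts_ext (fun w => - RtoC 1 * (p w * (/ f w * / f z)))%C); [ intros; ring | ].
    apply ccts_mult; [ apply ccts_const | apply ccts_mult; [ exact Hp | ] ].
    apply ccts_mult; [ apply ccts_inv; assumption | apply ccts_const ]. }
  destruct (ccts_neq_0 f z Cf H0) as [d' [Hd' H']].
  exists (Rmin d d'); split; [ apply Rmin_pos; assumption | intros w Hw ].
  destruct (H' w (Rlt_le_trans _ _ _ Hw (Rmin_r _ _))) as [_ Hn].
  pose proof (H w (Rlt_le_trans _ _ _ Hw (Rmin_l _ _))) as E.
  transitivity (/ f z - (f w - f z) * (/ f w * / f z))%C; [ field; split; assumption | ].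
  replace (f w - f z)%C with ((w - z) * p w)%C by (rewrite E; ring); ring.
Qed.

Lemma cdiff_div (f g : C -> C) (z : C) :
  cdiff f z -> cdiff g z -> g z <> RtoC 0 -> cdiff (fun w => f w / g w)%C z.
Proof. intros Hf Hg H0; apply cdiff_mult; [ | apply cdiff_inv ]; assumption. Qed.

Lemma cdiff_pow (f : C -> C) (n : nat) (z : C) : cdiff f z -> cdiff (fun w => f w ^ n)%C z.
Proof.
  intros Hf; induction n as [|n IH]; [ apply (cdiff_ext (fun _ => RtoC 1)); [ reflexivity | apply cdiff_const ] | ].
  apply (cdiff_ext (fun w => f w * f w ^ n)%C); [ intros; simpl; reflexivity | ].
  apply cdiff_mult; assumption.
Qed.

Lemma cdiff_eps (f : C -> C) (z l : C) :
  (forall e, 0 < e -> exists d, 0 < d /\ forall w, Cmod (w - z) < d ->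
     Cmod (f w - f z - l * (w - z)) <= e * Cmod (w - z)) -> cdiff f z.
Proof.
  intros H.
  exists (fun w => if Ceq_dec w z then l else ((f w - f z) / (w - z))%C); split.
  - intros e He; destruct (H (e / 2)) as [d [Hd Hw]]; [ lra | ].
    exists d; split; [ exact Hd | intros w Hwd ].
    destruct (Ceq_dec z z) as [_|]; [ | tauto ].
    destruct (Ceq_dec w z) as [->|Hn].
    + unfold Cminus; rewrite Cplus_opp_r, Cmod_0; exact He.
    + assert (Hn' : (w - z)%C <> RtoC 0) by (apply Cminus_eq_contra, Hn).
      replace ((f w - f z) / (w - z) - l)%C with ((f w - f z - l * (w - z)) / (w - z))%C by (field; exact Hn').
      rewrite Cmod_div by exact Hn'.
      assert (Hp := proj1 (Cmod_gt_0 _) Hn').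
      apply (Rmult_lt_reg_r (Cmod (w - z))); [ exact Hp | ].
      unfold Rdiv; rewrite Rmult_assoc, Rinv_l, Rmult_1_r by lra.
      specialize (Hw w Hwd); nra.
  - exists 1; split; [ lra | intros w _ ].
    destruct (Ceq_dec w z) as [->|Hn]; [ ring | ].
    field; apply Cminus_eq_contra, Hn.
Qed.

(** A remainder quadratic in w - z survives integration and summation when its constant is uniform
    or summable; differentiation under integral signs and of series passes through this form. *)
Lemma cdiff_quadratic (f : C -> C) (z l : C) (K d : R) :
  0 < d ->
  (forall w, Cmod (w - z) < d -> Cmod (f w - f z - l * (w - z)) <= K * Cmod (w - z) ^ 2) ->
  cdiff f z.
Proof.
  intros Hd H; apply (cdiff_eps f z l); intros e He.
  exists (Rmin d (e / (Rabs K + 1))).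
  pose proof (Rabs_pos K).
  assert (0 < e / (Rabs K + 1)) by (apply Rdiv_lt_0_compat; lra).
  split; [ apply Rmin_pos; assumption | intros w Hw ].
  eapply Rle_trans; [ apply H, (Rlt_le_trans _ _ _ Hw (Rmin_l _ _)) | ].
  pose proof (Rlt_le_trans _ _ _ Hw (Rmin_r _ _)) as Hw'.
  pose proof (Cmod_ge_0 (w - z)) as Hm.
  replace (K * Cmod (w - z) ^ 2) with (K * Cmod (w - z) * Cmod (w - z)) by ring.
  apply Rmult_le_compat_r; [ exact Hm | ].
  apply Rle_trans with ((Rabs K + 1) * (e / (Rabs K + 1))).
  - pose proof (Rle_abs K).
    apply Rle_trans with ((Rabs K + 1) * Cmod (w - z)); [ nra | apply Rmult_le_compat_l; lra ].
  - right; field; lra.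
Qed.

Lemma cdiff_Cexp (f : C -> C) (z : C) : cdiff f z -> cdiff (fun w => Cexp (f w)) z.
Proof.
  intros Hf; apply (cdiff_comp f Cexp z Hf); generalize (f z); clear f z Hf; intros z.
  apply (cdiff_quadratic Cexp z (Cexp z) (Cmod (Cexp z) * exp 1) 1); [ lra | intros w Hw ].
  replace (Cexp w - Cexp z - Cexp z * (w - z))%C with (Cexp z * (Cexp (w - z) - 1 - (w - z)))%C.
  - rewrite Cmod_mult, Rmult_assoc; apply Rmult_le_compat_l; [ apply Cmod_ge_0 | ].
    eapply Rle_trans; [ apply Cexp_sub1_sub_le | ].
    rewrite Rmult_comm; apply Rmult_le_compat_r; [ apply pow_le, Cmod_ge_0 | apply exp_le; lra ].
  - replace w with (z + (w - z))%C at 3 by ring; rewrite Cexp_plus; ring.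
Qed.

Lemma cdiff_C_differentiable (f : C -> C) (z : C) : cdiff f z <-> C_differentiable f z.
Proof.
  split.
  - intros [phi [Hphi [d [Hd H]]]]; exists (phi z); split.
    { apply (is_linear_scal_l (K := C_AbsRing) (V := C_NormedModule)). }
    intros x Hx.
    apply (is_filter_lim_locally_unique (V := AbsRing_NormedModule C_AbsRing)) in Hx; subst x.
    intros eps; destruct (Hphi eps (cond_pos eps)) as [d' [Hd' H']].
    assert (Hm : 0 < Rmin d d') by (apply Rmin_pos; assumption).
    exists (mkposreal _ Hm); intros w Hw.
    change (Cmod (w - z) < Rmin d d') in Hw.
    change (Cmod (f w - f z - (w - z) * phi z) <= eps * Cmod (w - z)).
    rewrite (H w (Rlt_le_trans _ _ _ Hw (Rmin_l _ _))).
    replace (f z + (w - z) * phi w - f z - (w - z) * phi z)%C with ((phi w - phi z) * (w - z))%C by ring.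
    rewrite Cmod_mult; apply Rmult_le_compat_r; [ apply Cmod_ge_0 | ].
    apply Rlt_le, H', (Rlt_le_trans _ _ _ Hw (Rmin_r _ _)).
  - intros [l [_ Hl]]; apply (cdiff_eps f z l); intros e He.
    destruct (Hl z (fun Q HQ => HQ) (mkposreal e He)) as [d H].
    exists d; split; [ apply cond_pos | intros w Hw ].
    specialize (H w Hw); change (Cmod (f w - f z - (w - z) * l) <= e * Cmod (w - z)) in H.
    rewrite Cmult_comm; exact H.
Qed.

(** The balls of the product uniform structure on C are squares; the square of half-side d / sqrt 2
    lies in the disc of radius d. *)
Lemma locally_Cmod (z : C) (Q : C -> Prop) :
  locally z Q <-> exists d, 0 < d /\ forall w, Cmod (w - z) < d -> Q w.
Proof.
  split.
  - intros [d H]; exists d; split; [ apply cond_pos | intros w Hw; apply H ].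
    apply C_NormedModule_mixin_compat1, Hw.
  - intros [d [Hd H]].
    assert (Hs : 0 < sqrt 2) by (apply sqrt_lt_R0; lra).
    assert (Hp : 0 < d / sqrt 2) by (apply Rdiv_lt_0_compat; assumption).
    exists (mkposreal _ Hp); intros w Hw; apply H.
    apply (C_NormedModule_mixin_compat2 z w) in Hw; simpl in Hw.
    replace (sqrt 2 * (d / sqrt 2)) with d in Hw by (field; lra); exact Hw.
Qed.

Lemma locally'_Cmod (z : C) (Q : C -> Prop) :
  locally' z Q <-> exists d, 0 < d /\ forall w, Cmod (w - z) < d -> w <> z -> Q w.
Proof. apply (locally_Cmod z (fun w => w <> z -> Q w)). Qed.

Lemma holomorphic_at_cdiff (f : C -> C) (z : C) (d : R) :
  0 < d -> (forall w, Cmod (w - z) < d -> cdiff f w) -> holomorphic_at f z.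
Proof.
  intros Hd H; apply locally_Cmod; exists d; split; [ exact Hd | ].
  intros w Hw; apply cdiff_C_differentiable, H, Hw.
Qed.

Lemma ccont_eps (g : R -> C) (t : R) :
  ccont g t <->
  forall e, 0 < e -> exists d, 0 < d /\ forall u, Rabs (u - t) < d -> Cmod (g u - g t) < e.
Proof.
  split.
  - intros [H1 H2] e He.
    assert (He2 : 0 < e / 2) by lra.
    destruct (proj1 (filterlim_locally _ _) H1 (mkposreal _ He2)) as [d K].
    destruct (proj1 (filterlim_locally _ _) H2 (mkposreal _ He2)) as [d' K'].
    exists (Rmin d d'); split; [ apply Rmin_pos; apply cond_pos | intros u Hu ].
    specialize (K u (Rlt_le_trans _ _ _ Hu (Rmin_l _ _))).
    specialize (K' u (Rlt_le_trans _ _ _ Hu (Rmin_r _ _))).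
    change (Rabs (Re (g u) - Re (g t)) < e / 2) in K.
    change (Rabs (Im (g u) - Im (g t)) < e / 2) in K'.
    eapply Rle_lt_trans; [ apply Cmod_le_ReIm | rewrite re_minus, im_minus; lra ].
  - intros H; split; apply filterlim_locally; intros e; destruct (H e (cond_pos e)) as [d [Hd K]];
      exists (mkposreal d Hd); intros u Hu; specialize (K u Hu).
    + change (Rabs (Re (g u - g t)) < e); eapply Rle_lt_trans; [ apply re_le_Cmod | exact K ].
    + change (Rabs (Im (g u - g t)) < e); eapply Rle_lt_trans; [ apply im_le_Cmod | exact K ].
Qed.

Lemma ccts_ccont (f : C -> C) (g : R -> C) (t : R) :
  ccts f (g t) -> ccont g t -> ccont (fun u => f (g u)) t.
Proof.
  intros Hf Hg; apply ccont_eps; intros e He.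
  destruct (Hf e He) as [d [Hd H]]; destruct (proj1 (ccont_eps g t) Hg d Hd) as [d' [Hd' H']].
  exists d'; split; [ exact Hd' | intros u Hu; apply H, H', Hu ].
Qed.

Lemma ccont_inv (g : R -> C) (t : R) : ccont g t -> g t <> RtoC 0 -> ccont (fun u => / g u)%C t.
Proof.
  intros Hg H0; apply (ccts_ccont (fun z => / z)%C g t); [ | exact Hg ].
  apply (ccts_inv (fun z => z)); [ apply ccts_id | exact H0 ].
Qed.

Lemma ccont_hline (y x : R) : ccont (fun t => (t, y) : C) x.
Proof. split; simpl; [ apply continuous_id | apply continuous_const ]. Qed.

Lemma ccont_vline (x y : R) : ccont (fun t => (x, t) : C) y.
Proof. split; simpl; [ apply continuous_const | apply continuous_id ]. Qed.

(** * Cauchy's theorem on rectangles *)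

(** The counterclockwise contour integral: dz is dx on the horizontal sides and i dy on the vertical
    ones. *)
Definition rect_int (f : C -> C) (x0 x1 y0 y1 : R) : C :=
  (CInt (fun x => f (x, y0)) x0 x1 + Ci * CInt (fun y => f (x1, y)) y0 y1
   - CInt (fun x => f (x, y1)) x0 x1 - Ci * CInt (fun y => f (x0, y)) y0 y1)%C.

Definition in_rect (x0 x1 y0 y1 : R) (z : C) : Prop := x0 <= Re z <= x1 /\ y0 <= Im z <= y1.

Definition rect_bd (x0 x1 y0 y1 : R) (z : C) : Prop :=
  in_rect x0 x1 y0 y1 z /\ (Re z = x0 \/ Re z = x1 \/ Im z = y0 \/ Im z = y1).

Lemma ex_CInt_hline (f : C -> C) (y x0 x1 : R) :
  x0 <= x1 -> (forall x, x0 <= x <= x1 -> ccts f (x, y)) -> ex_CInt (fun x => f (x, y)) x0 x1.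
Proof.
  intros Hx H; apply ex_CInt_cont; [ exact Hx | intros x Hx' ].
  apply (ccts_ccont f (fun t => (t, y) : C)); [ apply H, Hx' | apply ccont_hline ].
Qed.

Lemma ex_CInt_vline (f : C -> C) (x y0 y1 : R) :
  y0 <= y1 -> (forall y, y0 <= y <= y1 -> ccts f (x, y)) -> ex_CInt (fun y => f (x, y)) y0 y1.
Proof.
  intros Hy H; apply ex_CInt_cont; [ exact Hy | intros y Hy' ].
  apply (ccts_ccont f (fun t => (x, t) : C)); [ apply H, Hy' | apply ccont_vline ].
Qed.

Ltac rect_side H := apply H; unfold rect_bd, in_rect; cbn [Re Im fst snd]; lra.

Lemma rect_int_ex (f : C -> C) (x0 x1 y0 y1 : R) :
  x0 <= x1 -> y0 <= y1 -> (forall z, rect_bd x0 x1 y0 y1 z -> ccts f z) ->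
  ex_CInt (fun x => f (x, y0)) x0 x1 /\ ex_CInt (fun y => f (x1, y)) y0 y1 /\
  ex_CInt (fun x => f (x, y1)) x0 x1 /\ ex_CInt (fun y => f (x0, y)) y0 y1.
Proof.
  intros Hx Hy H; split; [ | split; [ | split ] ];
    [ apply ex_CInt_hline | apply ex_CInt_vline | apply ex_CInt_hline | apply ex_CInt_vline ];
    try assumption; intros t Ht; rect_side H.
Qed.

Lemma rect_int_plus (f g : C -> C) (x0 x1 y0 y1 : R) :
  x0 <= x1 -> y0 <= y1 ->
  (forall z, rect_bd x0 x1 y0 y1 z -> ccts f z) -> (forall z, rect_bd x0 x1 y0 y1 z -> ccts g z) ->
  rect_int (fun z => f z + g z)%C x0 x1 y0 y1 =
  (rect_int f x0 x1 y0 y1 + rect_int g x0 x1 y0 y1)%C.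
Proof.
  intros Hx Hy Hf Hg.
  destruct (rect_int_ex f _ _ _ _ Hx Hy Hf) as (F1 & F2 & F3 & F4).
  destruct (rect_int_ex g _ _ _ _ Hx Hy Hg) as (G1 & G2 & G3 & G4).
  unfold rect_int; rewrite !CInt_plus by assumption; ring.
Qed.

Lemma rect_int_scal (c : C) (f : C -> C) (x0 x1 y0 y1 : R) :
  x0 <= x1 -> y0 <= y1 -> (forall z, rect_bd x0 x1 y0 y1 z -> ccts f z) ->
  rect_int (fun z => c * f z)%C x0 x1 y0 y1 = (c * rect_int f x0 x1 y0 y1)%C.
Proof.
  intros Hx Hy Hf.
  destruct (rect_int_ex f _ _ _ _ Hx Hy Hf) as (F1 & F2 & F3 & F4).
  unfold rect_int; rewrite !CInt_scal by assumption; ring.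
Qed.

Lemma rect_int_ext (f g : C -> C) (x0 x1 y0 y1 : R) :
  x0 <= x1 -> y0 <= y1 -> (forall z, rect_bd x0 x1 y0 y1 z -> f z = g z) ->
  rect_int f x0 x1 y0 y1 = rect_int g x0 x1 y0 y1.
Proof.
  intros Hx Hy H; unfold rect_int.
  rewrite (CInt_ext (fun x => f (x, y0)) (fun x => g (x, y0))),
    (CInt_ext (fun x => f (x, y1)) (fun x => g (x, y1))),
    (CInt_ext (fun y => f (x0, y)) (fun y => g (x0, y))),
    (CInt_ext (fun y => f (x1, y)) (fun y => g (x1, y))); try assumption; try reflexivity;
    intros t Ht; rect_side H.
Qed.

Lemma rect_int_norm_le (f : C -> C) (M x0 x1 y0 y1 : R) :
  x0 <= x1 -> y0 <= y1 -> (forall z, rect_bd x0 x1 y0 y1 z -> ccts f z) ->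
  (forall z, rect_bd x0 x1 y0 y1 z -> Cmod (f z) <= M) ->
  Cmod (rect_int f x0 x1 y0 y1) <= 2 * ((x1 - x0) + (y1 - y0)) * M.
Proof.
  intros Hx Hy Hf HM.
  destruct (rect_int_ex f _ _ _ _ Hx Hy Hf) as (F1 & F2 & F3 & F4).
  assert (B1 : Cmod (CInt (fun x => f (x, y0)) x0 x1) <= (x1 - x0) * M)
    by (apply CInt_norm_le_const; try assumption; intros t Ht; rect_side HM).
  assert (B2 : Cmod (CInt (fun x => f (x, y1)) x0 x1) <= (x1 - x0) * M)
    by (apply CInt_norm_le_const; try assumption; intros t Ht; rect_side HM).
  assert (B3 : Cmod (CInt (fun y => f (x0, y)) y0 y1) <= (y1 - y0) * M)
    by (apply CInt_norm_le_const; try assumption; intros t Ht; rect_side HM).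
  assert (B4 : Cmod (CInt (fun y => f (x1, y)) y0 y1) <= (y1 - y0) * M)
    by (apply CInt_norm_le_const; try assumption; intros t Ht; rect_side HM).
  unfold rect_int.
  eapply Rle_trans; [ apply Cmod_sub_le | ].
  rewrite Cmod_mult, Cmod_Ci.
  pose proof (Cmod_sub_le (CInt (fun x => f (x, y0)) x0 x1 + Ci * CInt (fun y => f (x1, y)) y0 y1)
    (CInt (fun x => f (x, y1)) x0 x1)) as T1.
  pose proof (Cmod_triangle (CInt (fun x => f (x, y0)) x0 x1) (Ci * CInt (fun y => f (x1, y)) y0 y1)) as T2.
  rewrite Cmod_mult, Cmod_Ci in T2; lra.
Qed.

Lemma rect_int_split_x (f : C -> C) (x0 x1 x2 y0 y1 : R) :
  x0 <= x1 <= x2 ->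
  (forall x, x0 <= x <= x2 -> ccts f (x, y0) /\ ccts f (x, y1)) ->
  rect_int f x0 x2 y0 y1 = (rect_int f x0 x1 y0 y1 + rect_int f x1 x2 y0 y1)%C.
Proof.
  intros Hx H; unfold rect_int.
  rewrite (CInt_Chasles (fun x => f (x, y0)) x0 x1 x2), (CInt_Chasles (fun x => f (x, y1)) x0 x1 x2);
    try (apply ex_CInt_hline; [ lra | intros; apply H; lra ]); ring.
Qed.

Lemma rect_int_split_y (f : C -> C) (x0 x1 y0 y1 y2 : R) :
  y0 <= y1 <= y2 ->
  (forall y, y0 <= y <= y2 -> ccts f (x0, y) /\ ccts f (x1, y)) ->
  rect_int f x0 x1 y0 y2 = (rect_int f x0 x1 y0 y1 + rect_int f x0 x1 y1 y2)%C.
Proof.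
  intros Hx H; unfold rect_int.
  rewrite (CInt_Chasles (fun y => f (x0, y)) y0 y1 y2), (CInt_Chasles (fun y => f (x1, y)) y0 y1 y2);
    try (apply ex_CInt_vline; [ lra | intros; apply H; lra ]); ring.
Qed.

(** Affine functions have explicit primitives on each side; they are what Goursat's argument
    subtracts from f at the limit point. *)
Lemma rect_int_affine (A B : C) (x0 x1 y0 y1 : R) :
  x0 <= x1 -> y0 <= y1 -> rect_int (fun z => A + B * z)%C x0 x1 y0 y1 = RtoC 0.
Proof.
  intros Hx Hy.
  assert (Hh : forall y, CInt (fun x => A + B * (x, y))%C x0 x1 =
    ((A + B * (Ci * y)) * x1 + B * (x1 * x1 / 2)%R - ((A + B * (Ci * y)) * x0 + B * (x0 * x0 / 2)%R))%C).
  { intros y; apply (CInt_FTC (fun x => (A + B * (Ci * y)) * RtoC x + B * RtoC (x * x / 2))%C); try assumption.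
    - intros x _; eapply cderiv_eq.
      + apply cderiv_plus; apply cderiv_scal; apply cderiv_RtoC.
        * apply (is_derive_id (K := R_AbsRing)).
        * instantiate (1 := x); auto_derive; [ exact I | field ].
      + apply C_ext; unfold Re, Im; simpl; unfold one; simpl; ring.
    - intros x _; apply ccont_plus; [ apply ccont_const | ].
      apply ccont_mult; [ apply ccont_const | apply ccont_hline ]. }
  assert (Hv : forall x, CInt (fun y => A + B * (x, y))%C y0 y1 =
    ((A + B * x) * y1 + B * Ci * (y1 * y1 / 2)%R - ((A + B * x) * y0 + B * Ci * (y0 * y0 / 2)%R))%C).
  { intros x; apply (CInt_FTC (fun y => (A + B * x) * RtoC y + B * Ci * RtoC (y * y / 2))%C); try assumption.
    - intros y _; eapply cderiv_eq.
      + apply cderiv_plus; apply cderiv_scal; apply cderiv_RtoC.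
        * apply (is_derive_id (K := R_AbsRing)).
        * instantiate (1 := y); auto_derive; [ exact I | field ].
      + apply C_ext; unfold Re, Im; simpl; unfold one; simpl; ring.
    - intros y _; apply ccont_plus; [ apply ccont_const | ].
      apply ccont_mult; [ apply ccont_const | apply ccont_vline ]. }
  unfold rect_int; rewrite !Hh, !Hv; apply C_ext; unfold Re, Im; simpl; field.
Qed.

(** The common point is the supremum of the left ends, all of which lie below every right end. *)
Lemma nested_halves (w : R) (u : nat -> R) :
  0 <= w -> (forall n, u n <= u (S n) <= u n + w / 2 ^ S n) ->
  exists x, forall n, u n <= x <= u n + w / 2 ^ n.
Proof.
  intros Hw Hu.
  assert (Hstep : forall n, u (S n) + w / 2 ^ S n <= u n + w / 2 ^ n).
  { intros n; specialize (Hu n); assert (0 < 2 ^ n) by (apply pow_lt; lra).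
    replace (w / 2 ^ n) with (w / 2 ^ S n + w / 2 ^ S n) by (simpl; field; lra); lra. }
  assert (Hpos : forall n, 0 <= w / 2 ^ n).
  { intros n; apply Rmult_le_pos; [ exact Hw | apply Rlt_le, Rinv_0_lt_compat, pow_lt; lra ]. }
  assert (Hinc : forall k n, u n <= u (n + k)%nat).
  { induction k as [|k IH]; intros n; [ rewrite Nat.add_0_r; lra | ].
    rewrite <- plus_n_Sm; specialize (IH n); destruct (Hu (n + k)%nat); lra. }
  assert (Hdec : forall k n, u (n + k)%nat + w / 2 ^ (n + k) <= u n + w / 2 ^ n).
  { induction k as [|k IH]; intros n; [ rewrite Nat.add_0_r; lra | ].
    rewrite <- plus_n_Sm; specialize (IH n); specialize (Hstep (n + k)%nat); lra. }
  assert (Hup : forall m n, u m <= u n + w / 2 ^ n).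
  { intros m n; destruct (Nat.le_ge_cases m n) as [H|H].
    - replace n with (m + (n - m))%nat by lia; specialize (Hinc (n - m)%nat m).
      specialize (Hpos (m + (n - m))%nat); lra.
    - replace m with (n + (m - n))%nat by lia; specialize (Hdec (m - n)%nat n).
      specialize (Hpos (n + (m - n))%nat); lra. }
  destruct (completeness (fun x => exists n, x = u n)) as [x [H1 H2]].
  - exists (u 0%nat + w / 2 ^ 0); intros x [n ->]; apply Hup.
  - exists (u 0%nat), 0%nat; reflexivity.
  - exists x; intros n; split; [ apply H1; exists n; reflexivity | ].
    apply H2; intros y [m ->]; apply Hup.
Qed.

Lemma half_pow_small (w e : R) : 0 <= w -> 0 < e -> exists n, w / 2 ^ n < e.
Proof.
  intros Hw He.
  destruct (Pow_x_infinity 2 ltac:(rewrite Rabs_right; lra) (w / e + 1)) as [N HN].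
  exists N; specialize (HN N (Nat.le_refl N)).
  assert (Hp : 0 < 2 ^ N) by (apply pow_lt; lra).
  rewrite Rabs_right in HN by lra.
  apply (Rmult_lt_reg_r (2 ^ N)); [ exact Hp | ].
  unfold Rdiv; rewrite Rmult_assoc, Rinv_l, Rmult_1_r by lra.
  apply Rlt_le_trans with (e * (w / e + 1)); [ | apply Rmult_le_compat_l; lra ].
  replace (e * (w / e + 1)) with (w + e) by (field; lra); lra.
Qed.

(* A rectangle whose boundary integral is large compared to its squared size has a quarter with
   the same property; at the limit point differentiability is contradicted. *)
Lemma goursat (f : C -> C) (x0 x1 y0 y1 : R) :
  x0 <= x1 -> y0 <= y1 -> (forall z, in_rect x0 x1 y0 y1 z -> cdiff f z) ->
  rect_int f x0 x1 y0 y1 = RtoC 0.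
Proof.
  intros Hx Hy Hf.
  set (w := x1 - x0); set (h := y1 - y0).
  assert (Hw : 0 <= w) by (unfold w; lra); assert (Hh : 0 <= h) by (unfold h; lra).
  assert (Hcts : forall z, in_rect x0 x1 y0 y1 z -> ccts f z) by (intros; apply cdiff_ccts, Hf; assumption).
  apply Cmod_small_eq; intros e0 He0.
  replace (rect_int f x0 x1 y0 y1 - 0)%C with (rect_int f x0 x1 y0 y1) by ring.
  (* The threshold of [bad] is the perimeter 2 (w + h) times the remainder e (w + h), both scaled by
     2^(-n). This e keeps it below e0 at n = 0, and the + 1 allows a degenerate rectangle. *)
  set (e := e0 / (2 * (w + h) ^ 2 + 1)).
  assert (He : 0 < e) by (apply Rdiv_lt_0_compat; [ lra | nra ]).
  set (bad := fun (n : nat) (p : R * R) =>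
    x0 <= fst p /\ fst p + w / 2 ^ n <= x1 /\ y0 <= snd p /\ snd p + h / 2 ^ n <= y1 /\
    e * (2 * ((w + h) / 2 ^ n) ^ 2) <
      Cmod (rect_int f (fst p) (fst p + w / 2 ^ n) (snd p) (snd p + h / 2 ^ n))).
  apply Rnot_lt_le; intros Hbad.
  assert (B0 : bad 0%nat (x0, y0)).
  { unfold bad; cbn [fst snd pow]; unfold Rdiv; rewrite Rinv_1, !Rmult_1_r.
    replace (x0 + w) with x1 by (unfold w; ring); replace (y0 + h) with y1 by (unfold h; ring).
    repeat split; try lra; eapply Rle_lt_trans; [ | exact Hbad ].
    unfold e; apply Rle_trans with (e0 / (2 * (w + h) ^ 2 + 1) * (2 * (w + h) ^ 2 + 1));
      [ apply Rmult_le_compat_l; [ apply Rlt_le, He | nra ] | right; field; nra ]. }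
  assert (Bs : forall n p, bad n p -> exists q, bad (S n) q /\
      fst p <= fst q <= fst p + w / 2 ^ S n /\ snd p <= snd q <= snd p + h / 2 ^ S n).
  { intros n [a b] (K1 & K2 & K3 & K4 & K5); cbn [fst snd] in *.
    assert (P2 : 0 < 2 ^ n) by (apply pow_lt; lra).
    set (w' := w / 2 ^ S n); set (h' := h / 2 ^ S n).
    assert (Ew : w / 2 ^ n = w' + w') by (unfold w'; simpl; field; lra).
    assert (Eh : h / 2 ^ n = h' + h') by (unfold h'; simpl; field; lra).
    assert (Es : (w + h) / 2 ^ n = 2 * ((w + h) / 2 ^ S n)) by (simpl; field; lra).
    assert (Pw : 0 <= w') by (apply Rmult_le_pos; [ exact Hw | apply Rlt_le, Rinv_0_lt_compat, pow_lt; lra ]).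
    assert (Ph : 0 <= h') by (apply Rmult_le_pos; [ exact Hh | apply Rlt_le, Rinv_0_lt_compat, pow_lt; lra ]).
    rewrite Ew, Eh, Es in K5; rewrite Ew in K2; rewrite Eh in K4.
    set (s := (w + h) / 2 ^ S n) in *.
    assert (Hin : forall x y, x0 <= x <= x1 -> y0 <= y <= y1 -> ccts f (x, y))
      by (intros; apply Hcts; unfold in_rect; cbn [Re Im fst snd]; lra).
    (* If no quarter is bad, the four bounds e (2 s^2) add up to e (2 (2 s)^2), the bound that the
       parent violates. *)
    apply NNPP; intros Hno.
    assert (Q : forall a' b', (a' = a \/ a' = a + w') -> (b' = b \/ b' = b + h') ->
      Cmod (rect_int f a' (a' + w') b' (b' + h')) <= e * (2 * s ^ 2)).
    { intros a' b' Ha Hb; apply Rnot_lt_le; intros Hlt; apply Hno; exists (a', b').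
      unfold bad; cbn [fst snd]; fold w' h' s; destruct Ha, Hb; subst; repeat split; lra. }
    rewrite (rect_int_split_x f a (a + w') (a + (w' + w'))) in K5;
      [ | lra | intros x Hx'; split; apply Hin; lra ].
    rewrite (rect_int_split_y f a (a + w') b (b + h') (b + (h' + h'))) in K5;
      [ | lra | intros y Hy'; split; apply Hin; lra ].
    rewrite (rect_int_split_y f (a + w') (a + (w' + w')) b (b + h') (b + (h' + h'))) in K5;
      [ | lra | intros y Hy'; split; apply Hin; lra ].
    pose proof (Q a b ltac:(tauto) ltac:(tauto)) as Q1.
    pose proof (Q (a + w') b ltac:(tauto) ltac:(tauto)) as Q2.
    pose proof (Q a (b + h') ltac:(tauto) ltac:(tauto)) as Q3.
    pose proof (Q (a + w') (b + h') ltac:(tauto) ltac:(tauto)) as Q4.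
    replace (a + (w' + w')) with (a + w' + w') in K5 by ring.
    replace (b + (h' + h')) with (b + h' + h') in K5 by ring.
    pose proof (Cmod_triangle (rect_int f a (a + w') b (b + h') + rect_int f a (a + w') (b + h') (b + h' + h'))
      (rect_int f (a + w') (a + w' + w') b (b + h') + rect_int f (a + w') (a + w' + w') (b + h') (b + h' + h'))).
    pose proof (Cmod_triangle (rect_int f a (a + w') b (b + h')) (rect_int f a (a + w') (b + h') (b + h' + h'))).
    pose proof (Cmod_triangle (rect_int f (a + w') (a + w' + w') b (b + h'))
      (rect_int f (a + w') (a + w' + w') (b + h') (b + h' + h'))).
    nra. }
  (* Dependent choice: a bad quarter is selected at each stage together with its proof of
     badness. *)
  set (next := fun n (p : {p | bad n p}) =>
    constructive_indefinite_description _ (Bs n (proj1_sig p) (proj2_sig p))).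
  set (sq := fix sq (n : nat) : {p | bad n p} :=
    match n with
    | O => exist _ (x0, y0) B0
    | S m => exist _ (proj1_sig (next m (sq m))) (proj1 (proj2_sig (next m (sq m))))
    end).
  set (u := fun n => proj1_sig (sq n)).
  assert (Hb : forall n, bad n (u n)) by (intros n; apply (proj2_sig (sq n))).
  assert (Hs : forall n, fst (u n) <= fst (u (S n)) <= fst (u n) + w / 2 ^ S n /\
      snd (u n) <= snd (u (S n)) <= snd (u n) + h / 2 ^ S n)
    by (intros n; apply (proj2 (proj2_sig (next n (sq n))))).
  destruct (nested_halves w (fun n => fst (u n)) Hw ltac:(intros n; apply Hs)) as [x Hxn].
  destruct (nested_halves h (fun n => snd (u n)) Hh ltac:(intros n; apply Hs)) as [y Hyn].
  set (z := (x, y) : C).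
  assert (Hz : in_rect x0 x1 y0 y1 z).
  { destruct (Hb 0%nat) as (K1 & K2 & K3 & K4 & _); specialize (Hxn 0%nat); specialize (Hyn 0%nat).
    unfold in_rect, z; cbn [Re Im fst snd]; lra. }
  destruct (Hf z Hz) as [phi [Hphi [d [Hd Hd']]]].
  destruct (Hphi e He) as [d2 [Hd2 Hd2']].
  destruct (half_pow_small (w + h) (Rmin d d2)) as [n Hn]; [ lra | apply Rmin_pos; assumption | ].
  destruct (Hb n) as (K1 & K2 & K3 & K4 & K5); specialize (Hxn n); specialize (Hyn n).
  set (a := fst (u n)) in *; set (b := snd (u n)) in *.
  assert (P2 : 0 < 2 ^ n) by (apply pow_lt; lra).
  assert (Pw : 0 <= w / 2 ^ n) by (apply Rmult_le_pos; [ exact Hw | apply Rlt_le, Rinv_0_lt_compat, P2 ]).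
  assert (Ph : 0 <= h / 2 ^ n) by (apply Rmult_le_pos; [ exact Hh | apply Rlt_le, Rinv_0_lt_compat, P2 ]).
  assert (Es : (w + h) / 2 ^ n = w / 2 ^ n + h / 2 ^ n) by (field; lra).
  set (w' := w / 2 ^ n) in *; set (h' := h / 2 ^ n) in *.
  (* [r] is f minus its affine part at z. It has the same contour integral, and on small rectangles
     it is at most e times the distance to z. *)
  set (A := (f z - z * phi z)%C).
  set (r := fun v => (f v + (- A + - phi z * v))%C).
  assert (Hin : forall v, rect_bd a (a + w') b (b + h') v -> ccts f v).
  { intros v [[V1 V2] _]; apply Hcts; unfold in_rect; lra. }
  assert (Haff : forall p q v, ccts (fun v : C => p + q * v)%C v).
  { intros p q v; apply ccts_plus; [ apply ccts_const | apply ccts_mult; [ apply ccts_const | apply ccts_id ] ]. }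
  assert (E : rect_int f a (a + w') b (b + h') = rect_int r a (a + w') b (b + h')).
  { unfold r; rewrite rect_int_plus, rect_int_affine; try lra; try assumption; [ ring | intros; apply Haff ]. }
  rewrite E, Es in K5.
  assert (Bd : Cmod (rect_int r a (a + w') b (b + h')) <=
    2 * (((a + w') - a) + ((b + h') - b)) * (e * (w' + h'))).
  { apply rect_int_norm_le; try lra.
    - intros v Hv; unfold r; apply ccts_plus; [ apply Hin, Hv | apply Haff ].
    - intros v [[V1 V2] _].
      assert (Hvz : Cmod (v - z) <= w' + h').
      { eapply Rle_trans; [ apply Cmod_le_ReIm | ]; rewrite re_minus, im_minus; unfold z; cbn [Re Im fst snd].
        apply Rplus_le_compat; apply Rabs_le; lra. }
      assert (Hv1 : Cmod (v - z) < d) by (eapply Rle_lt_trans; [ exact Hvz | ];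
        rewrite <- Es; eapply Rlt_le_trans; [ exact Hn | apply Rmin_l ]).
      assert (Hv2 : Cmod (v - z) < d2) by (eapply Rle_lt_trans; [ exact Hvz | ];
        rewrite <- Es; eapply Rlt_le_trans; [ exact Hn | apply Rmin_r ]).
      replace (r v) with ((phi v - phi z) * (v - z))%C by (unfold r, A; rewrite (Hd' v Hv1); ring).
      rewrite Cmod_mult; specialize (Hd2' v Hv2).
      apply Rmult_le_compat; try apply Cmod_ge_0; lra. }
  nra.
Qed.

(** Goursat's theorem discards everything outside a square of half-side t around s, whose contour
    integral is at most its perimeter 8 t times a bound of g; t is arbitrarily small. *)
Lemma rect_int_exceptional (g : C -> C) (s : C) (B d x0 x1 y0 y1 : R) :
  x0 < Re s < x1 -> y0 < Im s < y1 ->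
  (forall z, in_rect x0 x1 y0 y1 z -> z <> s -> cdiff g z) ->
  0 < d -> (forall z, Cmod (z - s) < d -> z <> s -> Cmod (g z) <= B) ->
  rect_int g x0 x1 y0 y1 = RtoC 0.
Proof.
  intros Hx Hy Hg Hd HB.
  set (a := Re s) in *; set (b := Im s) in *.
  apply Cmod_small_eq; intros e He.
  replace (rect_int g x0 x1 y0 y1 - 0)%C with (rect_int g x0 x1 y0 y1) by ring.
  set (B' := Rabs B + 1); pose proof (Rabs_pos B) as PB; pose proof (Rle_abs B) as LB.
  assert (Hex : exists t, 0 < t /\ t < a - x0 /\ t < x1 - a /\ t < b - y0 /\ t < y1 - b /\ 2 * t < d /\ 8 * t * B' <= e).
  { assert (E : 0 < e / (8 * B')) by (apply Rdiv_lt_0_compat; unfold B'; lra).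
    exists (Rmin (e / (8 * B')) (Rmin ((a - x0) / 2) (Rmin ((x1 - a) / 2) (Rmin ((b - y0) / 2)
      (Rmin ((y1 - b) / 2) (d / 4)))))).
    set (t := Rmin _ _).
    assert (T1 : t <= e / (8 * B')) by apply Rmin_l.
    assert (T2 : t <= Rmin ((a - x0) / 2) (Rmin ((x1 - a) / 2) (Rmin ((b - y0) / 2)
      (Rmin ((y1 - b) / 2) (d / 4))))) by apply Rmin_r.
    assert (T3 : 0 < t) by (unfold t; repeat apply Rmin_pos; lra).
    pose proof (Rle_trans _ _ _ T2 (Rmin_l _ _)) as S1; pose proof (Rle_trans _ _ _ T2 (Rmin_r _ _)) as R1.
    pose proof (Rle_trans _ _ _ R1 (Rmin_l _ _)) as S2; pose proof (Rle_trans _ _ _ R1 (Rmin_r _ _)) as R2.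
    pose proof (Rle_trans _ _ _ R2 (Rmin_l _ _)) as S3; pose proof (Rle_trans _ _ _ R2 (Rmin_r _ _)) as R3.
    pose proof (Rle_trans _ _ _ R3 (Rmin_l _ _)) as S4; pose proof (Rle_trans _ _ _ R3 (Rmin_r _ _)) as S5.
    repeat split; try lra.
    replace e with (8 * (e / (8 * B')) * B') by (field; unfold B'; lra).
    apply Rmult_le_compat_r; unfold B' in *; lra. }
  destruct Hex as (t & Ht & T1 & T2 & T3 & T4 & T5 & T6).
  assert (Hc : forall x y, x0 <= x <= x1 -> y0 <= y <= y1 -> x <> a \/ y <> b -> ccts g (x, y)).
  { intros x y Hx' Hy' Hn; apply cdiff_ccts, Hg; [ unfold in_rect; cbn [Re Im fst snd]; lra | ].
    intros E; apply (f_equal Re) in E as E1; apply (f_equal Im) in E as E2; cbn [Re Im fst snd] in E1, E2.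
    unfold a, b, Re, Im in Hn; tauto. }
  assert (Hz : forall u0 u1 v0 v1, x0 <= u0 <= u1 -> u1 <= x1 -> y0 <= v0 <= v1 -> v1 <= y1 ->
     (u1 < a \/ a < u0 \/ v1 < b \/ b < v0) -> rect_int g u0 u1 v0 v1 = RtoC 0).
  { intros u0 u1 v0 v1 U0 U1 V0 V1 H; apply goursat; try lra.
    intros z [Z1 Z2]; apply Hg; [ unfold in_rect; lra | intros ->; fold a b in Z1, Z2; lra ]. }
  rewrite (rect_int_split_x g x0 (a - t) x1) by
    (try lra; intros x Hx'; split; apply Hc; lra).
  rewrite (rect_int_split_x g (a - t) (a + t) x1) by
    (try lra; intros x Hx'; split; apply Hc; lra).
  rewrite (rect_int_split_y g (a - t) (a + t) y0 (b - t) y1) by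
    (try lra; intros y Hy'; split; apply Hc; lra).
  rewrite (rect_int_split_y g (a - t) (a + t) (b - t) (b + t) y1) by
    (try lra; intros y Hy'; split; apply Hc; lra).
  rewrite (Hz x0 (a - t) y0 y1), (Hz (a + t) x1 y0 y1), (Hz (a - t) (a + t) y0 (b - t)),
    (Hz (a - t) (a + t) (b + t) y1) by lra.
  rewrite !Cplus_0_l, !Cplus_0_r.
  eapply Rle_trans; [ apply (rect_int_norm_le g B') | ]; try lra.
  - intros [x y] [[Z1 Z2] Z3]; cbn [Re Im fst snd] in *; apply Hc; lra.
  - intros z [[Z1 Z2] Z3].
    assert (z <> s) by (intros ->; fold a b in Z1, Z2, Z3; lra).
    apply Rle_trans with B; [ apply HB; [ | assumption ] | unfold B'; lra ].
    eapply Rle_lt_trans; [ apply Cmod_le_ReIm | ]; rewrite re_minus, im_minus; fold a b.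
    apply Rle_lt_trans with (t + t); [ apply Rplus_le_compat; apply Rabs_le; lra | lra ].
Qed.

(** * Cauchy's formula and its consequences *)

(** This is 2 pi i for s inside the rectangle. Cauchy's formula keeps it as a factor, so that its
    non-vanishing replaces its evaluation. *)
Definition kappa (x0 x1 y0 y1 : R) (s : C) : C := rect_int (fun z => / (z - s))%C x0 x1 y0 y1.

Lemma ccts_inv_sub (s z : C) : z <> s -> ccts (fun w => / (w - s))%C z.
Proof.
  intros H; apply (ccts_inv (fun w => w - s)%C); [ | apply Cminus_eq_contra, H ].
  apply ccts_plus; [ apply ccts_id | apply ccts_const ].
Qed.

Lemma rect_bd_neq (x0 x1 y0 y1 : R) (s z : C) :
  x0 < Re s < x1 -> y0 < Im s < y1 -> rect_bd x0 x1 y0 y1 z -> z <> s.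
Proof. intros Hx Hy [[H1 H2] H3] ->; lra. Qed.

Lemma sumsq_pos (a b : R) : a <> 0 \/ b <> 0 -> 0 < a * (a * 1) + b * (b * 1).
Proof.
  intros H; pose proof (Rle_0_sqr a) as Ha; pose proof (Rle_0_sqr b) as Hb; unfold Rsqr in *.
  destruct H as [H|H]; apply Rsqr_pos_lt in H; unfold Rsqr in H; lra.
Qed.

(* Each of the four sides contributes a positive imaginary part. *)
Lemma kappa_neq_0 (x0 x1 y0 y1 : R) (s : C) :
  x0 < Re s < x1 -> y0 < Im s < y1 -> kappa x0 x1 y0 y1 s <> RtoC 0.
Proof.
  intros Hx Hy H; apply (f_equal Im) in H.
  set (f := fun z => (/ (z - s))%C) in *.
  assert (Hc : forall z, rect_bd x0 x1 y0 y1 z -> ccts f z).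
  { intros z Hz; apply ccts_inv_sub, (rect_bd_neq _ _ _ _ _ _ Hx Hy Hz). }
  assert (Hh : forall y x, x0 <= x <= x1 -> y = y0 \/ y = y1 -> ccont (fun t => f (t, y)) x).
  { intros y x Hx' Hy'; apply (ccts_ccont f (fun t => (t, y) : C)); [ | apply ccont_hline ].
    apply Hc; unfold rect_bd, in_rect; cbn [Re Im fst snd]; lra. }
  assert (Hv : forall x y, y0 <= y <= y1 -> x = x0 \/ x = x1 -> ccont (fun t => f (x, t)) y).
  { intros x y Hy' Hx'; apply (ccts_ccont f (fun t => (x, t) : C)); [ | apply ccont_vline ].
    apply Hc; unfold rect_bd, in_rect; cbn [Re Im fst snd]; lra. }
  assert (I1 : 0 < RInt (fun x => Im (f (x, y0))) x0 x1).
  { apply RInt_gt_0; [ lra | | intros t Ht; exact (proj2 (Hh y0 t Ht (or_introl eq_refl))) ].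
    intros x Hx'; unfold f, Im; simpl; unfold Re, Im in *.
    apply Rdiv_lt_0_compat; [ lra | apply sumsq_pos; lra ]. }
  assert (I2 : 0 < RInt (fun y => Re (f (x1, y))) y0 y1).
  { apply RInt_gt_0; [ lra | | intros t Ht; exact (proj1 (Hv x1 t Ht (or_intror eq_refl))) ].
    intros y Hy'; unfold f, Re; simpl; unfold Re, Im in *.
    apply Rdiv_lt_0_compat; [ lra | apply sumsq_pos; lra ]. }
  assert (I3 : 0 < - RInt (fun x => Im (f (x, y1))) x0 x1).
  { change (0 < opp (RInt (fun x => Im (f (x, y1))) x0 x1)); rewrite <- (RInt_opp (V := R_CompleteNormedModule)).
    - apply RInt_gt_0; [ lra | | ].
      + intros x Hx'; unfold opp; simpl; unfold f, Im; simpl; unfold Re, Im in *; unfold Rdiv.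
        rewrite <- Ropp_mult_distr_l_reverse.
        apply Rdiv_lt_0_compat; [ lra | apply sumsq_pos; lra ].
      + intros x Hx'; apply (continuous_opp (fun x => Im (f (x, y1)))), (proj2 (Hh y1 x ltac:(lra) (or_intror eq_refl))).
    - apply (ex_RInt_continuous (V := R_CompleteNormedModule)); rewrite Rmin_left, Rmax_right by lra.
      intros t Ht; exact (proj2 (Hh y1 t Ht (or_intror eq_refl))). }
  assert (I4 : 0 < - RInt (fun y => Re (f (x0, y))) y0 y1).
  { change (0 < opp (RInt (fun y => Re (f (x0, y))) y0 y1)); rewrite <- (RInt_opp (V := R_CompleteNormedModule)).
    - apply RInt_gt_0; [ lra | | ].
      + intros y Hy'; unfold opp; simpl; unfold f, Re; simpl; unfold Re, Im in *; unfold Rdiv.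
        rewrite <- Ropp_mult_distr_l_reverse.
        apply Rdiv_lt_0_compat; [ lra | apply sumsq_pos; lra ].
      + intros y Hy'; apply (continuous_opp (fun y => Re (f (x0, y)))), (proj1 (Hv x0 y ltac:(lra) (or_introl eq_refl))).
    - apply (ex_RInt_continuous (V := R_CompleteNormedModule)); rewrite Rmin_left, Rmax_right by lra.
      intros t Ht; exact (proj1 (Hv x0 t Ht (or_introl eq_refl))). }
  change (Im (rect_int f x0 x1 y0 y1) = 0) in H; unfold rect_int in H.
  rewrite !im_minus, im_plus, !im_mult in H.
  change (Im (CInt (fun x => f (x, y0)) x0 x1)) with (RInt (fun x => Im (f (x, y0))) x0 x1) in H.
  change (Im (CInt (fun x => f (x, y1)) x0 x1)) with (RInt (fun x => Im (f (x, y1))) x0 x1) in H.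
  change (Re (CInt (fun y => f (x0, y)) y0 y1)) with (RInt (fun y => Re (f (x0, y))) y0 y1) in H.
  change (Re (CInt (fun y => f (x1, y)) y0 y1)) with (RInt (fun y => Re (f (x1, y))) y0 y1) in H.
  change (Re Ci) with 0 in H; change (Im Ci) with 1 in H; lra.
Qed.

(** The quotient (f z - f s) / (z - s) is bounded near s by differentiability, so its contour
    integral vanishes and only f s times [kappa] is left. *)
Lemma cauchy_formula (f : C -> C) (s : C) (x0 x1 y0 y1 : R) :
  x0 < Re s < x1 -> y0 < Im s < y1 -> (forall z, in_rect x0 x1 y0 y1 z -> cdiff f z) ->
  rect_int (fun z => f z / (z - s))%C x0 x1 y0 y1 = (f s * kappa x0 x1 y0 y1 s)%C.
Proof.
  intros Hx Hy Hf.
  set (g := fun z => ((f z - f s) * / (z - s))%C).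
  assert (Hg : forall z, in_rect x0 x1 y0 y1 z -> z <> s -> cdiff g z).
  { intros z Hz Hn; apply cdiff_mult; [ apply cdiff_minus; [ apply Hf, Hz | apply cdiff_const ] | ].
    apply (cdiff_inv (fun w => w - s)%C); [ | apply Cminus_eq_contra, Hn ].
    apply cdiff_minus; [ apply cdiff_id | apply cdiff_const ]. }
  assert (H0 : rect_int g x0 x1 y0 y1 = RtoC 0).
  { destruct (Hf s) as [phi [Hphi [d [Hd Hd']]]]; [ unfold in_rect; lra | ].
    destruct (ccts_bounded phi s Hphi) as [d2 [Hd2 Hb]].
    apply (rect_int_exceptional g s (Cmod (phi s) + 1) (Rmin d d2)); try assumption.
    - apply Rmin_pos; assumption.
    - intros z Hz Hn; unfold g.
      rewrite (Hd' z (Rlt_le_trans _ _ _ Hz (Rmin_l _ _))).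
      replace (_ * _)%C with (phi z) by (field; apply Cminus_eq_contra, Hn).
      apply Hb, (Rlt_le_trans _ _ _ Hz (Rmin_r _ _)). }
  rewrite (rect_int_ext _ (fun z => g z + f s * / (z - s))%C) by
    (try lra; intros z Hz; unfold g, Cdiv; ring).
  assert (Hk : forall z, rect_bd x0 x1 y0 y1 z -> ccts (fun w => / (w - s))%C z).
  { intros z Hz; apply ccts_inv_sub, (rect_bd_neq _ _ _ _ _ _ Hx Hy Hz). }
  rewrite rect_int_plus, rect_int_scal, H0; try lra; try assumption.
  - unfold kappa; ring.
  - intros z Hz; apply cdiff_ccts, Hg; [ apply Hz | apply (rect_bd_neq _ _ _ _ _ _ Hx Hy Hz) ].
  - intros z Hz; apply ccts_mult; [ apply ccts_const | apply Hk, Hz ].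
Qed.

Lemma ex_CInt_bounded (f : R -> C) (a b : R) :
  a <= b -> ex_CInt f a b -> exists M, forall t, a <= t <= b -> Cmod (f t) <= M.
Proof.
  intros Hab [H1 H2].
  destruct (ex_RInt_ub _ _ _ H1) as [M1 K1]; destruct (ex_RInt_ub _ _ _ H2) as [M2 K2].
  rewrite Rmin_left, Rmax_right in K1, K2 by assumption.
  exists (M1 + M2); intros t Ht; eapply Rle_trans; [ apply Cmod_le_ReIm | ].
  apply Rplus_le_compat; [ apply K1, Ht | apply K2, Ht ].
Qed.

Lemma rect_bd_bounded (f : C -> C) (x0 x1 y0 y1 : R) :
  x0 <= x1 -> y0 <= y1 -> (forall z, rect_bd x0 x1 y0 y1 z -> ccts f z) ->
  exists M, 0 <= M /\ forall z, rect_bd x0 x1 y0 y1 z -> Cmod (f z) <= M.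
Proof.
  intros Hx Hy Hf.
  destruct (rect_int_ex f _ _ _ _ Hx Hy Hf) as (F1 & F2 & F3 & F4).
  destruct (ex_CInt_bounded _ _ _ Hx F1) as [M1 K1]; destruct (ex_CInt_bounded _ _ _ Hy F2) as [M2 K2].
  destruct (ex_CInt_bounded _ _ _ Hx F3) as [M3 K3]; destruct (ex_CInt_bounded _ _ _ Hy F4) as [M4 K4].
  exists (Rabs M1 + Rabs M2 + Rabs M3 + Rabs M4).
  pose proof (Rle_abs M1); pose proof (Rle_abs M2); pose proof (Rle_abs M3); pose proof (Rle_abs M4).
  pose proof (Rabs_pos M1); pose proof (Rabs_pos M2); pose proof (Rabs_pos M3); pose proof (Rabs_pos M4).
  split; [ lra | ].
  intros [x y] [[Z1 Z2] Z3]; cbn [Re Im fst snd] in *; destruct Z3 as [->|[->|[->| ->]]].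
  - specialize (K4 y ltac:(lra)); lra.
  - specialize (K2 y ltac:(lra)); lra.
  - specialize (K1 x ltac:(lra)); lra.
  - specialize (K3 x ltac:(lra)); lra.
Qed.

(* Cauchy's formula for [f z / (z - c) ^ n], which stays holomorphic because [f] vanishes near [c],
   bounds [|f s|] by a multiple of [(|s - c| / r) ^ n] for every [n]. *)
Lemma vanish_square (f : C -> C) (c s : C) (r d : R) :
  (forall z, in_rect (Re c - r) (Re c + r) (Im c - r) (Im c + r) z -> cdiff f z) ->
  0 < d -> (forall z, Cmod (z - c) < d -> f z = RtoC 0) ->
  Cmod (s - c) < r -> f s = RtoC 0.
Proof.
  intros Hf Hd H0 Hs.
  destruct (Ceq_dec s c) as [->|Hsc].
  { apply H0; unfold Cminus; rewrite Cplus_opp_r, Cmod_0; exact Hd. }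
  set (x0 := Re c - r) in *; set (x1 := Re c + r) in *; set (y0 := Im c - r) in *; set (y1 := Im c + r) in *.
  assert (Psc : 0 < Cmod (s - c)) by (apply Cmod_pos_sub, Hsc).
  assert (Hr : 0 < r) by lra.
  assert (Hx : x0 < Re s < x1).
  { pose proof (re_le_Cmod (s - c)) as H; rewrite re_minus in H.
    assert (Rabs (Re s - Re c) < r) as H' by lra; apply Rabs_def2 in H'; unfold x0, x1; lra. }
  assert (Hy : y0 < Im s < y1).
  { pose proof (im_le_Cmod (s - c)) as H; rewrite im_minus in H.
    assert (Rabs (Im s - Im c) < r) as H' by lra; apply Rabs_def2 in H'; unfold y0, y1; lra. }
  assert (Hbd : forall z, rect_bd x0 x1 y0 y1 z -> r <= Cmod (z - c)).
  { intros z [_ Hz].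
    pose proof (re_le_Cmod (z - c)) as R1; pose proof (im_le_Cmod (z - c)) as R2.
    rewrite re_minus in R1; rewrite im_minus in R2; unfold x0, x1, y0, y1 in Hz.
    pose proof (Rle_abs (Re z - Re c)); pose proof (Rle_abs (Im z - Im c)).
    pose proof (Rle_abs (- (Re z - Re c))) as N1; pose proof (Rle_abs (- (Im z - Im c))) as N2.
    rewrite Rabs_Ropp in N1, N2; lra. }
  destruct (rect_bd_bounded f x0 x1 y0 y1) as [M [HM0 HM]]; try lra.
  { intros z [Hz _]; apply cdiff_ccts, Hf, Hz. }
  set (rho := r - Cmod (s - c)); assert (Hrho : 0 < rho) by (unfold rho; lra).
  assert (Hzs : forall z, rect_bd x0 x1 y0 y1 z -> rho <= Cmod (z - s)).
  { intros z Hz; specialize (Hbd z Hz); pose proof (Cmod_sub_triangle z s c); unfold rho; lra. }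
  set (k := Cmod (kappa x0 x1 y0 y1 s)).
  assert (Hk : 0 < k) by (apply Cmod_gt_0, kappa_neq_0; assumption).
  set (q := Cmod (s - c) / r).
  assert (Hq : 0 < q < 1).
  { split; [ apply Rdiv_lt_0_compat; lra | ].
    apply (Rmult_lt_reg_r r); [ lra | unfold q, Rdiv; rewrite Rmult_assoc, Rinv_l; lra ]. }
  set (L := 2 * ((x1 - x0) + (y1 - y0)) * (M / rho)).
  assert (HL : 0 <= L).
  { apply Rmult_le_pos; [ lra | apply Rmult_le_pos; [ exact HM0 | apply Rlt_le, Rinv_0_lt_compat, Hrho ] ]. }
  assert (Hn : forall n, Cmod (f s) * k <= L * q ^ n).
  { intros n.
    set (g := fun z => (f z / (z - c) ^ n)%C).
    assert (Hg : forall z, in_rect x0 x1 y0 y1 z -> cdiff g z).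
    (* Near c the numerator is 0, so g is the zero function there, whatever the quotient by 0 at c
       means. *)
    { intros z Hz; destruct (Ceq_dec z c) as [->|Hzc].
      - apply (cdiff_ext_loc (fun _ => RtoC 0) g c d Hd); [ | apply cdiff_const ].
        intros w Hw; unfold g; rewrite H0 by exact Hw; unfold Cdiv; ring.
      - apply cdiff_div; [ apply Hf, Hz | | apply Cpow_nz, Cminus_eq_contra, Hzc ].
        apply cdiff_pow, cdiff_minus; [ apply cdiff_id | apply cdiff_const ]. }
    pose proof (cauchy_formula g s x0 x1 y0 y1 Hx Hy Hg) as HC.
    assert (Bd : Cmod (rect_int (fun z => g z / (z - s))%C x0 x1 y0 y1) <=
      2 * ((x1 - x0) + (y1 - y0)) * (M / r ^ n / rho)).
    { apply rect_int_norm_le; try lra.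
      - intros z Hz; apply ccts_mult; [ apply cdiff_ccts, Hg, Hz | ].
        apply ccts_inv_sub, (rect_bd_neq _ _ _ _ _ _ Hx Hy Hz).
      - intros z Hz; specialize (Hbd z Hz); specialize (Hzs z Hz); specialize (HM z Hz).
        assert (Hzc : z <> c) by (intros ->; unfold Cminus in Hbd; rewrite Cplus_opp_r, Cmod_0 in Hbd; lra).
        assert (Hzs' : z <> s) by (apply (rect_bd_neq _ _ _ _ _ _ Hx Hy Hz)).
        unfold g; rewrite !Cmod_div by (try apply Cpow_nz; apply Cminus_eq_contra; assumption).
        rewrite Cmod_pow; unfold Rdiv.
        apply Rmult_le_compat.
        + apply Rmult_le_pos; [ apply Cmod_ge_0 | apply Rlt_le, Rinv_0_lt_compat, pow_lt; lra ].
        + apply Rlt_le, Rinv_0_lt_compat; lra.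
        + apply Rmult_le_compat; [ apply Cmod_ge_0 | apply Rlt_le, Rinv_0_lt_compat, pow_lt; lra | exact HM | ].
          apply Rinv_le_contravar; [ apply pow_lt; lra | apply pow_incr; lra ].
        + apply Rinv_le_contravar; lra. }
    rewrite HC, Cmod_mult in Bd; fold k in Bd; unfold g in Bd.
    rewrite Cmod_div, Cmod_pow in Bd by (apply Cpow_nz, Cminus_eq_contra, Hsc).
    assert (Pn : 0 < Cmod (s - c) ^ n) by (apply pow_lt, Psc).
    assert (Prn : 0 < r ^ n) by (apply pow_lt, Hr).
    apply (Rmult_le_compat_r (Cmod (s - c) ^ n)) in Bd; [ | lra ].
    replace (Cmod (f s) / Cmod (s - c) ^ n * k * Cmod (s - c) ^ n) with (Cmod (f s) * k) in Bd by (field; lra).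
    eapply Rle_trans; [ exact Bd | right ].
    unfold L, q, Rdiv; rewrite Rpow_mult_distr, pow_inv; field; lra. }
  apply Cmod_eq_0, Rle_antisym; [ | apply Cmod_ge_0 ].
  apply Rnot_lt_le; intros Hpos.
  destruct (pow_lt_1_zero q ltac:(rewrite Rabs_right; lra) (Cmod (f s) * k / (L + 1))) as [N HN].
  { apply Rdiv_lt_0_compat; [ apply Rmult_lt_0_compat; assumption | lra ]. }
  specialize (HN N (Nat.le_refl N)); specialize (Hn N).
  assert (Pq : 0 < q ^ N) by (apply pow_lt; lra).
  rewrite Rabs_right in HN by lra.
  assert (Cmod (f s) * k < Cmod (f s) * k); [ | lra ].
  apply Rle_lt_trans with (L * q ^ N); [ exact Hn | ].
  apply Rle_lt_trans with ((L + 1) * q ^ N); [ nra | ].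
  apply Rlt_le_trans with ((L + 1) * (Cmod (f s) * k / (L + 1))); [ apply Rmult_lt_compat_l; lra | right; field; lra ].
Qed.

(** The remainder of 1 / (g t - w) after its linear part at s is (w - s)^2 / ((g t - s)^2 (g t -
    w)), bounded because g stays at distance rho from s and hence rho / 2 from nearby w. *)
Lemma kernel_cdiff (k g : R -> C) (a b rho : R) (s : C) :
  a <= b -> 0 < rho -> (forall t, a <= t <= b -> ccont k t) -> (forall t, a <= t <= b -> ccont g t) ->
  (forall t, a <= t <= b -> rho <= Cmod (g t - s)) ->
  cdiff (fun w => CInt (fun t => k t / (g t - w))%C a b) s.
Proof.
  intros Hab Hrho Hk Hg Hr.
  destruct (ex_CInt_bounded k a b Hab (ex_CInt_cont k a b Hab Hk)) as [M HM].
  assert (Hw : forall w, Cmod (w - s) < rho / 2 -> forall t, a <= t <= b ->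
     rho / 2 <= Cmod (g t - w) /\ (g t - w)%C <> RtoC 0).
  { intros w Hw t Ht; specialize (Hr t Ht); pose proof (Cmod_sub_triangle (g t) w s).
    assert (rho / 2 <= Cmod (g t - w)) by lra; split; [ assumption | ].
    intros E; rewrite E, Cmod_0 in *; lra. }
  assert (Hs : Cmod (s - s) < rho / 2) by (unfold Cminus; rewrite Cplus_opp_r, Cmod_0; lra).
  assert (HI : forall w, Cmod (w - s) < rho / 2 -> forall t, a <= t <= b -> ccont (fun t => / (g t - w))%C t).
  { intros w Hw' t Ht; apply (ccont_inv (fun t => g t - w)%C); [ | apply (Hw w Hw' t Ht) ].
    apply ccont_minus; [ apply Hg, Ht | apply ccont_const ]. }
  set (D := fun t => (k t * (/ (g t - s) * / (g t - s)))%C).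
  assert (ED : ex_CInt D a b).
  { apply ex_CInt_cont; [ exact Hab | intros t Ht; apply ccont_mult; [ apply Hk, Ht | ] ].
    apply ccont_mult; apply HI; assumption. }
  assert (EF : forall w, Cmod (w - s) < rho / 2 -> ex_CInt (fun t => k t / (g t - w))%C a b).
  { intros w Hw'; apply ex_CInt_cont; [ exact Hab | intros t Ht; apply ccont_mult; [ apply Hk, Ht | ] ].
    apply HI; assumption. }
  apply (cdiff_quadratic _ s (CInt D a b) ((b - a) * (M * (/ rho * / rho * / (rho / 2)))) (rho / 2)); [ lra | ].
  intros w Hw'.
  rewrite (Cmult_comm (CInt D a b)), <- CInt_scal by exact ED.
  rewrite <- CInt_minus by (try assumption; apply EF; assumption).
  rewrite <- CInt_minus; [ | exact Hab | apply ex_CInt_minus; try assumption; apply EF; assumption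
    | apply ex_CInt_scal, ED ].
  replace ((b - a) * (M * (/ rho * / rho * / (rho / 2))) * Cmod (w - s) ^ 2)
    with ((b - a) * (M * (/ rho * / rho * / (rho / 2)) * Cmod (w - s) ^ 2)) by ring.
  apply CInt_norm_le_const; [ exact Hab | | ].
  - apply ex_CInt_minus; [ exact Hab | | apply ex_CInt_scal, ED ].
    apply ex_CInt_minus; try assumption; apply EF; assumption.
  - intros t Ht'; assert (Ht : a <= t <= b) by lra.
    destruct (Hw w Hw' t Ht) as [W1 W2]; destruct (Hw s Hs t Ht) as [_ S2]; specialize (Hr t Ht).
    replace (k t / (g t - w) - k t / (g t - s) - (w - s) * D t)%C
      with (k t * (/ (g t - s) * / (g t - s) * / (g t - w)) * (w - s) ^ 2)%C
      by (unfold D; field; split; assumption).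
    rewrite !Cmod_mult, Cmod_pow, !Cmod_inv by assumption.
    apply Rmult_le_compat_r; [ apply pow_le, Cmod_ge_0 | ].
    assert (0 < / Cmod (g t - s)) by (apply Rinv_0_lt_compat; lra).
    assert (0 < / Cmod (g t - w)) by (apply Rinv_0_lt_compat; lra).
    apply Rmult_le_compat; [ apply Cmod_ge_0 | | apply HM, Ht | ].
    + apply Rlt_le; repeat apply Rmult_lt_0_compat; assumption.
    + apply Rmult_le_compat; [ apply Rlt_le, Rmult_lt_0_compat; assumption | lra | | apply Rinv_le_contravar; lra ].
      apply Rmult_le_compat; try lra; apply Rinv_le_contravar; lra.
Qed.

Lemma rect_kernel_cdiff (k : C -> C) (s : C) (x0 x1 y0 y1 : R) :
  x0 < Re s < x1 -> y0 < Im s < y1 -> (forall z, rect_bd x0 x1 y0 y1 z -> ccts k z) ->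
  cdiff (fun w => rect_int (fun z => k z / (z - w))%C x0 x1 y0 y1) s.
Proof.
  intros Hx Hy Hk; unfold rect_int.
  set (rho := Rmin (Rmin (Re s - x0) (x1 - Re s)) (Rmin (Im s - y0) (y1 - Im s))).
  assert (Hrho : 0 < rho) by (unfold rho; repeat apply Rmin_pos; lra).
  assert (R1 : rho <= Re s - x0) by (eapply Rle_trans; [ apply Rmin_l | apply Rmin_l ]).
  assert (R2 : rho <= x1 - Re s) by (eapply Rle_trans; [ apply Rmin_l | apply Rmin_r ]).
  assert (R3 : rho <= Im s - y0) by (eapply Rle_trans; [ apply Rmin_r | apply Rmin_l ]).
  assert (R4 : rho <= y1 - Im s) by (eapply Rle_trans; [ apply Rmin_r | apply Rmin_r ]).
  assert (Hd : forall z, rect_bd x0 x1 y0 y1 z -> rho <= Cmod (z - s)).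
  { intros z [_ Hz]; pose proof (re_le_Cmod (z - s)) as A1; pose proof (im_le_Cmod (z - s)) as A2.
    rewrite re_minus in A1; rewrite im_minus in A2.
    pose proof (Rle_abs (Re z - Re s)); pose proof (Rle_abs (Im z - Im s)).
    pose proof (Rle_abs (- (Re z - Re s))) as N1; pose proof (Rle_abs (- (Im z - Im s))) as N2.
    rewrite Rabs_Ropp in N1, N2; lra. }
  assert (Hh : forall y, y = y0 \/ y = y1 ->
    cdiff (fun w => CInt (fun x => k (x, y) / ((x, y) - w))%C x0 x1) s).
  { intros y Hy'; assert (Hb : forall t, x0 <= t <= x1 -> rect_bd x0 x1 y0 y1 (t, y))
      by (intros t Ht; unfold rect_bd, in_rect; cbn [Re Im fst snd]; lra).
    apply (kernel_cdiff (fun x => k (x, y)) (fun x => (x, y)) x0 x1 rho s); try lra.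
    - intros t Ht; apply (ccts_ccont k (fun t => (t, y) : C)); [ apply Hk, Hb, Ht | apply ccont_hline ].
    - intros t Ht; apply ccont_hline.
    - intros t Ht; apply Hd, Hb, Ht. }
  assert (Hv : forall x, x = x0 \/ x = x1 ->
    cdiff (fun w => CInt (fun y => k (x, y) / ((x, y) - w))%C y0 y1) s).
  { intros x Hx'; assert (Hb : forall t, y0 <= t <= y1 -> rect_bd x0 x1 y0 y1 (x, t))
      by (intros t Ht; unfold rect_bd, in_rect; cbn [Re Im fst snd]; lra).
    apply (kernel_cdiff (fun y => k (x, y)) (fun y => (x, y)) y0 y1 rho s); try lra.
    - intros t Ht; apply (ccts_ccont k (fun t => (x, t) : C)); [ apply Hk, Hb, Ht | apply ccont_vline ].
    - intros t Ht; apply ccont_vline.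
    - intros t Ht; apply Hd, Hb, Ht. }
  apply cdiff_minus; [ apply cdiff_minus; [ apply cdiff_plus | ] | ].
  - apply Hh; left; reflexivity.
  - apply cdiff_mult; [ apply cdiff_const | apply Hv; right; reflexivity ].
  - apply Hh; right; reflexivity.
  - apply cdiff_mult; [ apply cdiff_const | apply Hv; left; reflexivity ].
Qed.

Lemma kappa_cdiff (x0 x1 y0 y1 : R) (s : C) :
  x0 < Re s < x1 -> y0 < Im s < y1 -> cdiff (kappa x0 x1 y0 y1) s.
Proof.
  intros Hx Hy; apply (cdiff_ext (fun w => rect_int (fun z => RtoC 1 / (z - w))%C x0 x1 y0 y1)).
  - intros w; unfold kappa; apply rect_int_ext; try lra; intros; unfold Cdiv; ring.
  - apply rect_kernel_cdiff; try assumption; intros; apply ccts_const.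
Qed.

(* The quotient satisfies Cauchy's formula by partial fractions, and the Cauchy integral of a
   continuous function is differentiable. *)
Lemma difference_quotient_cdiff (f : C -> C) (z0 : C) (r : R) :
  0 < r -> (forall z, Cmod (z - z0) < r -> cdiff f z) ->
  exists g, (forall z, Cmod (z - z0) < r / 3 -> cdiff g z) /\
    (forall z, Cmod (z - z0) < r / 3 -> z <> z0 -> g z = ((f z - f z0) / (z - z0))%C).
Proof.
  (* A square of half-side r / 3 stays in the disc, since its points are at distance at most 2 r / 3
     from the centre. *)
  intros Hr Hf; set (t := r / 3).
  set (x0 := Re z0 - t); set (x1 := Re z0 + t); set (y0 := Im z0 - t); set (y1 := Im z0 + t).
  assert (Ht : 0 < t) by (unfold t; lra).
  assert (Hin : forall z, in_rect x0 x1 y0 y1 z -> Cmod (z - z0) < r).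
  { intros z [Z1 Z2]; eapply Rle_lt_trans; [ apply Cmod_le_ReIm | ]; rewrite re_minus, im_minus.
    apply Rle_lt_trans with (t + t); [ | unfold t; lra ].
    apply Rplus_le_compat; apply Rabs_le; unfold x0, x1, y0, y1 in *; lra. }
  assert (Hint : forall z, Cmod (z - z0) < t -> x0 < Re z < x1 /\ y0 < Im z < y1).
  { intros z Hz; pose proof (re_le_Cmod (z - z0)) as A1; pose proof (im_le_Cmod (z - z0)) as A2.
    rewrite re_minus in A1; rewrite im_minus in A2.
    assert (B1 : Rabs (Re z - Re z0) < t) by lra; assert (B2 : Rabs (Im z - Im z0) < t) by lra.
    apply Rabs_def2 in B1, B2; unfold x0, x1, y0, y1; lra. }
  assert (Hz0 : Cmod (z0 - z0) < t) by (unfold Cminus; rewrite Cplus_opp_r, Cmod_0; exact Ht).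
  destruct (Hint z0 Hz0) as [X0 Y0].
  set (p := fun z => (f z - f z0)%C).
  assert (Hp : forall z, in_rect x0 x1 y0 y1 z -> cdiff p z).
  { intros z Hz; apply cdiff_minus; [ apply Hf, Hin, Hz | apply cdiff_const ]. }
  set (q := fun z => (p z / (z - z0))%C).
  assert (Hq : forall z, rect_bd x0 x1 y0 y1 z -> ccts q z).
  { intros z Hz; apply ccts_mult; [ apply cdiff_ccts, Hp, Hz | ].
    apply ccts_inv_sub, (rect_bd_neq _ _ _ _ _ _ X0 Y0 Hz). }
  exists (fun s => (rect_int (fun z => q z / (z - s)) x0 x1 y0 y1 / kappa x0 x1 y0 y1 s)%C).
  split; intros s Hs; destruct (Hint s Hs) as [Xs Ys].
  - apply cdiff_div; [ apply rect_kernel_cdiff; assumption | apply kappa_cdiff; assumption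
      | apply kappa_neq_0; assumption ].
  - intros Hsz.
    assert (Hn : (s - z0)%C <> RtoC 0) by (apply Cminus_eq_contra, Hsz).
    assert (Hk := kappa_neq_0 x0 x1 y0 y1 s Xs Ys).
    rewrite (rect_int_ext _ (fun z => / (s - z0) * (p z / (z - s)) + - / (s - z0) * (p z / (z - z0)))%C); try lra.
    + assert (C1 : forall w z, x0 < Re w < x1 -> y0 < Im w < y1 -> rect_bd x0 x1 y0 y1 z ->
        ccts (fun z => p z / (z - w))%C z).
      { intros w z Hw1 Hw2 Hz; apply ccts_mult; [ apply cdiff_ccts, Hp, Hz | ].
        apply ccts_inv_sub, (rect_bd_neq _ _ _ _ _ _ Hw1 Hw2 Hz). }
      rewrite rect_int_plus, !rect_int_scal; try lra;
        try (intros z Hz; try (apply ccts_mult; [ apply ccts_const | ]); apply C1; assumption).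
      (* Of the two values given by Cauchy's formula the one at [z0] is [p z0 = 0]. *)
      rewrite !cauchy_formula by assumption; unfold p; field; split; assumption.
    + intros z Hz; unfold q; field; repeat split; try assumption; apply Cminus_eq_contra;
        first [ apply (rect_bd_neq _ _ _ _ _ _ Xs Ys Hz) | apply (rect_bd_neq _ _ _ _ _ _ X0 Y0 Hz) | assumption ].
Qed.

(** * Complex series *)

Definition Clim (u : nat -> C) (l : C) : Prop :=
  forall e, 0 < e -> exists N, forall n, (N <= n)%nat -> Cmod (u n - l) < e.

(** Sums the n terms of index below n, whereas [sum_n a n] has n + 1 terms; telescoping inductions
    can then start from the empty sum. *)
Fixpoint csum (a : nat -> C) (n : nat) : C :=
  match n with O => RtoC 0 | S m => (csum a m + a m)%C end.

Definition is_cseries (a : nat -> C) (l : C) : Prop := Clim (csum a) l.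

Lemma Clim_unique (u : nat -> C) (l m : C) : Clim u l -> Clim u m -> l = m.
Proof.
  intros H1 H2; apply Cmod_small_eq; intros e He.
  destruct (H1 (e / 2)) as [N1 K1]; [ lra | ]; destruct (H2 (e / 2)) as [N2 K2]; [ lra | ].
  specialize (K1 (Nat.max N1 N2) (Nat.le_max_l _ _)); specialize (K2 (Nat.max N1 N2) (Nat.le_max_r _ _)).
  pose proof (Cmod_sub_triangle l (u (Nat.max N1 N2)) m) as T; rewrite (Cmod_sub_sym l (u _)) in T; lra.
Qed.

Lemma Clim_ext (u v : nat -> C) (l : C) : (forall n, u n = v n) -> Clim u l -> Clim v l.
Proof.
  intros H Hu e He; destruct (Hu e He) as [N K]; exists N; intros n Hn; rewrite <- H; apply K, Hn.
Qed.

Lemma Clim_const (c : C) : Clim (fun _ => c) c.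
Proof. intros e He; exists O; intros; unfold Cminus; rewrite Cplus_opp_r, Cmod_0; exact He. Qed.

Lemma Clim_plus (u v : nat -> C) (l m : C) : Clim u l -> Clim v m -> Clim (fun n => u n + v n)%C (l + m)%C.
Proof.
  intros H1 H2 e He.
  destruct (H1 (e / 2)) as [N1 K1]; [ lra | ]; destruct (H2 (e / 2)) as [N2 K2]; [ lra | ].
  exists (Nat.max N1 N2); intros n Hn.
  specialize (K1 n ltac:(lia)); specialize (K2 n ltac:(lia)).
  replace (u n + v n - (l + m))%C with ((u n - l) + (v n - m))%C by ring.
  eapply Rle_lt_trans; [ apply Cmod_triangle | lra ].
Qed.

Lemma Clim_scal (c : C) (u : nat -> C) (l : C) : Clim u l -> Clim (fun n => c * u n)%C (c * l)%C.
Proof.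
  intros H e He; pose proof (Cmod_ge_0 c) as Hc.
  destruct (H (e / (Cmod c + 1))) as [N K]; [ apply Rdiv_lt_0_compat; lra | ].
  exists N; intros n Hn; specialize (K n Hn); pose proof (Cmod_ge_0 (u n - l)).
  replace (c * u n - c * l)%C with (c * (u n - l))%C by ring; rewrite Cmod_mult.
  apply Rle_lt_trans with ((Cmod c + 1) * Cmod (u n - l)); [ nra | ].
  apply Rlt_le_trans with ((Cmod c + 1) * (e / (Cmod c + 1))); [ apply Rmult_lt_compat_l; lra | right; field; lra ].
Qed.

Lemma Clim_minus (u v : nat -> C) (l m : C) : Clim u l -> Clim v m -> Clim (fun n => u n - v n)%C (l - m)%C.
Proof.
  intros H1 H2; replace (l - m)%C with (l + (- RtoC 1) * m)%C by ring.
  apply (Clim_ext (fun n => u n + (- RtoC 1) * v n)%C); [ intros; ring | ].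
  apply Clim_plus; [ exact H1 | apply Clim_scal, H2 ].
Qed.

Lemma Clim_mod_le (u : nat -> C) (l : C) (M : R) : (forall n, Cmod (u n) <= M) -> Clim u l -> Cmod l <= M.
Proof.
  intros HM Hu; apply Rnot_lt_le; intros H.
  destruct (Hu (Cmod l - M)) as [N K]; [ lra | ].
  specialize (K N (Nat.le_refl N)); specialize (HM N).
  pose proof (Cmod_triangle_rev l (u N)) as T; rewrite Cmod_sub_sym in T; lra.
Qed.

Lemma Clim_squeeze_0 (u : nat -> C) (l : C) (v : nat -> R) :
  (forall n, Cmod (u n - l) <= v n) -> is_lim_seq v 0 -> Clim u l.
Proof.
  intros H Hv e He.
  apply is_lim_seq_spec in Hv; destruct (Hv (mkposreal e He)) as [N K].
  exists N; intros n Hn; specialize (K n Hn); simpl in K; rewrite Rminus_0_r in K.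
  eapply Rle_lt_trans; [ apply H | eapply Rle_lt_trans; [ apply Rle_abs | exact K ] ].
Qed.

Lemma Clim_Re_Im (u : nat -> C) (l : C) :
  Clim u l <-> is_lim_seq (fun n => Re (u n)) (Re l) /\ is_lim_seq (fun n => Im (u n)) (Im l).
Proof.
  split.
  - intros H; split; apply is_lim_seq_spec; intros e; destruct (H e (cond_pos e)) as [N K];
      exists N; intros n Hn; specialize (K n Hn).
    + rewrite <- re_minus; eapply Rle_lt_trans; [ apply re_le_Cmod | exact K ].
    + rewrite <- im_minus; eapply Rle_lt_trans; [ apply im_le_Cmod | exact K ].
  - intros [H1 H2] e He; assert (He2 : 0 < e / 2) by lra.
    apply is_lim_seq_spec in H1; apply is_lim_seq_spec in H2.
    destruct (H1 (mkposreal _ He2)) as [N1 K1]; destruct (H2 (mkposreal _ He2)) as [N2 K2].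
    exists (Nat.max N1 N2); intros n Hn.
    specialize (K1 n ltac:(lia)); specialize (K2 n ltac:(lia)); simpl in K1, K2.
    eapply Rle_lt_trans; [ apply Cmod_le_ReIm | rewrite re_minus, im_minus; lra ].
Qed.

Lemma csum_Re (a : nat -> C) (n : nat) : Re (csum a (S n)) = sum_n (fun k => Re (a k)) n.
Proof.
  induction n as [|n IH]; [ rewrite sum_O; unfold Re; simpl; ring | ].
  rewrite sum_Sn, <- IH; reflexivity.
Qed.

Lemma csum_Im (a : nat -> C) (n : nat) : Im (csum a (S n)) = sum_n (fun k => Im (a k)) n.
Proof.
  induction n as [|n IH]; [ rewrite sum_O; unfold Im; simpl; ring | ].
  rewrite sum_Sn, <- IH; reflexivity.
Qed.

Lemma csum_sum_n (a : nat -> C) (n : nat) :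
  csum a (S n) = sum_n (G := C_AbelianMonoid) a n.
Proof.
  induction n as [|n IH]; [ rewrite sum_O; simpl; ring | ].
  rewrite sum_Sn, <- IH; reflexivity.
Qed.

Lemma is_cseries_Re_Im (a : nat -> C) (l : C) :
  is_cseries a l <-> is_series (fun n => Re (a n)) (Re l) /\ is_series (fun n => Im (a n)) (Im l).
Proof.
  unfold is_cseries; rewrite Clim_Re_Im; split; intros [H1 H2]; split.
  - apply (is_lim_seq_ext (fun n => Re (csum a (S n))) (sum_n (fun k => Re (a k))) (Re l)); [ apply csum_Re | apply is_lim_seq_incr_1 in H1; exact H1 ].
  - apply (is_lim_seq_ext (fun n => Im (csum a (S n))) (sum_n (fun k => Im (a k))) (Im l)); [ apply csum_Im | apply is_lim_seq_incr_1 in H2; exact H2 ].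
  - apply is_lim_seq_incr_1, (is_lim_seq_ext (sum_n (fun k => Re (a k)))); [ intros; symmetry; apply csum_Re | exact H1 ].
  - apply is_lim_seq_incr_1, (is_lim_seq_ext (sum_n (fun k => Im (a k)))); [ intros; symmetry; apply csum_Im | exact H2 ].
Qed.

Lemma is_cseries_CSeries (a : nat -> C) (l : C) : is_cseries a l -> CSeries a = l.
Proof.
  intros H; apply is_cseries_Re_Im in H; destruct H as [H1 H2].
  apply C_ext; unfold CSeries; cbn [Re Im fst snd]; apply is_series_unique; assumption.
Qed.

Lemma is_cseries_is_series (a : nat -> C) (l : C) :
  is_cseries a l <-> is_series (K := C_AbsRing) (V := C_NormedModule) a l.
Proof.
  split.
  - intros H Q HQ; apply locally_Cmod in HQ; destruct HQ as [d [Hd HQ]].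
    destruct (H d Hd) as [N K]; exists N; intros n Hn.
    change (Q (sum_n (G := C_AbelianMonoid) a n)); rewrite <- csum_sum_n; apply HQ, K; lia.
  - intros H e He.
    destruct (H (fun w : C => Cmod (w - l) < e)) as [N K].
    { apply (locally_Cmod l (fun w : C => Cmod (w - l) < e)); exists e; tauto. }
    exists (S N); intros [|n] Hn; [ lia | ].
    rewrite csum_sum_n; apply (K n); lia.
Qed.

Lemma csum_ext (a b : nat -> C) (n : nat) : (forall k, (k < n)%nat -> a k = b k) -> csum a n = csum b n.
Proof.
  induction n as [|n IH]; intros H; [ reflexivity | simpl ].
  rewrite IH by (intros; apply H; lia); rewrite H by lia; reflexivity.
Qed.

Lemma csum_plus (a b : nat -> C) (n : nat) : csum (fun k => a k + b k)%C n = (csum a n + csum b n)%C.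
Proof. induction n as [|n IH]; simpl; [ ring | rewrite IH; ring ]. Qed.

Lemma csum_scal (c : C) (a : nat -> C) (n : nat) : csum (fun k => c * a k)%C n = (c * csum a n)%C.
Proof. induction n as [|n IH]; simpl; [ ring | rewrite IH; ring ]. Qed.

Lemma is_cseries_ext (a b : nat -> C) (l : C) : (forall n, a n = b n) -> is_cseries a l -> is_cseries b l.
Proof. intros H; apply Clim_ext; intros n; apply csum_ext; intros; apply H. Qed.

Lemma is_cseries_plus (a b : nat -> C) (l m : C) :
  is_cseries a l -> is_cseries b m -> is_cseries (fun n => a n + b n)%C (l + m)%C.
Proof.
  intros H1 H2; apply (Clim_ext (fun n => csum a n + csum b n)%C);
    [ intros; symmetry; apply csum_plus | apply Clim_plus; assumption ].
Qed.

Lemma is_cseries_scal (c : C) (a : nat -> C) (l : C) :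
  is_cseries a l -> is_cseries (fun n => c * a n)%C (c * l)%C.
Proof.
  intros H; apply (Clim_ext (fun n => c * csum a n)%C);
    [ intros; symmetry; apply csum_scal | apply Clim_scal; assumption ].
Qed.

Lemma is_cseries_minus (a b : nat -> C) (l m : C) :
  is_cseries a l -> is_cseries b m -> is_cseries (fun n => a n - b n)%C (l - m)%C.
Proof.
  intros H1 H2; replace (l - m)%C with (l + (- RtoC 1) * m)%C by ring.
  apply (is_cseries_ext (fun n => a n + (- RtoC 1) * b n)%C); [ intros; ring | ].
  apply is_cseries_plus; [ exact H1 | apply is_cseries_scal, H2 ].
Qed.

Lemma Series_partial_le (b : nat -> R) (n : nat) :
  (forall k, 0 <= b k) -> ex_series b -> sum_n b n <= Series b.
Proof.
  intros Hb He.
  apply (is_lim_seq_incr_compare (sum_n b) (Series b)); [ apply (Series_correct b He) | ].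
  intros k; rewrite sum_Sn; unfold plus; simpl; specialize (Hb (S k)); lra.
Qed.

Lemma csum_mod_le (a : nat -> C) (b : nat -> R) (n : nat) :
  (forall k, Cmod (a k) <= b k) -> ex_series b -> Cmod (csum a n) <= Series b.
Proof.
  intros H He.
  assert (Hb : forall k, 0 <= b k) by (intros k; eapply Rle_trans; [ apply Cmod_ge_0 | apply H ]).
  assert (Hs : forall m, Cmod (csum a (S m)) <= sum_n b m).
  { induction m as [|m IH]; [ rewrite sum_O; simpl; rewrite Cplus_0_l; apply H | ].
    rewrite sum_Sn; change (csum a (S (S m))) with (csum a (S m) + a (S m))%C.
    eapply Rle_trans; [ apply Cmod_triangle | apply Rplus_le_compat; [ exact IH | apply H ] ]. }
  destruct n as [|n].
  - simpl; rewrite Cmod_0; eapply Rle_trans; [ | apply (Series_partial_le b 0); assumption ].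
    rewrite sum_O; apply Hb.
  - eapply Rle_trans; [ apply Hs | apply Series_partial_le; assumption ].
Qed.

Lemma is_cseries_mod_le (a : nat -> C) (b : nat -> R) (l : C) :
  (forall k, Cmod (a k) <= b k) -> ex_series b -> is_cseries a l -> Cmod l <= Series b.
Proof. intros H He Ha; apply (Clim_mod_le (csum a)); [ intros; apply csum_mod_le; assumption | exact Ha ]. Qed.

Lemma is_cseries_abs (a : nat -> C) (b : nat -> R) :
  (forall k, Cmod (a k) <= b k) -> ex_series b -> is_cseries a (CSeries a).
Proof.
  intros H He; apply is_cseries_Re_Im; unfold CSeries; cbn [Re Im fst snd].
  split; apply Series_correct.
  - apply (ex_series_le (K := R_AbsRing) (V := R_CompleteNormedModule) _ b); [ | exact He ].
    intros n; eapply Rle_trans; [ apply (re_le_Cmod (a n)) | apply H ].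
  - apply (ex_series_le (K := R_AbsRing) (V := R_CompleteNormedModule) _ b); [ | exact He ].
    intros n; eapply Rle_trans; [ apply (im_le_Cmod (a n)) | apply H ].
Qed.

(** [l n] plays the derivative of [f n] at s: the bounds [b] and [m] give convergence, and [c] sums
    to the constant of the quadratic remainder. *)
Lemma cdiff_series (f : nat -> C -> C) (l : nat -> C) (b c m : nat -> R) (s : C) (d : R) :
  0 < d -> ex_series b -> ex_series c -> ex_series m ->
  (forall n w, Cmod (w - s) < d -> Cmod (f n w) <= b n) ->
  (forall n, Cmod (l n) <= m n) ->
  (forall n w, Cmod (w - s) < d -> Cmod (f n w - f n s - l n * (w - s)) <= c n * Cmod (w - s) ^ 2) ->
  cdiff (fun w => CSeries (fun n => f n w)) s.
Proof.
  intros Hd Hb Hc Hm Hf Hl Hq.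
  apply (cdiff_quadratic _ s (CSeries l) (Series c) d Hd); intros w Hw.
  assert (Hs : Cmod (s - s) < d) by (unfold Cminus; rewrite Cplus_opp_r, Cmod_0; exact Hd).
  assert (S1 := is_cseries_abs (fun n => f n w) b (fun n => Hf n w Hw) Hb).
  assert (S2 := is_cseries_abs (fun n => f n s) b (fun n => Hf n s Hs) Hb).
  assert (S3 := is_cseries_abs l m Hl Hm).
  assert (S4 := is_cseries_scal (w - s)%C l _ S3).
  rewrite (Cmult_comm (CSeries l)).
  rewrite Rmult_comm, <- Series_scal_l.
  apply (is_cseries_mod_le (fun n => f n w - f n s - (w - s) * l n)%C).
  - intros k; rewrite (Cmult_comm (w - s)), (Rmult_comm _ (c k)); apply Hq, Hw.
  - apply (ex_series_scal_l (K := R_AbsRing) (Cmod (w - s) ^ 2) c Hc).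
  - apply is_cseries_minus; [ apply is_cseries_minus | ]; assumption.
Qed.

(** * Complex powers of positive reals *)

Definition xpow (x : R) (s : C) : C := Cexp (s * RtoC (ln x)).

Lemma xpow_plus (x : R) (s t : C) : xpow x (s + t) = (xpow x s * xpow x t)%C.
Proof. unfold xpow; rewrite <- Cexp_plus; f_equal; ring. Qed.

Lemma Cmod_xpow (x : R) (s : C) : Cmod (xpow x s) = Rpower x (Re s).
Proof. unfold xpow; rewrite Cmod_Cexp, re_mult, re_RtoC, im_RtoC; unfold Rpower; f_equal; ring. Qed.

Lemma xpow_RtoC (x a : R) : xpow x (RtoC a) = RtoC (Rpower x a).
Proof. unfold xpow; rewrite <- RtoC_mult; apply Cexp_RtoC. Qed.

Lemma xpow_1_r (x : R) : 0 < x -> xpow x 1 = RtoC x.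
Proof. intros H; rewrite xpow_RtoC, Rpower_1 by exact H; reflexivity. Qed.

Lemma xpow_1_l (s : C) : xpow 1 s = RtoC 1.
Proof. unfold xpow; rewrite ln_1, Cmult_0_r; apply Cexp_0. Qed.

Lemma xpow_0_r (x : R) : xpow x 0 = RtoC 1.
Proof. unfold xpow; rewrite Cmult_0_l; apply Cexp_0. Qed.

Lemma xpow_opp (x : R) (s : C) : xpow x (- s) = (/ xpow x s)%C.
Proof. unfold xpow; rewrite <- Cexp_opp; f_equal; ring. Qed.

Lemma xpow_mult (x y : R) (s : C) : 0 < x -> 0 < y -> xpow (x * y) s = (xpow x s * xpow y s)%C.
Proof.
  intros Hx Hy; unfold xpow; rewrite ln_mult, RtoC_plus, <- Cexp_plus by assumption; f_equal; ring.
Qed.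

Lemma cderiv_xpow (x : R) (s : C) : 0 < x -> cderiv (fun t => xpow t s) x (s * xpow x (s - 1))%C.
Proof.
  intros Hx; eapply cderiv_eq.
  - apply (cderiv_Cexp (fun t => s * RtoC (ln t))%C), cderiv_scal, cderiv_RtoC, is_derive_ln, Hx.
  - fold (xpow x s); unfold Cminus; rewrite xpow_plus, xpow_opp, xpow_1_r, RtoC_inv by lra; ring.
Qed.

Lemma ccont_xpow (x : R) (s : C) : 0 < x -> ccont (fun t => xpow t s) x.
Proof. intros Hx; apply (cderiv_ccont _ _ _ (cderiv_xpow x s Hx)). Qed.

Lemma cdiff_xpow (x : R) (f : C -> C) (z : C) : cdiff f z -> cdiff (fun s => xpow x (f s)) z.
Proof.
  intros H; apply (cdiff_Cexp (fun s => f s * RtoC (ln x))%C), cdiff_mult; [ exact H | apply cdiff_const ].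
Qed.

Lemma ln_le' (x y : R) : 0 < x -> x <= y -> ln x <= ln y.
Proof. intros Hx [H| ->]; [ apply Rlt_le, ln_increasing; assumption | lra ]. Qed.

Lemma Rpower_pos (x a : R) : 0 < Rpower x a.
Proof. apply exp_pos. Qed.

Lemma Rpower_le_base_neg (x y a : R) : 0 < y <= x -> a <= 0 -> Rpower x a <= Rpower y a.
Proof.
  intros H Ha; apply exp_le; assert (ln y <= ln x) by (apply ln_le'; lra); nra.
Qed.

Lemma Rpower_le_exp (x a b : R) : 1 <= x -> a <= b -> Rpower x a <= Rpower x b.
Proof.
  intros H Hab; apply exp_le; assert (0 <= ln x) by (rewrite <- ln_1; apply ln_le'; lra); nra.
Qed.

Lemma ln_le_Rpower (x a : R) : 0 < a -> ln x <= Rpower x a / a.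
Proof.
  intros Ha; apply (Rmult_le_reg_l a); [ exact Ha | ].
  replace (a * (Rpower x a / a)) with (Rpower x a) by (field; lra).
  unfold Rpower; pose proof (exp_ineq1_le (a * ln x)); lra.
Qed.

Lemma is_derive_Rpower (x a : R) : 0 < x -> is_derive (fun t => Rpower t a) x (a * Rpower x (a - 1)).
Proof.
  intros Hx; unfold Rpower; auto_derive; [ exact Hx | ].
  replace ((a - 1) * ln x) with (a * ln x + - ln x) by ring.
  rewrite exp_plus, exp_Ropp, exp_ln by exact Hx; field; lra.
Qed.

(** The mean value theorem for a primitive. Summed over the integers, the right side telescopes,
    whence the convergence of the p-series. *)
Lemma Rpower_telescope (x p : R) : 1 <= x -> 1 < p ->
  (p - 1) * Rpower (x + 1) (- p) <= Rpower x (1 - p) - Rpower (x + 1) (1 - p).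
Proof.
  intros Hx Hp.
  destruct (MVT_gen (fun t => Rpower t (1 - p)) x (x + 1) (fun t => (1 - p) * Rpower t (1 - p - 1)))
    as [c [Hc E]].
  - intros t Ht; rewrite Rmin_left in Ht by lra; apply is_derive_Rpower; lra.
  - intros t Ht; rewrite Rmin_left in Ht by lra.
    apply continuity_pt_filterlim.
    apply (ex_derive_continuous (V := R_NormedModule) (fun t => Rpower t (1 - p)) t).
    eexists; apply is_derive_Rpower; lra.
  - rewrite Rmin_left, Rmax_right in Hc by lra; cbv beta in E.
    replace (1 - p - 1) with (- p) in E by ring.
    assert (Rpower (x + 1) (- p) <= Rpower c (- p)) by (apply Rpower_le_base_neg; lra).
    nra.
Qed.

Lemma Rpower_lim_0 (p : R) : 0 < p -> is_lim_seq (fun n => Rpower (INR n + 1) (- p)) 0.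
Proof.
  intros Hp; apply is_lim_seq_spec; intros e.
  destruct (nfloor_ex (Rpower e (- / p))) as [N HN]; [ apply Rlt_le, Rpower_pos | ].
  exists N; intros n Hn; rewrite Rminus_0_r, Rabs_right by (apply Rle_ge, Rlt_le, Rpower_pos).
  replace (pos e) with (Rpower (Rpower e (- / p)) (- p)).
  - apply exp_increasing.
    assert (ln (Rpower e (- / p)) < ln (INR n + 1)); [ | nra ].
    apply ln_increasing; [ apply Rpower_pos | ].
    apply le_INR in Hn; lra.
  - rewrite Rpower_mult; replace (- / p * - p) with 1 by (field; lra); apply Rpower_1, cond_pos.
Qed.

Lemma ex_series_Rpower (p : R) : 1 < p -> ex_series (fun n => Rpower (INR n + 1) (- p)).
Proof.
  intros Hp; apply (ex_series_incr_1 (K := R_AbsRing)).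
  apply (ex_series_le (K := R_AbsRing) (V := R_CompleteNormedModule) _
    (fun n => / (p - 1) * (Rpower (INR n + 1) (1 - p) - Rpower (INR (S n) + 1) (1 - p)))).
  - intros n; unfold norm; simpl; unfold abs; simpl.
    rewrite Rabs_right by (apply Rle_ge, Rlt_le, Rpower_pos).
    change (match n with O => 1 | S _ => INR n + 1 end) with (INR (S n)); rewrite S_INR.
    pose proof (pos_INR n).
    apply (Rmult_le_reg_l (p - 1)); [ lra | ].
    rewrite <- Rmult_assoc, Rinv_r, Rmult_1_l by lra; apply Rpower_telescope; lra.
  - apply (ex_series_scal_l (K := R_AbsRing) (/ (p - 1))
      (fun n => Rpower (INR n + 1) (1 - p) - Rpower (INR (S n) + 1) (1 - p))).
    exists 1.
    apply (is_lim_seq_ext (fun n => 1 - Rpower (INR (S n) + 1) (1 - p))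
      (sum_n (fun n => Rpower (INR n + 1) (1 - p) - Rpower (INR (S n) + 1) (1 - p))) 1).
    + induction n as [|n IH].
      * rewrite sum_O; unfold Rpower at 2; simpl INR; rewrite Rplus_0_l, ln_1, Rmult_0_r, exp_0; reflexivity.
      * rewrite sum_Sn, <- IH; unfold plus; simpl; ring.
    + replace (Finite 1) with (Finite (1 - 0)) by (f_equal; ring).
      apply (is_lim_seq_minus' (fun _ => 1)); [ apply is_lim_seq_const | ].
      apply (is_lim_seq_incr_1 (fun n => Rpower (INR n + 1) (1 - p))).
      replace (1 - p) with (- (p - 1)) by ring; apply Rpower_lim_0; lra.
Qed.

Lemma continuous_ln_pos (x : R) : 0 < x -> continuous ln x.
Proof.
  intros Hx; apply (ex_derive_continuous (V := R_NormedModule) ln x); exists (/ x); apply is_derive_ln, Hx.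
Qed.

(** * Mellin integrals over [1, oo), cut at the integers *)

(** The kernel may depend on the cell: Abel summation uses the value of [Sr b] at the right end of
    the cell minus [Sr b x], which jumps at the integers. *)
Definition mellin_term (k : nat -> R -> C) (n : nat) (s : C) : C :=
  CInt (fun x => k n x * xpow x (- s))%C (INR n + 1) (INR n + 2).

Definition mellin (k : nat -> R -> C) (s : C) : C := CSeries (fun n => mellin_term k n s).

(** With growth exponent a the integral converges absolutely for Re s > a + 1. Continuity on the
    closed cell is asked of the kernel of that cell, never of the glued function. *)
Definition mellin_ok (k : nat -> R -> C) (B a : R) : Prop :=
  forall n x, INR n + 1 <= x <= INR n + 2 -> ccont (k n) x /\ Cmod (k n x) <= B * Rpower x a.

Lemma mellin_ex (k : nat -> R -> C) (B a : R) (n : nat) (s : C) :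
  mellin_ok k B a -> ex_CInt (fun x => k n x * xpow x (- s))%C (INR n + 1) (INR n + 2).
Proof.
  intros H; apply ex_CInt_cont; [ lra | intros x Hx; pose proof (pos_INR n) ].
  apply ccont_mult; [ apply (H n x Hx) | apply ccont_xpow; lra ].
Qed.

Lemma mellin_ok_pos (k : nat -> R -> C) (B a : R) : mellin_ok k B a -> 0 <= B.
Proof.
  intros H; destruct (H 0%nat 1) as [_ H1]; [ simpl; lra | ].
  pose proof (Cmod_ge_0 (k 0%nat 1)); pose proof (Rpower_pos 1 a).
  apply Rnot_lt_le; intros HB; nra.
Qed.

Lemma mellin_term_le (k : nat -> R -> C) (B a e : R) (n : nat) (s : C) :
  mellin_ok k B a -> a - Re s <= e -> e <= 0 ->
  Cmod (mellin_term k n s) <= B * Rpower (INR n + 1) e.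
Proof.
  intros H He He0; pose proof (mellin_ok_pos _ _ _ H) as HB; pose proof (pos_INR n) as Hn.
  replace (B * Rpower (INR n + 1) e) with ((INR n + 2 - (INR n + 1)) * (B * Rpower (INR n + 1) e)) by ring.
  apply CInt_norm_le_const; [ lra | eapply mellin_ex, H | ].
  intros x Hx; destruct (H n x) as [_ Hk]; [ lra | ].
  rewrite Cmod_mult, Cmod_xpow, re_opp.
  apply Rle_trans with (B * Rpower x a * Rpower x (- Re s));
    [ apply Rmult_le_compat_r; [ apply Rlt_le, Rpower_pos | exact Hk ] | ].
  rewrite Rmult_assoc, <- Rpower_plus; apply Rmult_le_compat_l; [ exact HB | ].
  apply Rle_trans with (Rpower x e); [ apply Rpower_le_exp; lra | apply Rpower_le_base_neg; lra ].
Qed.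

Lemma mellin_series (k : nat -> R -> C) (B a : R) (s : C) :
  mellin_ok k B a -> a + 1 < Re s -> is_cseries (fun n => mellin_term k n s) (mellin k s).
Proof.
  intros H Hs; apply (is_cseries_abs _ (fun n => B * Rpower (INR n + 1) (- (Re s - a)))).
  - intros n; apply (mellin_term_le k B a); [ exact H | lra | lra ].
  - apply (ex_series_scal_l (K := R_AbsRing) B (fun n => Rpower (INR n + 1) (- (Re s - a)))), ex_series_Rpower; lra.
Qed.

Lemma mellin_cdiff (k : nat -> R -> C) (B a : R) (s : C) :
  mellin_ok k B a -> a + 1 < Re s -> cdiff (mellin k) s.
Proof.
  intros H Hs; pose proof (mellin_ok_pos _ _ _ H) as HB.
  (* The room above the abscissa of convergence is 4 t. Moving w costs one t, and each logarithm
     costs x^t / t, so the exponents 1 + 3 t and 1 + t remain. *)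
  set (t := (Re s - 1 - a) / 4); assert (Ht : 0 < t) by (unfold t; lra).
  set (D := fun n x => (k n x * (RtoC (- ln x) * xpow x (- s)))%C).
  assert (HX : forall n x, INR n + 1 <= x <= INR n + 2 -> 1 <= x /\ 0 <= ln x).
  { intros n x Hx; pose proof (pos_INR n); split; [ lra | rewrite <- ln_1; apply ln_le'; lra ]. }
  assert (ED : forall n, ex_CInt (D n) (INR n + 1) (INR n + 2)).
  { intros n; apply ex_CInt_cont; [ lra | intros x Hx; destruct (HX n x Hx) ].
    apply ccont_mult; [ apply (H n x Hx) | apply ccont_mult; [ | apply ccont_xpow; lra ] ].
    apply ccont_RtoC, (continuous_opp ln), continuous_ln_pos; lra. }
  assert (Hser : forall c e, 1 < e -> ex_series (fun n => c * Rpower (INR n + 1) (- e))).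
  { intros c e He; apply (ex_series_scal_l (K := R_AbsRing) c (fun n => Rpower (INR n + 1) (- e))), ex_series_Rpower, He. }
  apply (cdiff_series (mellin_term k) (fun n => CInt (D n) (INR n + 1) (INR n + 2))
    (fun n => B * Rpower (INR n + 1) (- (1 + 3 * t))) (fun n => B / (t * t) * Rpower (INR n + 1) (- (1 + t)))
    (fun n => B / t * Rpower (INR n + 1) (- (1 + 3 * t))) s t Ht); try (apply Hser; lra).
  - intros n w Hw; apply (mellin_term_le k B a); [ exact H | | lra ].
    pose proof (re_le_Cmod (w - s)) as R1; rewrite re_minus in R1.
    assert (R2 : Rabs (Re w - Re s) < t) by lra; apply Rabs_def2 in R2; unfold t in *; lra.
  - intros n; pose proof (pos_INR n).
    replace (B / t * Rpower (INR n + 1) (- (1 + 3 * t)))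
      with ((INR n + 2 - (INR n + 1)) * (B / t * Rpower (INR n + 1) (- (1 + 3 * t)))) by ring.
    apply CInt_norm_le_const; [ lra | apply ED | intros x Hx' ].
    destruct (HX n x) as [X1 X2]; [ lra | ]; destruct (H n x) as [_ Hk]; [ lra | ].
    unfold D; rewrite !Cmod_mult, Cmod_xpow, Cmod_R, Rabs_Ropp, (Rabs_right (ln x)), re_opp by lra.
    apply Rle_trans with (B * Rpower x a * (Rpower x t / t * Rpower x (- Re s))).
    + apply Rmult_le_compat; [ apply Cmod_ge_0 | | exact Hk | ].
      * apply Rmult_le_pos; [ lra | apply Rlt_le, Rpower_pos ].
      * apply Rmult_le_compat_r; [ apply Rlt_le, Rpower_pos | apply ln_le_Rpower, Ht ].
    + replace (B * Rpower x a * (Rpower x t / t * Rpower x (- Re s)))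
        with (B / t * (Rpower x a * Rpower x t * Rpower x (- Re s))) by (field; lra).
      rewrite <- !Rpower_plus; apply Rmult_le_compat_l; [ apply Rdiv_le_0_compat; assumption | ].
      replace (a + t + - Re s) with (- (1 + 3 * t)) by (unfold t; field).
      apply Rpower_le_base_neg; lra.
  - intros n w Hw; pose proof (pos_INR n).
    unfold mellin_term.
    rewrite (Cmult_comm (CInt (D n) _ _)), <- CInt_scal by apply ED.
    rewrite <- CInt_minus; [ | lra | eapply mellin_ex, H | eapply mellin_ex, H ].
    rewrite <- CInt_minus; [ | lra | apply ex_CInt_minus; [ lra | eapply mellin_ex, H | eapply mellin_ex, H ]
      | apply ex_CInt_scal, ED ].
    replace (B / (t * t) * Rpower (INR n + 1) (- (1 + t)) * Cmod (w - s) ^ 2)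
      with ((INR n + 2 - (INR n + 1)) * (B / (t * t) * Rpower (INR n + 1) (- (1 + t)) * Cmod (w - s) ^ 2)) by ring.
    apply CInt_norm_le_const; [ lra | | intros x Hx' ].
    { apply ex_CInt_minus; [ lra | | apply ex_CInt_scal, ED ].
      apply ex_CInt_minus; [ lra | eapply mellin_ex, H | eapply mellin_ex, H ]. }
    destruct (HX n x) as [X1 X2]; [ lra | ]; destruct (H n x) as [_ Hk]; [ lra | ].
    set (u := ((w - s) * RtoC (- ln x))%C).
    replace (k n x * xpow x (- w) - k n x * xpow x (- s) - (w - s) * D n x)%C
      with (k n x * (xpow x (- s) * (Cexp u - 1 - u)))%C.
    2:{ replace (- w)%C with (- s + - (w - s))%C by ring; rewrite xpow_plus.
        replace (xpow x (- (w - s))) with (Cexp u)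
          by (unfold xpow, u; f_equal; rewrite RtoC_opp; ring).
        unfold D, u; ring. }
    rewrite !Cmod_mult, Cmod_xpow, re_opp.
    assert (Hu : Cmod u = Cmod (w - s) * ln x)
      by (unfold u; rewrite Cmod_mult, Cmod_R, Rabs_Ropp, Rabs_right; lra).
    pose proof (Cmod_ge_0 (w - s)) as W0.
    assert (Hexp : exp (Cmod u) <= Rpower x t) by (rewrite Hu; apply exp_le; nra).
    pose proof (ln_le_Rpower x t Ht) as Hln.
    pose proof (Rpower_pos x t) as Pt; pose proof (Rpower_pos x a) as Pa; pose proof (Rpower_pos x (- Re s)) as Ps.
    assert (E : B / (t * t) * Rpower x (- (1 + t)) =
      B * Rpower x a * (Rpower x (- Re s) * (Rpower x t / t * (Rpower x t / t) * Rpower x t))).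
    { replace (- (1 + t)) with (a + - Re s + t + t + t) by (unfold t; field).
      rewrite !Rpower_plus; field; lra. }
    apply Rle_trans with (B / (t * t) * Rpower x (- (1 + t)) * Cmod (w - s) ^ 2).
    + rewrite E, !Rmult_assoc, <- (Rmult_assoc B).
      apply Rmult_le_compat; [ apply Cmod_ge_0 | apply Rmult_le_pos; [ lra | apply Cmod_ge_0 ] | exact Hk | ].
      apply Rmult_le_compat_l; [ lra | ].
      eapply Rle_trans; [ apply Cexp_sub1_sub_le | ].
      rewrite Hu at 1; replace ((Cmod (w - s) * ln x) ^ 2) with (ln x * ln x * Cmod (w - s) ^ 2) by ring.
      replace (Rpower x t / t * (Rpower x t / t * (Rpower x t * Cmod (w - s) ^ 2)))
        with (Rpower x t / t * (Rpower x t / t) * Cmod (w - s) ^ 2 * Rpower x t) by ring.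
      apply Rmult_le_compat; [ | apply Rlt_le, exp_pos | | exact Hexp ].
      * apply Rmult_le_pos; [ nra | apply pow_le, W0 ].
      * apply Rmult_le_compat_r; [ apply pow_le, W0 | apply Rmult_le_compat; lra ].
    + apply Rmult_le_compat_r; [ apply pow_le, W0 | ].
      apply Rmult_le_compat_l; [ apply Rdiv_le_0_compat; nra | apply Rpower_le_base_neg; lra ].
Qed.

Lemma mellin_partial (k : R -> C) (B a : R) (n : nat) (s : C) :
  mellin_ok (fun _ => k) B a ->
  ex_CInt (fun x => k x * xpow x (- s))%C 1 (INR n + 1) /\
  csum (fun n => mellin_term (fun _ => k) n s) n = CInt (fun x => k x * xpow x (- s))%C 1 (INR n + 1).
Proof.
  intros H; induction n as [|n [IH1 IH2]].
  - simpl INR; rewrite Rplus_0_l; split.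
    + split; apply ex_RInt_point.
    + unfold CInt; rewrite !RInt_point; reflexivity.
  - rewrite S_INR; replace (INR n + 1 + 1) with (INR n + 2) by ring.
    pose proof (mellin_ex _ _ _ n s H) as E; cbv beta in E.
    split.
    + destruct IH1 as [A1 A2], E as [E1 E2]; split;
        [ apply (ex_RInt_Chasles (V := R_NormedModule) _ _ (INR n + 1)) | apply (ex_RInt_Chasles (V := R_NormedModule) _ _ (INR n + 1)) ]; assumption.
    + simpl csum; rewrite IH2, (CInt_Chasles _ 1 (INR n + 1) (INR n + 2)) by assumption; reflexivity.
Qed.

Lemma mellin_lim (k : R -> C) (B a : R) (s : C) :
  mellin_ok (fun _ => k) B a -> a + 1 < Re s ->
  Clim (fun n => CInt (fun x => k x * xpow x (- s))%C 1 (INR n + 1)) (mellin (fun _ => k) s).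
Proof.
  intros H Hs; apply (Clim_ext (csum (fun n => mellin_term (fun _ => k) n s))).
  - intros n; apply (mellin_partial k B a n s H).
  - apply (mellin_series _ B a); assumption.
Qed.

Lemma nat_cut (x : R) : 1 <= x -> exists n, INR n + 1 <= x <= INR n + 2.
Proof. intros Hx; destruct (nfloor_ex (x - 1)) as [n Hn]; [ lra | exists n; lra ]. Qed.

(** The unfolding arguments cut the integral at powers of b, which need not be integers. *)
Lemma mellin_lim_R (k : R -> C) (B a : R) (s : C) :
  mellin_ok (fun _ => k) B a -> a + 1 < Re s ->
  forall e, 0 < e -> exists X0, 1 <= X0 /\ forall X, X0 <= X ->
    Cmod (CInt (fun x => k x * xpow x (- s))%C 1 X - mellin (fun _ => k) s) < e.
Proof.
  intros H Hs e He; pose proof (mellin_ok_pos _ _ _ H) as HB.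
  destruct (mellin_lim k B a s H Hs (e / 2)) as [N1 K1]; [ lra | ].
  assert (Hl : is_lim_seq (fun n => B * Rpower (INR n + 1) (- (Re s - a))) 0).
  { replace (Finite 0) with (Rbar_mult B 0) by (simpl; f_equal; ring).
    apply is_lim_seq_scal_l, Rpower_lim_0; lra. }
  apply is_lim_seq_spec in Hl; destruct (Hl (mkposreal (e / 2) ltac:(lra))) as [N2 K2].
  exists (INR (Nat.max N1 N2) + 3); pose proof (pos_INR (Nat.max N1 N2)); split; [ lra | intros X HX ].
  destruct (nat_cut X) as [n Hn]; [ lra | ].
  assert (Hnn : (Nat.max N1 N2 <= n)%nat) by (apply INR_le; lra).
  specialize (K1 n ltac:(lia)); specialize (K2 n ltac:(lia)); cbv beta in K2; simpl pos in K2.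
  pose proof (pos_INR n).
  assert (Ex : ex_CInt (fun x => k x * xpow x (- s))%C (INR n + 1) X).
  { apply ex_CInt_cont; [ lra | intros x Hx ].
    apply ccont_mult; [ apply (H n x); lra | apply ccont_xpow; lra ]. }
  rewrite (CInt_Chasles _ 1 (INR n + 1) X); [ | apply (mellin_partial k B a n s H) | exact Ex ].
  match goal with |- Cmod (?p + ?q - ?r) < _ => replace (p + q - r)%C with ((p - r) + q)%C by ring end.
  eapply Rle_lt_trans; [ apply Cmod_triangle | ].
  assert (Cmod (CInt (fun x => k x * xpow x (- s))%C (INR n + 1) X) <= (X - (INR n + 1)) * (B * Rpower (INR n + 1) (- (Re s - a)))).
  { apply CInt_norm_le_const; [ lra | exact Ex | intros x Hx ].
    destruct (H n x) as [_ Hk]; [ lra | ].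
    rewrite Cmod_mult, Cmod_xpow, re_opp.
    apply Rle_trans with (B * Rpower x a * Rpower x (- Re s));
      [ apply Rmult_le_compat_r; [ apply Rlt_le, Rpower_pos | exact Hk ] | ].
    rewrite Rmult_assoc, <- Rpower_plus; apply Rmult_le_compat_l; [ exact HB | ].
    replace (a + - Re s) with (- (Re s - a)) by ring; apply Rpower_le_base_neg; lra. }
  rewrite Rminus_0_r, Rabs_right in K2
    by (apply Rle_ge, Rmult_le_pos; [ exact HB | apply Rlt_le, Rpower_pos ]).
  assert (0 <= B * Rpower (INR n + 1) (- (Re s - a))) by (apply Rmult_le_pos; [ exact HB | apply Rlt_le, Rpower_pos ]).
  nra.
Qed.

(** * The Riemann zeta function *)

(* The 1-periodic primitive of the sawtooth [{x} - 1/2] that vanishes at the integers. *)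
Definition saw2 (x : R) : R := (frac_part x * frac_part x - frac_part x) / 2.

Lemma frac_part_shift (n : Z) (x : R) : IZR n <= x < IZR n + 1 -> frac_part x = x - IZR n.
Proof.
  intros H; unfold frac_part; rewrite <- (Int_part_spec x n) by lra; reflexivity.
Qed.

(** The right end is included because the polynomial and [saw2] both vanish there; the ends of a
    cell then need no separate treatment. *)
Lemma saw2_on (n : Z) (x : R) :
  IZR n <= x <= IZR n + 1 -> saw2 x = ((x - IZR n) * (x - IZR n) - (x - IZR n)) / 2.
Proof.
  intros [H1 [H2|H2]]; unfold saw2.
  - rewrite (frac_part_shift n) by lra; reflexivity.
  - rewrite (frac_part_shift (n + 1)) by (rewrite plus_IZR; lra); rewrite plus_IZR, H2; field.
Qed.

Lemma saw2_nat (n : nat) (x : R) :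
  INR n <= x <= INR n + 1 -> saw2 x = ((x - INR n) * (x - INR n) - (x - INR n)) / 2.
Proof. rewrite INR_IZR_INZ; apply saw2_on. Qed.

Lemma saw2_bound (x : R) : Rabs (saw2 x) <= 1 / 8.
Proof.
  unfold saw2; destruct (base_fp x); apply Rabs_le; pose proof (pow2_ge_0 (frac_part x - 1 / 2)); nra.
Qed.

Lemma Int_part_bounds (x : R) : IZR (Int_part x) <= x < IZR (Int_part x) + 1.
Proof. destruct (base_Int_part x); lra. Qed.

Lemma saw2_periodic (x : R) : saw2 (x + 1) = saw2 x.
Proof.
  pose proof (Int_part_bounds x) as H.
  rewrite (saw2_on (Int_part x) x), (saw2_on (Int_part x + 1) (x + 1)) by (rewrite ?plus_IZR; lra).
  rewrite plus_IZR; field.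
Qed.

(** The slope {x} - 1/2 is at most 1/2 in modulus. Points at distance below 1 lie in the same cell
    or in adjacent ones; beyond that the bound 1/8 suffices. *)
Lemma saw2_lip (x y : R) : Rabs (saw2 x - saw2 y) <= Rabs (x - y) / 2.
Proof.
  assert (W : forall x y, x <= y -> Rabs (saw2 x - saw2 y) <= (y - x) / 2).
  { clear x y; intros x y Hxy.
    destruct (Rle_lt_dec 1 (y - x)) as [H|H].
    - pose proof (saw2_bound x) as Bx; pose proof (saw2_bound y) as By.
      apply Rabs_le_between in Bx, By; apply Rabs_le; lra.
    - pose proof (Int_part_bounds x) as Hx; set (n := Int_part x) in *.
      rewrite (saw2_on n x) by lra.
      set (a := x - IZR n).
      destruct (Rle_lt_dec y (IZR n + 1)) as [H1|H1].
      + rewrite (saw2_on n y) by lra; set (b := y - IZR n).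
        replace (y - x) with (b - a) by (unfold a, b; ring).
        assert (0 <= a <= b) by (unfold a, b; lra); assert (b <= 1) by (unfold b; lra).
        apply Rabs_le; split; nra.
      + rewrite (saw2_on (n + 1) y) by (rewrite plus_IZR; lra); rewrite plus_IZR.
        set (b := y - (IZR n + 1)).
        replace (y - x) with (b + 1 - a) by (unfold a, b; ring).
        assert (0 <= a <= 1) by (unfold a; lra); assert (0 <= b <= 1) by (unfold b; lra).
        apply Rabs_le; split; nra. }
  destruct (Rle_lt_dec x y) as [H|H].
  - rewrite (Rabs_minus_sym x y), (Rabs_right (y - x)) by lra; apply W, H.
  - rewrite Rabs_minus_sym, (Rabs_right (x - y)) by lra; apply W; lra.
Qed.

Lemma continuous_lip (f : R -> R) (L x : R) :
  (forall y, Rabs (f y - f x) <= L * Rabs (y - x)) -> continuous f x.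
Proof.
  intros H; apply filterlim_locally; intros e.
  assert (He : 0 < e / (Rabs L + 1)) by (apply Rdiv_lt_0_compat; [ apply cond_pos | pose proof (Rabs_pos L); lra ]).
  exists (mkposreal _ He); intros y Hy; change (Rabs (y - x) < e / (Rabs L + 1)) in Hy.
  change (Rabs (f y - f x) < e).
  pose proof (Rabs_pos L); pose proof (Rle_abs L); pose proof (Rabs_pos (y - x)).
  eapply Rle_lt_trans; [ apply H | ].
  apply Rle_lt_trans with ((Rabs L + 1) * Rabs (y - x)); [ nra | ].
  replace (pos e) with ((Rabs L + 1) * (e / (Rabs L + 1))) by (field; lra).
  apply Rmult_lt_compat_l; lra.
Qed.

Lemma saw2_continuous (x : R) : continuous saw2 x.
Proof. apply (continuous_lip _ (1 / 2)); intros y; pose proof (saw2_lip y x); lra. Qed.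

Lemma saw2_mellin_ok : mellin_ok (fun _ x => RtoC (saw2 x)) (1 / 8) 0.
Proof.
  intros n x Hx; pose proof (pos_INR n); split; [ apply ccont_RtoC, saw2_continuous | ].
  rewrite Cmod_R, Rpower_O, Rmult_1_r by lra; apply saw2_bound.
Qed.

(** The Euler-Maclaurin formula to second order. The kernel is bounded, so the integral converges
    for Re s > -1, which covers the imaginary axis where the [tau b k] lie. *)
Definition zeta0 (s : C) : C :=
  (s / (s - 1) - / 2 - s * (s + 1) * mellin (fun _ x => RtoC (saw2 x)) (s + 2))%C.

(** Multiplied by (s - 1) s (s + 1), the identity is free of denominators and holds for every s. *)
Lemma saw2_mellin_term (n : nat) (s : C) :
  ((s - 1) * s * (s + 1) * mellin_term (fun _ x => RtoC (saw2 x)) n (s + 2))%C =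
  (- (s - 1) / 2 * (xpow (INR n + 2) (- s) + xpow (INR n + 1) (- s))
   - xpow (INR n + 2) (1 - s) + xpow (INR n + 1) (1 - s))%C.
Proof.
  pose proof (pos_INR n) as Hn; set (m := INR n + 1).
  replace (INR n + 2) with (m + 1) by (unfold m; ring).
  assert (Hm : 1 <= m) by (unfold m; lra).
  assert (H2 : RtoC 2 <> RtoC 0) by (intros E; injection E; lra).
  unfold mellin_term; replace (INR n + 2) with (m + 1) by (unfold m; ring); fold m.
  rewrite <- CInt_scal.
  2:{ apply ex_CInt_cont; [ lra | intros x Hx; apply ccont_mult;
      [ apply ccont_RtoC, saw2_continuous | apply ccont_xpow; lra ] ]. }
  set (p := fun x => ((x - m) * (x - m) - (x - m)) / 2).
  (* [F] comes from two integrations by parts, with p' = x - m - 1/2 and p'' = 1; its last term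
     integrates the remaining x^(-s). *)
  set (F := fun x => (- (s - 1) * s * (RtoC (p x) * xpow x (- s - 1))
    + - (s - 1) * (RtoC (x - m - / 2) * xpow x (- s)) + - RtoC 1 * xpow x (1 - s))%C).
  rewrite (CInt_ext _ (fun x => (s - 1) * s * (s + 1) * (RtoC (p x) * xpow x (- (s + 2))))%C).
  2: lra.
  2:{ intros x Hx; unfold p; rewrite (saw2_nat (S n)) by (rewrite S_INR; fold m; lra).
      rewrite S_INR; fold m; ring. }
  rewrite (CInt_FTC F); [ | lra | | ].
  - unfold F, p.
    replace (m + 1 - m) with 1 by ring; replace (m - m) with 0 by ring.
    replace ((1 * 1 - 1) / 2) with 0 by field; replace ((0 * 0 - 0) / 2) with 0 by field.
    replace (1 - / 2) with (/ 2) by field; replace (0 - / 2) with (- / 2) by ring.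
    rewrite RtoC_opp, RtoC_inv by lra; field; exact H2.
  - intros x Hx.
    assert (Dp : is_derive p x (x - m - / 2)) by (unfold p; auto_derive; [ exact I | field ]).
    assert (Dq : is_derive (fun x => x - m - / 2) x 1) by (auto_derive; [ exact I | ring ]).
    unfold F; eapply cderiv_eq.
    + apply cderiv_plus; [ apply cderiv_plus | ].
      * apply cderiv_scal, (cderiv_mult (fun x => RtoC (p x)) (fun x => xpow x (- s - 1)));
          [ apply cderiv_RtoC, Dp | apply cderiv_xpow; lra ].
      * apply cderiv_scal, (cderiv_mult (fun x => RtoC (x - m - / 2)) (fun x => xpow x (- s)));
          [ apply (cderiv_RtoC (fun x => x - m - / 2)), Dq | apply cderiv_xpow; lra ].
      * apply cderiv_scal, cderiv_xpow; lra.
    + cbv beta; replace (- s - 1 - 1)%C with (- (s + 2))%C by ring.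
      replace (1 - s - 1)%C with (- s)%C by ring.
      ring.
  - intros x Hx; apply ccont_mult; [ apply ccont_const | apply ccont_mult; [ apply ccont_RtoC | apply ccont_xpow; lra ] ].
    unfold p; apply (ex_derive_continuous (V := R_NormedModule) (fun x => ((x - m) * (x - m) - (x - m)) / 2)).
    auto_derive; exact I.
Qed.

(** The boundary terms telescope, and each interior integer receives the two halves of its term. *)
Lemma zeta_partial (N : nat) (s : C) :
  ((s - 1) * s * (s + 1) * csum (fun n => mellin_term (fun _ x => RtoC (saw2 x)) n (s + 2)) N)%C =
  (- (s - 1) * (csum (fun n => xpow (INR n + 1) (- s)) N + / 2 * xpow (INR N + 1) (- s) - / 2)
   - xpow (INR N + 1) (1 - s) + 1)%C.
Proof.
  assert (H2 : RtoC 2 <> RtoC 0) by (intros E; injection E; lra).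
  induction N as [|N IH].
  - simpl csum; simpl INR; rewrite Rplus_0_l, !xpow_1_l; field; exact H2.
  - simpl csum; rewrite S_INR, Cmult_plus_distr_l, IH, saw2_mellin_term.
    replace (INR N + 1 + 1) with (INR N + 2) by ring; field; exact H2.
Qed.

Lemma xpow_lim_0 (s : C) : Re s < 0 -> Clim (fun n => xpow (INR n + 1) s) 0.
Proof.
  intros Hs; apply (Clim_squeeze_0 _ _ (fun n => Rpower (INR n + 1) (- (- Re s)))); [ | apply Rpower_lim_0; lra ].
  intros n; replace (xpow (INR n + 1) s - 0)%C with (xpow (INR n + 1) s) by ring.
  rewrite Cmod_xpow, Ropp_involutive; apply Rle_refl.
Qed.

Lemma zeta0_series (s : C) : 1 < Re s -> is_cseries (fun n => xpow (INR n + 1) (- s)) (zeta0 s).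
Proof.
  intros Hs.
  assert (H1 : (s - 1)%C <> RtoC 0).
  { intros E; apply (f_equal Re) in E; rewrite re_minus, !re_RtoC in E; lra. }
  assert (H2 : RtoC 2 <> RtoC 0) by (intros E; injection E; lra).
  pose proof (mellin_series _ _ _ (s + 2)%C saw2_mellin_ok ltac:(rewrite re_plus, re_RtoC; lra)) as HM.
  apply (Clim_ext (fun N => - / (s - 1) * ((s - 1) * s * (s + 1)
     * csum (fun n => mellin_term (fun _ x => RtoC (saw2 x)) n (s + 2)) N
     + (xpow (INR N + 1) (1 - s) - 1)) + (/ 2 - / 2 * xpow (INR N + 1) (- s)))%C).
  - intros N; rewrite zeta_partial; field; repeat split; assumption.
  - unfold zeta0.
    replace (s / (s - 1) - / 2 - s * (s + 1) * mellin (fun _ x => RtoC (saw2 x)) (s + 2))%C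
      with (- / (s - 1) * ((s - 1) * s * (s + 1) * mellin (fun _ x => RtoC (saw2 x)) (s + 2) + (0 - 1))
            + (/ 2 - / 2 * 0))%C by (field; repeat split; assumption).
    apply Clim_plus.
    + apply Clim_scal, Clim_plus; [ apply Clim_scal, HM | ].
      apply Clim_minus; [ apply xpow_lim_0; rewrite re_minus, re_RtoC; lra | apply Clim_const ].
    + apply Clim_minus; [ apply Clim_const | apply Clim_scal, xpow_lim_0; rewrite re_opp; lra ].
Qed.

Lemma dirichlet_one (s l : C) :
  is_dirichlet_series (fun _ => RtoC 1) s l <-> is_cseries (fun n => xpow (INR n + 1) (- s)) l.
Proof.
  unfold is_dirichlet_series; rewrite <- is_cseries_is_series.
  assert (E : forall n, (RtoC 1 * nat_cpow (n + 1) (- s))%C = xpow (INR n + 1) (- s)).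
  { intros n; rewrite Cmult_1_l; unfold nat_cpow, xpow; rewrite plus_INR; reflexivity. }
  split; apply is_cseries_ext; intros; rewrite E; reflexivity.
Qed.

(** * Continuation of zeta to the punctured plane *)

Definition periodic0 (p : R -> R) : Prop :=
  (forall x, continuous p x) /\ (forall x, p (x + 1) = p x) /\ RInt p 0 1 = 0.

(** The subtracted constant gives the primitive mean 0, so that it has in turn a periodic primitive
    and the construction iterates. *)
Definition prim0 (p : R -> R) (x : R) : R := RInt p 0 x - RInt (fun y => RInt p 0 y) 0 1.

Lemma ex_RInt_cont (p : R -> R) (a b : R) : (forall x, continuous p x) -> ex_RInt p a b.
Proof. intros H; apply (ex_RInt_continuous (V := R_CompleteNormedModule)); intros; apply H. Qed.

Lemma is_derive_prim (p : R -> R) (x : R) :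
  (forall x, continuous p x) -> is_derive (fun x => RInt p 0 x) x (p x).
Proof.
  intros H; apply (is_derive_RInt (V := R_NormedModule) p (fun x => RInt p 0 x) 0 x); [ | apply H ].
  apply filter_forall; intros y; apply (RInt_correct (V := R_CompleteNormedModule)), ex_RInt_cont, H.
Qed.

Lemma prim0_derive (p : R -> R) (x : R) : periodic0 p -> is_derive (prim0 p) x (p x).
Proof.
  intros [H _]; unfold prim0; rewrite <- (Rminus_0_r (p x)).
  apply (is_derive_minus (V := R_NormedModule) (fun x => RInt p 0 x));
    [ apply is_derive_prim, H | apply (is_derive_const (V := R_NormedModule)) ].
Qed.

Lemma prim0_periodic0 (p : R -> R) : periodic0 p -> periodic0 (prim0 p).
Proof.
  intros Hp; pose proof Hp as [H1 [H2 H3]]; split; [ | split ].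
  - intros x; apply (ex_derive_continuous (V := R_NormedModule)); exists (p x); apply prim0_derive, Hp.
  - intros x; unfold prim0; f_equal.
    rewrite <- (RInt_Chasles (V := R_CompleteNormedModule) p 0 1 (x + 1)) by (apply ex_RInt_cont, H1).
    rewrite H3; unfold plus; simpl; rewrite Rplus_0_l.
    pose proof (RInt_comp_lin (V := R_CompleteNormedModule) p 1 1 0 x) as E.
    replace (1 * 0 + 1) with 1 in E by ring; replace (1 * x + 1) with (x + 1) in E by ring.
    rewrite <- E by (apply ex_RInt_cont, H1).
    apply RInt_ext; intros y _; unfold scal; simpl; unfold mult; simpl.
    rewrite !Rmult_1_l; apply H2.
  - unfold prim0.
    assert (C1 : forall x, continuous (fun x => RInt p 0 x) x).
    { intros x; apply (ex_derive_continuous (V := R_NormedModule)); exists (p x); apply is_derive_prim, H1. }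
    rewrite (RInt_minus (V := R_CompleteNormedModule) (fun x => RInt p 0 x));
      [ | apply ex_RInt_cont, C1 | apply ex_RInt_const ].
    rewrite RInt_const; unfold minus, plus, opp, scal; simpl; unfold mult; simpl; ring.
Qed.

Lemma periodic_nat (p : R -> R) (n : nat) (x : R) : (forall x, p (x + 1) = p x) -> p (x + INR n) = p x.
Proof.
  intros H; induction n as [|n IH]; [ simpl; f_equal; ring | ].
  rewrite S_INR, <- Rplus_assoc, H; exact IH.
Qed.

Lemma periodic0_bounded (p : R -> R) : periodic0 p -> exists B, mellin_ok (fun _ x => RtoC (p x)) B 0.
Proof.
  intros [H1 [H2 _]]; destruct (ex_RInt_ub p 0 1 (ex_RInt_cont p 0 1 H1)) as [B HB].
  rewrite Rmin_left, Rmax_right in HB by lra.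
  exists B; intros n x Hx; pose proof (pos_INR n); split; [ apply ccont_RtoC, H1 | ].
  rewrite Cmod_R, Rpower_O, Rmult_1_r by lra.
  replace x with ((x - INR (S n)) + INR (S n)) by ring; rewrite periodic_nat by exact H2.
  apply HB; rewrite S_INR; lra.
Qed.

Lemma RInt_saw2 : RInt saw2 0 1 = - / 12.
Proof.
  rewrite (RInt_ext saw2 (fun x => (x * x - x) / 2)).
  - replace (- / 12) with (minus ((fun x => x * x * x / 6 - x * x / 4) 1) ((fun x => x * x * x / 6 - x * x / 4) 0))
      by (unfold minus, plus, opp; simpl; field).
    apply (is_RInt_unique (V := R_CompleteNormedModule)).
    apply (is_RInt_derive (V := R_CompleteNormedModule) (fun x => x * x * x / 6 - x * x / 4) (fun x => (x * x - x) / 2)).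
    + intros x _; auto_derive; [ exact I | field ].
    + intros x _; apply (ex_derive_continuous (V := R_NormedModule)); auto_derive; exact I.
  - rewrite Rmin_left, Rmax_right by lra; intros x Hx.
    rewrite (saw2_on 0) by (simpl; lra); simpl; rewrite Rminus_0_r; reflexivity.
Qed.

Lemma saw2_shift_periodic0 : periodic0 (fun x => saw2 x + / 12).
Proof.
  split; [ | split ].
  - intros x; apply (continuous_plus saw2 (fun _ => / 12)); [ apply saw2_continuous | apply continuous_const ].
  - intros x; rewrite saw2_periodic; reflexivity.
  - rewrite (RInt_plus (V := R_CompleteNormedModule) saw2 (fun _ => / 12));
      [ | apply ex_RInt_cont, saw2_continuous | apply ex_RInt_const ].
    rewrite RInt_saw2, RInt_const; unfold plus, scal; simpl; unfold mult; simpl; lra.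
Qed.

(** [bern k] is the periodic Bernoulli function of degree k + 2 divided by (k + 2)!; the shift by
    1/12 gives [saw2] mean 0. *)
Fixpoint bern (k : nat) : R -> R :=
  match k with O => fun x => saw2 x + / 12 | S j => prim0 (bern j) end.

Lemma bern_periodic0 (k : nat) : periodic0 (bern k).
Proof. induction k as [|k IH]; [ apply saw2_shift_periodic0 | apply prim0_periodic0, IH ]. Qed.

(* Each integration by parts moves the half-plane of convergence one unit to the left. *)
Fixpoint bern_mellin (m k : nat) (s : C) : C :=
  match m with
  | O => mellin (fun _ x => RtoC (bern k x)) s
  | S j => (- RtoC (bern (S k) 1) + s * bern_mellin j (S k) (s + 1))%C
  end.

(** The boundary term at infinity vanishes because a continuous periodic function is bounded; the
    one at 1 is the constant in [bern_mellin]. *)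
Lemma bern_mellin_parts (k : nat) (s : C) : 1 < Re s -> bern_mellin 1 k s = bern_mellin 0 k s.
Proof.
  intros Hs; simpl.
  destruct (periodic0_bounded _ (bern_periodic0 k)) as [B HB].
  destruct (periodic0_bounded _ (bern_periodic0 (S k))) as [B' HB'].
  pose proof (mellin_ok_pos _ _ _ HB') as PB'.
  pose proof (mellin_lim _ _ _ s HB ltac:(lra)) as L1.
  pose proof (mellin_lim _ _ _ (s + 1)%C HB' ltac:(rewrite re_plus, re_RtoC; lra)) as L2.
  symmetry; apply (Clim_unique _ _ _ L1).
  set (q := bern (S k)) in *.
  apply (Clim_ext (fun N => RtoC (q (INR N + 1)%R) * xpow (INR N + 1) (- s) - RtoC (q 1)
    + s * CInt (fun x => RtoC (q x) * xpow x (- (s + 1))) 1 (INR N + 1))%C).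
  - intros N; pose proof (pos_INR N) as HN.
    destruct (mellin_partial _ _ _ N s HB) as [E1 _].
    destruct (mellin_partial _ _ _ N (s + 1)%C HB') as [E2 _].
    assert (E : CInt (fun x => RtoC (bern k x) * xpow x (- s) - s * (RtoC (q x) * xpow x (- (s + 1))))%C 1 (INR N + 1)
      = (RtoC (q (INR N + 1)%R) * xpow (INR N + 1) (- s) - RtoC (q 1) * xpow 1 (- s))%C).
    { apply (CInt_FTC (fun x => RtoC (q x) * xpow x (- s))%C); [ lra | | ].
      - intros x Hx.
        assert (Dq : is_derive q x (bern k x)) by (apply prim0_derive, bern_periodic0).
        eapply cderiv_eq.
        + apply (cderiv_mult (fun x => RtoC (q x)) (fun x => xpow x (- s)));
            [ apply cderiv_RtoC, Dq | apply cderiv_xpow; lra ].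
        + cbv beta; replace (- (s + 1))%C with (- s - 1)%C by ring; ring.
      - intros x Hx; apply ccont_minus; [ | apply ccont_mult; [ apply ccont_const | ] ];
          (apply ccont_mult; [ apply ccont_RtoC, bern_periodic0 | apply ccont_xpow; lra ]). }
    rewrite CInt_minus in E; [ | lra | exact E1 | apply ex_CInt_scal, E2 ].
    rewrite CInt_scal in E by exact E2.
    rewrite xpow_1_l in E.
    transitivity (RtoC (q (INR N + 1)%R) * xpow (INR N + 1) (- s) - RtoC (q 1) * 1
      + s * CInt (fun x => RtoC (q x) * xpow x (- (s + 1))) 1 (INR N + 1))%C; [ ring | rewrite <- E; ring ].
  - change (prim0 (bern k)) with q.
    replace (- RtoC (q 1))%C with (0 - RtoC (q 1))%C by ring.
    apply Clim_plus; [ | apply Clim_scal, L2 ].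
    apply Clim_minus; [ | apply Clim_const ].
    apply (Clim_squeeze_0 _ _ (fun n => B' * Rpower (INR n + 1) (- Re s))).
    + intros n; pose proof (pos_INR n); destruct (HB' n (INR n + 1)) as [_ K]; [ lra | ].
      rewrite Rpower_O, Rmult_1_r in K by lra.
      rewrite Cminus_0_r, Cmod_mult, Cmod_xpow, re_opp; apply Rmult_le_compat_r; [ apply Rlt_le, Rpower_pos | exact K ].
    + replace (Finite 0) with (Rbar_mult B' 0) by (simpl; f_equal; ring).
      apply is_lim_seq_scal_l, Rpower_lim_0; lra.
Qed.

Lemma bern_mellin_cdiff (m k : nat) (s : C) : 1 - INR m < Re s -> cdiff (bern_mellin m k) s.
Proof.
  revert k s; induction m as [|m IH]; intros k s Hs.
  - destruct (periodic0_bounded _ (bern_periodic0 k)) as [B HB]; simpl in Hs |- *.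
    apply (mellin_cdiff _ B 0); [ exact HB | lra ].
  - rewrite S_INR in Hs; simpl bern_mellin.
    apply cdiff_plus; [ apply cdiff_const | apply cdiff_mult; [ apply cdiff_id | ] ].
    apply (cdiff_comp (fun s => s + 1)%C (bern_mellin m (S k)));
      [ apply cdiff_plus; [ apply cdiff_id | apply cdiff_const ] | ].
    apply IH; rewrite re_plus, re_RtoC; lra.
Qed.

(** Two depths that are both valid at s agree there, so the continuation may change its depth from
    point to point. *)
Lemma bern_mellin_stable (j m k : nat) (s : C) :
  1 - INR m < Re s -> bern_mellin (m + j) k s = bern_mellin m k s.
Proof.
  assert (Hstep : forall m k s, 1 - INR m < Re s -> bern_mellin (S m) k s = bern_mellin m k s).
  { clear; induction m as [|m IH]; intros k s Hs.
    - apply bern_mellin_parts; simpl in Hs; lra.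
    - rewrite S_INR in Hs.
      change (bern_mellin (S (S m)) k s) with (- RtoC (bern (S k) 1) + s * bern_mellin (S m) (S k) (s + 1))%C.
      rewrite IH; [ reflexivity | rewrite re_plus, re_RtoC; lra ]. }
  intros Hs; induction j as [|j IH]; [ rewrite Nat.add_0_r; reflexivity | ].
  rewrite <- plus_n_Sm, Hstep; [ exact IH | rewrite plus_INR; pose proof (pos_INR j); lra ].
Qed.

(** The term s / 12 compensates the shift of [saw2] by 1/12, because s (s + 1) times the integral of
    x^(-s-2) over [1, oo) is s. *)
Definition zeta_at (m : nat) (s : C) : C :=
  (s / (s - 1) - / 2 + s / 12 - s * (s + 1) * bern_mellin m 0 (s + 2))%C.

(** The depth grows with - Re s, so one function covers the plane; [Z.to_nat] turns a negative [up]
    into depth 0. *)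
Definition zeta_ext (s : C) : C := zeta_at (Z.to_nat (up (- Re s))) s.

Lemma zeta_at_stable (m n : nat) (s : C) :
  - Re s < INR m -> - Re s < INR n -> zeta_at m s = zeta_at n s.
Proof.
  intros Hm Hn; unfold zeta_at; do 2 f_equal.
  assert (E : (Re (s + 2) = Re s + 2)%R) by (rewrite re_plus, re_RtoC; reflexivity).
  rewrite <- (bern_mellin_stable n m 0 (s + 2)) by lra.
  rewrite <- (bern_mellin_stable m n 0 (s + 2)) by lra; rewrite Nat.add_comm; reflexivity.
Qed.

Lemma zeta_ext_at (m : nat) (s : C) : - Re s < INR m -> zeta_ext s = zeta_at m s.
Proof.
  intros Hm; apply zeta_at_stable; [ | exact Hm ].
  destruct (archimed (- Re s)) as [H _].
  destruct (Z_le_gt_dec 0 (up (- Re s))) as [H0|H0].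
  - rewrite INR_IZR_INZ, Z2Nat.id by exact H0; lra.
  - assert (IZR (up (- Re s)) < 0) by (apply (IZR_lt _ 0); lia).
    pose proof (pos_INR (Z.to_nat (up (- Re s)))); lra.
Qed.

Lemma zeta_ext_cdiff (s : C) : s <> RtoC 1 -> cdiff zeta_ext s.
Proof.
  intros Hs.
  (* Depth m exceeds |Re s| + 1, so on the unit disc around s the function is the fixed expression
     [zeta_at m]. *)
  destruct (nfloor_ex (Rabs (Re s) + 2)) as [m Hm]; [ pose proof (Rabs_pos (Re s)); lra | ].
  assert (Hre : Rabs (Re s) + 1 < INR m) by lra.
  pose proof (Rle_abs (- Re s)) as H1; rewrite Rabs_Ropp in H1.
  apply (cdiff_ext_loc (zeta_at m) zeta_ext s 1); [ lra | | ].
  - intros w Hw; symmetry; apply zeta_ext_at.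
    pose proof (re_le_Cmod (w - s)) as R1; rewrite re_minus in R1.
    assert (R2 : Rabs (Re w - Re s) < 1) by lra; apply Rabs_def2 in R2; lra.
  - unfold zeta_at.
    assert (P1 : forall c, cdiff (fun s => s + c)%C s) by (intros; apply cdiff_plus; [ apply cdiff_id | apply cdiff_const ]).
    apply cdiff_minus; [ apply cdiff_plus; [ apply cdiff_minus | ] | ].
    + apply cdiff_div; [ apply cdiff_id | apply P1 | apply Cminus_eq_contra, Hs ].
    + apply cdiff_const.
    + apply cdiff_mult; [ apply cdiff_id | apply cdiff_const ].
    + apply cdiff_mult; [ apply cdiff_mult; [ apply cdiff_id | apply P1 ] | ].
      apply (cdiff_comp (fun s => s + 2)%C (bern_mellin m 0)); [ apply P1 | ].
      apply bern_mellin_cdiff; rewrite re_plus, re_RtoC; lra.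
Qed.

Lemma zeta_ext_zeta0 (s : C) : -1 < Re s -> zeta_ext s = zeta0 s.
Proof.
  intros Hs; rewrite (zeta_ext_at 1) by (simpl; lra); unfold zeta_at.
  assert (E : (Re (s + 2) = Re s + 2)%R) by (rewrite re_plus, re_RtoC; reflexivity).
  change 1%nat with (0 + 1)%nat; rewrite (bern_mellin_stable 1 0) by (rewrite E; simpl; lra).
  assert (Hn : (s + 1)%C <> RtoC 0).
  { intros H; apply (f_equal Re) in H; rewrite re_plus, !re_RtoC in H; lra. }
  destruct (periodic0_bounded _ (bern_periodic0 0)) as [B HB].
  pose proof (mellin_lim _ _ _ (s + 2)%C HB ltac:(lra)) as L1.
  pose proof (mellin_lim _ _ _ (s + 2)%C saw2_mellin_ok ltac:(lra)) as L2.
  assert (L3 : bern_mellin 0 0 (s + 2) =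
    (mellin (fun _ x => RtoC (saw2 x)) (s + 2) + / 12 * / (s + 1))%C).
  { simpl bern_mellin; apply (Clim_unique _ _ _ L1).
    apply (Clim_ext (fun N => CInt (fun x => RtoC (saw2 x) * xpow x (- (s + 2))) 1 (INR N + 1)
      + / 12 * (/ (s + 1) - / (s + 1) * xpow (INR N + 1) (- (s + 1))))%C).
    - intros N; pose proof (pos_INR N).
      assert (Ec : ex_CInt (fun x => xpow x (- (s + 2))) 1 (INR N + 1)).
      { apply ex_CInt_cont; [ lra | intros; apply ccont_xpow; lra ]. }
      rewrite (CInt_ext (fun x => RtoC (bern 0 x) * xpow x (- (s + 2)))%C
        (fun x => RtoC (saw2 x) * xpow x (- (s + 2)) + / 12 * xpow x (- (s + 2)))%C).
      + rewrite CInt_plus, CInt_scal; [ | exact Ec | apply (mellin_partial _ _ _ N (s + 2)%C saw2_mellin_ok)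
          | apply ex_CInt_scal, Ec ].
        f_equal; f_equal.
        rewrite (CInt_FTC (fun x => - / (s + 1) * xpow x (- (s + 1)))%C); [ | lra | | ].
        * rewrite xpow_1_l; ring.
        * intros x Hx; eapply cderiv_eq; [ apply cderiv_scal, cderiv_xpow; lra | ].
          replace (- (s + 1) - 1)%C with (- (s + 2))%C by ring; field; exact Hn.
        * intros; apply ccont_xpow; lra.
      + lra.
      + intros x Hx; simpl bern; rewrite RtoC_plus, RtoC_inv by lra; ring.
    - apply Clim_plus; [ exact L2 | apply Clim_scal ].
      replace (/ (s + 1))%C with (/ (s + 1) - / (s + 1) * 0)%C at 1 by ring.
      apply Clim_minus; [ apply Clim_const | apply Clim_scal, xpow_lim_0 ].
      rewrite re_opp, re_plus, re_RtoC; lra. }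
  rewrite L3; unfold zeta0.
  assert (H12 : RtoC 12 <> RtoC 0) by (intros H; injection H; lra).
  unfold Cdiv; transitivity (s * / (s - 1) - / 2 + s * / 12 - s * (s + 1) * mellin (fun _ x => RtoC (saw2 x)) (s + 2)
    - s * / 12 * ((s + 1) * / (s + 1)))%C; [ ring | rewrite Cinv_r by exact Hn; ring ].
Qed.

(** A witness of the specification is what gives meaning to the value that [epsilon] returns. *)
Lemma zeta_ext_is_riemann_zeta : is_riemann_zeta zeta_ext.
Proof.
  split; intros s Hs.
  - apply dirichlet_one; rewrite zeta_ext_zeta0 by lra; apply zeta0_series, Hs.
  - apply cdiff_C_differentiable, zeta_ext_cdiff, Hs.
Qed.

(* The squares used to move left stay away from the real axis, hence from the possible singularity at 1. *)
Lemma is_riemann_zeta_unique (Z1 Z2 : C -> C) (s : C) :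
  is_riemann_zeta Z1 -> is_riemann_zeta Z2 -> Im s <> 0 -> Z1 s = Z2 s.
Proof.
  intros [A1 D1] [A2 D2] Hs.
  set (f := fun s => (Z1 s - Z2 s)%C).
  assert (Hf : forall z, Im z <> 0 -> cdiff f z).
  { intros z Hz; assert (z <> RtoC 1) by (intros ->; apply Hz; apply im_RtoC).
    apply cdiff_minus; apply cdiff_C_differentiable; [ apply D1 | apply D2 ]; assumption. }
  assert (H0 : forall z, 1 < Re z -> f z = RtoC 0).
  { intros z Hz; unfold f; rewrite (Clim_unique _ (Z1 z) (Z2 z)
      (proj1 (dirichlet_one z _) (A1 z Hz)) (proj1 (dirichlet_one z _) (A2 z Hz))); ring. }
  (* Each move to the left gains a quarter of |Im z|, since a square around a point at that height
     must keep off the real axis; hence a bound that depends on the height of z. *)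
  assert (Hn : forall n z, Im z <> 0 -> 1 - INR n * (Rabs (Im z) / 4) < Re z -> f z = RtoC 0).
  { induction n as [|n IH]; intros z Hz Hr; [ apply H0; simpl in Hr; lra | ].
    rewrite S_INR in Hr; set (t := Rabs (Im z)) in *.
    assert (Ht : 0 < t) by (apply Rabs_pos_lt, Hz).
    pose proof (pos_INR n) as Pn.
    set (c := (z + RtoC (t / 3))%C).
    assert (Rc : Re c = Re z + t / 3) by (unfold c; rewrite re_plus, re_RtoC; reflexivity).
    assert (Ic : Im c = Im z) by (unfold c; rewrite im_plus, im_RtoC; ring).
    (* The centre lies t / 3 to the right, which beats the gain t / 4 by t / 12. On a disc of radius
       t / (48 (n + 1)) the change of abscissa and n / 4 times the change of height together stay
       below t / 12, so the induction hypothesis applies. *)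
    apply (vanish_square f c z (t / 2) (Rmin (t / 2) (t / (48 * (INR n + 1))))).
    - intros v [_ V2]; apply Hf; rewrite Ic in V2; unfold t, Rabs in V2, Ht; destruct (Rcase_abs (Im z)); lra.
    - apply Rmin_pos; [ lra | apply Rdiv_lt_0_compat; lra ].
    - intros v Hv.
      pose proof (Rlt_le_trans _ _ _ Hv (Rmin_l _ _)) as Hv1.
      pose proof (Rlt_le_trans _ _ _ Hv (Rmin_r _ _)) as Hv2.
      set (d := Cmod (v - c)) in *.
      pose proof (re_le_Cmod (v - c)) as R1; rewrite re_minus, Rc in R1; fold d in R1; apply Rabs_le_between in R1.
      pose proof (im_le_Cmod (v - c)) as R2; rewrite im_minus, Ic in R2; fold d in R2.
      assert (R3 : t - d <= Rabs (Im v)).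
      { unfold t; pose proof (Rabs_triang_inv (Im z) (Im v)) as T; rewrite Rabs_minus_sym in T; lra. }
      assert (Hd : d * (48 * (INR n + 1)) < t).
      { apply (Rmult_lt_compat_r (48 * (INR n + 1))) in Hv2; [ | lra ].
        replace (t / (48 * (INR n + 1)) * (48 * (INR n + 1))) with t in Hv2 by (field; lra); exact Hv2. }
      assert (Pd : 0 <= d) by apply Cmod_ge_0.
      apply IH; [ intros E; rewrite E, Rabs_R0 in R3; lra | ].
      assert (INR n * ((t - d) / 4) <= INR n * (Rabs (Im v) / 4)) by (apply Rmult_le_compat_l; lra).
      assert (INR n * d <= t / 48) by nra.
      nra.
    - unfold c; replace (z - (z + RtoC (t / 3)))%C with (- RtoC (t / 3))%C by ring.
      rewrite Cmod_opp, Cmod_R, Rabs_right; lra. }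
  assert (Ht : 0 < Rabs (Im s) / 4) by (apply Rabs_pos_lt in Hs; lra).
  destruct (nfloor_ex (Rabs (1 - Re s) / (Rabs (Im s) / 4))) as [n Hnn].
  { apply Rdiv_le_0_compat; [ apply Rabs_pos | exact Ht ]. }
  apply Ceq_minus, (Hn (S n) s Hs); rewrite S_INR.
  destruct Hnn as [_ Hnn].
  apply (Rmult_lt_compat_r (Rabs (Im s) / 4)) in Hnn; [ | exact Ht ].
  unfold Rdiv at 1 in Hnn; rewrite Rmult_assoc, Rinv_l, Rmult_1_r in Hnn by lra.
  pose proof (Rle_abs (1 - Re s)); lra.
Qed.

(** The specification determines zeta off the real axis, so the chosen function may be replaced by
    the explicit formula, in particular at every [tau b k] with k <> 0. *)
Lemma riemann_zeta_zeta0 (s : C) : Im s <> 0 -> -1 < Re s -> riemann_zeta s = zeta0 s.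
Proof.
  intros Hs Hr; rewrite <- zeta_ext_zeta0 by exact Hr.
  apply is_riemann_zeta_unique; [ | exact zeta_ext_is_riemann_zeta | exact Hs ].
  unfold riemann_zeta; apply epsilon_spec; exists zeta_ext; exact zeta_ext_is_riemann_zeta.
Qed.

(** * Non-vanishing of zeta on the line of abscissa 1 *)

Definition rough (N m : nat) : Prop :=
  forall p, (p < N)%nat -> prime (Z.of_nat p) -> ~ (Z.of_nat p | Z.of_nat m)%Z.

Definition rough_ind (N m : nat) : R := if excluded_middle_informative (rough N m) then 1 else 0.

Definition sieve_term (N : nat) (s : C) (m : nat) : C := (RtoC (rough_ind N m) * xpow (INR m) (- s))%C.

(** For Re s > 1 this is zeta times the product of 1 - p^(-s) over the primes p below N. Removing
    one prime at a time reaches the Euler product as a limit, with no infinite product to handle. *)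
Definition sieve (N : nat) (s : C) : C := CSeries (fun n => sieve_term N s (S n)).

Lemma rough_ind_bound (N m : nat) : 0 <= rough_ind N m <= 1.
Proof. unfold rough_ind; destruct (excluded_middle_informative _); lra. Qed.

Lemma sieve_term_le (N : nat) (s : C) (n : nat) :
  Cmod (sieve_term N s (S n)) <= Rpower (INR n + 1) (- Re s).
Proof.
  unfold sieve_term; rewrite Cmod_mult, Cmod_R, Cmod_xpow, re_opp, S_INR.
  pose proof (rough_ind_bound N (S n)); rewrite Rabs_right by lra.
  pose proof (Rpower_pos (INR n + 1) (- Re s)); nra.
Qed.

Lemma sieve_series (N : nat) (s : C) : 1 < Re s -> is_cseries (fun n => sieve_term N s (S n)) (sieve N s).
Proof.
  intros Hs; apply (is_cseries_abs _ (fun n => Rpower (INR n + 1) (- Re s)));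
    [ intros; apply sieve_term_le | apply ex_series_Rpower, Hs ].
Qed.

Lemma sieve_0 (s : C) : 1 < Re s -> sieve 0 s = zeta0 s.
Proof.
  intros Hs; apply is_cseries_CSeries.
  apply (is_cseries_ext (fun n => xpow (INR n + 1) (- s))); [ | apply zeta0_series, Hs ].
  intros n; unfold sieve_term, rough_ind; rewrite S_INR.
  destruct (excluded_middle_informative _) as [H|H]; [ ring | exfalso; apply H; intros p Hp; lia ].
Qed.

Lemma csum_add (a : nat -> C) (m n : nat) : csum a (m + n) = (csum a m + csum (fun k => a (m + k)%nat) n)%C.
Proof.
  induction n as [|n IH]; [ rewrite Nat.add_0_r; simpl; ring | ].
  rewrite <- plus_n_Sm; simpl; rewrite IH; ring.
Qed.

Lemma csum_zero (a : nat -> C) (n : nat) : (forall k, (k < n)%nat -> a k = RtoC 0) -> csum a n = RtoC 0.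
Proof.
  induction n as [|n IH]; intros H; [ reflexivity | simpl ].
  rewrite IH by (intros; apply H; lia); rewrite H by lia; ring.
Qed.

Definition only_multiples (N : nat) (f : nat -> C) (m : nat) : C :=
  if excluded_middle_informative (Z.of_nat N | Z.of_nat m)%Z then f m else RtoC 0.

Lemma csum_multiples (f : nat -> C) (N K : nat) :
  (0 < N)%nat ->
  csum (fun n => only_multiples N f (S n)) (N * K) = csum (fun j => f (N * S j)%nat) K.
Proof.
  intros HN; induction K as [|K IH]; [ rewrite Nat.mul_0_r; reflexivity | ].
  replace (N * S K)%nat with (N * K + N)%nat by lia.
  rewrite csum_add, IH; simpl csum; f_equal.
  destruct N as [|N]; [ lia | simpl csum ].
  rewrite csum_zero.
  - unfold only_multiples; destruct (excluded_middle_informative _) as [H|H].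
    + rewrite Cplus_0_l; f_equal; lia.
    + exfalso; apply H; exists (Z.of_nat (S K)); lia.
  - intros k Hk; unfold only_multiples; destruct (excluded_middle_informative _) as [[q Hq]|H]; [ | reflexivity ].
    exfalso.
    assert (E : ((q - Z.of_nat K) * Z.of_nat (S N) = Z.of_nat (S k))%Z) by lia.
    assert (q - Z.of_nat K <= 0 \/ 1 <= q - Z.of_nat K)%Z as [H|H] by lia; nia.
Qed.

Lemma Clim_subseq (u : nat -> C) (l : C) (N : nat) : (0 < N)%nat -> Clim u l -> Clim (fun k => u (N * k)%nat) l.
Proof. intros HN H e He; destruct (H e He) as [M K]; exists M; intros n Hn; apply K; nia. Qed.

Lemma rough_ind_prime_mult (N m : nat) : prime (Z.of_nat N) -> rough_ind N (N * m) = rough_ind N m.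
Proof.
  intros HN.
  assert (E : rough N (N * m) <-> rough N m).
  { split; intros H p Hp Pp D; apply (H p Hp Pp); rewrite ?Nat2Z.inj_mul in *.
    - apply Z.divide_mul_r, D.
    - apply prime_mult in D; [ | exact Pp ]; destruct D as [D|D]; [ exfalso | exact D ].
      apply prime_divisors in D; [ | exact HN ].
      destruct Pp as [P1 _]; lia. }
  unfold rough_ind; do 2 destruct (excluded_middle_informative _); tauto.
Qed.

(** The step removes the multiples N j. As N j has a prime factor below N exactly when j has one,
    these terms add up to N^(-s) times the whole sieved series. *)
Lemma sieve_step_prime (N : nat) (s : C) :
  1 < Re s -> prime (Z.of_nat N) -> sieve (S N) s = ((1 - xpow (INR N) (- s)) * sieve N s)%C.
Proof.
  intros Hs HN.
  assert (PN : (0 < N)%nat) by (destruct HN as [P1 _]; lia).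
  pose proof (sieve_series N s Hs) as S1; pose proof (sieve_series (S N) s Hs) as S2.
  pose proof (is_cseries_minus _ _ _ _ S1 S2) as S3.
  assert (S4 : is_cseries (fun n => sieve_term N s (N * S n)%nat) (sieve N s - sieve (S N) s)%C).
  (* Partial sums cut at multiples of N consist of complete blocks, each with exactly one multiple
     of N. *)
  { apply (Clim_ext (fun K => csum (fun n => only_multiples N (sieve_term N s) (S n)) (N * K))).
    - intros K; apply csum_multiples, PN.
    - apply (Clim_subseq (csum (fun n => only_multiples N (sieve_term N s) (S n)))); [ exact PN | ].
      apply (is_cseries_ext (fun n => sieve_term N s (S n) - sieve_term (S N) s (S n))%C); [ | exact S3 ].
      intros n; unfold only_multiples, sieve_term, rough_ind.
      destruct (excluded_middle_informative (Z.of_nat N | Z.of_nat (S n))%Z) as [D|D].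
      + destruct (excluded_middle_informative (rough (S N) (S n))) as [R|R]; [ | ring ].
        exfalso; apply (R N); [ lia | exact HN | exact D ].
      + destruct (excluded_middle_informative (rough (S N) (S n))) as [R|R];
          destruct (excluded_middle_informative (rough N (S n))) as [R'|R']; try ring; exfalso.
        * apply R'; intros p Hp; apply R; lia.
        * apply R; intros p Hp Pp; destruct (Nat.eq_dec p N) as [->|]; [ exact D | apply R'; [ lia | exact Pp ] ]. }
  pose proof (is_cseries_scal (xpow (INR N) (- s)) _ _ S1) as S5.
  assert (E : (sieve N s - sieve (S N) s)%C = (xpow (INR N) (- s) * sieve N s)%C).
  { apply (Clim_unique _ _ _ S4); apply (is_cseries_ext (fun n => xpow (INR N) (- s) * sieve_term N s (S n))%C);
      [ | exact S5 ].
    intros n; unfold sieve_term; rewrite rough_ind_prime_mult by exact HN.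
    rewrite mult_INR, xpow_mult; [ ring | apply lt_0_INR; lia | apply lt_0_INR; lia ]. }
  replace (sieve (S N) s) with (sieve N s - (sieve N s - sieve (S N) s))%C by ring.
  rewrite E; ring.
Qed.

Lemma sieve_step_not_prime (N : nat) (s : C) : ~ prime (Z.of_nat N) -> sieve (S N) s = sieve N s.
Proof.
  intros HN; unfold sieve; f_equal; apply FunctionalExtensionality.functional_extensionality; intros n.
  unfold sieve_term; do 2 f_equal.
  assert (E : rough (S N) (S n) <-> rough N (S n)).
  { split; intros H p Hp Pp; apply H; try exact Pp; try lia.
    destruct (Nat.eq_dec p N) as [->|]; [ contradiction | lia ]. }
  unfold rough_ind; do 2 destruct (excluded_middle_informative _); tauto.
Qed.

Lemma exists_prime_divisor (m : nat) :
  (2 <= m)%nat -> exists p, (p <= m)%nat /\ prime (Z.of_nat p) /\ (Z.of_nat p | Z.of_nat m)%Z.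
Proof.
  induction m as [m IH] using lt_wf_ind; intros Hm.
  destruct (prime_dec (Z.of_nat m)) as [H|H].
  - exists m; split; [ lia | split; [ exact H | apply Z.divide_refl ] ].
  - apply not_prime_divide in H; [ | lia ]; destruct H as [q [Hq D]].
    destruct (IH (Z.to_nat q)) as [p [P1 [P2 P3]]]; [ lia | lia | ].
    rewrite Z2Nat.id in P3 by lia.
    exists p; split; [ lia | split; [ exact P2 | apply (Z.divide_trans _ q); assumption ] ].
Qed.

Lemma cseries_tail_le (a : nat -> C) (b : nat -> R) (l : C) (N : nat) :
  (forall k, Cmod (a k) <= b k) -> ex_series b -> is_cseries a l ->
  Cmod (l - csum a (S N)) <= Series b - sum_n b N.
Proof.
  intros H He Ha.
  assert (E : is_cseries (fun k => a (S N + k)%nat) (l - csum a (S N))%C).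
  { intros e Hp; destruct (Ha e Hp) as [M K]; exists M; intros n Hn.
    specialize (K (S N + n)%nat ltac:(lia)); rewrite csum_add in K.
    replace (csum (fun k => a (S N + k)%nat) n - (l - csum a (S N)))%C
      with (csum a (S N) + csum (fun k => a (S N + k)%nat) n - l)%C by ring; exact K. }
  rewrite (Series_incr_n b (S N)) by (try lia; exact He).
  simpl pred; rewrite sum_n_Reals; replace (_ + _ - _) with (Series (fun k => b (S N + k)%nat)) by ring.
  apply (is_cseries_mod_le (fun k => a (S N + k)%nat)); [ intros; apply H | | exact E ].
  apply (ex_series_incr_n (K := R_AbsRing) (V := R_NormedModule) b (S N)), He.
Qed.

(** Among the integers up to N + 1 only 1 has no prime factor below N + 2, so the distance to 1 is
    at most a tail of a convergent series. *)
Lemma sieve_lim (s : C) : 1 < Re s -> Clim (fun N => sieve N s) 1.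
Proof.
  intros Hs; set (b := fun n => Rpower (INR n + 1) (- Re s)).
  assert (Hb : ex_series b) by (apply ex_series_Rpower, Hs).
  assert (Hsh : Clim (fun N => sieve (S (S N)) s) 1).
  { apply (Clim_squeeze_0 _ _ (fun N => Series b - sum_n b N)).
    - intros N.
      assert (E : csum (fun n => sieve_term (S (S N)) s (S n)) (S N) = RtoC 1).
      { change (S N) with (1 + N)%nat at 2; rewrite csum_add, (csum_zero _ N).
        - simpl csum; unfold sieve_term, rough_ind.
          destruct (excluded_middle_informative _) as [H|H]; [ simpl INR; rewrite xpow_1_l; ring | exfalso; apply H ].
          intros p Hp [P1 _] D; apply Z.divide_1_r_nonneg in D; lia.
        - intros k Hk; unfold sieve_term, rough_ind.
          destruct (excluded_middle_informative _) as [H|H]; [ exfalso | ring ].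
          destruct (exists_prime_divisor (S (1 + k))) as [p [P1 [P2 P3]]]; [ lia | ].
          apply (H p); [ lia | exact P2 | exact P3 ]. }
      rewrite <- E; apply (cseries_tail_le _ b); [ intros; apply sieve_term_le | exact Hb | apply sieve_series, Hs ].
    - replace (Finite 0) with (Finite (Series b - Series b)) by (f_equal; ring).
      apply is_lim_seq_minus'; [ apply is_lim_seq_const | apply (Series_correct b Hb) ]. }
  intros e He; destruct (Hsh e He) as [M K]; exists (S (S M)); intros [|[|n]] Hn; try lia; apply K; lia.
Qed.

(** Here q = p^(-x), z = q e^(i a) and w = q e^(2 i a). Applying y <= e^(y-1) to the squared moduli
    leaves in the exponent 8 q^2 - 2 q (3 + 4 cos a + cos 2a), and the bracket is nonnegative. No
    logarithm of an Euler factor is formed, and the error q^2 is summable over the primes. *)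
Lemma euler_factor_le (q : R) (z w : C) :
  0 < q -> Cmod z = q -> Cmod w = q -> (RtoC q * w = z * z)%C ->
  Rabs (1 - q) ^ 3 * Cmod (1 - z) ^ 4 * Cmod (1 - w) <= exp (4 * q ^ 2).
Proof.
  intros Hq Hz Hw E.
  assert (V : forall v, Cmod v = q -> Cmod (1 - v) ^ 2 = 1 - 2 * Re v + q ^ 2).
  { intros v Hv; rewrite <- Hv, !Cmod2_alt, re_minus, im_minus, re_RtoC, im_RtoC; ring. }
  set (x := Re z); set (y := Im z).
  assert (Exy : x ^ 2 + y ^ 2 = q ^ 2) by (rewrite <- Hz, Cmod2_alt; reflexivity).
  assert (Ew : q * Re w = 2 * x ^ 2 - q ^ 2).
  { apply (f_equal Re) in E; rewrite !re_mult, re_RtoC, im_RtoC in E; fold x y in E; nra. }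
  set (u := (1 - q) ^ 2); set (v := Cmod (1 - z) ^ 2); set (t := Cmod (1 - w) ^ 2).
  assert (Hexp : forall a, 0 <= a -> a <= exp (a - 1)) by (intros a _; pose proof (exp_ineq1_le (a - 1)); lra).
  assert (Hu : 0 <= u) by (unfold u; apply pow2_ge_0).
  assert (Hv : 0 <= v) by (unfold v; apply pow2_ge_0).
  assert (Ht : 0 <= t) by (unfold t; apply pow2_ge_0).
  assert (B : u ^ 3 * v ^ 4 * t <= exp (8 * q ^ 2)).
  { apply Rle_trans with (exp (u - 1) ^ 3 * exp (v - 1) ^ 4 * exp (t - 1)).
    - apply Rmult_le_compat; [ apply Rmult_le_pos; apply pow_le; assumption | assumption | | apply Hexp, Ht ].
      apply Rmult_le_compat; try (apply pow_le; assumption); apply pow_incr; split; try assumption; apply Hexp; assumption.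
    -
      replace (exp (u - 1) ^ 3) with (exp (3 * (u - 1))) by
        (replace (3 * (u - 1)) with ((u - 1) + ((u - 1) + (u - 1))) by ring; rewrite !exp_plus; ring).
      replace (exp (v - 1) ^ 4) with (exp (4 * (v - 1))) by
        (replace (4 * (v - 1)) with ((v - 1) + ((v - 1) + ((v - 1) + (v - 1)))) by ring; rewrite !exp_plus; ring).
      rewrite <- !exp_plus; apply exp_le.
      assert (E1 : 3 * (u - 1) + 4 * (v - 1) + (t - 1) = 8 * q ^ 2 - (6 * q + 8 * x + 2 * Re w)).
      { unfold u, v, t; rewrite (V z Hz), (V w Hw); fold x; ring. }
      assert (0 <= 6 * q + 8 * x + 2 * Re w); [ | lra ].
      apply (Rmult_le_reg_l q); [ exact Hq | rewrite Rmult_0_r ].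
      replace (q * (6 * q + 8 * x + 2 * Re w)) with (4 * (q + x) ^ 2 + 2 * (q * Re w - (2 * x ^ 2 - q ^ 2))) by ring.
      rewrite Ew; pose proof (pow2_ge_0 (q + x)); lra. }
  apply Rsqr_incr_0_var; [ | apply Rlt_le, exp_pos ].
  unfold Rsqr; rewrite <- exp_plus.
  replace (4 * q ^ 2 + 4 * q ^ 2) with (8 * q ^ 2) by ring.
  eapply Rle_trans; [ right | exact B ].
  unfold u, v, t; rewrite <- (pow2_abs (1 - q)); ring.
Qed.

Definition phi341 (N : nat) (x t : R) : R :=
  Cmod (sieve N (RtoC x)) ^ 3 * Cmod (sieve N (x, t)) ^ 4 * Cmod (sieve N (x, 2 * t)).

Lemma phi341_nonneg (N : nat) (x t : R) : 0 <= phi341 N x t.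
Proof.
  unfold phi341; apply Rmult_le_pos; [ apply Rmult_le_pos; apply pow_le | ]; apply Cmod_ge_0.
Qed.

(** Only a prime N changes the product, and then q = N^(-x) is at most 1 / N. *)
Lemma phi341_step (N : nat) (x t : R) :
  1 < x -> (0 < N)%nat -> phi341 (S N) x t <= exp (4 * / INR N ^ 2) * phi341 N x t.
Proof.
  intros Hx HN; pose proof (lt_0_INR N HN) as PN.
  assert (H1 : 1 <= INR N) by (apply (le_INR 1); lia).
  pose proof (phi341_nonneg N x t) as Pp.
  assert (Hi : 0 < / INR N ^ 2) by (apply Rinv_0_lt_compat, pow_lt, PN).
  destruct (classic (prime (Z.of_nat N))) as [P|P].
  - unfold phi341; rewrite !sieve_step_prime by (try exact P; simpl; lra).
    rewrite !Cmod_mult, !Rpow_mult_distr.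
    set (q := Rpower (INR N) (- x)).
    replace (xpow (INR N) (- RtoC x)) with (RtoC q) by (rewrite <- RtoC_opp, xpow_RtoC; reflexivity).
    set (z := xpow (INR N) (- (x, t))); set (w := xpow (INR N) (- (x, 2 * t))).
    assert (Hf : Rabs (1 - q) ^ 3 * Cmod (1 - z) ^ 4 * Cmod (1 - w) <= exp (4 * q ^ 2)).
    { apply euler_factor_le; [ apply Rpower_pos | unfold z; rewrite Cmod_xpow; reflexivity
        | unfold w; rewrite Cmod_xpow; reflexivity | ].
      unfold q, z, w; rewrite <- xpow_RtoC, <- !xpow_plus; f_equal; apply C_ext; unfold Re, Im; simpl; ring. }
    rewrite <- Cmod_R, RtoC_minus in Hf.
    assert (Hq : q ^ 2 <= / INR N ^ 2).
    { rewrite <- pow_inv; apply pow_incr; split; [ apply Rlt_le, Rpower_pos | ].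
      rewrite <- (Rpower_1 (INR N) PN), <- Rpower_Ropp; apply Rpower_le_exp; lra. }
    assert (He : exp (4 * q ^ 2) <= exp (4 * / INR N ^ 2)) by (apply exp_le; lra).
    unfold phi341 in Pp.
    match goal with |- ?a * ?b * (?c * ?d) * (?e * ?f) <= _ =>
      replace (a * b * (c * d) * (e * f)) with ((a * c * e) * (b * d * f)) by ring end.
    apply Rmult_le_compat_r; [ exact Pp | lra ].
  - unfold phi341; rewrite !sieve_step_not_prime by exact P; fold (phi341 N x t).
    assert (1 <= exp (4 * / INR N ^ 2)) by (rewrite <- exp_0; apply exp_le; lra); nra.
Qed.

(** [phi341 N] tends to 1, yet on the way from 0 to N it grows at most by the factor exp (4 sum
    1/n^2). Its initial value, the product of zeta values, is therefore bounded below by a constant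
    that depends neither on x nor on t. *)
Lemma phi341_lower : exists c, 0 < c /\ forall x t, 1 < x ->
  c <= Cmod (zeta0 (RtoC x)) ^ 3 * Cmod (zeta0 (x, t)) ^ 4 * Cmod (zeta0 (x, 2 * t)).
Proof.
  set (b := fun n => Rpower (INR n + 1) (Ropp 2)).
  assert (Hb : ex_series b) by (apply ex_series_Rpower; lra).
  assert (Eb : forall n, b n = / INR (S n) ^ 2).
  { intros n; unfold b; rewrite S_INR, Rpower_Ropp; f_equal; pose proof (pos_INR n).
    replace 2 with (INR 2) by (simpl; ring); rewrite Rpower_pow by lra; reflexivity. }
  assert (Pb : forall k, 0 <= b k) by (intros; apply Rlt_le, Rpower_pos).
  set (M := exp (4 * Series b)).
  exists (/ M); split; [ apply Rinv_0_lt_compat, exp_pos | intros x t Hx ].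
  assert (R1 : 1 < Re (RtoC x)) by (rewrite re_RtoC; exact Hx).
  rewrite <- !sieve_0 by (assumption || (simpl; lra)).
  fold (phi341 0 x t).
  pose proof (phi341_nonneg 0 x t) as P0.
  (* As 0 is not prime, the first step is free, and the bound 1 / N^2 is only used from N = 1 on. *)
  assert (E1 : phi341 1 x t = phi341 0 x t).
  { unfold phi341; rewrite !sieve_step_not_prime; [ reflexivity | | | ]; intros [P _]; simpl in P; lia. }
  assert (Hn : forall n, phi341 (S (S n)) x t <= exp (4 * sum_n b n) * phi341 0 x t).
  { induction n as [|n IH].
    - eapply Rle_trans; [ apply phi341_step; [ exact Hx | lia ] | ].
      rewrite sum_O, Eb, E1; apply Rle_refl.
    - eapply Rle_trans; [ apply phi341_step; [ exact Hx | lia ] | ].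
      rewrite sum_Sn, Eb; unfold plus; simpl plus; rewrite Rmult_plus_distr_l, exp_plus.
      rewrite (Rmult_comm (exp (4 * sum_n b n))), Rmult_assoc.
      apply Rmult_le_compat_l; [ apply Rlt_le, exp_pos | exact IH ]. }
  assert (L : is_lim_seq (fun N => phi341 N x t) 1).
  { assert (Lm : forall s, 1 < Re s -> is_lim_seq (fun N => Cmod (sieve N s)) 1).
    { intros s Hs; apply is_lim_seq_spec; intros e; destruct (sieve_lim s Hs e (cond_pos e)) as [N K].
      exists N; intros n Hn'; specialize (K n Hn').
      eapply Rle_lt_trans; [ | exact K ]; apply Rabs_le; split.
      - pose proof (Cmod_triangle_rev 1 (sieve n s)) as T; rewrite Cmod_1, Cmod_sub_sym in T; lra.
      - pose proof (Cmod_triangle_rev (sieve n s) 1) as T; rewrite Cmod_1 in T; lra. }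
    assert (Lp : forall u k, is_lim_seq u 1 -> is_lim_seq (fun n => u n ^ k) 1).
    { intros u k Hu; induction k as [|k IH]; simpl; [ apply is_lim_seq_const | ].
      replace (Finite 1) with (Finite (1 * 1)) by (f_equal; ring); apply is_lim_seq_mult'; assumption. }
    unfold phi341; replace (Finite 1) with (Finite (1 * 1 * 1)) by (f_equal; ring).
    apply is_lim_seq_mult'; [ apply is_lim_seq_mult'; apply Lp | ]; apply Lm; assumption || (simpl; lra). }
  assert (U : 1 <= M * phi341 0 x t).
  { apply (is_lim_seq_le (fun n => phi341 (S (S n)) x t) (fun _ => M * phi341 0 x t) 1 (M * phi341 0 x t)).
    - intros n; eapply Rle_trans; [ apply Hn | apply Rmult_le_compat_r; [ exact P0 | ] ].
      apply exp_le; pose proof (Series_partial_le b n Pb Hb); lra.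
    - apply (is_lim_seq_incr_1 (fun n => phi341 (S n) x t)), (is_lim_seq_incr_1 (fun n => phi341 n x t)), L.
    - apply is_lim_seq_const. }
  assert (PM : 0 < M) by apply exp_pos.
  apply (Rmult_le_reg_l M); [ exact PM | rewrite Rinv_r by lra; exact U ].
Qed.

(* [(s - 1) zeta s], which has no pole. *)
Definition zeta_num (s : C) : C :=
  (s - (s - 1) / 2 - (s - 1) * s * (s + 1) * mellin (fun _ x => RtoC (saw2 x)) (s + 2))%C.

Lemma zeta_num_zeta0 (s : C) : s <> RtoC 1 -> zeta_num s = ((s - 1) * zeta0 s)%C.
Proof.
  intros H; assert (H2 : RtoC 2 <> RtoC 0) by (intros E; injection E; lra).
  unfold zeta_num, zeta0; field; repeat split; try exact H2; apply Cminus_eq_contra, H.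
Qed.

Lemma zeta_num_cdiff (s : C) : -1 < Re s -> cdiff zeta_num s.
Proof.
  intros Hs; unfold zeta_num.
  assert (P1 : forall c, cdiff (fun s => s + c)%C s) by (intros; apply cdiff_plus; [ apply cdiff_id | apply cdiff_const ]).
  apply cdiff_minus; [ apply cdiff_minus; [ apply cdiff_id | apply cdiff_mult; [ apply P1 | apply cdiff_const ] ] | ].
  apply cdiff_mult.
  - apply cdiff_mult; [ apply cdiff_mult; [ apply P1 | apply cdiff_id ] | apply P1 ].
  - apply (cdiff_comp (fun s => s + 2)%C (mellin (fun _ x => RtoC (saw2 x)))); [ apply P1 | ].
    apply (mellin_cdiff _ _ _ _ saw2_mellin_ok); rewrite re_plus, re_RtoC; lra.
Qed.

Lemma zeta0_cdiff (s : C) : -1 < Re s -> s <> RtoC 1 -> cdiff zeta0 s.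
Proof.
  intros Hs H1.
  apply (cdiff_ext_loc (fun w => zeta_num w / (w - 1))%C zeta0 s (Cmod (s - 1))); [ apply Cmod_pos_sub, H1 | | ].
  - intros w Hw.
    assert (Hw1 : w <> RtoC 1) by (intros ->; rewrite Cmod_sub_sym in Hw; lra).
    rewrite zeta_num_zeta0 by exact Hw1; field; apply Cminus_eq_contra, Hw1.
  - apply cdiff_div; [ apply zeta_num_cdiff, Hs | | apply Cminus_eq_contra, H1 ].
    apply cdiff_minus; [ apply cdiff_id | apply cdiff_const ].
Qed.

(** A zero at 1 + i t would make the three factors at abscissa 1 + h of order at most h^(-3), h^4
    and 1. Their product is then at most of order h, against a lower bound independent of h. *)
Lemma zeta0_line_one (t : R) : t <> 0 -> zeta0 (1, t) <> RtoC 0.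
Proof.
  intros Ht H0.
  destruct phi341_lower as [c [Hc Hlow]].
  assert (N1 : ((1, t) : C) <> RtoC 1) by (intros E; injection E; intros; contradiction).
  assert (N2 : ((1, 2 * t) : C) <> RtoC 1) by (intros E; injection E; intros; lra).
  destruct (ccts_bounded zeta_num 1 (cdiff_ccts _ _ (zeta_num_cdiff 1 ltac:(rewrite re_RtoC; lra)))) as [d1 [Hd1 B1]].
  destruct (zeta0_cdiff (1, t) ltac:(simpl; lra) N1) as [g [Hg [d2 [Hd2 E2]]]].
  destruct (ccts_bounded g (1, t) Hg) as [d3 [Hd3 B3]].
  destruct (ccts_bounded zeta0 (1, 2 * t) (cdiff_ccts _ _ (zeta0_cdiff (1, 2 * t) ltac:(simpl; lra) N2))) as [d4 [Hd4 B4]].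
  set (K1 := Cmod (zeta_num 1) + 1) in *; set (K2 := Cmod (g (1, t)) + 1) in *;
    set (K3 := Cmod (zeta0 (1, 2 * t)) + 1) in *.
  assert (P1 : 0 < K1) by (unfold K1; pose proof (Cmod_ge_0 (zeta_num 1)); lra).
  assert (P2 : 0 < K2) by (unfold K2; pose proof (Cmod_ge_0 (g (1, t))); lra).
  assert (P3 : 0 < K3) by (unfold K3; pose proof (Cmod_ge_0 (zeta0 (1, 2 * t))); lra).
  set (K := K1 ^ 3 * K2 ^ 4 * K3).
  assert (PK : 0 < K) by (unfold K; apply Rmult_lt_0_compat; [ apply Rmult_lt_0_compat; apply pow_lt | ]; assumption).
  (* The first entry gives h K <= c / 2; the others put the points of abscissa 1 + h into the discs
     where the local bounds hold. *)
  set (h := Rmin (c / (2 * K)) (Rmin (d1 / 2) (Rmin (d2 / 2) (Rmin (d3 / 2) (d4 / 2))))).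
  assert (Ph : 0 < h).
  { unfold h; repeat apply Rmin_pos; try lra; apply Rdiv_lt_0_compat; lra. }
  assert (L1 : h <= c / (2 * K)) by apply Rmin_l.
  pose proof (Rmin_r (c / (2 * K)) (Rmin (d1 / 2) (Rmin (d2 / 2) (Rmin (d3 / 2) (d4 / 2))))) as L2; fold h in L2.
  pose proof (Rle_trans _ _ _ L2 (Rmin_l _ _)) as S1; pose proof (Rle_trans _ _ _ L2 (Rmin_r _ _)) as R1.
  pose proof (Rle_trans _ _ _ R1 (Rmin_l _ _)) as S2; pose proof (Rle_trans _ _ _ R1 (Rmin_r _ _)) as R2.
  pose proof (Rle_trans _ _ _ R2 (Rmin_l _ _)) as S3; pose proof (Rle_trans _ _ _ R2 (Rmin_r _ _)) as S4.
  set (x := 1 + h).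
  assert (Dh : forall y, Cmod ((x, y) - (1, y)) = h).
  { intros y; replace ((x, y) - (1, y))%C with (RtoC h) by (apply C_ext; unfold Re, Im, x; simpl; ring).
    rewrite Cmod_R, Rabs_right; lra. }
  specialize (Hlow x t ltac:(unfold x; lra)).
  assert (F1 : Cmod (zeta0 (RtoC x)) <= K1 / h).
  { assert (D : Cmod (RtoC x - 1) = h) by (rewrite <- RtoC_minus, Cmod_R, Rabs_right; unfold x; lra).
    assert (Nh : RtoC x <> RtoC 1) by (intros E; injection E; unfold x; lra).
    specialize (B1 (RtoC x) ltac:(lra)).
    rewrite zeta_num_zeta0, Cmod_mult, D in B1 by exact Nh.
    apply (Rmult_le_reg_l h); [ exact Ph | ]; replace (h * (K1 / h)) with K1 by (field; lra); exact B1. }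
  assert (F2 : Cmod (zeta0 (x, t)) <= h * K2).
  { rewrite (E2 (x, t)) by (rewrite Dh; lra).
    rewrite H0, Cplus_0_l, Cmod_mult, Dh; apply Rmult_le_compat_l; [ lra | apply B3; rewrite Dh; lra ]. }
  assert (F3 : Cmod (zeta0 (x, 2 * t)) <= K3) by (apply B4; rewrite Dh; lra).
  assert (Bd : c <= (K1 / h) ^ 3 * (h * K2) ^ 4 * K3).
  { eapply Rle_trans; [ exact Hlow | ].
    apply Rmult_le_compat; [ apply Rmult_le_pos; apply pow_le, Cmod_ge_0 | apply Cmod_ge_0 | | exact F3 ].
    apply Rmult_le_compat; try (apply pow_le, Cmod_ge_0); apply pow_incr; split; try apply Cmod_ge_0; assumption. }
  replace ((K1 / h) ^ 3 * (h * K2) ^ 4 * K3) with (h * K) in Bd by (unfold K; field; lra).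
  assert (h * K <= c / 2); [ | lra ].
  replace (c / 2) with (c / (2 * K) * K) by (field; lra); apply Rmult_le_compat_r; lra.
Qed.

(** * Pointwise convergence of Fourier series *)

(* [RInt_ext] leaves equations typed in the normed module [R], which [ring] does not recognise. *)
Ltac req := match goal with |- @eq _ ?a ?b => change (@eq R a b) end.

Lemma sin_int_bound (l a b : R) : 0 < l -> Rabs (RInt (fun v => sin (l * v)) a b) <= 2 / l.
Proof.
  intros Hl.
  assert (E : RInt (fun v => sin (l * v)) a b = - cos (l * b) / l - - cos (l * a) / l).
  { apply (is_RInt_unique (V := R_CompleteNormedModule)).
    apply (is_RInt_derive (V := R_CompleteNormedModule) (fun v => - cos (l * v) / l) (fun v => sin (l * v))).
    - intros x _; auto_derive; [ exact I | field; lra ].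
    - intros x _; apply (ex_derive_continuous (V := R_NormedModule) (fun v => sin (l * v))); auto_derive; exact I. }
  rewrite E; replace (- cos (l * b) / l - - cos (l * a) / l) with ((cos (l * a) - cos (l * b)) / l) by (field; lra).
  unfold Rdiv; rewrite Rabs_mult, (Rabs_right (/ l)) by (apply Rle_ge, Rlt_le, Rinv_0_lt_compat, Hl).
  apply Rmult_le_compat_r; [ apply Rlt_le, Rinv_0_lt_compat, Hl | ].
  pose proof (COS_bound (l * a)); pose proof (COS_bound (l * b)); apply Rabs_le; lra.
Qed.

Lemma continuous_sin_lin (l x : R) : continuous (fun v => sin (l * v)) x.
Proof. apply (ex_derive_continuous (V := R_NormedModule) (fun v => sin (l * v))); auto_derive; exact I. Qed.

(** On cells shorter than a modulus of uniform continuity q is replaced by its value at the left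
    end; the sine then integrates to at most 2 / l on each of the n cells. *)
Lemma riemann_lebesgue (q : R -> R) (a b : R) :
  a <= b -> (forall x, a <= x <= b -> continuous q x) ->
  forall e, 0 < e -> exists L, 0 < L /\ forall l, L <= l -> Rabs (RInt (fun v => q v * sin (l * v)) a b) <= e.
Proof.
  intros Hab Hq e He.
  destruct Hab as [Hab| <-].
  2:{ exists 1; split; [ lra | intros; rewrite RInt_point; unfold zero; simpl; rewrite Rabs_R0; lra ]. }
  assert (Hc : forall c d, a <= c <= d -> d <= b -> forall l, ex_RInt (fun v => q v * sin (l * v)) c d).
  { intros c d Hc Hd l; apply (ex_RInt_continuous (V := R_CompleteNormedModule)).
    rewrite Rmin_left, Rmax_right by lra; intros x Hx.
    apply (continuous_mult (K := R_AbsRing)); [ apply Hq; lra | apply continuous_sin_lin ]. }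
  destruct (ex_RInt_ub q a b) as [M HM].
  { apply (ex_RInt_continuous (V := R_CompleteNormedModule)); rewrite Rmin_left, Rmax_right by lra; exact Hq. }
  rewrite Rmin_left, Rmax_right in HM by lra.
  assert (HM0 : 0 <= M) by (eapply Rle_trans; [ apply (norm_ge_0 (q a)) | apply HM; lra ]).
  set (e' := e / (2 * (b - a))).
  assert (He' : 0 < e') by (apply Rdiv_lt_0_compat; lra).
  destruct (Heine q (fun c => a <= c <= b) (compact_P3 a b)
    ltac:(intros x Hx; apply continuity_pt_filterlim, Hq, Hx) (mkposreal e' He')) as [d Hd].
  destruct (nfloor_ex ((b - a) / d)) as [n0 Hn0]; [ apply Rdiv_le_0_compat; [ lra | apply cond_pos ] | ].
  set (n := S n0).
  assert (Pn : 0 < INR n) by (apply lt_0_INR; unfold n; lia).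
  set (w := (b - a) / INR n).
  assert (Pw : 0 < w) by (apply Rdiv_lt_0_compat; lra).
  assert (Wd : w < d).
  { unfold w; apply (Rmult_lt_reg_r (INR n)); [ exact Pn | ].
    unfold Rdiv; rewrite Rmult_assoc, Rinv_l, Rmult_1_r by lra.
    destruct Hn0 as [_ H]; apply (Rmult_lt_compat_r d) in H; [ | apply cond_pos ].
    unfold Rdiv in H; rewrite Rmult_assoc, Rinv_l, Rmult_1_r in H by (pose proof (cond_pos d); lra).
    unfold n; rewrite S_INR; lra. }
  assert (Wn : INR n * w = b - a) by (unfold w; field; lra).
  (* From this frequency on, the n oscillating integrals contribute at most e / 2; the other e / 2
     comes from uniform continuity. *)
  exists (4 * INR n * (M + 1) / e); split; [ apply Rdiv_lt_0_compat; [ nra | exact He ] | intros l Hl ].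
  assert (Pl : 0 < l) by (eapply Rlt_le_trans; [ | exact Hl ]; apply Rdiv_lt_0_compat; [ nra | exact He ]).
  assert (Hk : forall k, (k <= n)%nat -> Rabs (RInt (fun v => q v * sin (l * v)) a (a + INR k * w)) <=
     INR k * (e' * w + M * (2 / l))).
  { induction k as [|k IH]; intros Hkn.
    - simpl INR; rewrite !Rmult_0_l, Rplus_0_r, RInt_point; unfold zero; simpl; rewrite Rabs_R0; lra.
    - assert (Hk1 : INR (S k) <= INR n) by (apply le_INR, Hkn).
      rewrite S_INR in *; pose proof (pos_INR k).
      set (c := a + INR k * w); replace (a + (INR k + 1) * w) with (c + w) by (unfold c; ring).
      assert (Bc : a <= c /\ c + w <= b).
      { unfold c; split; [ nra | ]; replace b with (a + INR n * w) by (rewrite Wn; ring); nra. }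
      rewrite <- (RInt_Chasles (V := R_CompleteNormedModule) _ a c (c + w)) by (apply Hc; lra).
      unfold plus; simpl; eapply Rle_trans; [ apply Rabs_triang | ].
      rewrite Rmult_plus_distr_r, Rmult_1_l; apply Rplus_le_compat; [ apply IH; lia | ].
      assert (Es : RInt (fun v => q v * sin (l * v)) c (c + w) =
        RInt (fun v => (q v - q c) * sin (l * v)) c (c + w) + q c * RInt (fun v => sin (l * v)) c (c + w)).
      { assert (X1 : ex_RInt (fun v => sin (l * v)) c (c + w)) by (apply ex_RInt_cont, continuous_sin_lin).
        assert (X2 : ex_RInt (fun v => (q v - q c) * sin (l * v)) c (c + w)).
        { apply (ex_RInt_continuous (V := R_CompleteNormedModule)); rewrite Rmin_left, Rmax_right by lra; intros x Hx.
          apply (continuous_mult (K := R_AbsRing)); [ | apply continuous_sin_lin ].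
          apply (continuous_minus q (fun _ => q c)); [ apply Hq; lra | apply continuous_const ]. }
        rewrite <- (RInt_scal (V := R_CompleteNormedModule)) by exact X1.
        rewrite <- (RInt_plus (V := R_CompleteNormedModule) (fun v => (q v - q c) * sin (l * v)));
          [ | exact X2 | apply (ex_RInt_scal (V := R_NormedModule)), X1 ].
        apply RInt_ext; intros x _; unfold plus, scal; simpl; unfold mult; simpl; req; ring. }
      rewrite Es; eapply Rle_trans; [ apply Rabs_triang | apply Rplus_le_compat ].
      + replace (e' * w) with ((c + w - c) * e') by ring.
        apply abs_RInt_le_const; [ lra | | ].
        * apply (ex_RInt_continuous (V := R_CompleteNormedModule)); rewrite Rmin_left, Rmax_right by lra; intros x Hx.
          apply (continuous_mult (K := R_AbsRing)); [ | apply continuous_sin_lin ].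
          apply (continuous_minus q (fun _ => q c)); [ apply Hq; lra | apply continuous_const ].
        * intros x Hx; rewrite Rabs_mult.
          assert (Rabs (q x - q c) < e').
          { apply (Hd x c); try lra; rewrite Rabs_right; lra. }
          assert (Rabs (sin (l * x)) <= 1) by (apply Rabs_le; pose proof (SIN_bound (l * x)); lra).
          pose proof (Rabs_pos (q x - q c)); pose proof (Rabs_pos (sin (l * x))); nra.
      + rewrite Rabs_mult; apply Rmult_le_compat; try apply Rabs_pos; [ apply HM; lra | apply sin_int_bound, Pl ]. }
  specialize (Hk n (Nat.le_refl n)); replace (a + INR n * w) with b in Hk by (rewrite Wn; ring).
  eapply Rle_trans; [ exact Hk | ].
  replace (INR n * (e' * w + M * (2 / l))) with (e' * (INR n * w) + 2 * INR n * M / l) by (field; lra).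
  rewrite Wn; replace (e' * (b - a)) with (e / 2) by (unfold e'; field; lra).
  assert (2 * INR n * M / l <= e / 2); [ | lra ].
  apply (Rmult_le_reg_r l); [ exact Pl | ]; unfold Rdiv; rewrite Rmult_assoc, Rinv_l, Rmult_1_r by lra.
  apply (Rmult_le_compat_l (e / 2)) in Hl; [ | lra ].
  replace (e / 2 * (4 * INR n * (M + 1) / e)) with (2 * INR n * (M + 1)) in Hl by (field; lra); nra.
Qed.

Definition dirichlet_kernel (N : nat) (v : R) : R :=
  sum_n (fun k => match k with O => 1 | S _ => 2 * cos (2 * PI * INR k * v) end) N.

Lemma dirichlet_kernel_S (N : nat) (v : R) :
  dirichlet_kernel (S N) v = dirichlet_kernel N v + 2 * cos (2 * PI * INR (S N) * v).
Proof. unfold dirichlet_kernel; rewrite sum_Sn; reflexivity. Qed.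

Lemma dirichlet_kernel_continuous (N : nat) (v : R) : continuous (dirichlet_kernel N) v.
Proof.
  induction N as [|N IH].
  - apply (continuous_ext (fun _ => 1)); [ intros; unfold dirichlet_kernel; rewrite sum_O; reflexivity | apply continuous_const ].
  - apply (continuous_ext (fun v => dirichlet_kernel N v + 2 * cos (2 * PI * INR (S N) * v)));
      [ intros; symmetry; apply dirichlet_kernel_S | ].
    apply (continuous_plus (dirichlet_kernel N)); [ exact IH | ].
    apply (ex_derive_continuous (V := R_NormedModule) (fun v => 2 * cos (2 * PI * INR (S N) * v))).
    auto_derive; exact I.
Qed.

Lemma dirichlet_kernel_even (N : nat) (v : R) : dirichlet_kernel N (- v) = dirichlet_kernel N v.
Proof.
  apply sum_n_ext; intros [|k]; [ reflexivity | ].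
  replace (2 * PI * INR (S k) * - v) with (- (2 * PI * INR (S k) * v)) by ring; rewrite cos_neg; reflexivity.
Qed.

Lemma dirichlet_kernel_periodic (N : nat) (v : R) : dirichlet_kernel N (v + 1) = dirichlet_kernel N v.
Proof.
  apply sum_n_ext; intros [|k]; [ reflexivity | ].
  replace (2 * PI * INR (S k) * (v + 1)) with (2 * PI * INR (S k) * v + 2 * INR (S k) * PI) by ring.
  rewrite cos_period; reflexivity.
Qed.

(** The closed form of the kernel, kept as a product so that the zeros of the sine are covered as
    well. *)
Lemma dirichlet_kernel_sin (N : nat) (v : R) :
  dirichlet_kernel N v * sin (PI * v) = sin ((2 * INR N + 1) * PI * v).
Proof.
  induction N as [|N IH].
  - unfold dirichlet_kernel; rewrite sum_O; simpl INR; rewrite Rmult_1_l; f_equal; ring.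
  - rewrite dirichlet_kernel_S, Rmult_plus_distr_r, IH, S_INR.
    set (A := 2 * PI * (INR N + 1) * v).
    replace ((2 * INR N + 1) * PI * v) with (A - PI * v) by (unfold A; ring).
    replace ((2 * (INR N + 1) + 1) * PI * v) with (A + PI * v) by (unfold A; ring).
    rewrite sin_minus, sin_plus; ring.
Qed.

Lemma dirichlet_kernel_bound (N : nat) (v : R) : Rabs (dirichlet_kernel N v) <= 2 * INR N + 1.
Proof.
  induction N as [|N IH].
  - unfold dirichlet_kernel; rewrite sum_O; simpl; rewrite Rabs_right; lra.
  - rewrite dirichlet_kernel_S, S_INR; eapply Rle_trans; [ apply Rabs_triang | ].
    rewrite Rabs_mult, (Rabs_right 2) by lra.
    assert (Rabs (cos (2 * PI * (INR N + 1) * v)) <= 1)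
      by (apply Rabs_le; pose proof (COS_bound (2 * PI * (INR N + 1) * v)); lra).
    lra.
Qed.

(** Since PI v <= 1 <= PI / 3, the cosine is at least 1/2 up to PI v, and by the mean value theorem
    the sine is at least PI v / 2. *)
Lemma sin_lower (v : R) : 0 < v <= 1 / 4 -> v <= sin (PI * v).
Proof.
  intros Hv; pose proof PI2_3_2; pose proof PI_4.
  destruct (MVT_gen sin 0 (PI * v) cos) as [c [Hc E]].
  - intros x _; apply is_derive_sin.
  - intros x _; apply continuity_pt_filterlim, continuous_sin.
  - assert (0 <= PI * v <= 1) by nra.
    rewrite Rmin_left, Rmax_right in Hc by lra; rewrite sin_0, !Rminus_0_r in E; rewrite E.
    assert (1 / 2 <= cos c).
    { rewrite <- cos_PI3; apply cos_decr_1; lra. }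
    nra.
Qed.

Lemma dirichlet_kernel_near (N : nat) (v : R) : 0 < v <= 1 / 4 -> Rabs (dirichlet_kernel N v) <= / v.
Proof.
  intros Hv; pose proof (sin_lower v Hv) as Hs; pose proof (dirichlet_kernel_sin N v) as E.
  assert (Rabs (dirichlet_kernel N v * sin (PI * v)) <= 1)
    by (rewrite E; apply Rabs_le; pose proof (SIN_bound ((2 * INR N + 1) * PI * v)); lra).
  rewrite Rabs_mult, (Rabs_right (sin (PI * v))) in H by lra.
  pose proof (Rabs_pos (dirichlet_kernel N v)).
  apply (Rmult_le_reg_r v); [ lra | rewrite Rinv_l by lra; nra ].
Qed.

(** Near 0 the kernel is at most 1/v, and sqrt v / v has a primitive that is small there, uniformly
    in N; away from 0, dividing by sin (PI v) leaves a continuous function for the Riemann-Lebesgue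
    lemma. *)
Lemma dini_half (g : R -> R) (K : R) :
  0 <= K -> (forall v, continuous g v) -> (forall v, 0 <= v <= 1 / 2 -> Rabs (g v) <= K * sqrt v) ->
  is_lim_seq (fun N => RInt (fun v => g v * dirichlet_kernel N v) 0 (1 / 2)) 0.
Proof.
  intros HK Hg Hb; apply is_lim_seq_spec; intros e.
  pose proof (cond_pos e) as Pe.
  set (r := Rmin (1 / 2) (e / (8 * (K + 1)))).
  assert (Pr : 0 < r) by (apply Rmin_pos; [ lra | apply Rdiv_lt_0_compat; lra ]).
  assert (R1 : r <= 1 / 2) by apply Rmin_l.
  assert (R2 : K * r <= e / 8).
  { assert (r <= e / (8 * (K + 1))) by apply Rmin_r.
    apply Rle_trans with ((K + 1) * (e / (8 * (K + 1)))); [ nra | right; field; lra ]. }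
  (* Chosen so that sqrt d = r, hence 2 K sqrt d <= e / 4. *)
  set (d := r * r).
  assert (Pd : 0 < d <= 1 / 4) by (unfold d; nra).
  assert (Hgc : forall N v, continuous (fun v => g v * dirichlet_kernel N v) v).
  { intros N v; apply (continuous_mult (K := R_AbsRing)); [ apply Hg | apply dirichlet_kernel_continuous ]. }
  assert (Hsin : forall v, d <= v <= 1 / 2 -> 0 < sin (PI * v)).
  { intros v Hv; pose proof PI_RGT_0; apply sin_gt_0; nra. }
  destruct (riemann_lebesgue (fun v => g v / sin (PI * v)) d (1 / 2) ltac:(lra)) with (e := e / 4) as [L [PL HL]].
  { intros v Hv; apply (continuous_mult (K := R_AbsRing)); [ apply Hg | ].
    apply (continuous_Rinv_comp (fun v => sin (PI * v))); [ apply continuous_sin_lin | ].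
    specialize (Hsin v Hv); lra. }
  { lra. }
  destruct (nfloor_ex L) as [N0 HN0]; [ lra | ].
  exists (S N0); intros N HN; rewrite Rminus_0_r.
  assert (HNL : L <= (2 * INR N + 1) * PI).
  { apply le_INR in HN; rewrite S_INR in HN; pose proof PI2_3_2; pose proof (pos_INR N); nra. }
  rewrite <- (RInt_Chasles (V := R_CompleteNormedModule) _ 0 d (1 / 2)) by (apply ex_RInt_cont, Hgc).
  unfold plus; simpl; eapply Rle_lt_trans; [ apply Rabs_triang | ].
  assert (B2 : Rabs (RInt (fun v => g v * dirichlet_kernel N v) d (1 / 2)) <= e / 4).
  { rewrite (RInt_ext _ (fun v => g v / sin (PI * v) * sin ((2 * INR N + 1) * PI * v))); [ apply HL, HNL | ].
    rewrite Rmin_left, Rmax_right by lra; intros v Hv.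
    rewrite <- dirichlet_kernel_sin; req; field; specialize (Hsin v ltac:(lra)); lra. }
  assert (B1 : Rabs (RInt (fun v => g v * dirichlet_kernel N v) 0 d) <= e / 2).
  { pose proof (pos_INR N) as PN.
    (* K / sqrt v is unbounded at 0. A cut-off c that depends on N isolates an interval on which the
       trivial bound 2 N + 1 of the kernel is enough. *)
    set (c := Rmin (d / 2) (e / (4 * (K + 1) * (2 * INR N + 1)))).
    assert (Pc : 0 < c) by (apply Rmin_pos; [ lra | apply Rdiv_lt_0_compat; [ lra | nra ] ]).
    assert (C1 : c <= d / 2) by apply Rmin_l.
    assert (C2 : c * ((K + 1) * (2 * INR N + 1)) <= e / 4).
    { assert (c <= e / (4 * (K + 1) * (2 * INR N + 1))) by apply Rmin_r.
      apply Rle_trans with (e / (4 * (K + 1) * (2 * INR N + 1)) * ((K + 1) * (2 * INR N + 1)));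
        [ apply Rmult_le_compat_r; [ nra | exact H ] | right; field; nra ]. }
    rewrite <- (RInt_Chasles (V := R_CompleteNormedModule) _ 0 c d) by (apply ex_RInt_cont, Hgc).
    unfold plus; simpl; eapply Rle_trans; [ apply Rabs_triang | ].
    assert (B3 : Rabs (RInt (fun v => g v * dirichlet_kernel N v) 0 c) <= (c - 0) * ((K + 1) * (2 * INR N + 1))).
    { apply abs_RInt_le_const; [ lra | apply ex_RInt_cont, Hgc | intros v Hv ].
      rewrite Rabs_mult; apply Rmult_le_compat; try apply Rabs_pos; [ | apply dirichlet_kernel_bound ].
      eapply Rle_trans; [ apply Hb; lra | ].
      assert (sqrt v <= 1) by (rewrite <- sqrt_1; apply sqrt_le_1_alt; lra).
      pose proof (sqrt_pos v); nra. }
    assert (B4 : Rabs (RInt (fun v => g v * dirichlet_kernel N v) c d) <= 2 * K * sqrt d - 2 * K * sqrt c).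
    { eapply Rle_trans; [ apply abs_RInt_le; [ lra | apply ex_RInt_cont, Hgc ] | ].
      assert (E : is_RInt (fun v => K / sqrt v) c d (2 * K * sqrt d - 2 * K * sqrt c)).
      { apply (is_RInt_derive (V := R_CompleteNormedModule) (fun v => 2 * K * sqrt v) (fun v => K / sqrt v));
          rewrite Rmin_left, Rmax_right by lra; intros v Hv.
        - auto_derive; [ lra | ]; assert (0 < sqrt v) by (apply sqrt_lt_R0; lra); field; lra.
        - assert (0 < sqrt v) by (apply sqrt_lt_R0; lra).
          apply (ex_derive_continuous (V := R_NormedModule) (fun v => K / sqrt v)); auto_derive; lra. }
      rewrite <- (is_RInt_unique (V := R_CompleteNormedModule) _ _ _ _ E).
      apply RInt_le; [ lra | | eexists; exact E | ].
      - apply (ex_RInt_norm (fun v => g v * dirichlet_kernel N v)), ex_RInt_cont, Hgc.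
      - intros v Hv; rewrite Rabs_mult.
        assert (Ps : 0 < sqrt v) by (apply sqrt_lt_R0; lra).
        replace (K / sqrt v) with (K * sqrt v * / v).
        + apply Rmult_le_compat; try apply Rabs_pos; [ apply Hb; lra | apply dirichlet_kernel_near; lra ].
        + rewrite <- (sqrt_sqrt v) at 2 by lra; field; lra. }
    replace (sqrt d) with r in B4 by (unfold d; rewrite sqrt_square; lra).
    assert (0 <= 2 * K * sqrt c) by (pose proof (sqrt_pos c); nra).
    nra. }
  lra.
Qed.

Lemma RInt_shift (G : R -> R) (a b t : R) :
  (forall x, continuous G x) -> RInt (fun v => G (v + t)) a b = RInt G (a + t) (b + t).
Proof.
  intros HG.
  pose proof (RInt_comp_lin (V := R_CompleteNormedModule) G 1 t a b) as E.
  replace (1 * a + t) with (a + t) in E by ring; replace (1 * b + t) with (b + t) in E by ring.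
  rewrite <- E by (apply ex_RInt_cont, HG).
  apply RInt_ext; intros x _; unfold scal; simpl; unfold mult; simpl; rewrite !Rmult_1_l; reflexivity.
Qed.

Lemma RInt_period (G : R -> R) (a : R) :
  (forall x, continuous G x) -> (forall x, G (x + 1) = G x) -> RInt G a (a + 1) = RInt G 0 1.
Proof.
  intros HG HP.
  assert (Ex : forall c d, ex_RInt G c d) by (intros; apply ex_RInt_cont, HG).
  rewrite <- (RInt_Chasles (V := R_CompleteNormedModule) G a 0 (a + 1)) by apply Ex.
  rewrite <- (RInt_Chasles (V := R_CompleteNormedModule) G 0 1 (a + 1)) by apply Ex.
  assert (E : RInt G 1 (a + 1) = RInt G 0 a).
  { rewrite <- (RInt_ext (fun v => G (v + 1)) G 0 a) by (intros; apply HP).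
    rewrite RInt_shift by exact HG; f_equal; ring. }
  rewrite E, <- (opp_RInt_swap (V := R_CompleteNormedModule) G 0 a) by apply Ex.
  unfold plus, opp; simpl; ring.
Qed.

(** The frequencies k and -k taken together in real form, since Dini's criterion gives the
    convergence of symmetric sums. *)
Definition fourier_term (h : R -> R) (x : R) (k : nat) : R :=
  match k with
  | O => RInt h 0 1
  | S _ => 2 * RInt (fun u => h u * cos (2 * PI * INR k * (x - u))) 0 1
  end.

Lemma continuous_cos_term (h : R -> R) (x : R) (k : nat) (u : R) :
  (forall u, continuous h u) -> continuous (fun u => h u * cos (2 * PI * INR k * (x - u))) u.
Proof.
  intros Hh; apply (continuous_mult (K := R_AbsRing)); [ apply Hh | ].
  apply (ex_derive_continuous (V := R_NormedModule) (fun u => cos (2 * PI * INR k * (x - u)))); auto_derive; exact I.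
Qed.

Lemma continuous_kernel_term (h : R -> R) (x : R) (N : nat) (u : R) :
  (forall u, continuous h u) -> continuous (fun u => h u * dirichlet_kernel N (x - u)) u.
Proof.
  intros Hh; apply (continuous_mult (K := R_AbsRing)); [ apply Hh | ].
  apply (continuous_comp (fun u => x - u) (dirichlet_kernel N)); [ | apply dirichlet_kernel_continuous ].
  apply (continuous_minus (fun _ => x) (fun u => u)); [ apply continuous_const | apply continuous_id ].
Qed.

Lemma fourier_partial (h : R -> R) (x : R) (N : nat) :
  (forall u, continuous h u) ->
  sum_n (fourier_term h x) N = RInt (fun u => h u * dirichlet_kernel N (x - u)) 0 1.
Proof.
  intros Hh; induction N as [|N IH].
  - rewrite sum_O; simpl; apply RInt_ext; intros u _; unfold dirichlet_kernel; rewrite sum_O; req; ring.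
  - rewrite sum_Sn, IH; unfold fourier_term.
    rewrite <- (RInt_scal (V := R_CompleteNormedModule)) by (apply ex_RInt_cont; intros; apply continuous_cos_term, Hh).
    rewrite <- (RInt_plus (V := R_CompleteNormedModule)).
    + apply RInt_ext; intros u _; rewrite dirichlet_kernel_S.
      change (h u * dirichlet_kernel N (x - u) + 2 * (h u * cos (2 * PI * INR (S N) * (x - u))) =
        h u * (dirichlet_kernel N (x - u) + 2 * cos (2 * PI * INR (S N) * (x - u)))); ring.
    + apply ex_RInt_cont; intros; apply continuous_kernel_term, Hh.
    + apply (ex_RInt_scal (V := R_NormedModule)), ex_RInt_cont; intros; apply continuous_cos_term, Hh.
Qed.

(** This is a partial Fourier sum of the constant 1, in which every term of positive index
    vanishes. *)
Lemma dirichlet_kernel_mass (x : R) (N : nat) : RInt (fun u => dirichlet_kernel N (x - u)) 0 1 = 1.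
Proof.
  rewrite (RInt_ext _ (fun u => 1 * dirichlet_kernel N (x - u))) by (intros; req; ring).
  rewrite <- (fourier_partial (fun _ => 1)) by (intros; apply continuous_const).
  assert (H : forall k, fourier_term (fun _ => 1) x (S k) = 0).
  { intros k; unfold fourier_term; set (l := 2 * PI * INR (S k)).
    assert (Pl : 0 < l).
    { unfold l; pose proof PI_RGT_0; pose proof (lt_0_INR (S k) ltac:(lia)); nra. }
    rewrite (RInt_ext _ (fun u => cos (l * (x - u)))) by (intros; req; ring).
    assert (E : RInt (fun u => cos (l * (x - u))) 0 1 = - sin (l * (x - 1)) / l - - sin (l * (x - 0)) / l).
    { apply (is_RInt_unique (V := R_CompleteNormedModule)).
      apply (is_RInt_derive (V := R_CompleteNormedModule) (fun u => - sin (l * (x - u)) / l) (fun u => cos (l * (x - u)))).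
      - intros u _; auto_derive; [ exact I | unfold Rminus; field; lra ].
      - intros u _; apply (ex_derive_continuous (V := R_NormedModule) (fun u => cos (l * (x - u)))); auto_derive; exact I. }
    rewrite E; replace (l * (x - 0)) with (l * (x - 1) + 2 * INR (S k) * PI) by (unfold l; ring).
    rewrite sin_period; field; lra. }
  induction N as [|N IH].
  - rewrite sum_O; simpl; rewrite RInt_const; unfold scal; simpl; unfold mult; simpl; ring.
  - rewrite sum_Sn, IH, H; unfold plus; simpl; ring.
Qed.

Lemma continuous_holder (f : R -> R) (K x : R) :
  0 <= K -> (forall y, Rabs (f y - f x) <= K * sqrt (Rabs (y - x))) -> continuous f x.
Proof.
  intros HK H; apply filterlim_locally; intros e; pose proof (cond_pos e).
  set (r := e / (K + 1)); assert (Pr : 0 < r) by (apply Rdiv_lt_0_compat; lra).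
  assert (Pr2 : 0 < r * r) by nra.
  exists (mkposreal _ Pr2); intros y Hy; change (Rabs (y - x) < r * r) in Hy.
  change (Rabs (f y - f x) < e); eapply Rle_lt_trans; [ apply H | ].
  assert (sqrt (Rabs (y - x)) < r).
  { rewrite <- (sqrt_square r) by lra; apply sqrt_lt_1_alt; split; [ apply Rabs_pos | exact Hy ]. }
  pose proof (sqrt_pos (Rabs (y - x))).
  apply Rle_lt_trans with ((K + 1) * sqrt (Rabs (y - x))); [ nra | ].
  replace (pos e) with ((K + 1) * r) by (unfold r; field; lra); apply Rmult_lt_compat_l; lra.
Qed.

(** By periodicity and the mass 1 of the kernel, the error is the integral of (h (x + v) - h x)
    times the kernel at v over [-1/2, 1/2]; evenness of the kernel folds it into two integrals over
    [0, 1/2] as in [dini_half]. *)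
Lemma dini (h : R -> R) (K x : R) :
  0 <= K -> (forall x y, Rabs (h x - h y) <= K * sqrt (Rabs (x - y))) -> (forall x, h (x + 1) = h x) ->
  is_series (fourier_term h x) (h x).
Proof.
  intros HK HH HP.
  assert (Hc : forall u, continuous h u) by (intros u; apply (continuous_holder h K u HK); intros; apply HH).
  set (g := fun v => h (v + x) - h x); set (g' := fun v => h (- v + x) - h x).
  assert (Gc : forall v, continuous g v).
  { intros v; apply (continuous_minus (fun v => h (v + x)) (fun _ => h x)); [ | apply continuous_const ].
    apply (continuous_comp (fun v => v + x) h); [ | apply Hc ].
    apply (continuous_plus (fun v => v) (fun _ => x)); [ apply continuous_id | apply continuous_const ]. }
  assert (Gc' : forall v, continuous g' v).
  { intros v; apply (continuous_comp (fun v => - v) g); [ | apply Gc ];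
      apply (continuous_opp (V := R_NormedModule) (fun v : R => v)), continuous_id. }
  assert (L1 : is_lim_seq (fun N => RInt (fun v => g v * dirichlet_kernel N v) 0 (1 / 2)) 0).
  { apply (dini_half g K HK Gc); intros v Hv; unfold g; eapply Rle_trans; [ apply HH | ].
    replace (v + x - x) with v by ring; rewrite Rabs_right by lra; apply Rle_refl. }
  assert (L2 : is_lim_seq (fun N => RInt (fun v => g' v * dirichlet_kernel N v) 0 (1 / 2)) 0).
  { apply (dini_half g' K HK Gc'); intros v Hv; unfold g'; eapply Rle_trans; [ apply HH | ].
    replace (- v + x - x) with (- v) by ring; rewrite Rabs_Ropp, Rabs_right by lra; apply Rle_refl. }
  assert (E : forall N, sum_n (fourier_term h x) N =
    h x + (RInt (fun v => g v * dirichlet_kernel N v) 0 (1 / 2) + RInt (fun v => g' v * dirichlet_kernel N v) 0 (1 / 2))).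
  { intros N; rewrite fourier_partial by exact Hc.
    set (G := fun u => (h u - h x) * dirichlet_kernel N (x - u)).
    assert (Hd : forall u, continuous (fun u => h u - h x) u).
    { intros u; apply (continuous_minus h (fun _ => h x)); [ apply Hc | apply continuous_const ]. }
    assert (HG : forall u, continuous G u) by (intros; apply continuous_kernel_term, Hd).
    assert (E1 : RInt (fun u => h u * dirichlet_kernel N (x - u)) 0 1 = h x + RInt G 0 1).
    { assert (X1 : ex_RInt (fun u => dirichlet_kernel N (x - u)) 0 1).
      { apply ex_RInt_cont; intros u; apply (continuous_ext (fun u => 1 * dirichlet_kernel N (x - u))); [ intros; req; ring | ].
        apply (continuous_kernel_term (fun _ => 1)); intros; apply continuous_const. }
      replace (h x) with (h x * RInt (fun u => dirichlet_kernel N (x - u)) 0 1) by (rewrite dirichlet_kernel_mass; ring).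
      change (h x * RInt (fun u => dirichlet_kernel N (x - u)) 0 1)
        with (scal (h x) (RInt (fun u => dirichlet_kernel N (x - u)) 0 1)).
      rewrite <- (RInt_scal (V := R_CompleteNormedModule)) by exact X1.
      change (RInt (fun u => h u * dirichlet_kernel N (x - u)) 0 1 =
        plus (RInt (fun u => scal (h x) (dirichlet_kernel N (x - u))) 0 1) (RInt G 0 1)).
      rewrite <- (RInt_plus (V := R_CompleteNormedModule));
        [ | apply (ex_RInt_scal (V := R_NormedModule)), X1 | apply ex_RInt_cont, HG ].
      apply RInt_ext; intros u _; unfold plus, scal, G; simpl; unfold mult; simpl; req; ring. }
    rewrite E1; f_equal.
    assert (PG : forall u, G (u + 1) = G u).
    { intros u; unfold G; rewrite HP; f_equal.
      rewrite <- (dirichlet_kernel_periodic N (x - (u + 1))); f_equal; ring. }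
    rewrite <- (RInt_period G (- (1 / 2) + x) HG PG).
    replace (- (1 / 2) + x + 1) with (1 / 2 + x) by field.
    rewrite <- RInt_shift by exact HG.
    set (Gx := fun v => G (v + x)).
    assert (HGx : forall v, continuous Gx v).
    { intros v; apply (continuous_comp (fun v => v + x) G); [ | apply HG ].
      apply (continuous_plus (fun v => v) (fun _ => x)); [ apply continuous_id | apply continuous_const ]. }
    assert (EG : forall v, Gx v = g v * dirichlet_kernel N v).
    { intros v; unfold Gx, G, g; f_equal; rewrite <- dirichlet_kernel_even; f_equal; ring. }
    rewrite <- (RInt_Chasles (V := R_CompleteNormedModule) Gx (- (1 / 2)) 0 (1 / 2)) by (apply ex_RInt_cont, HGx).
    rewrite (RInt_ext (fun v => g v * dirichlet_kernel N v) Gx) by (intros; symmetry; apply EG).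
    rewrite (RInt_ext (fun v => g' v * dirichlet_kernel N v) (fun v => Gx (- v))).
    2:{ intros v _; rewrite EG, dirichlet_kernel_even; reflexivity. }
    assert (ES : RInt Gx (- (1 / 2)) 0 = RInt (fun v => Gx (- v)) 0 (1 / 2)).
    { pose proof (RInt_comp_lin (V := R_CompleteNormedModule) Gx (-1) 0 0 (1 / 2)) as S.
      replace (-1 * 0 + 0) with 0 in S by ring; replace (-1 * (1 / 2) + 0) with (- (1 / 2)) in S by ring.
      rewrite <- (opp_RInt_swap (V := R_CompleteNormedModule) Gx 0 (- (1 / 2))) by (apply ex_RInt_cont, HGx).
      rewrite <- S by (apply ex_RInt_cont, HGx).
      rewrite <- (RInt_opp (V := R_CompleteNormedModule)).
      - apply RInt_ext; intros v _; unfold opp, scal; simpl; unfold mult; simpl.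
        replace (-1 * v + 0) with (- v) by ring; req; ring.
      - apply ex_RInt_cont; intros v; apply (continuous_scal_r (K := R_AbsRing) (V := R_NormedModule) (-1) (fun v => Gx (-1 * v + 0))).
        apply (continuous_comp (fun v => -1 * v + 0) Gx); [ | apply HGx ].
        apply (ex_derive_continuous (V := R_NormedModule) (fun v => -1 * v + 0)); auto_derive; exact I. }
    rewrite ES; unfold plus; simpl; ring. }
  apply (is_lim_seq_ext (fun N => h x + (RInt (fun v => g v * dirichlet_kernel N v) 0 (1 / 2)
    + RInt (fun v => g' v * dirichlet_kernel N v) 0 (1 / 2))) (sum_n (fourier_term h x)) (h x)).
  - intros N; symmetry; apply E.
  - replace (Finite (h x)) with (Finite (h x + (0 + 0))) by (f_equal; ring).
    apply is_lim_seq_plus'; [ apply is_lim_seq_const | apply is_lim_seq_plus'; assumption ].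
Qed.

(** * The functional equation *)

Lemma CInt_subst (f : R -> C) (g dg : R -> R) (a b : R) :
  a <= b -> (forall x, a <= x <= b -> ccont f (g x)) ->
  (forall x, a <= x <= b -> is_derive g x (dg x) /\ continuous dg x) ->
  CInt (fun y => RtoC (dg y) * f (g y))%C a b = CInt f (g a) (g b).
Proof.
  intros Hab Hf Hg; unfold CInt; f_equal.
  - rewrite <- (RInt_comp (V := R_CompleteNormedModule) (fun t => Re (f t)) g dg a b);
      [ | rewrite Rmin_left, Rmax_right by exact Hab; intros; apply Hf; assumption
        | rewrite Rmin_left, Rmax_right by exact Hab; intros; apply Hg; assumption ].
    apply RInt_ext; intros x _; rewrite re_scal_l; reflexivity.
  - rewrite <- (RInt_comp (V := R_CompleteNormedModule) (fun t => Im (f t)) g dg a b);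
      [ | rewrite Rmin_left, Rmax_right by exact Hab; intros; apply Hf; assumption
        | rewrite Rmin_left, Rmax_right by exact Hab; intros; apply Hg; assumption ].
    apply RInt_ext; intros x _; rewrite im_scal_l; reflexivity.
Qed.

Lemma CInt_swap (f : R -> C) (a b : R) : ex_CInt f a b -> CInt f b a = (- CInt f a b)%C.
Proof.
  intros [H1 H2]; unfold CInt, Copp; simpl; f_equal; symmetry;
    apply (opp_RInt_swap (V := R_CompleteNormedModule)); assumption.
Qed.

Lemma sqrt_holder_of_lip (d : R) : 0 <= d -> Rmin d 1 <= sqrt d.
Proof.
  intros Hd; destruct (Rle_lt_dec d 1) as [H|H].
  - rewrite Rmin_left by lra; rewrite <- (sqrt_square d) at 1 by lra.
    apply sqrt_le_1_alt; nra.
  - rewrite Rmin_right by lra; rewrite <- sqrt_1 at 1; apply sqrt_le_1_alt; lra.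
Qed.

Lemma saw2_holder (x y : R) : Rabs (saw2 x - saw2 y) <= 1 * sqrt (Rabs (x - y)).
Proof.
  rewrite Rmult_1_l; eapply Rle_trans; [ | apply sqrt_holder_of_lip, Rabs_pos ].
  pose proof (saw2_lip x y); pose proof (saw2_bound x) as Bx; pose proof (saw2_bound y) as By.
  pose proof (Rabs_pos (x - y)).
  apply Rmin_glb; [ lra | ]; apply Rabs_le_between in Bx, By; apply Rabs_le; lra.
Qed.

(** * The Fourier series of the sawtooth primitive *)

Definition freq (j : nat) : R := 2 * PI * (INR j + 1).

Lemma freq_pos (j : nat) : 1 <= freq j.
Proof. unfold freq; pose proof PI2_3_2; pose proof (pos_INR j); nra. Qed.

Lemma saw2_fourier_term (x : R) (j : nat) :
  fourier_term saw2 x (S j) = 2 * cos (freq j * x) / freq j ^ 2.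
Proof.
  unfold fourier_term; rewrite S_INR; fold (freq j); pose proof (freq_pos j) as Hl.
  set (F := fun u => - ((u * u - u) / 2) * sin (freq j * (x - u)) / freq j
    + (u - / 2) * cos (freq j * (x - u)) / freq j ^ 2 + sin (freq j * (x - u)) / freq j ^ 3).
  assert (E : RInt (fun u => saw2 u * cos (freq j * (x - u))) 0 1 = F 1 - F 0).
  { rewrite (RInt_ext _ (fun u => (u * u - u) / 2 * cos (freq j * (x - u)))).
    - apply (is_RInt_unique (V := R_CompleteNormedModule)).
      apply (is_RInt_derive (V := R_CompleteNormedModule) F).
      + intros u _; unfold F; auto_derive; [ exact I | unfold Rminus; field; lra ].
      + intros u _; apply (ex_derive_continuous (V := R_NormedModule) (fun u => (u * u - u) / 2 * cos (freq j * (x - u)))).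
        auto_derive; exact I.
    - rewrite Rmin_left, Rmax_right by lra; intros u Hu.
      rewrite (saw2_on 0) by (simpl; lra); simpl; rewrite Rminus_0_r; reflexivity. }
  rewrite E; unfold F.
  replace (freq j * (x - 0)) with (freq j * (x - 1) + 2 * INR (S j) * PI) by (unfold freq; rewrite S_INR; ring).
  replace (freq j * x) with (freq j * (x - 1) + 2 * INR (S j) * PI) by (unfold freq; rewrite S_INR; ring).
  rewrite sin_period, !cos_period; field; lra.
Qed.

(** Subtracting the value at 0 replaces cos by cos - 1. Each term then vanishes to second order at 0
    and can be integrated down to 0 against x^(-s-2) in the strip -1 < Re s < 0. *)
Lemma saw2_series (x : R) : is_series (fun j => 2 * (cos (freq j * x) - 1) / freq j ^ 2) (saw2 x).
Proof.
  assert (H : forall x, is_series (fun j => 2 * cos (freq j * x) / freq j ^ 2) (saw2 x + / 12)).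
  { clear x; intros x; pose proof (dini saw2 1 x ltac:(lra) saw2_holder saw2_periodic) as D.
    apply (is_series_ext (fun j => fourier_term saw2 x (S j))); [ intros; apply saw2_fourier_term | ].
    apply (is_series_incr_1 (K := R_AbsRing) (V := R_NormedModule) (fourier_term saw2 x)).
    match goal with |- is_series _ ?v => replace v with (saw2 x); [ exact D | ] end.
    simpl; rewrite RInt_saw2; unfold plus; simpl; ring. }
  assert (S0 : saw2 0 = 0) by (rewrite (saw2_on 0) by (simpl; lra); simpl; field).
  pose proof (is_series_minus (K := R_AbsRing) (V := R_NormedModule) _ _ _ _ (H x) (H 0)) as D.
  replace (saw2 x) with (minus (saw2 x + / 12) (saw2 0 + / 12)) by (rewrite S0; unfold minus, plus, opp; simpl; ring).
  eapply is_series_ext; [ | exact D ].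
  intros j; pose proof (freq_pos j); cbv beta; rewrite Rmult_0_r, cos_0; unfold minus, plus, opp; simpl; field; lra.
Qed.

Lemma abs_cos_sub1 (u : R) : 0 <= u -> Rabs (cos u - 1) <= u.
Proof.
  intros Hu; destruct (MVT_gen cos 0 u (fun t => - sin t)) as [c [Hc E]].
  - intros x _; apply is_derive_cos.
  - intros x _; apply continuity_pt_filterlim, continuous_cos.
  - rewrite cos_0, Rminus_0_r in E; rewrite E, Rabs_mult, Rabs_Ropp, (Rabs_right u) by lra.
    assert (Rabs (sin c) <= 1) by (apply Rabs_le; pose proof (SIN_bound c); lra); nra.
Qed.

Lemma abs_cos_sub1_2 (u : R) : Rabs (cos u - 1) <= 2.
Proof. apply Rabs_le; pose proof (COS_bound u); lra. Qed.

(** Interpolates between the bounds u and 2, so that the cut-off error near 0 becomes an explicit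
    power. *)
Lemma abs_cos_sub1_Rpower (u a : R) : 0 < u -> 0 < a < 1 -> Rabs (cos u - 1) <= 2 * Rpower u a.
Proof.
  intros Hu Ha; destruct (Rle_lt_dec u 1) as [H|H].
  - eapply Rle_trans; [ apply abs_cos_sub1; lra | ].
    assert (u <= Rpower u a).
    { rewrite <- (Rpower_1 u Hu) at 1; apply exp_le; assert (ln u <= 0) by (rewrite <- ln_1; apply ln_le'; lra); nra. }
    lra.
  - eapply Rle_trans; [ apply abs_cos_sub1_2 | ].
    assert (1 <= Rpower u a).
    { rewrite <- (Rpower_O u) by lra; apply Rpower_le_exp; lra. }
    lra.
Qed.

Lemma cos_taylor (u : R) : 0 <= u <= 1 -> Rabs (cos u - 1 + u ^ 2 / 2) <= u ^ 4.
Proof.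
  intros Hu; pose proof PI2_3_2.
  destruct (cos_bound u 0) as [H1 H2]; [ lra | lra | ].
  unfold cos_approx, cos_term in H1, H2; simpl in H1, H2.
  apply Rabs_le; split; nra.
Qed.

(** * The cosine integral and its continuation *)

Definition cosker (u : R) : C := RtoC (cos u - 1).
(** The part of the integral over (0, 1) is moved to [1, oo) by u = 1 / v. Taking out the Taylor
    term - u^2 / 2, which contributes 1 / (2 (s - 1)), leaves a kernel of order v^(-4) and continues
    the integral to Re s < 3. *)
Definition cosker_inv (v : R) : C := RtoC (cos (/ v) - 1 + (/ v) ^ 2 / 2).

Lemma cosker_ccont (u : R) : ccont cosker u.
Proof.
  apply ccont_RtoC, (continuous_minus cos (fun _ => 1)); [ apply continuous_cos | apply continuous_const ].
Qed.

Lemma cosker_ok : mellin_ok (fun _ => cosker) 2 0.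
Proof.
  intros n x Hx; pose proof (pos_INR n); split; [ apply cosker_ccont | ].
  unfold cosker; rewrite Cmod_R, Rpower_O, Rmult_1_r by lra; apply abs_cos_sub1_2.
Qed.

Lemma cosker_inv_ok : mellin_ok (fun _ => cosker_inv) 1 (- (4)).
Proof.
  intros n x Hx; pose proof (pos_INR n); split.
  - apply ccont_RtoC, (ex_derive_continuous (V := R_NormedModule) (fun v => cos (/ v) - 1 + (/ v) ^ 2 / 2)).
    auto_derive; lra.
  - assert (Hi : 0 <= / x <= 1).
    { split; [ apply Rlt_le, Rinv_0_lt_compat; lra | rewrite <- Rinv_1; apply Rinv_le_contravar; lra ]. }
    unfold cosker_inv; rewrite Cmod_R, Rmult_1_l; eapply Rle_trans; [ apply cos_taylor, Hi | right ].
    rewrite Rpower_Ropp, pow_inv; f_equal; replace 4 with (INR 4) by (simpl; ring); rewrite Rpower_pow by lra; reflexivity.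
Qed.

Definition cosint (s : C) (a b : R) : C := CInt (fun u => cosker u * xpow u (- (s + 2)))%C a b.

Lemma cosint_ccont (s : C) (u : R) : 0 < u -> ccont (fun u => cosker u * xpow u (- (s + 2)))%C u.
Proof. intros; apply ccont_mult; [ apply cosker_ccont | apply ccont_xpow; assumption ]. Qed.

Lemma cosint_ex (s : C) (a b : R) : 0 < a <= b -> ex_CInt (fun u => cosker u * xpow u (- (s + 2)))%C a b.
Proof. intros; apply ex_CInt_cont; [ lra | intros; apply cosint_ccont; lra ]. Qed.

Lemma cosint_Chasles (s : C) (a b c : R) : 0 < a <= b -> b <= c -> cosint s a c = (cosint s a b + cosint s b c)%C.
Proof. intros; apply CInt_Chasles; apply cosint_ex; lra. Qed.

(* The integral of [(cos u - 1) u^(-s-2)] over (0, oo), times [s - 1]. *)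
Definition cosnum (s : C) : C :=
  ((s - 1) * (mellin (fun _ => cosker_inv) (- s) + mellin (fun _ => cosker) (s + 2)) + / 2)%C.

Definition cosfull (s : C) : C :=
  (mellin (fun _ => cosker_inv) (- s) + / (2 * (s - 1)) + mellin (fun _ => cosker) (s + 2))%C.

Lemma cosint_lower (s : C) (X : R) : 1 <= X -> s <> RtoC 1 ->
  cosint s (/ X) 1 = (CInt (fun v => cosker_inv v * xpow v (- - s)) 1 X
    + / (2 * (s - 1)) - / (2 * (s - 1)) * xpow X (s - 1))%C.
Proof.
  intros HX Hs.
  assert (Hi : 0 < / X <= 1).
  { split; [ apply Rinv_0_lt_compat; lra | rewrite <- Rinv_1; apply Rinv_le_contravar; lra ]. }
  assert (Hn : (s - 1)%C <> RtoC 0) by (apply Cminus_eq_contra, Hs).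
  assert (H2 : RtoC 2 <> RtoC 0) by (intros E; injection E; lra).
  assert (E1 : cosint s 1 (/ X) = CInt (fun v => RtoC (- / v ^ 2) * (cosker (/ v) * xpow (/ v) (- (s + 2))))%C 1 X).
  { unfold cosint; rewrite <- Rinv_1 at 1; symmetry.
    apply (CInt_subst (fun u => cosker u * xpow u (- (s + 2)))%C (fun v => / v) (fun v => - / v ^ 2)); [ exact HX | | ].
    - intros v Hv; apply cosint_ccont, Rinv_0_lt_compat; lra.
    - intros v Hv; split; [ auto_derive; [ lra | field; lra ] | ].
      apply (ex_derive_continuous (V := R_NormedModule) (fun v => - / v ^ 2)); auto_derive; nra. }
  unfold cosint in E1; rewrite CInt_swap in E1 by (apply cosint_ex, Hi); fold (cosint s (/ X) 1) in E1.
  replace (cosint s (/ X) 1) with (- - cosint s (/ X) 1)%C by ring; rewrite E1.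
  assert (Ex1 : ex_CInt (fun v => cosker_inv v * xpow v (- - s))%C 1 X).
  { apply ex_CInt_cont; [ exact HX | intros v Hv; apply ccont_mult; [ | apply ccont_xpow; lra ] ].
    destruct (nat_cut v) as [n Hn']; [ lra | apply (cosker_inv_ok n v Hn') ]. }
  assert (Ex2 : ex_CInt (fun v => xpow v (s - 2)) 1 X)
    by (apply ex_CInt_cont; [ exact HX | intros; apply ccont_xpow; lra ]).
  assert (E2 : CInt (fun v => xpow v (s - 2)) 1 X = (/ (s - 1) * xpow X (s - 1) - / (s - 1) * xpow 1 (s - 1))%C).
  { apply (CInt_FTC (fun v => / (s - 1) * xpow v (s - 1))%C); [ exact HX | | intros; apply ccont_xpow; lra ].
    intros v Hv; eapply cderiv_eq; [ apply cderiv_scal, cderiv_xpow; lra | ].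
    replace (s - 1 - 1)%C with (s - 2)%C by ring; field; exact Hn. }
  rewrite (CInt_ext _ (fun v => - RtoC 1 * (cosker_inv v * xpow v (- - s)) + / 2 * xpow v (s - 2))%C); [ | exact HX | ].
  - rewrite CInt_plus, !CInt_scal, E2, xpow_1_l by (try exact Ex1; try exact Ex2; apply ex_CInt_scal; assumption).
    field; repeat split; assumption.
  - intros v Hv.
    replace (- - s)%C with s by ring.
    assert (Ev : xpow (/ v) (- (s + 2)) = (xpow v s * RtoC (v * v))%C).
    { unfold xpow at 1; rewrite ln_Rinv by lra.
      replace (- (s + 2) * RtoC (- ln v))%C with ((s + 1 + 1) * RtoC (ln v))%C by (rewrite RtoC_opp; ring).
      fold (xpow v (s + 1 + 1)); rewrite !xpow_plus, xpow_1_r, RtoC_mult by lra; ring. }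
    assert (Ew : xpow v (s - 2) = (xpow v s * RtoC (/ (v * v)))%C).
    { replace (s - 2)%C with (s + - (1) + - (1))%C by ring; rewrite !xpow_plus, !xpow_opp, !xpow_1_r by lra.
      rewrite RtoC_inv, RtoC_mult by nra; field; intros E; injection E; lra. }
    rewrite Ev, Ew; unfold cosker, cosker_inv.
    replace (/ 2)%C with (RtoC (/ 2)) by (rewrite RtoC_inv by lra; reflexivity).
    replace (- RtoC 1)%C with (RtoC (Ropp 1)) by (rewrite RtoC_opp; reflexivity).
    transitivity (xpow v s * RtoC (- / v ^ 2 * (cos (/ v) - 1) * (v * v)))%C; [ rewrite !RtoC_mult; ring | ].
    transitivity (xpow v s * RtoC (Ropp 1 * (cos (/ v) - 1 + (/ v) ^ 2 / 2) + / 2 * / (v * v)))%C.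
    + do 2 f_equal; field; lra.
    + rewrite RtoC_plus, !RtoC_mult; ring.
Qed.

Lemma cosint_lim (s : C) : -1 < Re s < 0 ->
  Clim (fun N => cosint s (/ (INR N + 1)) (INR N + 1)) (cosfull s).
Proof.
  intros Hs.
  assert (N1 : s <> RtoC 1) by (intros ->; rewrite re_RtoC in Hs; lra).
  apply (Clim_ext (fun N => (CInt (fun v => cosker_inv v * xpow v (- - s)) 1 (INR N + 1)
    + (/ (2 * (s - 1)) - / (2 * (s - 1)) * xpow (INR N + 1) (s - 1))
    + CInt (fun u => cosker u * xpow u (- (s + 2))) 1 (INR N + 1)))%C).
  - intros N; pose proof (pos_INR N).
    assert (Hi : 0 < / (INR N + 1) <= 1).
    { split; [ apply Rinv_0_lt_compat; lra | rewrite <- Rinv_1; apply Rinv_le_contravar; lra ]. }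
    rewrite (cosint_Chasles s _ 1 (INR N + 1)), cosint_lower by (assumption || lra).
    unfold cosint; ring.
  - unfold cosfull; apply Clim_plus; [ apply Clim_plus | ].
    + apply (mellin_lim _ _ _ _ cosker_inv_ok); rewrite re_opp; lra.
    + replace (/ (2 * (s - 1)))%C with (/ (2 * (s - 1)) - / (2 * (s - 1)) * 0)%C at 1 by ring.
      apply Clim_minus; [ apply Clim_const | apply Clim_scal, xpow_lim_0; rewrite re_minus, re_RtoC; lra ].
    + apply (mellin_lim _ _ _ _ cosker_ok); rewrite re_plus, re_RtoC; lra.
Qed.

Lemma RInt_Rpower (c e a b : R) : 0 < a <= b -> e <> 0 ->
  is_RInt (fun u => c * Rpower u (e - 1)) a b (c / e * Rpower b e - c / e * Rpower a e).
Proof.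
  intros Hab He.
  apply (is_RInt_derive (V := R_CompleteNormedModule) (fun u => c / e * Rpower u e) (fun u => c * Rpower u (e - 1)));
    rewrite Rmin_left, Rmax_right by lra; intros u Hu.
  - replace (c * Rpower u (e - 1)) with (c / e * (e * Rpower u (e - 1))) by (field; exact He).
    apply (is_derive_scal (fun u => Rpower u e)), is_derive_Rpower; lra.
  - apply (continuous_scal_r (K := R_AbsRing) (V := R_NormedModule) c (fun u => Rpower u (e - 1))).
    apply (ex_derive_continuous (V := R_NormedModule) (fun u => Rpower u (e - 1))).
    eexists; apply is_derive_Rpower; lra.
Qed.

Lemma cosint_le (s : C) (a b c e : R) : 0 < a <= b -> e <> 0 -> 0 <= c ->
  (forall u, a <= u <= b -> Rabs (cos u - 1) <= c * Rpower u (Re s + 1 + e)) ->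
  Cmod (cosint s a b) <= c / e * Rpower b e - c / e * Rpower a e.
Proof.
  intros Hab He Hc H.
  pose proof (RInt_Rpower c e a b Hab He) as E.
  rewrite <- (is_RInt_unique (V := R_CompleteNormedModule) _ _ _ _ E).
  apply CInt_norm_le; [ lra | apply cosint_ex, Hab | eexists; exact E | intros u Hu ].
  rewrite Cmod_mult; unfold cosker; rewrite Cmod_R, Cmod_xpow, re_opp, re_plus, re_RtoC.
  eapply Rle_trans; [ apply Rmult_le_compat_r; [ apply Rlt_le, Rpower_pos | apply H; lra ] | ].
  rewrite Rmult_assoc, <- Rpower_plus; right; do 2 f_equal; ring.
Qed.

(** The error is a sum of explicit powers of the two cut-offs. After scaling by a frequency it is
    summable over the frequencies, which a mere limit would not give. *)
Lemma cosint_error (s : C) (a b : R) : -1 < Re s < 0 -> 0 < a <= b ->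
  Cmod (cosint s a b - cosfull s) <= 4 / (- Re s) * Rpower a (- Re s / 2) + 2 / (1 + Re s) * Rpower b (- (1 + Re s)).
Proof.
  intros Hs Hab; set (x := Re s) in *.
  apply Rnot_lt_le; intros Hlt.
  set (D := 4 / (- x) * Rpower a (- x / 2) + 2 / (1 + x) * Rpower b (- (1 + x))) in *.
  destruct (cosint_lim s Hs (Cmod (cosint s a b - cosfull s) - D)) as [N HN]; [ lra | ].
  destruct (nfloor_ex (Rmax b (/ a))) as [M HM].
  { eapply Rle_trans; [ | apply Rmax_l ]; lra. }
  set (n := Nat.max N M); specialize (HN n (Nat.le_max_l _ _)).
  assert (HnM : INR M <= INR n) by (apply le_INR, Nat.le_max_r).
  assert (T1 : b <= INR n + 1) by (pose proof (Rmax_l b (/ a)); lra).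
  assert (T2 : / a <= INR n + 1) by (pose proof (Rmax_r b (/ a)); lra).
  assert (T3 : 0 < / (INR n + 1) <= a).
  { split; [ apply Rinv_0_lt_compat; lra | ].
    rewrite <- (Rinv_inv a); apply Rinv_le_contravar; [ apply Rinv_0_lt_compat; lra | exact T2 ]. }
  assert (E : (cosint s (/ (INR n + 1)) (INR n + 1) - cosint s a b)%C =
    (cosint s (/ (INR n + 1)) a + cosint s b (INR n + 1))%C).
  { rewrite (cosint_Chasles s _ a (INR n + 1)), (cosint_Chasles s a b (INR n + 1)) by lra; ring. }
  (* Near 0 the exponent 1 + Re s / 2 lies between 0 and 1, as [abs_cos_sub1_Rpower] asks, and
     leaves the integrable power u^(-Re s / 2 - 1). *)
  assert (B1 : Cmod (cosint s (/ (INR n + 1)) a) <=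
    2 / (- x / 2) * Rpower a (- x / 2) - 2 / (- x / 2) * Rpower (/ (INR n + 1)) (- x / 2)).
  { apply cosint_le; [ lra | lra | lra | intros u Hu ].
    fold x; replace (x + 1 + - x / 2) with (1 + x / 2) by field; apply abs_cos_sub1_Rpower; lra. }
  assert (B2 : Cmod (cosint s b (INR n + 1)) <=
    2 / (- (1 + x)) * Rpower (INR n + 1) (- (1 + x)) - 2 / (- (1 + x)) * Rpower b (- (1 + x))).
  { apply cosint_le; [ lra | lra | lra | intros u Hu ].
    fold x; replace (x + 1 + - (1 + x)) with 0 by ring; rewrite Rpower_O by lra; rewrite Rmult_1_r; apply abs_cos_sub1_2. }
  assert (B3 : Cmod (cosint s (/ (INR n + 1)) (INR n + 1) - cosint s a b) <= D).
  { rewrite E; eapply Rle_trans; [ apply Cmod_triangle | ].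
    assert (0 <= 2 / (- x / 2) * Rpower (/ (INR n + 1)) (- x / 2)).
    { apply Rmult_le_pos; [ apply Rlt_le, Rdiv_lt_0_compat; lra | apply Rlt_le, Rpower_pos ]. }
    assert (0 <= 2 / (1 + x) * Rpower (INR n + 1) (- (1 + x))).
    { apply Rmult_le_pos; [ apply Rlt_le, Rdiv_lt_0_compat; lra | apply Rlt_le, Rpower_pos ]. }
    replace (2 / - (1 + x)) with (- (2 / (1 + x))) in B2 by (field; lra).
    replace (2 / (- x / 2)) with (4 / - x) in * by (field; lra).
    unfold D; lra. }
  pose proof (Cmod_sub_triangle (cosint s a b) (cosint s (/ (INR n + 1)) (INR n + 1)) (cosfull s)) as T.
  rewrite (Cmod_sub_sym (cosint s a b) (cosint s (/ (INR n + 1)) (INR n + 1))) in T; lra.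
Qed.

(** * Two evaluations of the Mellin integral of the sawtooth primitive *)

Definition sawint (s : C) (a b : R) : C := CInt (fun x => RtoC (saw2 x) * xpow x (- (s + 2)))%C a b.

Lemma sawint_ex (s : C) (a b : R) : 0 < a <= b -> ex_CInt (fun x => RtoC (saw2 x) * xpow x (- (s + 2)))%C a b.
Proof.
  intros; apply ex_CInt_cont; [ lra | intros x Hx; apply ccont_mult ];
    [ apply ccont_RtoC, saw2_continuous | apply ccont_xpow; lra ].
Qed.

Lemma xpow_inv_base (x : R) (s : C) : 0 < x -> xpow (/ x) s = xpow x (- s).
Proof. intros Hx; unfold xpow; rewrite ln_Rinv, RtoC_opp by exact Hx; f_equal; ring. Qed.

Lemma sawint_lower (s : C) (X : R) : 1 <= X -> s <> RtoC 1 -> s <> RtoC 0 ->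
  sawint s (/ X) 1 = (/ 2 * (/ (1 - s) + / s) - / 2 * (/ (1 - s) * xpow X (s - 1) + / s * xpow X s))%C.
Proof.
  intros HX H1 H0.
  assert (Hi : 0 < / X <= 1).
  { split; [ apply Rinv_0_lt_compat; lra | rewrite <- Rinv_1; apply Rinv_le_contravar; lra ]. }
  assert (Hn : (1 - s)%C <> RtoC 0) by (apply Cminus_eq_contra; intros E; apply H1; symmetry; exact E).
  assert (H2 : RtoC 2 <> RtoC 0) by (intros E; injection E; lra).
  unfold sawint; rewrite (CInt_ext _ (fun x => / 2 * (xpow x (- s) - xpow x (- s - 1)))%C); [ | lra | ].
  - rewrite (CInt_FTC (fun x => / 2 * (/ (1 - s) * xpow x (1 - s) + / s * xpow x (- s)))%C); [ | lra | | ].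
    + rewrite !xpow_1_l, !xpow_inv_base by lra.
      replace (- (1 - s))%C with (s - 1)%C by ring; replace (- - s)%C with s by ring; ring.
    + intros x Hx; eapply cderiv_eq.
      * apply cderiv_scal, cderiv_plus; apply cderiv_scal, cderiv_xpow; lra.
      * replace (1 - s - 1)%C with (- s)%C by ring; field; repeat split; assumption.
    + intros x Hx; apply ccont_mult; [ apply ccont_const | apply ccont_minus; apply ccont_xpow; lra ].
  - intros x Hx; rewrite (saw2_on 0) by (simpl; lra); simpl IZR; rewrite Rminus_0_r.
    replace (- s)%C with (- (s + 2) + 1 + 1)%C at 1 by ring.
    replace (- s - 1)%C with (- (s + 2) + 1)%C by ring.
    rewrite !xpow_plus, xpow_1_r by lra.
    replace (RtoC ((x * x - x) / 2)) with ((RtoC x * RtoC x - RtoC x) * / 2)%C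
      by (unfold Rdiv; rewrite RtoC_mult, RtoC_minus, RtoC_mult, RtoC_inv by lra; reflexivity).
    ring.
Qed.

(** This limit is - zeta0 s / (s (s + 1)): the elementary part of the Euler-Maclaurin formula is the
    integral over (0, 1). Convergence asks for Re s < 0 at 0, where [saw2 x] is close to - x / 2,
    and for Re s > -1 at infinity. *)
Lemma sawint_lim (s : C) : -1 < Re s < 0 ->
  Clim (fun N => sawint s (/ (INR N + 1)) (INR N + 1))
    (/ 2 * (/ (1 - s) + / s) + mellin (fun _ x => RtoC (saw2 x)) (s + 2))%C.
Proof.
  intros Hs.
  assert (N1 : s <> RtoC 1) by (intros ->; rewrite re_RtoC in Hs; lra).
  assert (N0 : s <> RtoC 0) by (intros ->; rewrite re_RtoC in Hs; lra).
  apply (Clim_ext (fun N => (/ 2 * (/ (1 - s) + / s)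
      - / 2 * (/ (1 - s) * xpow (INR N + 1) (s - 1) + / s * xpow (INR N + 1) s)
      + CInt (fun x => RtoC (saw2 x) * xpow x (- (s + 2))) 1 (INR N + 1))%C)).
  - intros N; pose proof (pos_INR N).
    assert (Hi : 0 < / (INR N + 1) <= 1).
    { split; [ apply Rinv_0_lt_compat; lra | rewrite <- Rinv_1; apply Rinv_le_contravar; lra ]. }
    rewrite <- (sawint_lower s (INR N + 1)) by (assumption || lra).
    symmetry; apply CInt_Chasles; apply sawint_ex; lra.
  - apply Clim_plus; [ | apply (mellin_lim _ _ _ _ saw2_mellin_ok); rewrite re_plus, re_RtoC; lra ].
    match goal with |- Clim ?u ?v => cut (Clim u (v - / 2 * (/ (1 - s) * 0 + / s * 0))%C) end.
    { intros H; rewrite !Cmult_0_r, Cplus_0_r, Cmult_0_r, Cminus_0_r in H; exact H. }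
    apply Clim_minus; [ apply Clim_const | apply Clim_scal, Clim_plus; apply Clim_scal, xpow_lim_0 ];
      rewrite ?re_minus, ?re_RtoC; lra.
Qed.

Definition saw_coeff (j : nat) : R := 2 / freq j ^ 2.

Lemma Rpower_m2 (x : R) : 0 < x -> Rpower x (Ropp 2) = / x ^ 2.
Proof.
  intros Hx; rewrite Rpower_Ropp; f_equal; replace 2 with (INR 2) by (simpl; ring); apply Rpower_pow, Hx.
Qed.

Lemma saw_coeff_le (j : nat) : 0 <= saw_coeff j <= 2 * Rpower (INR j + 1) (Ropp 2).
Proof.
  unfold saw_coeff; pose proof (pos_INR j).
  assert (Hf : INR j + 1 <= freq j) by (unfold freq; pose proof PI2_3_2; nra).
  split; [ apply Rdiv_le_0_compat; [ lra | apply pow_lt; lra ] | ].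
  unfold Rdiv; apply Rmult_le_compat_l; [ lra | ].
  rewrite Rpower_m2 by lra; apply Rinv_le_contravar; [ apply pow_lt; lra | apply pow_incr; lra ].
Qed.

Lemma CInt_csum (f : nat -> R -> C) (a b : R) (n : nat) :
  (forall j, ex_CInt (f j) a b) ->
  ex_CInt (fun x => csum (fun j => f j x) n) a b /\
  CInt (fun x => csum (fun j => f j x) n) a b = csum (fun j => CInt (f j) a b) n.
Proof.
  intros H; induction n as [|n [IH1 IH2]]; simpl csum.
  - split; [ split; apply ex_RInt_const | rewrite CInt_const; ring ].
  - split; [ apply ex_CInt_plus; [ exact IH1 | apply H ] | ].
    rewrite CInt_plus by (assumption || apply H); rewrite IH2; reflexivity.
Qed.

(** On a compact interval the cosine series converges uniformly and may be integrated term by term;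
    the substitution u = freq j x makes every term the same integral with scaled cut-offs. *)
Lemma sawint_series (s : C) (a b : R) : 0 < a <= b -> -1 < Re s ->
  is_cseries (fun j => RtoC (saw_coeff j) * (xpow (freq j) (s + 1) * cosint s (freq j * a) (freq j * b)))%C
    (sawint s a b).
Proof.
  intros Hab Hs.
  set (f := fun j x => (RtoC (saw_coeff j * (cos (freq j * x) - 1)) * xpow x (- (s + 2)))%C).
  assert (Ef : forall j, ex_CInt (f j) a b).
  { intros j; apply ex_CInt_cont; [ lra | intros x Hx; apply ccont_mult; [ apply ccont_RtoC | apply ccont_xpow; lra ] ].
    apply (ex_derive_continuous (V := R_NormedModule) (fun x => saw_coeff j * (cos (freq j * x) - 1))); auto_derive; exact I. }
  assert (Et : forall j, (RtoC (saw_coeff j) * (xpow (freq j) (s + 1) * cosint s (freq j * a) (freq j * b)))%C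
    = CInt (f j) a b).
  { intros j; pose proof (freq_pos j) as Pj.
    assert (E : cosint s (freq j * a) (freq j * b) =
      CInt (fun x => RtoC (freq j) * (cosker (freq j * x) * xpow (freq j * x) (- (s + 2))))%C a b).
    { symmetry; apply (CInt_subst (fun u => cosker u * xpow u (- (s + 2)))%C (fun x => freq j * x) (fun _ => freq j)); [ lra | | ].
      - intros x Hx; apply cosint_ccont; nra.
      - intros x Hx; split; [ auto_derive; [ exact I | ring ] | apply continuous_const ]. }
    assert (Ex : ex_CInt (fun x => RtoC (freq j) * (cosker (freq j * x) * xpow (freq j * x) (- (s + 2))))%C a b).
    { apply ex_CInt_cont; [ lra | intros x Hx; apply ccont_mult; [ apply ccont_const | ] ].
      apply (ccont_comp (fun u => cosker u * xpow u (- (s + 2)))%C (fun x => freq j * x)).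
      - apply (ex_derive_continuous (V := R_NormedModule) (fun x => freq j * x)); auto_derive; exact I.
      - apply cosint_ccont; nra. }
    rewrite E, <- CInt_scal by exact Ex; rewrite <- CInt_scal by (apply ex_CInt_scal, Ex).
    apply CInt_ext; [ lra | intros x Hx; unfold f, cosker ].
    rewrite xpow_mult, RtoC_mult by lra.
    transitivity (RtoC (saw_coeff j) * RtoC (cos (freq j * x) - 1) * xpow x (- (s + 2))
      * (xpow (freq j) (s + 1) * (xpow (freq j) 1 * xpow (freq j) (- (s + 2)))))%C.
    - rewrite xpow_1_r by lra; ring.
    - rewrite <- !xpow_plus; replace (s + 1 + (1 + - (s + 2)))%C with (RtoC 0) by ring; rewrite xpow_0_r; ring. }
  set (bd := fun j => 4 * Rpower (INR j + 1) (Ropp 2)).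
  assert (Hbd : ex_series bd).
  { apply (ex_series_scal_l (K := R_AbsRing) 4 (fun j => Rpower (INR j + 1) (Ropp 2))), ex_series_Rpower; lra. }
  assert (Htail : forall x N, Cmod (RtoC (saw2 x) - csum (fun j => RtoC (saw_coeff j * (cos (freq j * x) - 1))) (S N)) <=
    Series bd - sum_n bd N).
  { intros x N; apply cseries_tail_le; [ | exact Hbd | ].
    - intros j; rewrite Cmod_R, Rabs_mult; destruct (saw_coeff_le j) as [K1 K2].
      rewrite (Rabs_right (saw_coeff j)) by lra; unfold bd; pose proof (abs_cos_sub1_2 (freq j * x)).
      pose proof (Rabs_pos (cos (freq j * x) - 1)); nra.
    - apply is_cseries_Re_Im; split; simpl.
      + eapply is_series_ext; [ | apply saw2_series ].
        intros j; unfold saw_coeff; pose proof (freq_pos j); simpl; field; lra.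
      + apply (is_lim_seq_ext (fun _ => 0) (sum_n (fun _ => 0)) 0); [ | apply is_lim_seq_const ].
        intros n; rewrite sum_n_const; ring. }
  assert (Hlim : is_lim_seq (fun N => (b - a) * ((Series bd - sum_n bd N) * Rpower a (- (Re s + 2)))) 0).
  { replace (Finite 0) with (Finite ((b - a) * ((Series bd - Series bd) * Rpower a (- (Re s + 2))))) by (f_equal; ring).
    apply is_lim_seq_mult'; [ apply is_lim_seq_const | apply is_lim_seq_mult'; [ | apply is_lim_seq_const ] ].
    apply is_lim_seq_minus'; [ apply is_lim_seq_const | apply (Series_correct bd Hbd) ]. }
  assert (H : Clim (fun N => csum (fun j => CInt (f j) a b) (S N)) (sawint s a b)).
  { apply (Clim_squeeze_0 _ _ (fun N => (b - a) * ((Series bd - sum_n bd N) * Rpower a (- (Re s + 2))))); [ | exact Hlim ].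
    intros N; destruct (CInt_csum f a b (S N) Ef) as [X1 X2]; rewrite <- X2, Cmod_sub_sym; unfold sawint.
    rewrite <- CInt_minus; [ | lra | apply sawint_ex; lra | exact X1 ].
    apply CInt_norm_le_const; [ lra | apply ex_CInt_minus; [ lra | apply sawint_ex; lra | exact X1 ] | intros x Hx ].
    replace (csum (fun j => f j x) (S N)) with
      (xpow x (- (s + 2)) * csum (fun j => RtoC (saw_coeff j * (cos (freq j * x) - 1))) (S N))%C
      by (rewrite <- csum_scal; apply csum_ext; intros; unfold f; ring).
    match goal with |- Cmod (Cminus (Cmult ?p ?q) (Cmult ?q ?r)) <= _ =>
      replace (Cminus (Cmult p q) (Cmult q r)) with (Cmult (Cminus p r) q) by ring end.
    rewrite Cmod_mult, Cmod_xpow, re_opp, re_plus, re_RtoC.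
    apply Rmult_le_compat; [ apply Cmod_ge_0 | apply Rlt_le, Rpower_pos | apply Htail | apply Rpower_le_base_neg; lra ]. }
  apply (is_cseries_ext (fun j => CInt (f j) a b)); [ intros; symmetry; apply Et | ].
  intros e He; destruct (H e He) as [N K]; exists (S N); intros [|n] Hn; [ lia | apply K; lia ].
Qed.

Lemma Rpower_mult_base (x y e : R) : 0 < x -> 0 < y -> Rpower (x * y) e = Rpower x e * Rpower y e.
Proof. intros; unfold Rpower; rewrite ln_mult, <- exp_plus by assumption; f_equal; ring. Qed.

Lemma Rpower_inv_base (x e : R) : 0 < x -> Rpower (/ x) e = Rpower x (- e).
Proof. intros; unfold Rpower; rewrite ln_Rinv by assumption; f_equal; ring. Qed.

(** The series and the limit of the cut-offs 1 / T and T are interchanged: the j-th error is bounded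
    by two products of a negative power of T and a summable power of j + 1. *)
Lemma sawint_value (s : C) : -1 < Re s < 0 ->
  (/ 2 * (/ (1 - s) + / s) + mellin (fun _ x => RtoC (saw2 x)) (s + 2))%C =
  (2 * xpow (2 * PI) (s - 1) * cosfull s * zeta0 (1 - s))%C.
Proof.
  intros Hs; set (x := Re s) in *; pose proof PI_RGT_0 as HPI.
  pose proof (sawint_lim s Hs) as L; apply (Clim_unique _ _ _ L).
  assert (Z : is_cseries (fun j => RtoC (saw_coeff j) * (xpow (freq j) (s + 1) * cosfull s))%C
    (2 * xpow (2 * PI) (s - 1) * cosfull s * zeta0 (1 - s))%C).
  { apply (is_cseries_ext (fun n => 2 * xpow (2 * PI) (s - 1) * cosfull s * xpow (INR n + 1) (- (1 - s)))%C).
    - intros j; pose proof (freq_pos j) as Pj; pose proof (pos_INR j).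
      replace (- (1 - s))%C with (s - 1)%C by ring.
      transitivity (2 * cosfull s * (xpow (2 * PI) (s - 1) * xpow (INR j + 1) (s - 1)))%C; [ ring | ].
      rewrite <- xpow_mult by lra; fold (freq j).
      replace (s + 1)%C with (s - 1 + 1 + 1)%C by ring; rewrite !(xpow_plus (freq j) _ 1), xpow_1_r by lra.
      assert (Hq : RtoC (freq j) <> RtoC 0) by (intros E; injection E; lra).
      unfold saw_coeff; rewrite RtoC_div, RtoC_pow by (apply pow_nonzero; lra); field; exact Hq.
    - apply is_cseries_scal, zeta0_series; rewrite re_minus, re_RtoC; fold x; lra. }
  set (S1 := Series (fun j => Rpower (INR j + 1) (- (1 - x / 2)))).
  set (S2 := Series (fun j => Rpower (INR j + 1) (Ropp 2))).
  assert (X1 : ex_series (fun j => Rpower (INR j + 1) (- (1 - x / 2)))) by (apply ex_series_Rpower; lra).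
  assert (X2 : ex_series (fun j => Rpower (INR j + 1) (Ropp 2))) by (apply ex_series_Rpower; lra).
  set (C1 := 8 / (- x)); set (C2 := 4 / (1 + x)).
  assert (P1 : 0 <= C1) by (apply Rdiv_le_0_compat; lra).
  assert (P2 : 0 <= C2) by (apply Rdiv_le_0_compat; lra).
  apply (Clim_squeeze_0 _ _ (fun N => C1 * Rpower (INR N + 1) (- (- x / 2)) * S1 + C2 * Rpower (INR N + 1) (- (1 + x)) * S2)).
  - intros N; pose proof (pos_INR N); set (T := INR N + 1) in *.
    assert (HT : 1 <= T) by (unfold T; lra).
    assert (Hi : 0 < / T <= 1).
    { split; [ apply Rinv_0_lt_compat; lra | rewrite <- Rinv_1; apply Rinv_le_contravar; lra ]. }
    pose proof (is_cseries_minus _ _ _ _ (sawint_series s (/ T) T ltac:(lra) ltac:(fold x; lra)) Z) as D.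
    set (bd := fun j => C1 * Rpower T (- (- x / 2)) * Rpower (INR j + 1) (- (1 - x / 2))
                        + C2 * Rpower T (- (1 + x)) * Rpower (INR j + 1) (Ropp 2)).
    assert (Y1 := ex_series_scal_l (K := R_AbsRing) (V := R_NormedModule) (C1 * Rpower T (- (- x / 2))) _ X1).
    assert (Y2 := ex_series_scal_l (K := R_AbsRing) (V := R_NormedModule) (C2 * Rpower T (- (1 + x))) _ X2).
    assert (Es : C1 * Rpower T (- (- x / 2)) * S1 + C2 * Rpower T (- (1 + x)) * S2 = Series bd).
    { unfold bd, S1, S2; rewrite <- !Series_scal_l; symmetry; apply Series_plus; assumption. }
    rewrite Es.
    apply (is_cseries_mod_le _ bd _) with (3 := D).
    + intros j; pose proof (freq_pos j) as Pj; pose proof (pos_INR j) as Pjj.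
      match goal with |- Cmod (Cminus (Cmult ?p (Cmult ?q ?r)) (Cmult ?p (Cmult ?q ?t))) <= _ =>
        replace (Cminus (Cmult p (Cmult q r)) (Cmult p (Cmult q t))) with (Cmult (Cmult p q) (Cminus r t)) by ring end.
      rewrite !Cmod_mult, Cmod_R, Cmod_xpow, re_plus, re_RtoC; fold x.
      destruct (saw_coeff_le j) as [K1 _]; rewrite Rabs_right by lra.
      (* The coefficient 2 / freq^2 and the scaling freq^(s + 1) combine, in modulus, to 2 freq^(Re
         s - 1); without moduli this is what makes the limiting series zeta at 1 - s. *)
      assert (Esc : saw_coeff j * Rpower (freq j) (x + 1) = 2 * Rpower (freq j) (x - 1)).
      { unfold saw_coeff, Rdiv; replace (freq j ^ 2) with (Rpower (freq j) 2).
        - rewrite <- Rpower_Ropp, Rmult_assoc, <- Rpower_plus; do 2 f_equal; ring.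
        - replace 2 with (INR 2) at 1 by (simpl; ring); rewrite Rpower_pow by lra; reflexivity. }
      rewrite Esc.
      assert (Hab : 0 < freq j * / T <= freq j * T) by (split; [ apply Rmult_lt_0_compat; lra | apply Rmult_le_compat_l; lra ]).
      eapply Rle_trans; [ apply Rmult_le_compat_l;
        [ apply Rmult_le_pos; [ lra | apply Rlt_le, Rpower_pos ] | apply (cosint_error s _ _ Hs Hab) ] | ].
      fold x.
      rewrite !Rpower_mult_base, Rpower_inv_base by lra.
      assert (Hfj : INR j + 1 <= freq j) by (unfold freq; pose proof PI2_3_2; nra).
      assert (F1 : Rpower (freq j) (- (1 - x / 2)) <= Rpower (INR j + 1) (- (1 - x / 2))) by (apply Rpower_le_base_neg; lra).
      assert (F2 : Rpower (freq j) (Ropp 2) <= Rpower (INR j + 1) (Ropp 2)) by (apply Rpower_le_base_neg; lra).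
      replace (2 * Rpower (freq j) (x - 1) * (4 / - x * (Rpower (freq j) (- x / 2) * Rpower T (- (- x / 2)))
          + 2 / (1 + x) * (Rpower (freq j) (- (1 + x)) * Rpower T (- (1 + x)))))
        with (C1 * Rpower T (- (- x / 2)) * (Rpower (freq j) (x - 1) * Rpower (freq j) (- x / 2))
          + C2 * Rpower T (- (1 + x)) * (Rpower (freq j) (x - 1) * Rpower (freq j) (- (1 + x))))
        by (unfold C1, C2; field; lra).
      rewrite <- !Rpower_plus.
      replace (x - 1 + - x / 2) with (- (1 - x / 2)) by field.
      replace (x - 1 + - (1 + x)) with (Ropp 2) by ring.
      unfold bd; pose proof (Rpower_pos T (- (- x / 2))); pose proof (Rpower_pos T (- (1 + x))).
      apply Rplus_le_compat; (apply Rmult_le_compat_l; [ apply Rmult_le_pos; lra | assumption ]).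
    + apply (ex_series_plus (K := R_AbsRing) (V := R_NormedModule)
        (fun j => C1 * Rpower T (- (- x / 2)) * Rpower (INR j + 1) (- (1 - x / 2)))
        (fun j => C2 * Rpower T (- (1 + x)) * Rpower (INR j + 1) (Ropp 2))); assumption.
  - replace (Finite 0) with (Finite (C1 * 0 * S1 + C2 * 0 * S2)) by (f_equal; ring).
    apply is_lim_seq_plus'; (apply is_lim_seq_mult'; [ apply is_lim_seq_mult'; [ apply is_lim_seq_const | ] | apply is_lim_seq_const ]);
      apply Rpower_lim_0; lra.
Qed.

Lemma cosnum_cdiff (s : C) : -1 < Re s < 3 -> cdiff cosnum s.
Proof.
  intros Hs; unfold cosnum.
  assert (P1 : forall c, cdiff (fun s => s + c)%C s) by (intros; apply cdiff_plus; [ apply cdiff_id | apply cdiff_const ]).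
  apply cdiff_plus; [ apply cdiff_mult; [ apply P1 | apply cdiff_plus ] | apply cdiff_const ].
  - apply (cdiff_comp (fun s => - s)%C (mellin (fun _ => cosker_inv))); [ apply cdiff_opp, cdiff_id | ].
    apply (mellin_cdiff _ _ _ _ cosker_inv_ok); rewrite re_opp; lra.
  - apply (cdiff_comp (fun s => s + 2)%C (mellin (fun _ => cosker))); [ apply P1 | ].
    apply (mellin_cdiff _ _ _ _ cosker_ok); rewrite re_plus, re_RtoC; lra.
Qed.

(** The functional equation with all denominators cleared: holomorphic for -1 < Re s < 2, a strip
    that contains both -1 < Re s < 0, where the equation is derived, and the line Re s = 1, where it
    is used. *)
Definition func_eq_defect (s : C) : C :=
  (zeta_num s - (s + 1) * (2 * xpow (2 * PI) (s - 1)) * cosnum s * zeta_num (1 - s))%C.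

Lemma func_eq_defect_cdiff (s : C) : -1 < Re s < 2 -> cdiff func_eq_defect s.
Proof.
  intros Hs; unfold func_eq_defect.
  assert (P1 : forall c, cdiff (fun s => s + c)%C s) by (intros; apply cdiff_plus; [ apply cdiff_id | apply cdiff_const ]).
  apply cdiff_minus; [ apply zeta_num_cdiff; lra | ].
  apply cdiff_mult; [ apply cdiff_mult; [ apply cdiff_mult | ] | ].
  - apply P1.
  - apply cdiff_mult; [ apply cdiff_const | apply cdiff_xpow, P1 ].
  - apply cosnum_cdiff; lra.
  - apply (cdiff_comp (fun s => 1 - s)%C zeta_num); [ apply cdiff_minus; [ apply cdiff_const | apply cdiff_id ] | ].
    apply zeta_num_cdiff; rewrite re_minus, re_RtoC; lra.
Qed.

Lemma func_eq_strip (s : C) : -1 < Re s < 0 -> func_eq_defect s = RtoC 0.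
Proof.
  intros Hs; unfold func_eq_defect.
  assert (N1 : s <> RtoC 1) by (intros ->; rewrite re_RtoC in Hs; lra).
  assert (N0 : s <> RtoC 0) by (intros ->; rewrite re_RtoC in Hs; lra).
  assert (N2 : (1 - s)%C <> RtoC 1).
  { intros E; apply N0; replace s with (1 - (1 - s))%C by ring; rewrite E; ring. }
  assert (Hn : (s - 1)%C <> RtoC 0) by (apply Cminus_eq_contra, N1).
  assert (Hn' : (1 - s)%C <> RtoC 0) by (apply Cminus_eq_contra; intros E; apply N1; symmetry; exact E).
  assert (H2 : RtoC 2 <> RtoC 0) by (intros E; injection E; lra).
  rewrite (zeta_num_zeta0 (1 - s)%C) by exact N2.
  assert (Ek : cosnum s = ((s - 1) * cosfull s)%C) by (unfold cosnum, cosfull; field; repeat split; assumption).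
  assert (Ez : zeta_num s = (- (s - 1) * s * (s + 1) * (/ 2 * (/ (1 - s) + / s) + mellin (fun _ x => RtoC (saw2 x)) (s + 2)))%C)
    by (unfold zeta_num; field; repeat split; assumption).
  rewrite Ek, Ez, sawint_value by exact Hs; ring.
Qed.

(** Two moves are made, because a square centred in Re s < 0 that keeps to Re s > -1 has half-side
    below 1 and cannot reach Re s = 1. Half-side 65/100 around -3/10 serves all points with Re s <
    3/10; half-side 11/10 around 2/10 then covers [-9/10, 13/10]. *)
Lemma func_eq_line_one (t : R) : func_eq_defect (1, t) = RtoC 0.
Proof.
  assert (S1 : forall z, -1 < Re z < 3 / 10 -> func_eq_defect z = RtoC 0).
  { intros z Hz; destruct (Rlt_le_dec (Re z) 0) as [H|H]; [ apply func_eq_strip; lra | ].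
    apply (vanish_square func_eq_defect (- (3 / 10), Im z) z (65 / 100) (1 / 10)).
    - intros v [[V1 V2] _]; cbn [Re fst] in V1, V2; apply func_eq_defect_cdiff; lra.
    - lra.
    - intros v Hv; apply func_eq_strip.
      pose proof (re_le_Cmod (v - (- (3 / 10), Im z))) as R1; rewrite re_minus in R1; cbn [Re fst] in R1.
      assert (R2 : Rabs (Re v - - (3 / 10)) < 1 / 10) by (unfold Re in *; lra); apply Rabs_def2 in R2; lra.
    - eapply Rle_lt_trans; [ apply Cmod_le_ReIm | ]; rewrite re_minus, im_minus; cbn [Re Im fst snd].
      unfold Re, Im in *; rewrite (Rabs_right (fst z - - (3 / 10))) by lra.
      replace (snd z - snd z) with 0 by ring; rewrite Rabs_R0; lra. }
  apply (vanish_square func_eq_defect (2 / 10, t) (1, t) (11 / 10) (1 / 20)).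
  - intros v [[V1 V2] _]; cbn [Re fst] in V1, V2; apply func_eq_defect_cdiff; lra.
  - lra.
  - intros v Hv; apply S1.
    pose proof (re_le_Cmod (v - (2 / 10, t))) as R1; rewrite re_minus in R1; cbn [Re fst] in R1.
    assert (R2 : Rabs (Re v - 2 / 10) < 1 / 20) by (unfold Re in *; lra); apply Rabs_def2 in R2; lra.
  - eapply Rle_lt_trans; [ apply Cmod_le_ReIm | ]; rewrite re_minus, im_minus; cbn [Re Im fst snd].
    rewrite (Rabs_right (1 - 2 / 10)) by lra; replace (t - t) with 0 by ring; rewrite Rabs_R0; lra.
Qed.

(** In the functional equation at 1 - i t the argument 1 - s is i t, so a zero at i t would force
    one at 1 - i t. *)
Lemma zeta0_line_zero (t : R) : t <> 0 -> zeta0 (0, t) <> RtoC 0.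
Proof.
  intros Ht H0.
  pose proof (func_eq_line_one (- t)) as E; unfold func_eq_defect in E.
  replace (1 - (1, (- t)%R))%C with ((0, t) : C) in E by (apply C_ext; unfold Re, Im; simpl; ring).
  rewrite (zeta_num_zeta0 (0, t)), H0 in E by (intros F; injection F; intros; lra).
  rewrite !Cmult_0_r, Cminus_0_r, zeta_num_zeta0 in E by (intros F; injection F; intros; lra).
  assert (N : (((1, (- t)%R) : C) - 1)%C <> RtoC 0) by (intros F; injection F; intros; lra).
  apply (zeta0_line_one (- t)); [ lra | ].
  replace (zeta0 (1, (- t)%R)) with (/ ((1, (- t)%R) - 1) * (((1, (- t)%R) - 1) * zeta0 (1, (- t)%R)))%C by (field; exact N).
  rewrite E; ring.
Qed.

(** * Wallis and Stirling *)

Definition wallis_int (n : nat) : R := RInt (fun x => sin x ^ n) 0 (PI / 2).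

Lemma continuous_sin_pow (n : nat) (x : R) : continuous (fun x => sin x ^ n) x.
Proof. apply (ex_derive_continuous (V := R_NormedModule) (fun x => sin x ^ n)); auto_derive; exact I. Qed.

(** The derivative of sin^(n+1) cos integrates to 0 over the quarter period. *)
Lemma wallis_int_rec (n : nat) : (INR n + 2) * wallis_int (S (S n)) = (INR n + 1) * wallis_int n.
Proof.
  assert (E : is_RInt (fun x => (INR n + 1) * sin x ^ n - (INR n + 2) * sin x ^ (S (S n))) 0 (PI / 2)
    (sin (PI / 2) ^ S n * cos (PI / 2) - sin 0 ^ S n * cos 0)).
  { apply (is_RInt_derive (V := R_CompleteNormedModule) (fun x => sin x ^ S n * cos x)).
    - intros x _.
      assert (D : is_derive (fun x => sin x ^ S n * cos x) x
        (INR (S n) * cos x * sin x ^ n * cos x + sin x ^ S n * - sin x)).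
      { apply (is_derive_mult (fun x => sin x ^ S n) cos); [ | apply is_derive_cos | apply Rmult_comm ].
        apply (is_derive_pow sin (S n) x (cos x)), is_derive_sin. }
      replace ((INR n + 1) * sin x ^ n - (INR n + 2) * sin x ^ S (S n))
        with (INR (S n) * cos x * sin x ^ n * cos x + sin x ^ S n * - sin x); [ exact D | ].
      rewrite S_INR; pose proof (sin2_cos2 x) as H; unfold Rsqr in H; simpl pow.
      replace ((INR n + 1) * cos x * sin x ^ n * cos x) with ((INR n + 1) * sin x ^ n * (cos x * cos x)) by ring.
      replace (cos x * cos x) with (1 - sin x * sin x) by lra; ring.
    - intros x _; apply (continuous_minus (fun x => (INR n + 1) * sin x ^ n) (fun x => (INR n + 2) * sin x ^ S (S n)));
        apply (continuous_scal_r (K := R_AbsRing) (V := R_NormedModule)); apply continuous_sin_pow. }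
  replace (sin (PI / 2) ^ S n * cos (PI / 2) - sin 0 ^ S n * cos 0) with 0 in E by (rewrite cos_PI2, sin_0; simpl; ring).
  assert (E2 : is_RInt (fun x => (INR n + 1) * sin x ^ n - (INR n + 2) * sin x ^ (S (S n))) 0 (PI / 2)
    ((INR n + 1) * wallis_int n - (INR n + 2) * wallis_int (S (S n)))).
  { apply (is_RInt_minus (V := R_NormedModule) (fun x => (INR n + 1) * sin x ^ n));
      apply (is_RInt_scal (V := R_NormedModule)), (RInt_correct (V := R_CompleteNormedModule)), ex_RInt_cont, continuous_sin_pow. }
  pose proof (is_RInt_unique (V := R_CompleteNormedModule) _ _ _ _ E) as U1.
  pose proof (is_RInt_unique (V := R_CompleteNormedModule) _ _ _ _ E2) as U2.
  rewrite U1 in U2; lra.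
Qed.

Lemma wallis_int_decr (n : nat) : wallis_int (S n) <= wallis_int n.
Proof.
  pose proof PI_RGT_0; apply RInt_le; [ lra | apply ex_RInt_cont, continuous_sin_pow | apply ex_RInt_cont, continuous_sin_pow | ].
  intros x Hx; simpl; assert (0 <= sin x) by (apply sin_ge_0; lra); pose proof (SIN_bound x).
  assert (0 <= sin x ^ n) by (apply pow_le; assumption); nra.
Qed.

(** 4^M (M!)^2 / (2 M)!, in the recursive form that [wallis_int_rec] produces. *)
Fixpoint wallis (M : nat) : R :=
  match M with O => 1 | S m => wallis m * ((2 * INR m + 2) / (2 * INR m + 1)) end.

Lemma wallis_pos (M : nat) : 0 < wallis M.
Proof.
  induction M as [|M IH]; simpl; [ lra | pose proof (pos_INR M) ].
  apply Rmult_lt_0_compat; [ exact IH | apply Rdiv_lt_0_compat; lra ].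
Qed.

Lemma wallis_int_even (M : nat) : wallis_int (2 * M) * wallis M = PI / 2.
Proof.
  induction M as [|M IH].
  - simpl; unfold wallis_int; rewrite (RInt_ext _ (fun _ => 1)) by (intros; reflexivity).
    rewrite RInt_const; unfold scal; simpl; unfold mult; simpl; field.
  - replace (2 * S M)%nat with (S (S (2 * M))) by lia; simpl wallis.
    pose proof (wallis_int_rec (2 * M)) as R; rewrite mult_INR in R; simpl (INR 2) in R; pose proof (pos_INR M).
    rewrite <- IH; replace (wallis_int (S (S (2 * M)))) with ((2 * INR M + 1) * wallis_int (2 * M) / (2 * INR M + 2))
      by (apply (Rmult_eq_reg_l (2 * INR M + 2)); [ | lra ]; replace (1 + 1) with 2 in R by ring; rewrite R; field; lra).
    field; lra.
Qed.

Lemma wallis_int_odd (M : nat) : (2 * INR M + 1) * wallis_int (S (2 * M)) = wallis M.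
Proof.
  induction M as [|M IH].
  - simpl INR; simpl wallis; unfold wallis_int.
    assert (E : is_RInt (fun x => sin x ^ S (2 * 0)) 0 (PI / 2) (- cos (PI / 2) - - cos 0)).
    { apply (is_RInt_ext (V := R_NormedModule) sin); [ intros; simpl; ring | ].
      apply (is_RInt_derive (V := R_CompleteNormedModule) (fun x => - cos x) sin).
      - intros x _; auto_derive; [ exact I | ring ].
      - intros x _; apply continuous_sin. }
    rewrite (is_RInt_unique (V := R_CompleteNormedModule) _ _ _ _ E), cos_PI2, cos_0; ring.
  - replace (S (2 * S M)) with (S (S (S (2 * M)))) by lia; simpl wallis.
    pose proof (wallis_int_rec (S (2 * M))) as R; rewrite S_INR, mult_INR in R; simpl (INR 2) in R; pose proof (pos_INR M).
    rewrite <- IH, S_INR; replace (2 * (INR M + 1) + 1) with ((1 + 1) * INR M + 1 + 2) by ring.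
    rewrite R; field; lra.
Qed.

(** The sine integrals of exponents 2 M, 2 M + 1 and 2 M + 2 decrease; the outer ones are PI / 2
    over a Wallis product, the middle one is a Wallis product over 2 M + 1. *)
Lemma wallis_bounds (M : nat) : (0 < M)%nat ->
  PI * INR M <= wallis M ^ 2 <= PI * (INR M + / 2).
Proof.
  intros HM; pose proof (lt_0_INR M HM) as PM; pose proof (wallis_pos M) as PW; pose proof PI_RGT_0 as HPI.
  pose proof (wallis_int_even M) as E1; pose proof (wallis_int_odd M) as E2.
  pose proof (wallis_int_even (S M)) as E3.
  pose proof (wallis_int_decr (2 * M)) as D1; pose proof (wallis_int_decr (S (2 * M))) as D2.
  replace (2 * S M)%nat with (S (S (2 * M))) in E3 by lia; simpl wallis in E3.
  set (a := wallis_int (2 * M)) in *; set (b := wallis_int (S (2 * M))) in *; set (c := wallis_int (S (S (2 * M)))) in *.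
  set (w := wallis M) in *; set (m := INR M) in *.
  assert (Hb : b = w / (2 * m + 1)) by (rewrite <- E2; field; lra).
  assert (Ha : a = PI / 2 / w) by (rewrite <- E1; field; lra).
  assert (Hc : c = PI / 2 / (w * ((2 * m + 2) / (2 * m + 1)))) by (rewrite <- E3; field; lra).
  split.
  - rewrite Hb, Hc in D2.
    apply (Rmult_le_compat_r (w * (2 * m + 2))) in D2; [ | nra ].
    replace (PI / 2 / (w * ((2 * m + 2) / (2 * m + 1))) * (w * (2 * m + 2))) with (PI / 2 * (2 * m + 1)) in D2 by (field; lra).
    replace (w / (2 * m + 1) * (w * (2 * m + 2))) with (w ^ 2 * (2 * m + 2) / (2 * m + 1)) in D2 by (field; lra).
    apply (Rmult_le_compat_r (2 * m + 1)) in D2; [ | lra ].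
    replace (w ^ 2 * (2 * m + 2) / (2 * m + 1) * (2 * m + 1)) with (w ^ 2 * (2 * m + 2)) in D2 by (field; lra).
    apply (Rmult_le_reg_r (2 * m + 2)); [ lra | nra ].
  - rewrite Hb, Ha in D1.
    apply (Rmult_le_compat_r (w * (2 * m + 1))) in D1; [ | nra ].
    replace (w / (2 * m + 1) * (w * (2 * m + 1))) with (w ^ 2) in D1 by (field; lra).
    replace (PI / 2 / w * (w * (2 * m + 1))) with (PI * (m + / 2)) in D1 by (field; lra); exact D1.
Qed.

(** * Stirling's constant *)

Definition lnfact (n : nat) : R := ln (INR (fact n)).

Lemma lnfact_S (n : nat) : lnfact (S n) = ln (INR n + 1) + lnfact n.
Proof.
  unfold lnfact; change (fact (S n)) with (S n * fact n)%nat; rewrite mult_INR, S_INR, ln_mult; [ reflexivity | | ].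
  - pose proof (pos_INR n); lra.
  - apply lt_0_INR, lt_O_fact.
Qed.

Lemma ln_wallis (M : nat) : ln (wallis M) = 2 * INR M * ln 2 + 2 * lnfact M - lnfact (2 * M).
Proof.
  induction M as [|M IH].
  - simpl; unfold lnfact; simpl; rewrite ln_1; ring.
  - pose proof (pos_INR M) as PM; simpl wallis.
    rewrite ln_mult, IH by (apply wallis_pos || (apply Rdiv_lt_0_compat; lra)).
    rewrite ln_div by lra; replace (2 * S M)%nat with (S (S (2 * M))) by lia.
    rewrite !lnfact_S, !S_INR, mult_INR; simpl (INR 2).
    replace ((1 + 1) * INR M + 1 + 1) with (2 * (INR M + 1)) by ring.
    replace ((1 + 1) * INR M + 1) with (2 * INR M + 1) by ring.
    replace (2 * INR M + 2) with (2 * (INR M + 1)) by ring.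
    rewrite (ln_mult 2) by lra; ring.
Qed.

Lemma saw2_mellin_2_term (n : nat) :
  mellin_term (fun _ x => RtoC (saw2 x)) n 2 =
  RtoC (1 - (INR n + 3 / 2) * (ln (INR n + 2) - ln (INR n + 1))).
Proof.
  pose proof (pos_INR n) as Hn; set (m := INR n + 1).
  replace (INR n + 2) with (m + 1) by (unfold m; ring).
  unfold mellin_term; replace (INR n + 2) with (m + 1) by (unfold m; ring); fold m.
  assert (Hm : 1 <= m) by (unfold m; lra).
  set (p := fun x => ((x - m) * (x - m) - (x - m)) / 2).
  rewrite (CInt_ext _ (fun x => RtoC (p x / x ^ 2))).
  - rewrite CInt_RtoC; f_equal.
    set (F := fun x => - p x / x + (x - (m + / 2) * ln x)).
    assert (E : is_RInt (fun x => p x / x ^ 2) m (m + 1) (F (m + 1) - F m)).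
    { apply (is_RInt_derive (V := R_CompleteNormedModule) F); rewrite Rmin_left, Rmax_right by lra; intros x Hx.
      - unfold F, p; auto_derive; [ lra | field; lra ].
      - apply (ex_derive_continuous (V := R_NormedModule) (fun x => p x / x ^ 2)); unfold p; auto_derive; nra. }
    rewrite (is_RInt_unique (V := R_CompleteNormedModule) _ _ _ _ E); unfold F, p.
    replace (INR n + 3 / 2) with (m + / 2) by (unfold m; field); req; field; lra.
  - lra.
  - intros x Hx; unfold p; rewrite (saw2_nat (S n)) by (rewrite S_INR; fold m; lra); rewrite S_INR; fold m.
    rewrite <- RtoC_opp, xpow_RtoC, <- RtoC_mult; f_equal.
    change (- (2)) with (Ropp 2); rewrite Rpower_m2 by lra; reflexivity.
Qed.

Lemma saw2_mellin_2_partial (N : nat) :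
  csum (fun n => mellin_term (fun _ x => RtoC (saw2 x)) n 2) N =
  RtoC (INR N - (INR N + 3 / 2) * ln (INR N + 1) + lnfact (S N)).
Proof.
  induction N as [|N IH].
  - simpl csum; f_equal; unfold lnfact; simpl; rewrite !Rplus_0_l, ln_1; ring.
  - simpl csum; rewrite IH, saw2_mellin_2_term, <- RtoC_plus; f_equal.
    rewrite (lnfact_S (S N)), S_INR; replace (INR N + 1 + 1) with (INR N + 2) by ring; ring.
Qed.

(** Stirling's formula: the partial integrals are the logarithm of a factorial minus its leading
    terms, so the value is Stirling's constant ln (2 PI) / 2 minus 1. It enters the mean value
    [c_beta b 0]. *)
Lemma saw2_mellin_2 : mellin (fun _ x => RtoC (saw2 x)) 2 = RtoC (ln (2 * PI) / 2 - 1).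
Proof.
  pose proof (mellin_series _ _ _ 2 saw2_mellin_ok ltac:(rewrite re_RtoC; lra)) as HS.
  set (c := mellin (fun _ x => RtoC (saw2 x)) 2) in *; clearbody c.
  pose proof (proj1 (Clim_Re_Im _ _) HS) as [L1 L2].
  pose proof PI_RGT_0 as HPI.
  assert (Ic : Im c = 0).
  { apply is_lim_seq_unique in L2; rewrite (Lim_seq_ext _ (fun _ => 0)) in L2.
    - rewrite Lim_seq_const in L2; injection L2; intros E; symmetry; exact E.
    - intros n; rewrite saw2_mellin_2_partial, im_RtoC; reflexivity. }
  set (a := fun M => lnfact M - (INR M + / 2) * ln (INR M) + INR M).
  assert (La : is_lim_seq a (Re c + 1)).
  { apply is_lim_seq_incr_1; apply (is_lim_seq_ext (fun n => Re (csum (fun n => mellin_term (fun _ x => RtoC (saw2 x)) n 2) n) + 1)).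
    - intros N; rewrite saw2_mellin_2_partial, re_RtoC; unfold a; rewrite S_INR; field.
    - apply is_lim_seq_plus'; [ exact L1 | apply is_lim_seq_const ]. }
  assert (L2a : is_lim_seq (fun M => a (2 * M)%nat) (Re c + 1)).
  { apply (is_lim_seq_subseq a _ (fun M => (2 * M)%nat)); [ | exact La ].
    apply eventually_subseq; intros; lia. }
  (* The combination 2 a(M) - a(2 M) has the same limit as a, and in it the factorials combine to
     the Wallis product. *)
  assert (Lw : is_lim_seq (fun M => 2 * a (S M) - a (2 * S M)%nat) (2 * (Re c + 1) - (Re c + 1))).
  { apply (is_lim_seq_incr_1 (fun M => 2 * a M - a (2 * M)%nat)), is_lim_seq_minus'; [ | exact L2a ].
    apply is_lim_seq_mult'; [ apply is_lim_seq_const | exact La ]. }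
  assert (Lv : is_lim_seq (fun M => 2 * a (S M) - a (2 * S M)%nat) (ln (2 * PI) / 2)).
  { assert (E : forall M, 2 * a (S M) - a (2 * S M)%nat = (ln (wallis (S M) ^ 2 / INR (S M)) + ln 2) / 2).
    { intros M; pose proof (wallis_pos (S M)) as PW; pose proof (lt_0_INR (S M) ltac:(lia)) as PM.
      rewrite ln_div, ln_pow by (assumption || apply pow_lt, PW); rewrite ln_wallis; unfold a.
      rewrite mult_INR; replace (INR 2) with 2 by (simpl; ring); rewrite ln_mult by lra; field. }
    apply (is_lim_seq_le_le (fun _ => (ln PI + ln 2) / 2) _ (fun M => (ln PI + ln (1 + / 2 * / (INR M + 1)) + ln 2) / 2)).
    - intros M; rewrite E; destruct (wallis_bounds (S M) ltac:(lia)) as [B1 B2].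
      pose proof (lt_0_INR (S M) ltac:(lia)) as PM.
      assert (K1 : PI <= wallis (S M) ^ 2 / INR (S M)).
      { apply (Rmult_le_reg_r (INR (S M))); [ exact PM | unfold Rdiv; rewrite Rmult_assoc, Rinv_l, Rmult_1_r by lra; exact B1 ]. }
      assert (Pi : 0 < / (INR M + 1)) by (apply Rinv_0_lt_compat; pose proof (pos_INR M); lra).
      assert (K2 : wallis (S M) ^ 2 / INR (S M) <= PI * (1 + / 2 * / (INR M + 1))).
      { apply (Rmult_le_reg_r (INR (S M))); [ exact PM | unfold Rdiv; rewrite Rmult_assoc, Rinv_l, Rmult_1_r by lra ].
        eapply Rle_trans; [ exact B2 | right ]; rewrite S_INR in *; field; lra. }
      split.
      + assert (ln PI <= ln (wallis (S M) ^ 2 / INR (S M))) by (apply ln_le'; lra); lra.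
      + rewrite <- (ln_mult PI (1 + / 2 * / (INR M + 1))) by lra.
        assert (ln (wallis (S M) ^ 2 / INR (S M)) <= ln (PI * (1 + / 2 * / (INR M + 1)))) by (apply ln_le'; lra); lra.
    - replace (ln (2 * PI) / 2) with ((ln PI + ln 2) / 2) by (rewrite ln_mult by lra; field); apply is_lim_seq_const.
    - replace (ln (2 * PI) / 2) with ((ln PI + ln (1 + / 2 * 0) + ln 2) * / 2)
        by (rewrite Rmult_0_r, Rplus_0_r, ln_1, ln_mult by lra; field).
      apply is_lim_seq_mult'; [ | apply is_lim_seq_const ].
      apply is_lim_seq_plus'; [ apply is_lim_seq_plus'; [ apply is_lim_seq_const | ] | apply is_lim_seq_const ].
      apply (is_lim_seq_continuous ln (fun M => 1 + / 2 * / (INR M + 1)) (1 + / 2 * 0)).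
      + apply continuity_pt_filterlim, continuous_ln_pos; lra.
      + apply is_lim_seq_plus'; [ apply is_lim_seq_const | apply is_lim_seq_mult'; [ apply is_lim_seq_const | ] ].
        apply (is_lim_seq_ext (fun n => Rpower (INR n + 1) (- (1)))); [ | apply Rpower_lim_0; lra ].
        intros n; pose proof (pos_INR n); rewrite Rpower_Ropp, Rpower_1 by lra; reflexivity. }
  apply is_lim_seq_unique in Lw, Lv; rewrite Lv in Lw; injection Lw; intros Ec.
  apply C_ext; rewrite ?re_RtoC, ?im_RtoC; [ lra | exact Ic ].
Qed.

(** * The Delange-type function in closed form *)

Definition bpow (b v : R) : R := exp (v * ln b).

(** In the variable x = b^v the measure dv is dx / (x ln b), so integrating [wave] integrates saw2 x
    / x^2: this is the x^(-2) of the Euler-Maclaurin formula. *)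
Definition wave (b v : R) : R := saw2 (bpow b v) / bpow b v.

Definition wsum (b u : R) : R := Series (fun j => wave b (u + INR j)).

(* For [0 <= u <= 1] this is the value of [h_beta] (see [h_beta_hper]); the formula is 1-periodic
   on [u <= 1] only, because [saw2 x = (x^2 - x) / 2] on [0, 1]. *)
Definition h0 (b u : R) : R := (b - 1) * (wsum b u + bpow b u / (2 * (b - 1)) - u / 2) - / 2.

Definition hper (b u : R) : R := h0 b (frac_part u).

Lemma bpow_pos (b v : R) : 0 < bpow b v.
Proof. apply exp_pos. Qed.

Lemma bpow_plus (b v w : R) : bpow b (v + w) = bpow b v * bpow b w.
Proof. unfold bpow; rewrite <- exp_plus; f_equal; ring. Qed.

Lemma bpow_opp (b v : R) : bpow b (- v) = / bpow b v.
Proof. unfold bpow; rewrite <- exp_Ropp; f_equal; ring. Qed.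

Lemma bpow_1 (b : R) : 1 < b -> bpow b 1 = b.
Proof. intros H; unfold bpow; rewrite Rmult_1_l; apply exp_ln; lra. Qed.

Lemma bpow_0 (b : R) : bpow b 0 = 1.
Proof. unfold bpow; rewrite Rmult_0_l; apply exp_0. Qed.

Lemma ln_gt_0 (b : R) : 1 < b -> 0 < ln b.
Proof. intros H; rewrite <- ln_1; apply ln_increasing; lra. Qed.

Lemma bpow_le (b v w : R) : 1 < b -> v <= w -> bpow b v <= bpow b w.
Proof. intros H Hvw; apply exp_le; pose proof (ln_gt_0 b H); nra. Qed.

Lemma bpow_nat (b : R) (j : nat) : 1 < b -> bpow b (INR j) = b ^ j.
Proof. intros H; apply (Rpower_pow j b); lra. Qed.

Lemma bpow_opp_nat (b : R) (j : nat) : 1 < b -> bpow b (- INR j) = (/ b) ^ j.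
Proof. intros H; rewrite bpow_opp, bpow_nat, pow_inv by exact H; reflexivity. Qed.

Lemma wave_bound (b v : R) : Rabs (wave b v) <= / 8 * bpow b (- v).
Proof.
  unfold wave, Rdiv; rewrite Rabs_mult, bpow_opp.
  pose proof (bpow_pos b v) as H; assert (0 < / bpow b v) by (apply Rinv_0_lt_compat, H).
  rewrite (Rabs_right (/ bpow b v)) by lra.
  apply Rmult_le_compat_r; [ lra | pose proof (saw2_bound (bpow b v)); lra ].
Qed.

Lemma wave_bound_nat (b u : R) (j : nat) : 1 < b -> Rabs (wave b (u + INR j)) <= / 8 * bpow b (- u) * (/ b) ^ j.
Proof.
  intros H; eapply Rle_trans; [ apply wave_bound | right ].
  replace (- (u + INR j)) with (- u + - INR j) by ring; rewrite bpow_plus, bpow_opp_nat by exact H; ring.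
Qed.

Lemma ex_series_inv_geom (b c : R) : 1 < b -> ex_series (fun j => c * (/ b) ^ j).
Proof.
  intros H; apply (ex_series_scal_l (K := R_AbsRing) c (fun j => (/ b) ^ j)), ex_series_geom.
  rewrite Rabs_right by (apply Rle_ge, Rlt_le, Rinv_0_lt_compat; lra).
  rewrite <- Rinv_1; apply Rinv_lt_contravar; lra.
Qed.

Lemma wave_ex_series (b u : R) : 1 < b -> ex_series (fun j => wave b (u + INR j)).
Proof.
  intros H; apply (ex_series_le (K := R_AbsRing) (V := R_CompleteNormedModule) _ (fun j => / 8 * bpow b (- u) * (/ b) ^ j)).
  - intros j; apply (wave_bound_nat b u j H).
  - apply ex_series_inv_geom, H.
Qed.

(** The shift brings in one new term, taken at b^(u-1) <= 1, where [saw2] is a polynomial. The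
    corrections b^u / (2 (b - 1)) and u / 2 absorb its value (b^(u-1) - 1) / 2. *)
Lemma h0_shift (b u : R) : 1 < b -> u <= 1 -> h0 b (u - 1) = h0 b u.
Proof.
  intros Hb Hu; unfold h0.
  assert (E : wsum b (u - 1) = wave b (u - 1) + wsum b u).
  { unfold wsum; rewrite Series_incr_1 by (apply wave_ex_series, Hb); f_equal.
    - f_equal; simpl; ring.
    - apply Series_ext; intros j; f_equal; rewrite S_INR; ring. }
  set (y := bpow b (u - 1)) in *.
  assert (Py : 0 < y) by apply bpow_pos.
  assert (Ly : y <= 1) by (rewrite <- (bpow_0 b); apply bpow_le; lra).
  assert (Ey : bpow b u = b * y).
  { replace u with (u - 1 + 1) by ring; rewrite bpow_plus, bpow_1 by exact Hb; unfold y; ring. }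
  assert (Ew : wave b (u - 1) = (y - 1) / 2).
  { unfold wave; fold y; rewrite (saw2_on 0) by (simpl; lra); simpl; rewrite Rminus_0_r; field; lra. }
  rewrite E, Ew, Ey; field; lra.
Qed.

Lemma h0_shift_nat (b u : R) (k : nat) : 1 < b -> u <= 1 -> h0 b (u - INR k) = h0 b u.
Proof.
  intros Hb Hu; induction k as [|k IH]; [ simpl; f_equal; ring | ].
  rewrite S_INR; replace (u - (INR k + 1)) with (u - INR k - 1) by ring.
  pose proof (pos_INR k); rewrite h0_shift by (try exact Hb; lra); exact IH.
Qed.

(** Any n with u - n <= 1 may serve, not only the integer part, so two points on different sides of
    an integer can be compared with the same n. *)
Lemma hper_h0 (b u : R) (n : Z) : 1 < b -> u - IZR n <= 1 -> hper b u = h0 b (u - IZR n).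
Proof.
  intros Hb Hu; unfold hper; pose proof (Int_part_bounds u) as HI; set (m := Int_part u) in *.
  assert (Ef : frac_part u = u - IZR m) by (apply frac_part_shift, HI); rewrite Ef.
  destruct (Z_le_gt_dec m n) as [H|H].
  - replace (u - IZR n) with (u - IZR m - INR (Z.to_nat (n - m)))
      by (rewrite INR_IZR_INZ, Z2Nat.id, minus_IZR by lia; ring).
    symmetry; apply h0_shift_nat; [ exact Hb | lra ].
  - assert (H1 : (n + 1 <= m)%Z) by lia; apply IZR_le in H1; rewrite plus_IZR in H1.
    replace (u - IZR m) with (u - IZR n - 1) by lra; apply h0_shift; [ exact Hb | exact Hu ].
Qed.

Lemma hper_periodic (b u : R) : 1 < b -> hper b (u + 1) = hper b u.
Proof.
  intros Hb; pose proof (Int_part_bounds u) as HI.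
  rewrite (hper_h0 b u (Int_part u)), (hper_h0 b (u + 1) (Int_part u + 1)) by (rewrite ?plus_IZR; try exact Hb; lra).
  rewrite plus_IZR; f_equal; ring.
Qed.

Lemma exp_sub1_le (t : R) : Rabs (exp t - 1) <= Rabs t * exp (Rabs t).
Proof.
  pose proof (Cexp_sub1_le (RtoC t)) as H; rewrite Cexp_RtoC, <- RtoC_minus, !Cmod_R in H; exact H.
Qed.

Definition bpow_lip_const (b : R) : R := ln b * exp (2 * ln b).

Lemma bpow_lip_rel (b v w : R) : 1 < b -> Rabs (v - w) <= 2 ->
  Rabs (bpow b v - bpow b w) <= bpow b w * (bpow_lip_const b * Rabs (v - w)).
Proof.
  intros Hb Hd; pose proof (ln_gt_0 b Hb) as Hl.
  replace (bpow b v - bpow b w) with (bpow b w * (exp ((v - w) * ln b) - 1)).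
  - rewrite Rabs_mult, (Rabs_right (bpow b w)) by (apply Rle_ge, Rlt_le, bpow_pos).
    apply Rmult_le_compat_l; [ apply Rlt_le, bpow_pos | ].
    eapply Rle_trans; [ apply exp_sub1_le | ].
    rewrite Rabs_mult, (Rabs_right (ln b)) by lra; unfold bpow_lip_const.
    replace (ln b * exp (2 * ln b) * Rabs (v - w)) with (Rabs (v - w) * ln b * exp (2 * ln b)) by ring.
    apply Rmult_le_compat_l; [ pose proof (Rabs_pos (v - w)); nra | apply exp_le; nra ].
  - unfold bpow; replace (v * ln b) with (w * ln b + (v - w) * ln b) by ring; rewrite exp_plus; ring.
Qed.

Lemma bpow_lip_const_pos (b : R) : 1 < b -> 0 < bpow_lip_const b.
Proof. intros Hb; apply Rmult_lt_0_compat; [ apply ln_gt_0, Hb | apply exp_pos ]. Qed.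

(** [saw2] is Lipschitz, and a change of v changes b^v in proportion to b^v; dividing by b^v leaves
    a constant that is uniform for exponents at least -1. *)
Lemma wave_lip (b v w : R) : 1 < b -> -1 <= v -> -1 <= w -> Rabs (v - w) <= 2 ->
  Rabs (wave b v - wave b w) <= (/ 2 + b / 8) * bpow_lip_const b * Rabs (v - w).
Proof.
  intros Hb Hv Hw Hd.
  pose proof (bpow_lip_rel b v w Hb Hd) as HL.
  pose proof (bpow_pos b v) as PX; pose proof (bpow_pos b w) as PY.
  assert (HX : / b <= bpow b v).
  { rewrite <- (bpow_1 b Hb) at 1; rewrite <- bpow_opp; apply bpow_le; assumption. }
  unfold wave; set (X := bpow b v) in *; set (Y := bpow b w) in *.
  replace (saw2 X / X - saw2 Y / Y) with ((saw2 X - saw2 Y) / Y + saw2 X * ((Y - X) / Y * / X)) by (field; lra).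
  set (D := bpow_lip_const b * Rabs (v - w)) in *.
  assert (PD : 0 <= D) by (apply Rmult_le_pos; [ apply Rlt_le, bpow_lip_const_pos, Hb | apply Rabs_pos ]).
  assert (HD : Rabs (X - Y) / Y <= D).
  { apply (Rmult_le_reg_r Y); [ exact PY | unfold Rdiv; rewrite Rmult_assoc, Rinv_l by lra; lra ]. }
  assert (HiX : / X <= b).
  { rewrite <- (Rinv_inv b); apply Rinv_le_contravar; [ apply Rinv_0_lt_compat; lra | exact HX ]. }
  assert (PiX : 0 < / X) by (apply Rinv_0_lt_compat, PX).
  assert (PiY : 0 < / Y) by (apply Rinv_0_lt_compat, PY).
  eapply Rle_trans; [ apply Rabs_triang | ].
  unfold Rdiv; rewrite !Rabs_mult, (Rabs_right (/ Y)), (Rabs_right (/ X)), (Rabs_minus_sym Y X) by lra.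
  fold (Rdiv (Rabs (X - Y)) Y).
  pose proof (saw2_lip X Y) as S1; pose proof (saw2_bound X) as S2; pose proof (Rabs_pos (saw2 X)) as S3.
  assert (B1 : Rabs (saw2 X - saw2 Y) * / Y <= / 2 * D).
  { apply Rle_trans with (Rabs (X - Y) / 2 * / Y); [ apply Rmult_le_compat_r; lra | unfold Rdiv in *; lra ]. }
  assert (Q0 : 0 <= Rabs (X - Y) / Y) by (apply Rmult_le_pos; [ apply Rabs_pos | lra ]).
  assert (B2 : Rabs (saw2 X) * (Rabs (X - Y) / Y * / X) <= / 8 * (D * b)).
  { apply Rmult_le_compat; [ exact S3 | apply Rmult_le_pos; lra | lra | apply Rmult_le_compat; lra ]. }
  replace ((/ 2 + b * / 8) * bpow_lip_const b * Rabs (v - w)) with (/ 2 * D + / 8 * (D * b)) by (unfold D; ring).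
  lra.
Qed.

(** Geometric interpolation; A will be small in the distance of two points, B in the index of a
    term. *)
Lemma interp_le (m A B a : R) : 0 < a < 1 -> 0 <= m -> m <= A -> m <= B -> 0 < A -> 0 < B ->
  m <= Rpower A a * Rpower B (1 - a).
Proof.
  intros Ha H0 HA HB PA PB; destruct H0 as [H0| <-].
  - rewrite <- (Rpower_1 m H0) at 1; replace 1 with (a + (1 - a)) at 1 by ring; rewrite Rpower_plus.
    apply Rmult_le_compat; try (apply Rlt_le, Rpower_pos); apply Rle_Rpower_l; lra.
  - apply Rmult_le_pos; apply Rlt_le, Rpower_pos.
Qed.

Lemma Rpower_pow_base (x e : R) (j : nat) : 0 < x -> Rpower (x ^ j) e = Rpower x e ^ j.
Proof.
  intros Hx; rewrite <- !Rpower_pow, !Rpower_mult by (exact Hx || apply Rpower_pos); f_equal; ring.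
Qed.

(** The j-th term has a Lipschitz bound without decay in j and a supremum bound of order b^(-j).
    Interpolation gives |u - v|^a times b^(-(1 - a) j), which is summable because a < 1. *)
Lemma h0_holder (b a : R) : 1 < b -> 0 < a < 1 ->
  exists K, 0 <= K /\ forall u v, -1 <= u <= 1 -> -1 <= v <= 1 -> u <> v ->
    Rabs (h0 b u - h0 b v) <= K * Rpower (Rabs (u - v)) a.
Proof.
  intros Hb Ha.
  set (L1 := (/ 2 + b / 8) * bpow_lip_const b).
  pose proof (bpow_lip_const_pos b Hb) as PL.
  assert (P1 : 0 < L1) by (apply Rmult_lt_0_compat; lra).
  set (q := Rpower (/ b) (1 - a)).
  assert (Pib : 0 < / b) by (apply Rinv_0_lt_compat; lra).
  assert (Hq : 0 < q < 1).
  { split; [ apply Rpower_pos | ]; unfold q; rewrite Rpower_inv_base by lra.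
    apply (Rlt_le_trans _ (Rpower b 0)); [ apply Rpower_lt; lra | rewrite Rpower_O; lra ]. }
  (* The interpolated bounds form a geometric series of ratio q; b / 4 is twice the supremum bound b
     / 8 of the term j = 0 on [-1, 1]. *)
  set (W := Rpower L1 a * Rpower (b / 4) (1 - a) * / (1 - q)).
  set (K := (b - 1) * (W + b * bpow_lip_const b * 2 / (2 * (b - 1)) + 1)).
  assert (PW : 0 < W).
  { unfold W; repeat apply Rmult_lt_0_compat; try apply Rpower_pos; apply Rinv_0_lt_compat; lra. }
  assert (PK : 0 <= b * bpow_lip_const b * 2 / (2 * (b - 1))) by (apply Rdiv_le_0_compat; nra).
  exists K; split; [ unfold K; nra | intros u v Hu Hv Huv ].
  set (d := Rabs (u - v)).
  assert (Pd : 0 < d) by (apply Rabs_pos_lt; lra).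
  assert (Ld : d <= 2) by (apply Rabs_le; lra).
  assert (Hd : d <= 2 * Rpower d a).
  { assert (E : d = Rpower d (1 - a) * Rpower d a) by (rewrite <- Rpower_plus; replace (1 - a + a) with 1 by ring; rewrite Rpower_1; lra).
    rewrite E at 1; apply Rmult_le_compat_r; [ apply Rlt_le, Rpower_pos | ].
    apply Rle_trans with (Rpower 2 (1 - a)); [ apply Rle_Rpower_l; lra | ].
    rewrite <- (Rpower_1 2) at 2 by lra; apply Rpower_le_exp; lra. }
  assert (Ed : Rabs (u - v) = d) by reflexivity.
  assert (HW : Rabs (wsum b u - wsum b v) <= W * Rpower d a).
  { unfold wsum; rewrite <- Series_minus by (apply wave_ex_series, Hb).
    set (g := fun j : nat => Rpower (L1 * d) a * Rpower (b / 4) (1 - a) * q ^ j).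
    assert (Eg : ex_series g).
    { apply (ex_series_scal_l (K := R_AbsRing) (Rpower (L1 * d) a * Rpower (b / 4) (1 - a)) (fun j => q ^ j)), ex_series_geom.
      rewrite Rabs_right; lra. }
    assert (Hj : forall j, Rabs (wave b (u + INR j) - wave b (v + INR j)) <= g j).
    { intros j; pose proof (pos_INR j) as Pj; unfold g.
      assert (Pbj : 0 < (/ b) ^ j) by (apply pow_lt, Pib).
      assert (Eq : Rpower (b / 4) (1 - a) * q ^ j = Rpower (b / 4 * (/ b) ^ j) (1 - a)).
      { unfold q; rewrite <- Rpower_pow_base, Rpower_mult_base by lra; reflexivity. }
      rewrite Rmult_assoc, Eq; apply interp_le; try exact Ha; try nra.
      - apply Rabs_pos.
      - unfold L1; eapply Rle_trans; [ apply wave_lip; try exact Hb; try lra | ].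
        + replace (u + INR j - (v + INR j)) with (u - v) by ring; exact Ld.
        + replace (u + INR j - (v + INR j)) with (u - v) by ring; apply Rle_refl.
      - assert (Bw : forall t, -1 <= t <= 1 -> Rabs (wave b (t + INR j)) <= b / 8 * (/ b) ^ j).
        { intros t Ht; eapply Rle_trans; [ apply wave_bound_nat, Hb | ].
          assert (bpow b (- t) <= b) by (rewrite <- (bpow_1 b Hb) at 2; apply bpow_le; lra).
          apply Rmult_le_compat_r; lra. }
        pose proof (Bw u Hu); pose proof (Bw v Hv).
        eapply Rle_trans; [ apply Rabs_triang | rewrite Rabs_Ropp ]; lra. }
    assert (Ex : ex_series (fun j => Rabs (wave b (u + INR j) - wave b (v + INR j)))).
    { apply (ex_series_le (K := R_AbsRing) (V := R_CompleteNormedModule) _ g); [ | exact Eg ].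
      intros j; unfold norm; simpl; unfold abs; simpl; rewrite Rabs_Rabsolu; apply Hj. }
    eapply Rle_trans; [ apply Series_Rabs, Ex | ].
    eapply Rle_trans; [ apply (Series_le _ g); [ intros j; split; [ apply Rabs_pos | apply Hj ] | exact Eg ] | right ].
    unfold g; rewrite Series_scal_l, Series_geom by (rewrite Rabs_right; lra).
    rewrite Rpower_mult_base by lra; unfold W; ring. }
  assert (HB : Rabs (bpow b u - bpow b v) <= b * bpow_lip_const b * d).
  { eapply Rle_trans; [ apply bpow_lip_rel; [ exact Hb | exact Ld ] | ].
    rewrite Ed, Rmult_assoc; apply Rmult_le_compat_r; [ nra | ].
    rewrite <- (bpow_1 b Hb) at 2; apply bpow_le; lra. }
  unfold h0.
  match goal with |- Rabs ?x <= _ => replace x with ((b - 1) * ((wsum b u - wsum b v)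
    + (bpow b u - bpow b v) * / (2 * (b - 1)) + - (u - v) * / 2)) by (field; lra) end.
  rewrite Rabs_mult, (Rabs_right (b - 1)) by lra; unfold K; rewrite Rmult_assoc; apply Rmult_le_compat_l; [ lra | ].
  assert (Pi : 0 < / (2 * (b - 1))) by (apply Rinv_0_lt_compat; lra).
  eapply Rle_trans; [ apply Rabs_triang | ]; eapply Rle_trans; [ apply Rplus_le_compat_r, Rabs_triang | ].
  rewrite !Rabs_mult, Rabs_Ropp, Ed, (Rabs_right (/ (2 * (b - 1)))), (Rabs_right (/ 2)) by lra.
  rewrite !Rmult_plus_distr_r; apply Rplus_le_compat; [ apply Rplus_le_compat; [ exact HW | ] | lra ].
  apply Rle_trans with (b * bpow_lip_const b * d * / (2 * (b - 1))); [ apply Rmult_le_compat_r; lra | ].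
  replace (b * bpow_lip_const b * 2 / (2 * (b - 1)) * Rpower d a)
    with (b * bpow_lip_const b * (2 * Rpower d a) * / (2 * (b - 1))) by (unfold Rdiv; ring).
  apply Rmult_le_compat_r; [ lra | apply Rmult_le_compat_l; [ nra | exact Hd ] ].
Qed.

(** Points at distance at most 1 are brought into [-1, 1] by a common shift; beyond that distance
    fractional parts are compared, whose difference is at most 1. *)
Lemma hper_holder (b a : R) : 1 < b -> 0 < a < 1 ->
  exists K, 0 <= K /\ forall x y, x <> y -> Rabs (hper b x - hper b y) <= K * Rpower (Rabs (x - y)) a.
Proof.
  intros Hb Ha; destruct (h0_holder b a Hb Ha) as [K [PK HK]]; exists K; split; [ exact PK | ].
  assert (W : forall x y, y < x -> Rabs (hper b x - hper b y) <= K * Rpower (Rabs (x - y)) a).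
  { intros x y Hxy; destruct (Rle_lt_dec (x - y) 1) as [H|H].
    - pose proof (Int_part_bounds x) as HI; set (n := Int_part x) in *.
      rewrite (hper_h0 b x n), (hper_h0 b y n) by (try exact Hb; lra).
      replace (x - y) with ((x - IZR n) - (y - IZR n)) by ring; apply HK; lra.
    - unfold hper; destruct (base_fp x) as [X1 X2]; destruct (base_fp y) as [Y1 Y2].
      destruct (Req_dec (frac_part x) (frac_part y)) as [E|E].
      + rewrite E, Rminus_diag, Rabs_R0; apply Rmult_le_pos; [ exact PK | apply Rlt_le, Rpower_pos ].
      + eapply Rle_trans; [ apply HK; lra | apply Rmult_le_compat_l; [ exact PK | ] ].
        apply Rle_Rpower_l; [ lra | split; [ apply Rabs_pos_lt; lra | ] ].
        apply Rle_trans with 1; [ apply Rabs_le; lra | rewrite Rabs_right; lra ]. }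
  intros x y Hxy; destruct (Rtotal_order x y) as [H|[H|H]]; [ | contradiction | apply W, H ].
  rewrite Rabs_minus_sym, (Rabs_minus_sym x y); apply W, H.
Qed.

Lemma hper_sqrt_holder (b : R) : 1 < b ->
  exists K, 0 <= K /\ forall x y, Rabs (hper b x - hper b y) <= K * sqrt (Rabs (x - y)).
Proof.
  intros Hb; destruct (hper_holder b (/ 2) Hb ltac:(lra)) as [K [PK HK]]; exists K; split; [ exact PK | ].
  intros x y; destruct (Req_dec x y) as [->|H].
  - rewrite !Rminus_diag, Rabs_R0, sqrt_0; lra.
  - rewrite <- Rpower_sqrt by (apply Rabs_pos_lt; lra); apply HK, H.
Qed.

Lemma hper_continuous (b x : R) : 1 < b -> continuous (hper b) x.
Proof.
  intros Hb; destruct (hper_sqrt_holder b Hb) as [K [PK HK]].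
  apply (continuous_holder _ K); [ exact PK | intros; apply HK ].
Qed.

(** * Fourier coefficients *)

Lemma tau_val (b : R) (k : Z) : 1 < b -> tau b k = ((0, 2 * PI * IZR k / ln b) : C).
Proof.
  intros Hb; pose proof (ln_gt_0 b Hb); unfold tau, Cdiv; rewrite <- RtoC_inv by lra.
  apply C_ext; unfold Re, Im; simpl; field; lra.
Qed.

Lemma Cexp_2PI_nat (n : nat) : Cexp (0, 2 * PI * INR n) = RtoC 1.
Proof.
  unfold Cexp; cbn [Re Im fst snd]; replace (2 * PI * INR n) with (0 + 2 * INR n * PI) by ring.
  rewrite cos_period, sin_period, cos_0, sin_0, exp_0; apply C_ext; unfold Re, Im; simpl; ring.
Qed.

Lemma Cexp_2PI (k : Z) : Cexp (0, 2 * PI * IZR k) = RtoC 1.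
Proof.
  destruct (Z_le_gt_dec 0 k) as [H|H].
  - rewrite <- (Z2Nat.id k H), <- INR_IZR_INZ; apply Cexp_2PI_nat.
  - replace ((0, 2 * PI * IZR k) : C) with (- ((0, (2 * PI * INR (Z.to_nat (- k)))%R) : C))%C.
    + rewrite Cexp_opp, Cexp_2PI_nat; field; intros E; injection E; lra.
    + rewrite INR_IZR_INZ, Z2Nat.id, opp_IZR by lia; apply C_ext; unfold Re, Im; simpl; ring.
Qed.

Definition char (k : Z) (u : R) : C := Cexp (0, - (2 * PI * IZR k * u)).

Lemma char_scal (k : Z) (u : R) : char k u = Cexp (RtoC u * (0, - (2 * PI * IZR k))).
Proof. unfold char; f_equal; apply C_ext; unfold Re, Im; simpl; ring. Qed.

Lemma char_ccont (k : Z) (u : R) : ccont (char k) u.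
Proof.
  apply (ccont_ext (fun u => Cexp (RtoC u * (0, - (2 * PI * IZR k))))); [ intros; symmetry; apply char_scal | ].
  apply ccont_Cexp, (cderiv_ccont _ _ _ (cderiv_id_scal _ _)).
Qed.

Lemma Cmod_char (k : Z) (u : R) : Cmod (char k u) = 1.
Proof. unfold char; rewrite Cmod_Cexp; apply exp_0. Qed.

Lemma char_1 (k : Z) : char k 1 = RtoC 1.
Proof.
  unfold char; rewrite <- (Cexp_2PI (- k)); f_equal; rewrite opp_IZR; apply C_ext; unfold Re, Im; simpl; ring.
Qed.

Lemma char_plus (k : Z) (u v : R) : char k (u + v) = (char k u * char k v)%C.
Proof. unfold char; rewrite <- Cexp_plus; f_equal; apply C_ext; unfold Re, Im; simpl; ring. Qed.

Lemma char_nat (k : Z) (j : nat) : char k (INR j) = RtoC 1.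
Proof.
  induction j as [|j IH].
  - unfold char; simpl; replace (- (2 * PI * IZR k * 0)) with 0 by ring; apply Cexp_0.
  - rewrite S_INR, char_plus, IH, char_1; ring.
Qed.

Lemma char_int (k : Z) : k <> 0%Z -> CInt (char k) 0 1 = RtoC 0.
Proof.
  intros Hk; set (w := ((0, - (2 * PI * IZR k)) : C)).
  assert (Hw : w <> RtoC 0).
  { intros E; injection E; intros E1; pose proof PI_RGT_0; apply Hk, eq_IZR; nra. }
  pose proof (Cexp_sub1_int w) as E.
  rewrite <- (CInt_ext (char k)) in E; [ | lra | intros; apply char_scal ].
  assert (E1 : Cexp w = RtoC 1).
  { rewrite <- (char_1 k), char_scal; fold w; f_equal; ring. }
  rewrite E1 in E; unfold Cminus in E; rewrite Cplus_opp_r in E.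
  replace (CInt (char k) 0 1) with (/ w * (w * CInt (char k) 0 1))%C by (field; exact Hw); rewrite <- E; ring.
Qed.

Lemma char_int_id (k : Z) : k <> 0%Z ->
  CInt (fun u => RtoC u * char k u)%C 0 1 = (/ (0, (- (2 * PI * IZR k))%R))%C.
Proof.
  intros Hk; set (w := ((0, - (2 * PI * IZR k)) : C)).
  assert (Hw : w <> RtoC 0).
  { intros E; injection E; intros E1; pose proof PI_RGT_0; apply Hk, eq_IZR; nra. }
  change (((0, (- (2 * PI * IZR k))%R) : C)) with w.
  rewrite (CInt_FTC (fun u => / w * (RtoC u * char k u) + - / w * / w * char k u)%C); [ | lra | | ].
  - rewrite char_1; replace (char k 0) with (RtoC 1) by (symmetry; apply (char_nat k 0)); ring.
  - intros u _.
    assert (D : cderiv (char k) u (w * char k u)%C).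
    { destruct (cderiv_Cexp (fun u => RtoC u * w)%C u w (cderiv_id_scal w u)) as [D1 D2].
      rewrite (char_scal k u); fold w.
      split; [ apply (is_derive_ext (fun t : R => Re (Cexp (RtoC t * w)))); [ | exact D1 ]
             | apply (is_derive_ext (fun t : R => Im (Cexp (RtoC t * w)))); [ | exact D2 ] ];
        intros t; rewrite char_scal; reflexivity. }
    eapply cderiv_eq.
    + apply cderiv_plus; apply cderiv_scal; [ | exact D ].
      apply (cderiv_mult (fun u => RtoC u) (char k)); [ | exact D ].
      apply (cderiv_RtoC (fun u => u)), (is_derive_id (K := R_AbsRing)).
    + cbv beta.
      change (@one R_AbsRing) with 1; field; exact Hw.
  - intros u _; apply ccont_mult; [ apply ccont_RtoC, continuous_id | apply char_ccont ].
Qed.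

Lemma bpow_continuous (b u : R) : continuous (bpow b) u.
Proof. apply (ex_derive_continuous (V := R_NormedModule) (bpow b)); unfold bpow; auto_derive; exact I. Qed.

Lemma bpow_char_int (b : R) (k : Z) : 1 < b ->
  CInt (fun u => RtoC (bpow b u) * char k u)%C 0 1 = ((b - 1) / (ln b * (1 - tau b k)))%C.
Proof.
  intros Hb; pose proof (ln_gt_0 b Hb) as Hl.
  set (w := ((ln b, - (2 * PI * IZR k)) : C)).
  assert (Ew : w = (ln b * (1 - tau b k))%C).
  { rewrite tau_val by exact Hb; apply C_ext; unfold Re, Im; simpl; field; lra. }
  assert (Hw : w <> RtoC 0) by (intros E; injection E; intros; lra).
  assert (Eb : forall u, (RtoC (bpow b u) * char k u)%C = Cexp (RtoC u * w)).
  { intros u; unfold bpow; rewrite <- Cexp_RtoC; unfold char; rewrite <- Cexp_plus; f_equal.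
    apply C_ext; unfold Re, Im; simpl; ring. }
  rewrite (CInt_ext _ (fun u => Cexp (RtoC u * w))); [ | lra | intros; apply Eb ].
  pose proof (Cexp_sub1_int w) as E.
  assert (E1 : Cexp w = RtoC b).
  { rewrite <- (Cmult_1_l w), <- Eb, char_1, bpow_1 by exact Hb; ring. }
  rewrite E1 in E; rewrite <- Ew.
  replace (CInt (fun u => Cexp (RtoC u * w)) 0 1) with (/ w * (w * CInt (fun u => Cexp (RtoC u * w)) 0 1))%C
    by (field; exact Hw).
  rewrite <- E; field; exact Hw.
Qed.

(** In the variable x = b^w a character becomes a power of x, which turns Fourier coefficients into
    Mellin integrals. *)
Lemma xpow_bpow (b : R) (k : Z) (w : R) : 1 < b -> xpow (bpow b w) (- tau b k) = char k w.
Proof.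
  intros Hb; pose proof (ln_gt_0 b Hb) as Hl.
  unfold xpow, bpow, char; rewrite ln_exp, tau_val by exact Hb; f_equal.
  apply C_ext; unfold Re, Im; simpl; field; lra.
Qed.

Lemma wave_continuous (b u : R) : continuous (wave b) u.
Proof.
  unfold wave; apply (continuous_mult (K := R_AbsRing)).
  - apply (continuous_comp (bpow b) saw2); [ apply bpow_continuous | apply saw2_continuous ].
  - apply (continuous_Rinv_comp (bpow b)); [ apply bpow_continuous | pose proof (bpow_pos b u); lra ].
Qed.

Lemma wave_char_ccont (b : R) (k : Z) (t u : R) : ccont (fun u => RtoC (wave b (u + t)) * char k u)%C u.
Proof.
  apply ccont_mult; [ apply ccont_RtoC | apply char_ccont ].
  apply (continuous_comp (fun u => u + t) (wave b)); [ | apply wave_continuous ].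
  apply (continuous_plus (fun u => u) (fun _ => t)); [ apply continuous_id | apply continuous_const ].
Qed.

(** Unfolding: the substitution x = b^(u + j) maps [0, 1] onto [b^j, b^(j+1)], and these intervals
    tile [1, b^J]. *)
Lemma wave_char_partial (b : R) (k : Z) (J : nat) : 1 < b ->
  csum (fun j => CInt (fun u => RtoC (wave b (u + INR j)) * char k u)%C 0 1) J =
  (/ ln b * CInt (fun x => RtoC (saw2 x) * xpow x (- (tau b k + 2))) 1 (b ^ J))%C.
Proof.
  intros Hb; pose proof (ln_gt_0 b Hb) as Hl.
  assert (Hlc : RtoC (ln b) <> RtoC 0) by (intros E; injection E; lra).
  set (f := fun x => (RtoC (saw2 x) * xpow x (- (tau b k + 2)))%C).
  assert (Hf : forall x, 0 < x -> ccont f x).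
  { intros x Hx; apply ccont_mult; [ apply ccont_RtoC, saw2_continuous | apply ccont_xpow, Hx ]. }
  assert (Hterm : forall j, CInt (fun u => RtoC (wave b (u + INR j)) * char k u)%C 0 1 =
     (/ ln b * CInt f (b ^ j) (b ^ S j))%C).
  { intros j.
    pose proof (CInt_subst f (fun u => bpow b (u + INR j)) (fun u => ln b * bpow b (u + INR j)) 0 1 ltac:(lra)) as E.
    cbv beta in E; rewrite Rplus_0_l, bpow_nat in E by exact Hb.
    replace (bpow b (1 + INR j)) with (b ^ S j) in E by (rewrite bpow_plus, bpow_1, bpow_nat by exact Hb; reflexivity).
    rewrite <- E.
    - rewrite <- CInt_scal.
      + apply CInt_ext; [ lra | intros u _; unfold f ].
        replace (- (tau b k + 2))%C with (- tau b k + - (1) + - (1))%C by ring.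
        pose proof (bpow_pos b (u + INR j)) as PX.
        rewrite !xpow_plus, xpow_bpow, xpow_opp, xpow_1_r, char_plus, char_nat by assumption.
        unfold wave; rewrite RtoC_mult, RtoC_div by lra.
        assert (RtoC (bpow b (u + INR j)) <> RtoC 0) by (intros F; injection F; lra).
        field; split; assumption.
      + apply ex_CInt_cont; [ lra | intros u _; apply ccont_mult ].
        * apply ccont_RtoC, (ex_derive_continuous (V := R_NormedModule) (fun u => ln b * bpow b (u + INR j))).
          unfold bpow; auto_derive; exact I.
        * apply (ccont_comp f (fun u => bpow b (u + INR j))); [ | apply Hf, bpow_pos ].
          apply (ex_derive_continuous (V := R_NormedModule) (fun u => bpow b (u + INR j))); unfold bpow; auto_derive; exact I.
    - intros u _; apply Hf, bpow_pos.
    - intros u _; split.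
      + unfold bpow; auto_derive; [ exact I | ring ].
      + apply (ex_derive_continuous (V := R_NormedModule) (fun u => ln b * bpow b (u + INR j))).
        unfold bpow; auto_derive; exact I. }
  assert (Hp : forall j, 1 <= b ^ j) by (intros j; apply pow_R1_Rle; lra).
  induction J as [|J IH].
  - simpl; unfold CInt; rewrite !RInt_point; apply C_ext; unfold Re, Im; simpl; unfold zero; simpl; ring.
  - simpl csum; rewrite IH, Hterm, <- Cmult_plus_distr_l; f_equal; symmetry; apply CInt_Chasles.
    + apply ex_CInt_cont; [ apply Hp | intros x Hx; apply Hf; lra ].
    + apply ex_CInt_cont; [ simpl; specialize (Hp J); nra | intros x Hx; apply Hf; specialize (Hp J); lra ].
Qed.

(* Equal to [wsum b u] on [0, 1], but visibly continuous. *)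
Definition wsum_per (b u : R) : R := (hper b u + / 2) / (b - 1) - bpow b u / (2 * (b - 1)) + u / 2.

Lemma wsum_per_wsum (b u : R) : 1 < b -> u <= 1 -> wsum_per b u = wsum b u.
Proof.
  intros Hb Hu; unfold wsum_per; rewrite (hper_h0 b u 0) by (try exact Hb; simpl; lra); simpl IZR; rewrite Rminus_0_r.
  unfold h0; field; lra.
Qed.

Lemma wsum_per_continuous (b u : R) : 1 < b -> continuous (wsum_per b) u.
Proof.
  intros Hb; unfold wsum_per.
  apply (continuous_plus (fun u => (hper b u + / 2) / (b - 1) - bpow b u / (2 * (b - 1))) (fun u => u / 2)).
  - apply (continuous_minus (fun u => (hper b u + / 2) / (b - 1)) (fun u => bpow b u / (2 * (b - 1)))).
    + apply (continuous_mult (K := R_AbsRing)); [ | apply continuous_const ].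
      apply (continuous_plus (hper b) (fun _ => / 2)); [ apply hper_continuous, Hb | apply continuous_const ].
    + apply (continuous_mult (K := R_AbsRing)); [ apply bpow_continuous | apply continuous_const ].
  - apply (continuous_mult (K := R_AbsRing)); [ apply continuous_id | apply continuous_const ].
Qed.

(** The partial sums converge uniformly on [0, 1], which gives the left side as a limit; the Mellin
    integral along the cut-offs b^J gives the right side. *)
Lemma wsum_char_int (b : R) (k : Z) : 1 < b ->
  CInt (fun u => RtoC (wsum_per b u) * char k u)%C 0 1 =
  (/ ln b * mellin (fun _ x => RtoC (saw2 x)) (tau b k + 2))%C.
Proof.
  intros Hb; pose proof (ln_gt_0 b Hb) as Hl.
  set (f := fun (j : nat) u => (RtoC (wave b (u + INR j)) * char k u)%C).
  assert (Ef : forall j, ex_CInt (f j) 0 1) by (intros j; apply ex_CInt_cont; [ lra | intros; apply wave_char_ccont ]).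
  assert (Ew : ex_CInt (fun u => RtoC (wsum_per b u) * char k u)%C 0 1).
  { apply ex_CInt_cont; [ lra | intros u _; apply ccont_mult; [ apply ccont_RtoC, wsum_per_continuous, Hb | apply char_ccont ] ]. }
  assert (L1 : Clim (fun N => csum (fun j => CInt (f j) 0 1) (S N)) (CInt (fun u => RtoC (wsum_per b u) * char k u)%C 0 1)).
  { set (bd := fun j : nat => / 8 * (/ b) ^ j).
    assert (Hbd : ex_series bd) by (apply ex_series_inv_geom, Hb).
    apply (Clim_squeeze_0 _ _ (fun N => (1 - 0) * (Series bd - sum_n bd N))).
    - intros N; destruct (CInt_csum f 0 1 (S N) Ef) as [X1 X2]; rewrite <- X2, Cmod_sub_sym.
      rewrite <- CInt_minus by (assumption || lra).
      apply CInt_norm_le_const; [ lra | apply ex_CInt_minus; assumption || lra | intros u Hu ].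
      replace (csum (fun j => f j u) (S N)) with (char k u * csum (fun j => RtoC (wave b (u + INR j))) (S N))%C
        by (rewrite <- csum_scal; apply csum_ext; intros; unfold f; ring).
      match goal with |- Cmod (Cminus (Cmult ?p ?q) (Cmult ?q ?r)) <= _ =>
        replace (Cminus (Cmult p q) (Cmult q r)) with (Cmult (Cminus p r) q) by ring end.
      rewrite Cmod_mult, Cmod_char, Rmult_1_r, wsum_per_wsum by (try exact Hb; lra).
      apply (cseries_tail_le _ bd); [ | exact Hbd | ].
      + intros j; rewrite Cmod_R; eapply Rle_trans; [ apply wave_bound_nat, Hb | unfold bd ].
        assert (bpow b (- u) <= 1) by (rewrite <- (bpow_0 b); apply bpow_le; lra).
        apply Rmult_le_compat_r; [ apply Rlt_le, pow_lt, Rinv_0_lt_compat; lra | lra ].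
      + apply is_cseries_Re_Im; split; simpl.
        * apply (Series_correct (fun j => wave b (u + INR j))), wave_ex_series, Hb.
        * apply (is_lim_seq_ext (fun _ => 0) (sum_n (fun _ => 0)) 0); [ | apply is_lim_seq_const ].
          intros n; rewrite sum_n_const; ring.
    - replace (Finite 0) with (Finite ((1 - 0) * (Series bd - Series bd))) by (f_equal; ring).
      apply is_lim_seq_mult'; [ apply is_lim_seq_const | ].
      apply is_lim_seq_minus'; [ apply is_lim_seq_const | apply (Series_correct bd Hbd) ]. }
  apply (Clim_unique _ _ _ L1).
  apply (Clim_ext (fun N => / ln b * CInt (fun x => RtoC (saw2 x) * xpow x (- (tau b k + 2))) 1 (b ^ S N))%C).
  { intros N; symmetry; apply wave_char_partial, Hb. }
  apply Clim_scal; intros e He.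
  destruct (mellin_lim_R _ _ _ (tau b k + 2)%C saw2_mellin_ok ltac:(rewrite tau_val by exact Hb; simpl; lra) e He)
    as [X0 [HX0 HX]].
  destruct (Pow_x_infinity b ltac:(rewrite Rabs_right; lra) X0) as [N0 HN0].
  exists N0; intros n Hn; apply HX.
  specialize (HN0 (S n) ltac:(lia)); rewrite Rabs_right in HN0; [ lra | ].
  apply Rle_ge, pow_le; lra.
Qed.

Definition fcoeff (b : R) (k : Z) : C := CInt (fun u => RtoC (hper b u) * char k u)%C 0 1.

Lemma fcoeff_split (b : R) (k : Z) : 1 < b ->
  fcoeff b k = ((b - 1) * (/ ln b * mellin (fun _ x => RtoC (saw2 x)) (tau b k + 2))
    + / 2 * ((b - 1) / (ln b * (1 - tau b k)))
    + - ((b - 1) / 2) * CInt (fun u => RtoC u * char k u) 0 1 + - / 2 * CInt (char k) 0 1)%C.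
Proof.
  intros Hb; unfold fcoeff.
  assert (E1 : ex_CInt (fun u => RtoC (wsum_per b u) * char k u)%C 0 1).
  { apply ex_CInt_cont; [ lra | intros u _; apply ccont_mult; [ apply ccont_RtoC, wsum_per_continuous, Hb | apply char_ccont ] ]. }
  assert (E2 : ex_CInt (fun u => RtoC (bpow b u) * char k u)%C 0 1).
  { apply ex_CInt_cont; [ lra | intros u _; apply ccont_mult; [ apply ccont_RtoC, bpow_continuous | apply char_ccont ] ]. }
  assert (E3 : ex_CInt (fun u => RtoC u * char k u)%C 0 1).
  { apply ex_CInt_cont; [ lra | intros u _; apply ccont_mult; [ apply ccont_RtoC, continuous_id | apply char_ccont ] ]. }
  assert (E4 : ex_CInt (char k) 0 1) by (apply ex_CInt_cont; [ lra | intros; apply char_ccont ]).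
  rewrite (CInt_ext _ (fun u => (b - 1) * (RtoC (wsum_per b u) * char k u) + / 2 * (RtoC (bpow b u) * char k u)
    + - ((b - 1) / 2) * (RtoC u * char k u) + - / 2 * char k u)%C); [ | lra | ].
  - pose proof (ex_CInt_scal (b - 1)%C _ _ _ E1) as F1; pose proof (ex_CInt_scal (/ 2)%C _ _ _ E2) as F2.
    pose proof (ex_CInt_scal (- ((b - 1) / 2))%C _ _ _ E3) as F3; pose proof (ex_CInt_scal (- / 2)%C _ _ _ E4) as F4.
    pose proof (ex_CInt_plus _ _ _ _ F1 F2) as F12; pose proof (ex_CInt_plus _ _ _ _ F12 F3) as F123.
    rewrite (CInt_plus _ _ _ _ F123 F4), (CInt_plus _ _ _ _ F12 F3), (CInt_plus _ _ _ _ F1 F2).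
    rewrite !CInt_scal by assumption; rewrite wsum_char_int, bpow_char_int by exact Hb; reflexivity.
  - intros u Hu.
    assert (Eh : hper b u = (b - 1) * wsum_per b u + / 2 * bpow b u + - ((b - 1) / 2) * u + - / 2)
      by (unfold wsum_per; field; lra).
    rewrite Eh, !RtoC_plus, !RtoC_mult, !RtoC_opp, RtoC_div, !RtoC_minus, !RtoC_inv by lra; ring.
Qed.

(** For k <> 0 the elementary integrals complete the Mellin integral at t = [tau b k] by (1 / (1 -
    t) + 1 / t) / 2, and the sum is - zeta0 t / (t (t + 1)). For k = 0 the value comes from
    Stirling's constant, and the constant - 1/2 in [h0] contributes only there. *)
Lemma fcoeff_c_beta (b : R) (k : Z) : 1 < b -> fcoeff b k = c_beta b k.
Proof.
  intros Hb; pose proof (ln_gt_0 b Hb) as Hl; pose proof PI_RGT_0 as HPI.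
  rewrite fcoeff_split by exact Hb; unfold c_beta.
  assert (Hlc : RtoC (ln b) <> RtoC 0) by (intros E; injection E; lra).
  assert (H2 : RtoC 2 <> RtoC 0) by (intros E; injection E; lra).
  destruct (Z.eq_dec k 0) as [->|Hk].
  - assert (Et : tau b 0 = RtoC 0) by (rewrite tau_val by exact Hb; apply C_ext; unfold Re, Im; simpl; field; lra).
    assert (Ec : forall u, char 0 u = RtoC 1).
    { intros u; unfold char; simpl; replace (- (2 * PI * 0 * u)) with 0 by ring; apply Cexp_0. }
    rewrite Et, Cplus_0_l, saw2_mellin_2.
    rewrite (CInt_ext (char 0) (fun _ => RtoC 1)) by (try lra; intros; apply Ec); rewrite CInt_const.
    rewrite (CInt_ext _ (fun u => RtoC u)) by (try lra; intros; rewrite Ec; ring); rewrite CInt_RtoC.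
    assert (Ei : RInt (fun u => u) 0 1 = / 2).
    { replace (/ 2) with (minus ((fun u => u * u / 2) 1) ((fun u => u * u / 2) 0)) by (unfold minus, plus, opp; simpl; field).
      apply (is_RInt_unique (V := R_CompleteNormedModule)).
      apply (is_RInt_derive (V := R_CompleteNormedModule) (fun u => u * u / 2) (fun u => u)).
      - intros u _; auto_derive; [ exact I | field ].
      - intros u _; apply continuous_id. }
    rewrite Ei; set (L := ln (2 * PI)).
    replace (RtoC ((b - 1) / (2 * ln b) * (L - 1) - (b + 1) / 4))
      with (RtoC ((b - 1) * (/ ln b * (L / 2 - 1)) + / 2 * ((b - 1) / ln b) + - ((b - 1) * / 2) * / 2 + - / 2))
      by (f_equal; field; lra).
    rewrite Rminus_0_r; unfold Rdiv; rewrite !RtoC_plus, !RtoC_mult, !RtoC_opp, !RtoC_mult, !RtoC_minus, !RtoC_mult, !RtoC_inv by lra.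
    field; repeat split; assumption.
  - set (t := tau b k) in *.
    assert (Et : t = ((0, 2 * PI * IZR k / ln b) : C)) by (apply tau_val, Hb).
    assert (Kk : IZR k <> 0) by (intros E; apply Hk, eq_IZR, E).
    assert (It : Im t <> 0).
    { rewrite Et; cbn [Im snd]; intros E; apply Kk.
      assert (E' : 2 * PI * IZR k = 0) by (replace (2 * PI * IZR k) with (2 * PI * IZR k / ln b * ln b) by (field; lra); rewrite E; ring).
      nra. }
    assert (Rt : Re t = 0) by (rewrite Et; reflexivity).
    rewrite riemann_zeta_zeta0 by (assumption || (rewrite Rt; lra)).
    rewrite char_int, char_int_id by exact Hk.
    assert (T0 : t <> RtoC 0) by (intros E; apply It; rewrite E; apply im_RtoC).
    assert (T1 : forall r, r <> 0 -> (t + RtoC r)%C <> RtoC 0).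
    { intros r Hr E; apply It; apply (f_equal Im) in E; rewrite im_plus, !im_RtoC in E; lra. }
    assert (Em : (2 * PI * Ci * IZR k)%C = (ln b * t)%C).
    { rewrite Et; apply C_ext; unfold Re, Im; simpl; field; lra. }
    assert (Ew : ((0, (- (2 * PI * IZR k))%R) : C) = (- (ln b * t))%C).
    { rewrite Et; apply C_ext; unfold Re, Im; simpl; field; lra. }
    rewrite Ew, Em; unfold zeta0.
    assert (T2 : (1 - t)%C <> RtoC 0).
    { intros E; apply It; apply (f_equal Im) in E; rewrite im_minus, !im_RtoC in E; lra. }
    assert (T3 : (t - 1)%C <> RtoC 0).
    { intros E; apply It; apply (f_equal Im) in E; rewrite im_minus, !im_RtoC in E; lra. }
    assert (T4 : (1 + t)%C <> RtoC 0) by (rewrite Cplus_comm; apply T1; lra).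
    field; repeat split; assumption.
Qed.

(** The cosine integral is the form that Dini's criterion handles; the sine integral is odd in k and
    will cancel. *)
Lemma fcoeff_term (b x : R) (k : Z) : 1 < b ->
  (c_beta b k * Cexp (2 * PI * Ci * IZR k * x))%C =
  ((RInt (fun u => hper b u * cos (2 * PI * IZR k * (x - u))) 0 1,
    RInt (fun u => hper b u * sin (2 * PI * IZR k * (x - u))) 0 1) : C).
Proof.
  intros Hb; rewrite <- fcoeff_c_beta by exact Hb; unfold fcoeff; rewrite Cmult_comm, <- CInt_scal.
  - apply C_ext; unfold CInt; cbn [Re Im fst snd]; apply RInt_ext; intros u _;
      (replace (Cexp (2 * PI * Ci * IZR k * x) * (RtoC (hper b u) * char k u))%C
        with (RtoC (hper b u) * Cexp (0, (2 * PI * IZR k * (x - u))%R))%C;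
       [ unfold Cexp; rewrite ?re_scal_l, ?im_scal_l; cbn [Re Im fst snd]; rewrite exp_0; req; ring
       | unfold char; replace ((0, 2 * PI * IZR k * (x - u)) : C)
           with ((2 * PI * Ci * IZR k * x) + (0, (- (2 * PI * IZR k * u))%R))%C;
         [ rewrite Cexp_plus; ring | apply C_ext; unfold Re, Im; simpl; ring ] ]).
  - apply ex_CInt_cont; [ lra | intros u _; apply ccont_mult; [ apply ccont_RtoC, hper_continuous, Hb | apply char_ccont ] ].
Qed.

(** [Series] is defined from the partial sums even when they diverge, and dropping a leading 0 only
    shifts them; this serves the sine parts of the Fourier series. *)
Lemma Series_zero_head (u : nat -> R) : u O = 0 -> Series u = Series (fun n => u (S n)).
Proof.
  intros H0; unfold Series; rewrite <- Lim_seq_incr_1; f_equal; apply Lim_seq_ext; intros n.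
  induction n as [|n IH].
  - rewrite sum_Sn, !sum_O, H0; unfold plus; simpl; ring.
  - rewrite sum_Sn, IH, (sum_Sn (fun n => u (S n))); reflexivity.
Qed.

(* The imaginary parts of the two half-series are opposite whether or not they converge. *)
Lemma h_beta_hper (b x : R) : 1 < b -> h_beta b x = RtoC (hper b x).
Proof.
  intros Hb.
  destruct (hper_sqrt_holder b Hb) as [K [PK HK]].
  pose proof (dini (hper b) K x PK HK (fun x => hper_periodic b x Hb)) as D.
  set (c := fun n : nat => RInt (fun u => hper b u * cos (2 * PI * INR (S n) * (x - u))) 0 1).
  set (d := fun n : nat => RInt (fun u => hper b u * sin (2 * PI * INR (S n) * (x - u))) 0 1).
  set (m := RInt (hper b) 0 1).
  assert (Dc : is_series (fun n => 2 * c n) (hper b x - m)).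
  { apply (is_series_incr_1 (K := R_AbsRing) (V := R_NormedModule) (fourier_term (hper b) x)).
    match goal with |- is_series _ ?v => replace v with (hper b x); [ exact D | ] end.
    unfold plus; simpl; fold m; ring. }
  assert (Dh : is_series c ((hper b x - m) / 2)).
  { apply (is_series_ext (fun n => scal (/ 2) (2 * c n))).
    - intros n; unfold scal; simpl; unfold mult; simpl; field.
    - replace ((hper b x - m) / 2) with (scal (/ 2) (hper b x - m)) by (unfold scal; simpl; unfold mult; simpl; field).
      apply (is_series_scal (K := R_AbsRing) (V := R_NormedModule)), Dc. }
  set (a := fun k : Z => (c_beta b k * Cexp (2 * PI * Ci * IZR k * x))%C).
  change (h_beta b x) with (CSeries (fun n => a (Z.of_nat n)) + CSeries (fun n => a (- Z.of_nat (n + 1))%Z))%C.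
  assert (A0 : a 0%Z = RtoC m).
  { unfold a; rewrite fcoeff_term by exact Hb; apply C_ext; cbn [Re Im fst snd]; rewrite ?re_RtoC, ?im_RtoC.
    - apply RInt_ext; intros u _; simpl; rewrite Rmult_0_r, Rmult_0_l, cos_0; req; ring.
    - rewrite (RInt_ext _ (fun _ => 0)); [ rewrite RInt_const; unfold scal; simpl; unfold mult; simpl; ring | ].
      intros u _; simpl; rewrite Rmult_0_r, Rmult_0_l, sin_0; req; ring. }
  assert (Ap : forall n, a (Z.of_nat (S n)) = ((c n, d n) : C)).
  { intros n; unfold a; rewrite fcoeff_term, <- INR_IZR_INZ by exact Hb; reflexivity. }
  assert (An : forall n, a (- Z.of_nat (n + 1))%Z = ((c n, - d n) : C)).
  { intros n; unfold a; rewrite fcoeff_term by exact Hb; rewrite opp_IZR, <- INR_IZR_INZ.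
    replace (n + 1)%nat with (S n) by lia; apply C_ext; cbn [Re Im fst snd]; unfold c, d.
    - apply RInt_ext; intros u _.
      replace (2 * PI * - INR (S n) * (x - u)) with (- (2 * PI * INR (S n) * (x - u))) by ring; rewrite cos_neg; reflexivity.
    - change (- RInt (fun u => hper b u * sin (2 * PI * INR (S n) * (x - u))) 0 1)
        with (opp (RInt (fun u => hper b u * sin (2 * PI * INR (S n) * (x - u))) 0 1)).
      rewrite <- (RInt_opp (V := R_CompleteNormedModule)).
      + apply RInt_ext; intros u _.
        replace (2 * PI * - INR (S n) * (x - u)) with (- (2 * PI * INR (S n) * (x - u))) by ring; rewrite sin_neg.
        unfold opp; simpl; req; ring.
      + apply ex_RInt_cont; intros u; apply (continuous_mult (K := R_AbsRing)); [ apply hper_continuous, Hb | ].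
        apply (ex_derive_continuous (V := R_NormedModule) (fun u => sin (2 * PI * INR (S n) * (x - u)))); auto_derive; exact I. }
  apply C_ext; unfold CSeries; rewrite ?re_plus, ?im_plus, ?re_RtoC, ?im_RtoC; cbn [Re Im fst snd].
  - rewrite (Series_ext (fun n => Re (a (- Z.of_nat (n + 1))%Z)) c) by (intros n; rewrite An; reflexivity).
    rewrite (Series_incr_1 (fun n => Re (a (Z.of_nat n)))).
    + rewrite (Series_ext _ c) by (intros n; rewrite Ap; reflexivity).
      change (Z.of_nat 0) with 0%Z; rewrite A0, re_RtoC, (is_series_unique _ _ Dh); field.
    + apply (ex_series_incr_1 (K := R_AbsRing) (V := R_NormedModule)).
      exists ((hper b x - m) / 2); apply (is_series_ext c); [ intros n; rewrite Ap; reflexivity | exact Dh ].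
  - rewrite (Series_ext (fun n => Im (a (- Z.of_nat (n + 1))%Z)) (fun n => - d n)) by (intros n; rewrite An; reflexivity).
    rewrite Series_zero_head by (change (Z.of_nat 0) with 0%Z; rewrite A0; apply im_RtoC).
    rewrite (Series_ext _ d) by (intros n; rewrite Ap; reflexivity).
    rewrite Series_opp; ring.
Qed.

(** * The interpolated sum *)

Definition lead (b : R) : R := (b - 1) / (2 * ln b).

Definition Sr (b x : R) : R := lead b * x * ln x + hper b (ln x / ln b) * x.

Lemma S_beta_Sr (b : R) (n : nat) : 1 < b -> S_beta b n = RtoC (Sr b (INR n)).
Proof.
  intros Hb; unfold S_beta, Sr; rewrite h_beta_hper, <- RtoC_mult, <- RtoC_plus by exact Hb; reflexivity.
Qed.

Lemma lead_pos (b : R) : 1 < b -> 0 < lead b.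
Proof. intros Hb; pose proof (ln_gt_0 b Hb); unfold lead; apply Rdiv_lt_0_compat; lra. Qed.

Lemma hper_bounded (b : R) : 1 < b -> exists H, 0 <= H /\ forall u, Rabs (hper b u) <= H.
Proof.
  intros Hb; destruct (hper_sqrt_holder b Hb) as [K [PK HK]].
  exists (Rabs (hper b 0) + K); split; [ pose proof (Rabs_pos (hper b 0)); lra | intros u ].
  destruct (base_fp u) as [P1 P2].
  assert (E : hper b u = hper b (frac_part u)).
  { rewrite (hper_h0 b (frac_part u) 0) by (try exact Hb; simpl; lra); simpl; rewrite Rminus_0_r; reflexivity. }
  rewrite E; specialize (HK (frac_part u) 0); rewrite Rminus_0_r, (Rabs_right (frac_part u)) in HK by lra.
  assert (sqrt (frac_part u) <= 1) by (rewrite <- sqrt_1; apply sqrt_le_1_alt; lra).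
  assert (K * sqrt (frac_part u) <= K * 1) by (apply Rmult_le_compat_l; lra).
  pose proof (Rabs_triang (hper b (frac_part u) - hper b 0) (hper b 0)) as T.
  replace (hper b (frac_part u) - hper b 0 + hper b 0) with (hper b (frac_part u)) in T by ring; lra.
Qed.

Lemma hper_log_continuous (b x : R) : 1 < b -> 0 < x -> continuous (fun x => hper b (ln x / ln b)) x.
Proof.
  intros Hb Hx; apply (continuous_comp (fun x => ln x / ln b) (hper b)); [ | apply hper_continuous, Hb ].
  apply (continuous_mult (K := R_AbsRing)); [ apply continuous_ln_pos, Hx | apply continuous_const ].
Qed.

Lemma Sr_continuous (b x : R) : 1 < b -> 0 < x -> continuous (Sr b) x.
Proof.
  intros Hb Hx; unfold Sr.
  apply (continuous_plus (fun x => lead b * x * ln x) (fun x => hper b (ln x / ln b) * x)).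
  - apply (continuous_mult (K := R_AbsRing)); [ | apply continuous_ln_pos, Hx ].
    apply (continuous_mult (K := R_AbsRing)); [ apply continuous_const | apply continuous_id ].
  - apply (continuous_mult (K := R_AbsRing)); [ apply hper_log_continuous; assumption | apply continuous_id ].
Qed.

Lemma ln_diff_le (x y : R) : 0 < x <= y -> 0 <= ln y - ln x <= (y - x) / x.
Proof.
  intros [Hx Hy]; split; [ pose proof (ln_le' x y Hx Hy); lra | ].
  assert (Hq : 0 < y / x) by (apply Rdiv_lt_0_compat; lra).
  rewrite <- ln_div by lra.
  pose proof (exp_ineq1_le (ln (y / x))) as E; rewrite exp_ln in E by exact Hq.
  replace ((y - x) / x) with (y / x - 1) by (field; lra); lra.
Qed.

Lemma Rpower_ge_1 (x e : R) : 1 <= x -> 0 <= e -> 1 <= Rpower x e.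
Proof. intros Hx He; rewrite <- (Rpower_O x) by lra; apply Rpower_le_exp; assumption. Qed.

(** Over a step of at most 1, x ln x moves by O(ln x) + O(1), and the bounded [hper] times y - x
    stays bounded. The logarithms to base b differ by at most 1 / (x ln b), so Hoelder continuity of
    exponent 1 - e bounds x times the variation of [hper] by a multiple of x^e. *)
Lemma Sr_increment_le (b e : R) : 1 < b -> 0 < e < 1 ->
  exists B, forall x y, 1 <= x <= y -> y <= x + 1 -> Rabs (Sr b y - Sr b x) <= B * Rpower x e.
Proof.
  intros Hb He; pose proof (ln_gt_0 b Hb) as Hl; pose proof (lead_pos b Hb) as HA.
  destruct (hper_bounded b Hb) as [H [PH HH]].
  destruct (hper_holder b (1 - e) Hb ltac:(lra)) as [K [PK HK]].
  exists (lead b * (2 / e + 1) + H + K * Rpower (/ ln b) (1 - e)); intros x y Hx Hy.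
  set (P := Rpower x e).
  assert (P1 : 1 <= P) by (apply Rpower_ge_1; lra).
  assert (Ly : 0 <= ln y <= 2 / e * P).
  { split; [ rewrite <- ln_1; apply ln_le'; lra | ].
    assert (T1 : ln y <= ln (2 * x)) by (apply ln_le'; lra).
    pose proof (ln_le_Rpower (2 * x) e ltac:(lra)) as T2; rewrite Rpower_mult_base in T2 by lra.
    assert (T3 : Rpower 2 e <= 2) by (rewrite <- (Rpower_1 2) at 2 by lra; apply Rpower_le_exp; lra).
    assert (T4 : Rpower 2 e * P / e <= 2 * P / e).
    { apply Rmult_le_compat_r; [ apply Rlt_le, Rinv_0_lt_compat; lra | apply Rmult_le_compat_r; lra ]. }
    replace (2 / e * P) with (2 * P / e) by (field; lra); fold P in T2; lra. }
  destruct (ln_diff_le x y ltac:(lra)) as [D1 D2].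
  assert (D3 : ln y - ln x <= / x).
  { eapply Rle_trans; [ exact D2 | ]; replace (/ x) with (1 / x) by (field; lra).
    apply Rmult_le_compat_r; [ apply Rlt_le, Rinv_0_lt_compat; lra | lra ]. }
  assert (D4 : x * (ln y - ln x) <= 1) by (replace 1 with (x * / x) by (field; lra); apply Rmult_le_compat_l; lra).
  assert (D5 : 0 <= x * (ln y - ln x)) by (apply Rmult_le_pos; lra).
  assert (E1 : Rabs (y * ln y - x * ln x) <= (2 / e + 1) * P).
  { replace (y * ln y - x * ln x) with ((y - x) * ln y + x * (ln y - ln x)) by ring.
    rewrite Rabs_right by (apply Rle_ge, Rplus_le_le_0_compat; [ apply Rmult_le_pos; lra | exact D5 ]).
    assert ((y - x) * ln y <= 1 * ln y) by (apply Rmult_le_compat_r; lra); lra. }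
  assert (E2 : Rabs ((y - x) * hper b (ln y / ln b)) <= H * P).
  { rewrite Rabs_mult, (Rabs_right (y - x)) by lra; specialize (HH (ln y / ln b)).
    pose proof (Rabs_pos (hper b (ln y / ln b))).
    assert ((y - x) * Rabs (hper b (ln y / ln b)) <= 1 * H) by (apply Rmult_le_compat; lra).
    assert (H * 1 <= H * P) by (apply Rmult_le_compat_l; lra); lra. }
  assert (E3 : Rabs (x * (hper b (ln y / ln b) - hper b (ln x / ln b))) <= K * Rpower (/ ln b) (1 - e) * P).
  { destruct (Req_dec (ln y / ln b) (ln x / ln b)) as [EQ|NE].
    - rewrite EQ, Rminus_diag, Rmult_0_r, Rabs_R0.
      apply Rmult_le_pos; [ apply Rmult_le_pos; [ exact PK | apply Rlt_le, Rpower_pos ] | lra ].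
    - specialize (HK _ _ NE); rewrite Rabs_mult, (Rabs_right x) by lra.
      assert (Q0 : 0 < Rabs (ln y / ln b - ln x / ln b)) by (apply Rabs_pos_lt; lra).
      assert (Q1 : Rabs (ln y / ln b - ln x / ln b) <= / ln b * / x).
      { replace (ln y / ln b - ln x / ln b) with (/ ln b * (ln y - ln x)) by (field; lra).
        rewrite Rabs_mult, !Rabs_right by (try (apply Rle_ge, Rlt_le, Rinv_0_lt_compat); lra).
        apply Rmult_le_compat_l; [ apply Rlt_le, Rinv_0_lt_compat | ]; lra. }
      assert (Q2 : Rpower (Rabs (ln y / ln b - ln x / ln b)) (1 - e) <= Rpower (/ ln b * / x) (1 - e))
        by (apply Rle_Rpower_l; lra).
      assert (IL : 0 < / ln b) by (apply Rinv_0_lt_compat; lra).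
      assert (IX : 0 < / x) by (apply Rinv_0_lt_compat; lra).
      rewrite Rpower_mult_base, (Rpower_inv_base x) in Q2 by lra.
      assert (Q3 : x * Rpower x (- (1 - e)) = P).
      { unfold P; rewrite <- (Rpower_1 x) at 1 by lra; rewrite <- Rpower_plus; f_equal; ring. }
      eapply Rle_trans; [ apply Rmult_le_compat_l; [ lra | exact HK ] | ].
      eapply Rle_trans; [ apply Rmult_le_compat_l; [ lra | apply Rmult_le_compat_l; [ exact PK | exact Q2 ] ] | ].
      rewrite <- Q3; apply Req_le; ring. }
  replace (Sr b y - Sr b x) with (lead b * (y * ln y - x * ln x) + (y - x) * hper b (ln y / ln b)
    + x * (hper b (ln y / ln b) - hper b (ln x / ln b))) by (unfold Sr; ring).
  eapply Rle_trans; [ apply Rabs_triang | ].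
  eapply Rle_trans; [ apply Rplus_le_compat_r, Rabs_triang | ].
  rewrite (Rabs_mult (lead b)), (Rabs_right (lead b)) by lra.
  assert (lead b * Rabs (y * ln y - x * ln x) <= lead b * ((2 / e + 1) * P)) by (apply Rmult_le_compat_l; lra).
  lra.
Qed.

(** Abel summation produces the value at the right end n + 2 of the cell; the kernel is 0 there and
    starts afresh in the next cell. *)
Definition incr (b : R) (n : nat) (x : R) : C := RtoC (Sr b (INR n + 2) - Sr b x).

Lemma incr_mellin_ok (b e : R) : 1 < b -> 0 < e < 1 -> exists B, mellin_ok (incr b) B e.
Proof.
  intros Hb He; destruct (Sr_increment_le b e Hb He) as [B HB]; exists B; intros n x Hx.
  pose proof (pos_INR n); split.
  - apply (ccont_RtoC (fun x => Sr b (INR n + 2) - Sr b x)).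
    apply (continuous_minus (fun _ => Sr b (INR n + 2)) (Sr b)); [ apply continuous_const | apply Sr_continuous; lra ].
  - unfold incr; rewrite Cmod_R; apply HB; lra.
Qed.

Lemma incr_mellin_exponent (b : R) (s : C) : 1 < b -> 0 < Re s ->
  exists B a, mellin_ok (incr b) B a /\ a + 1 < Re (s + 1)%C.
Proof.
  intros Hb Hs; rewrite re_plus, re_RtoC.
  (* Half of the minimum of Re s and 1 is an exponent in (0, 1) that is below Re s. *)
  destruct (incr_mellin_ok b (Rmin (Re s) 1 / 2) Hb) as [B HB].
  - pose proof (Rmin_l (Re s) 1); pose proof (Rmin_r (Re s) 1); assert (0 < Rmin (Re s) 1) by (apply Rmin_glb_lt; lra); lra.
  - exists B, (Rmin (Re s) 1 / 2); split; [ exact HB | pose proof (Rmin_l (Re s) 1); lra ].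
Qed.

Lemma Clim_eq (u : nat -> C) (l m : C) : Clim u l -> l = m -> Clim u m.
Proof. intros H <-; exact H. Qed.

Lemma ln_xpow_lim (s : C) : Re s < 0 -> Clim (fun n => RtoC (ln (INR n + 1)) * xpow (INR n + 1) s)%C 0.
Proof.
  intros Hs; set (e := - Re s / 2).
  apply (Clim_squeeze_0 _ _ (fun n => / e * Rpower (INR n + 1) (- e))).
  - intros n; pose proof (pos_INR n); rewrite Cminus_0_r, Cmod_mult, Cmod_R, Cmod_xpow.
    rewrite Rabs_right by (apply Rle_ge; rewrite <- ln_1; apply ln_le'; lra).
    pose proof (ln_le_Rpower (INR n + 1) e ltac:(unfold e; lra)) as L.
    pose proof (Rpower_pos (INR n + 1) (Re s)).
    eapply Rle_trans; [ apply Rmult_le_compat_r; [ lra | exact L ] | ].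
    replace (- e) with (e + Re s) by (unfold e; field); rewrite Rpower_plus; apply Req_le; field; unfold e; lra.
  - replace (Finite 0) with (Finite (/ e * 0)) by (f_equal; ring).
    apply is_lim_seq_mult'; [ apply is_lim_seq_const | apply Rpower_lim_0; unfold e; lra ].
Qed.

Lemma bounded_xpow_lim (u : nat -> R) (H : R) (s : C) :
  (forall n, Rabs (u n) <= H) -> Re s < 0 -> Clim (fun n => RtoC (u n) * xpow (INR n + 1) s)%C 0.
Proof.
  intros Hu Hs; apply (Clim_squeeze_0 _ _ (fun n => H * Rpower (INR n + 1) (- - Re s))).
  - intros n; rewrite Cminus_0_r, Cmod_mult, Cmod_R, Cmod_xpow, Ropp_involutive.
    apply Rmult_le_compat_r; [ apply Rlt_le, Rpower_pos | apply Hu ].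
  - replace (Finite 0) with (Finite (H * 0)) by (f_equal; ring).
    apply is_lim_seq_mult'; [ apply is_lim_seq_const | apply Rpower_lim_0; lra ].
Qed.

(** * Mellin transforms of the logarithm and of the periodic factor *)

Lemma ln_mellin_ok (e : R) : 0 < e -> mellin_ok (fun _ x => RtoC (ln x)) (/ e) e.
Proof.
  intros He n x Hx; pose proof (pos_INR n); split.
  - apply ccont_RtoC, continuous_ln_pos; lra.
  - rewrite Cmod_R, Rabs_right by (apply Rle_ge; rewrite <- ln_1; apply ln_le'; lra).
    pose proof (ln_le_Rpower x e He) as L; unfold Rdiv in L; lra.
Qed.

Lemma neq_of_Re (s t : C) : Re s <> Re t -> (s - t)%C <> RtoC 0.
Proof. intros H E; apply (f_equal Re) in E; rewrite re_minus, re_RtoC in E; lra. Qed.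

Lemma ln_mellin (s : C) : 1 < Re s -> mellin (fun _ x => RtoC (ln x)) s = (/ (s - 1) ^ 2)%C.
Proof.
  intros Hs.
  assert (Hn : (s - 1)%C <> RtoC 0) by (apply neq_of_Re; rewrite re_RtoC; lra).
  set (Fp := fun x : R => (- / (s - 1) * (RtoC (ln x) * xpow x (1 - s)) + - / (s - 1) ^ 2 * xpow x (1 - s))%C).
  apply (Clim_unique (fun n => CInt (fun x => RtoC (ln x) * xpow x (- s))%C 1 (INR n + 1))).
  - apply (mellin_lim (fun x => RtoC (ln x)) (/ ((Re s - 1) / 2)) ((Re s - 1) / 2)); [ apply ln_mellin_ok; lra | lra ].
  - apply (Clim_ext (fun n => - / (s - 1) * (RtoC (ln (INR n + 1)) * xpow (INR n + 1) (1 - s))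
      + (- / (s - 1) ^ 2 * xpow (INR n + 1) (1 - s) + / (s - 1) ^ 2))%C).
    + intros n; pose proof (pos_INR n).
      rewrite (CInt_FTC Fp); [ | lra | | ].
      * unfold Fp; rewrite ln_1, xpow_1_l; ring.
      * intros x Hx.
        assert (Dl : cderiv (fun x => RtoC (ln x)) x (RtoC (/ x))).
        { apply (cderiv_RtoC ln); apply is_derive_Reals, derivable_pt_lim_ln; lra. }
        pose proof (cderiv_xpow x (1 - s)%C ltac:(lra)) as Dx.
        eapply cderiv_eq.
        -- apply cderiv_plus; apply cderiv_scal; [ | exact Dx ].
           apply (cderiv_mult (fun x => RtoC (ln x)) (fun x => xpow x (1 - s))); [ exact Dl | exact Dx ].
        -- replace (1 - s - 1)%C with (- s)%C by ring.
           replace (1 - s)%C with (1 + - s)%C by ring.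
           assert (Hx0 : RtoC x <> RtoC 0) by (intros E; injection E; lra).
           rewrite xpow_plus, xpow_1_r, RtoC_inv by lra; field; repeat split; assumption.
      * intros x Hx; apply ccont_mult; [ apply ccont_RtoC, continuous_ln_pos; lra | apply ccont_xpow; lra ].
    + assert (Hr : Re (1 - s)%C < 0) by (rewrite re_minus, re_RtoC; lra).
      apply (Clim_eq _ (- / (s - 1) * 0 + (- / (s - 1) ^ 2 * 0 + / (s - 1) ^ 2))%C); [ | ring ].
      apply Clim_plus; [ apply Clim_scal, ln_xpow_lim, Hr | ].
      apply Clim_plus; [ apply Clim_scal, xpow_lim_0, Hr | apply Clim_const ].
Qed.

Lemma xpow_pow (x : R) (j : nat) (s : C) : 0 < x -> xpow (x ^ j) s = (xpow x s ^ j)%C.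
Proof.
  intros Hx; induction j as [|j IH]; simpl; [ apply xpow_1_l | ].
  rewrite xpow_mult, IH by (try exact Hx; apply pow_lt, Hx); reflexivity.
Qed.

Lemma Cmod_pow' (z : C) (n : nat) : Cmod (z ^ n)%C = Cmod z ^ n.
Proof. induction n as [|n IH]; simpl; [ apply Cmod_1 | rewrite Cmod_mult, IH; reflexivity ]. Qed.

Lemma csum_geom (q : C) (J : nat) : ((1 - q) * csum (fun j => q ^ j) J)%C = (1 - q ^ J)%C.
Proof. induction J as [|J IH]; simpl; [ ring | rewrite Cmult_plus_distr_l, IH; ring ]. Qed.

(** At w = (1 - s) ln b the exponential is b^(u (1 - s)). The interval is compact, so a continuous h
    gives an entire function of w. *)
Definition laplace (h : R -> R) (w : C) : C := CInt (fun u => RtoC (h u) * Cexp (RtoC u * w))%C 0 1.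

Lemma laplace_ex (h : R -> R) (w : C) : (forall u, continuous h u) ->
  ex_CInt (fun u => RtoC (h u) * Cexp (RtoC u * w))%C 0 1.
Proof.
  intros Hh; apply ex_CInt_cont; [ lra | intros u _; apply ccont_mult; [ apply ccont_RtoC, Hh | ] ].
  apply ccont_Cexp, (cderiv_ccont _ _ _ (cderiv_id_scal _ _)).
Qed.

Lemma laplace_cdiff (h : R -> R) (z : C) : (forall u, continuous h u) -> cdiff (laplace h) z.
Proof.
  intros Hh.
  destruct (ex_CInt_bounded (fun u => RtoC (h u)) 0 1 ltac:(lra)) as [M HM].
  { apply ex_CInt_cont; [ lra | intros; apply ccont_RtoC, Hh ]. }
  assert (PM : 0 <= M) by (specialize (HM 0 ltac:(lra)); pose proof (Cmod_ge_0 (RtoC (h 0))); lra).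
  assert (E0 : ex_CInt (fun u => RtoC (u * h u) * Cexp (RtoC u * z))%C 0 1).
  { apply (laplace_ex (fun u => u * h u)); intros u; apply (continuous_mult (K := R_AbsRing)); [ apply continuous_id | apply Hh ]. }
  apply (cdiff_quadratic _ z (CInt (fun u => RtoC (u * h u) * Cexp (RtoC u * z))%C 0 1) (M * (exp (Cmod z) * exp 1)) 1); [ lra | ].
  intros w Hw; unfold laplace.
  rewrite (Cmult_comm _ (w - z)%C), <- (CInt_scal (w - z)%C) by exact E0.
  pose proof (ex_CInt_scal (w - z)%C _ _ _ E0) as E1.
  pose proof (ex_CInt_minus _ _ _ _ Rle_0_1 (laplace_ex h w Hh) (laplace_ex h z Hh)) as E2.
  rewrite <- (CInt_minus _ _ _ _ Rle_0_1 (laplace_ex h w Hh) (laplace_ex h z Hh)).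
  rewrite <- (CInt_minus _ _ _ _ Rle_0_1 E2 E1).
  match goal with |- _ <= ?r => replace r with ((1 - 0) * r) by ring end.
  apply CInt_norm_le_const; [ lra | apply (ex_CInt_minus _ _ _ _ Rle_0_1 E2 E1) | intros u Hu ].
  set (v := (RtoC u * (w - z))%C).
  replace (RtoC (h u) * Cexp (RtoC u * w) - RtoC (h u) * Cexp (RtoC u * z) - (w - z) * (RtoC (u * h u) * Cexp (RtoC u * z)))%C
    with (RtoC (h u) * (Cexp (RtoC u * z) * (Cexp v - 1 - v)))%C.
  2:{ replace (RtoC u * w)%C with (RtoC u * z + v)%C by (unfold v; ring); rewrite Cexp_plus, RtoC_mult; unfold v; ring. }
  assert (Cu : Cmod (RtoC u) = u) by (rewrite Cmod_R, Rabs_right; lra).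
  assert (Hv : Cmod v <= Cmod (w - z)).
  { unfold v; rewrite Cmod_mult, Cu; pose proof (Cmod_ge_0 (w - z)); nra. }
  rewrite !Cmod_mult.
  pose proof (Cmod_ge_0 v) as V0.
  assert (B1 : Cmod (Cexp (RtoC u * z)) <= exp (Cmod z)).
  { eapply Rle_trans; [ apply Cmod_Cexp_le | apply exp_le; rewrite Cmod_mult, Cu; pose proof (Cmod_ge_0 z); nra ]. }
  assert (B2 : Cmod (Cexp v - 1 - v) <= exp 1 * Cmod (w - z) ^ 2).
  { eapply Rle_trans; [ apply Cexp_sub1_sub_le | ].
    rewrite Rmult_comm; apply Rmult_le_compat; [ apply Rlt_le, exp_pos | apply pow2_ge_0 | apply exp_le; lra | ].
    apply pow_incr; lra. }
  replace (M * (exp (Cmod z) * exp 1) * Cmod (w - z) ^ 2) with (M * (exp (Cmod z) * (exp 1 * Cmod (w - z) ^ 2))) by ring.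
  apply Rmult_le_compat; [ apply Cmod_ge_0 | apply Rmult_le_pos; apply Cmod_ge_0 | apply HM; lra | ].
  apply Rmult_le_compat; try apply Cmod_ge_0; assumption.
Qed.

(** By periodicity the pieces over [b^j, b^(j+1)] differ only by the factor b^(j (1 - s)). The
    resulting geometric sum is the origin of the denominator [Den]. *)
Lemma hper_mellin_partial (b : R) (s : C) (J : nat) : 1 < b ->
  CInt (fun x => RtoC (hper b (ln x / ln b)) * xpow x (- s))%C 1 (b ^ J) =
  (ln b * laplace (hper b) ((1 - s) * ln b) * csum (fun j => xpow b (1 - s) ^ j) J)%C.
Proof.
  intros Hb; pose proof (ln_gt_0 b Hb) as Hl.
  set (f := fun x => (RtoC (hper b (ln x / ln b)) * xpow x (- s))%C).
  assert (Hf : forall x, 0 < x -> ccont f x).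
  { intros x Hx; apply ccont_mult; [ apply ccont_RtoC, hper_log_continuous; assumption | apply ccont_xpow, Hx ]. }
  assert (Hterm : forall j, CInt f (b ^ j) (b ^ S j) =
    (ln b * laplace (hper b) ((1 - s) * ln b) * xpow b (1 - s) ^ j)%C).
  { intros j.
    pose proof (CInt_subst f (fun u => bpow b (u + INR j)) (fun u => ln b * bpow b (u + INR j)) 0 1 ltac:(lra)) as E.
    cbv beta in E; rewrite Rplus_0_l, bpow_nat in E by exact Hb.
    replace (bpow b (1 + INR j)) with (b ^ S j) in E by (rewrite bpow_plus, bpow_1, bpow_nat by exact Hb; reflexivity).
    rewrite <- E.
    - unfold laplace.
      replace (ln b * CInt (fun u => RtoC (hper b u) * Cexp (RtoC u * ((1 - s) * ln b))) 0 1 * xpow b (1 - s) ^ j)%C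
        with ((ln b * xpow b (1 - s) ^ j) * CInt (fun u => RtoC (hper b u) * Cexp (RtoC u * ((1 - s) * ln b))) 0 1)%C by ring.
      rewrite <- CInt_scal by (apply laplace_ex; intros; apply hper_continuous, Hb).
      apply CInt_ext; [ lra | intros u _; unfold f ].
      set (X := bpow b (u + INR j)); assert (PX : 0 < X) by apply bpow_pos.
      assert (LX : ln X / ln b = u + INR j) by (unfold X, bpow; rewrite ln_exp; field; lra).
      rewrite LX, (periodic_nat (hper b)) by (intros; apply hper_periodic, Hb).
      assert (EX : (X * xpow X (- s))%C = (Cexp (RtoC u * ((1 - s) * ln b)) * xpow b (1 - s) ^ j)%C).
      { rewrite <- (xpow_1_r X PX) at 1; rewrite <- xpow_plus; unfold X; rewrite bpow_plus, bpow_nat by exact Hb.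
        rewrite xpow_mult, xpow_pow by (try apply pow_lt; try apply bpow_pos; lra).
        f_equal; unfold xpow, bpow; rewrite ln_exp, RtoC_mult; f_equal; ring. }
      rewrite RtoC_mult.
      replace (ln b * X * (hper b u * xpow X (- s)))%C with (ln b * hper b u * (X * xpow X (- s)))%C by ring.
      rewrite EX; ring.
    - intros u _; apply Hf, bpow_pos.
    - intros u _; split.
      + unfold bpow; auto_derive; [ exact I | ring ].
      + apply (ex_derive_continuous (V := R_NormedModule) (fun u => ln b * bpow b (u + INR j))).
        unfold bpow; auto_derive; exact I. }
  assert (Hp : forall j, 1 <= b ^ j) by (intros j; apply pow_R1_Rle; lra).
  induction J as [|J IH].
  - simpl; unfold CInt; rewrite !RInt_point; apply C_ext; unfold Re, Im; simpl; unfold zero; simpl; ring.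
  - simpl csum; rewrite Cmult_plus_distr_l, <- IH, <- Hterm; apply CInt_Chasles.
    + apply ex_CInt_cont; [ apply Hp | intros x Hx; apply Hf; lra ].
    + apply ex_CInt_cont; [ simpl; specialize (Hp J); nra | intros x Hx; apply Hf; specialize (Hp J); lra ].
Qed.

Lemma hper_mellin_ok (b : R) : 1 < b -> exists B, mellin_ok (fun _ x => RtoC (hper b (ln x / ln b))) B 0.
Proof.
  intros Hb; destruct (hper_bounded b Hb) as [H [PH HH]]; exists H; intros n x Hx; pose proof (pos_INR n); split.
  - apply (ccont_RtoC (fun x => hper b (ln x / ln b))), hper_log_continuous; lra.
  - rewrite Cmod_R, Rpower_O, Rmult_1_r by lra; apply HH.
Qed.

Definition Den (b : R) (s : C) : C := (1 - xpow b (1 - s))%C.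

Lemma hper_mellin (b : R) (s : C) : 1 < b -> 1 < Re s ->
  mellin (fun _ x => RtoC (hper b (ln x / ln b))) s = (ln b * laplace (hper b) ((1 - s) * ln b) / Den b s)%C.
Proof.
  intros Hb Hs; set (q := xpow b (1 - s)).
  assert (Hq : Cmod q < 1).
  { unfold q; rewrite Cmod_xpow, re_minus, re_RtoC; unfold Rpower; rewrite <- exp_0 at 2; apply exp_increasing.
    pose proof (ln_gt_0 b Hb); nra. }
  assert (Hd : (1 - q)%C <> RtoC 0).
  { intros E; assert (E' : q = RtoC 1) by (replace q with (1 - (1 - q))%C by ring; rewrite E; ring).
    rewrite E', Cmod_1 in Hq; lra. }
  destruct (hper_mellin_ok b Hb) as [B HB].
  set (c := (ln b * laplace (hper b) ((1 - s) * ln b))%C).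
  apply (Clim_unique (fun J => CInt (fun x => RtoC (hper b (ln x / ln b)) * xpow x (- s))%C 1 (b ^ J))).
  - intros e He.
    destruct (mellin_lim_R _ _ _ s HB ltac:(lra) e He) as [X0 [HX0 HX]].
    destruct (Pow_x_infinity b ltac:(rewrite Rabs_right; lra) X0) as [N0 HN0].
    exists N0; intros n Hn; apply HX.
    specialize (HN0 n Hn); rewrite Rabs_right in HN0; [ lra | ].
    apply Rle_ge, pow_le; lra.
  - apply (Clim_ext (fun J => c / Den b s + - (c / Den b s) * q ^ J)%C).
    + intros J; rewrite hper_mellin_partial by exact Hb; fold q c; unfold Den; fold q.
      replace (csum (fun j => q ^ j)%C J) with ((1 - q ^ J) / (1 - q))%C by (rewrite <- csum_geom; field; exact Hd).
      field; exact Hd.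
    + apply (Clim_eq _ (c / Den b s + - (c / Den b s) * 0)%C); [ | ring ].
      apply Clim_plus; [ apply Clim_const | apply Clim_scal ].
      apply (Clim_squeeze_0 _ _ (fun J => Cmod q ^ J)).
      * intros n; rewrite Cminus_0_r, Cmod_pow'; lra.
      * apply is_lim_seq_geom; rewrite Rabs_right; [ exact Hq | apply Rle_ge, Cmod_ge_0 ].
Qed.

(** * The continued Dirichlet series *)

Definition regular_part (b : R) (s : C) : C := (- RtoC (Sr b 1) + s * mellin (incr b) (s + 1))%C.

Definition Fb (b : R) (s : C) : C :=
  (regular_part b s + s * lead b / (s - 1) ^ 2 + s * (ln b * laplace (hper b) ((1 - s) * ln b) / Den b s))%C.

(** The difference of powers is s times the integral of x^(-s-1) over the cell. The constant S(n +
    2) is split into its excess over S(x) plus S(x), and S(x) is x times [lead b * ln x] plus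
    [hper]; hence s + 1 in the first integral and s in the others. *)
Lemma abel_step (b : R) (n : nat) (s : C) : 1 < b -> 
  (RtoC (Sr b (INR n + 2)) * (xpow (INR n + 1) (- s) - xpow (INR n + 2) (- s)))%C =
  (s * (mellin_term (incr b) n (s + 1) + (lead b * mellin_term (fun _ x => RtoC (ln x)) n s
    + mellin_term (fun _ x => RtoC (hper b (ln x / ln b))) n s)))%C.
Proof.
  intros Hb; pose proof (pos_INR n) as Hn.
  destruct (incr_mellin_ok b (1 / 2) Hb ltac:(lra)) as [B1 HB1].
  destruct (hper_mellin_ok b Hb) as [B3 HB3].
  pose proof (mellin_ex _ _ _ n (s + 1)%C HB1) as E1.
  pose proof (mellin_ex _ _ _ n s (ln_mellin_ok 1 Rlt_0_1)) as E2.
  pose proof (mellin_ex _ _ _ n s HB3) as E3.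
  pose proof (ex_CInt_scal (lead b) _ _ _ E2) as E2'.
  pose proof (ex_CInt_plus _ _ _ _ E2' E3) as E23.
  unfold mellin_term.
  rewrite <- (CInt_scal (lead b) _ _ _ E2), <- (CInt_plus _ _ _ _ E2' E3), <- (CInt_plus _ _ _ _ E1 E23).
  rewrite (CInt_ext _ (fun x => RtoC (Sr b (INR n + 2)) * xpow x (- (s + 1)))%C); [ | lra | ].
  - assert (E4 : ex_CInt (fun x => xpow x (- (s + 1))) (INR n + 1) (INR n + 2)).
    { apply ex_CInt_cont; [ lra | intros x Hx; apply ccont_xpow; lra ]. }
    rewrite (CInt_scal _ _ _ _ E4).
    assert (FT : CInt (fun x => - s * xpow x (- (s + 1)))%C (INR n + 1) (INR n + 2)
      = (xpow (INR n + 2) (- s) - xpow (INR n + 1) (- s))%C).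
    { apply (CInt_FTC (fun x => xpow x (- s))); [ lra | | ].
      - intros x Hx; eapply cderiv_eq; [ apply cderiv_xpow; lra | ].
        replace (- s - 1)%C with (- (s + 1))%C by ring; reflexivity.
      - intros x Hx; apply ccont_mult; [ apply ccont_const | apply ccont_xpow; lra ]. }
    rewrite (CInt_scal _ _ _ _ E4) in FT.
    replace (xpow (INR n + 1) (- s) - xpow (INR n + 2) (- s))%C with (- (xpow (INR n + 2) (- s) - xpow (INR n + 1) (- s)))%C by ring.
    rewrite <- FT; ring.
  - intros x Hx.
    assert (EX : xpow x (- s) = (x * xpow x (- (s + 1)))%C).
    { replace (- s)%C with (1 + - (s + 1))%C by ring; rewrite xpow_plus, xpow_1_r by lra; reflexivity. }
    rewrite EX; unfold incr; replace (Sr b x) with (lead b * x * ln x + hper b (ln x / ln b) * x) by reflexivity.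
    rewrite RtoC_minus, RtoC_plus, !RtoC_mult; ring.
Qed.

Lemma abel_partial (b : R) (N : nat) (s : C) : 1 < b ->
  csum (fun n => (RtoC (Sr b (INR n + 2)) - RtoC (Sr b (INR n + 1))) * xpow (INR n + 1) (- s))%C N =
  (RtoC (Sr b (INR N + 1)) * xpow (INR N + 1) (- s) - RtoC (Sr b 1)
   + csum (fun n => RtoC (Sr b (INR n + 2)) * (xpow (INR n + 1) (- s) - xpow (INR n + 2) (- s))) N)%C.
Proof.
  intros Hb; induction N as [|N IH].
  - simpl; rewrite Rplus_0_l, xpow_1_l; ring.
  - simpl csum; rewrite IH, S_INR; replace (INR N + 1 + 1) with (INR N + 2) by ring; ring.
Qed.

(** The boundary term S(N + 1) (N + 1)^(-s) tends to 0, since S(x) = O(x ln x) for large x and Re s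
    > 1; the rest is summed cell by cell. *)
Lemma Fb_cseries (b : R) (s : C) : 1 < b -> 1 < Re s ->
  is_cseries (fun n => (RtoC (Sr b (INR n + 2)) - RtoC (Sr b (INR n + 1))) * xpow (INR n + 1) (- s))%C (Fb b s).
Proof.
  intros Hb Hs.
  destruct (incr_mellin_exponent b s Hb ltac:(lra)) as [B1 [a1 [HB1 Ha1]]].
  destruct (hper_mellin_ok b Hb) as [B3 HB3].
  destruct (hper_bounded b Hb) as [H [PH HH]].
  assert (Hn : (s - 1)%C <> RtoC 0) by (apply neq_of_Re; rewrite re_RtoC; lra).
  assert (L : is_cseries (fun n => RtoC (Sr b (INR n + 2)) * (xpow (INR n + 1) (- s) - xpow (INR n + 2) (- s)))%C
    (s * (mellin (incr b) (s + 1) + (lead b * mellin (fun _ x => RtoC (ln x)) s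
      + mellin (fun _ x => RtoC (hper b (ln x / ln b))) s)))%C).
  { apply (is_cseries_ext (fun n => s * (mellin_term (incr b) n (s + 1) + (lead b * mellin_term (fun _ x => RtoC (ln x)) n s
      + mellin_term (fun _ x => RtoC (hper b (ln x / ln b))) n s)))%C); [ intros n; symmetry; apply abel_step, Hb | ].
    apply is_cseries_scal, is_cseries_plus; [ apply (mellin_series _ B1 a1); assumption | ].
    apply is_cseries_plus.
    - apply is_cseries_scal, (mellin_series _ (/ ((Re s - 1) / 2)) ((Re s - 1) / 2)); [ apply ln_mellin_ok; lra | lra ].
    - apply (mellin_series _ B3 0); [ exact HB3 | lra ]. }
  rewrite ln_mellin, hper_mellin in L by assumption.
  assert (Hr : Re (1 - s)%C < 0) by (rewrite re_minus, re_RtoC; lra).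
  assert (L0 : Clim (fun N => RtoC (Sr b (INR N + 1)) * xpow (INR N + 1) (- s))%C 0).
  { apply (Clim_ext (fun N => lead b * (RtoC (ln (INR N + 1)) * xpow (INR N + 1) (1 - s))
      + RtoC (hper b (ln (INR N + 1) / ln b)) * xpow (INR N + 1) (1 - s))%C).
    - intros N; pose proof (pos_INR N); replace (1 - s)%C with (1 + - s)%C by ring.
      rewrite xpow_plus, xpow_1_r by lra.
      replace (RtoC (Sr b (INR N + 1))) with (lead b * RtoC (INR N + 1) * ln (INR N + 1)
        + hper b (ln (INR N + 1) / ln b) * RtoC (INR N + 1))%C by (unfold Sr; rewrite (RtoC_plus (lead b * _ * _)), !RtoC_mult; reflexivity).
      ring.
    - replace (RtoC 0) with (lead b * 0 + 0)%C by ring.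
      apply Clim_plus; [ apply Clim_scal, ln_xpow_lim, Hr | ].
      apply (bounded_xpow_lim (fun N => hper b (ln (INR N + 1) / ln b)) H); [ intros; apply HH | exact Hr ]. }
  unfold is_cseries.
  eapply Clim_ext; [ intros N; symmetry; apply abel_partial, Hb | ].
  replace (Fb b s) with (0 - RtoC (Sr b 1) + s * (mellin (incr b) (s + 1) + (lead b * / (s - 1) ^ 2
      + ln b * laplace (hper b) ((1 - s) * ln b) / Den b s)))%C by (unfold Fb, regular_part, Cdiv; ring).
  apply Clim_plus; [ apply Clim_minus; [ exact L0 | apply Clim_const ] | exact L ].
Qed.

Lemma Fb_dirichlet (b : R) (s : C) : 1 < b -> 1 < Re s -> is_dirichlet_series (d_beta b) s (Fb b s).
Proof.
  intros Hb Hs; unfold is_dirichlet_series; apply is_cseries_is_series.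
  eapply is_cseries_ext; [ | apply Fb_cseries; assumption ].
  intros n; unfold d_beta; rewrite !S_beta_Sr by exact Hb.
  replace (INR (n + 1 + 1)) with (INR n + 2) by (rewrite !plus_INR; simpl; ring).
  unfold nat_cpow, xpow; replace (INR (n + 1)) with (INR n + 1) by (rewrite plus_INR; simpl; ring); reflexivity.
Qed.

Lemma regular_part_cdiff (b : R) (s : C) : 1 < b -> 0 < Re s -> cdiff (regular_part b) s.
Proof.
  intros Hb Hs; destruct (incr_mellin_exponent b s Hb Hs) as [B [a [HB Ha]]].
  apply cdiff_plus; [ apply cdiff_const | apply cdiff_mult; [ apply cdiff_id | ] ].
  apply (cdiff_comp (fun s => s + 1)%C (mellin (incr b))); [ apply cdiff_plus; [ apply cdiff_id | apply cdiff_const ] | ].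
  apply (mellin_cdiff _ B a); assumption.
Qed.

Lemma hper_laplace_cdiff (b : R) (s : C) : 1 < b -> cdiff (fun s => laplace (hper b) ((1 - s) * ln b))%C s.
Proof.
  intros Hb; apply (cdiff_comp (fun s => (1 - s) * ln b)%C (laplace (hper b))).
  - apply cdiff_mult; [ apply cdiff_minus; [ apply cdiff_const | apply cdiff_id ] | apply cdiff_const ].
  - apply laplace_cdiff; intros; apply hper_continuous, Hb.
Qed.

Lemma Den_cdiff (b : R) (s : C) : cdiff (Den b) s.
Proof.
  apply cdiff_minus; [ apply cdiff_const | apply cdiff_xpow, cdiff_minus; [ apply cdiff_const | apply cdiff_id ] ].
Qed.

Lemma Den_1 (b : R) : Den b 1 = RtoC 0.
Proof. unfold Den; replace (1 - 1)%C with (RtoC 0) by ring; rewrite xpow_0_r; ring. Qed.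

Lemma Cpow_neq_0 (z : C) (n : nat) : z <> RtoC 0 -> (z ^ n)%C <> RtoC 0.
Proof. intros Hz; induction n as [|n IH]; simpl; [ intros E; injection E; lra | apply Cmult_neq_0; assumption ]. Qed.

Lemma main_double_cdiff (b : R) (s : C) : s <> RtoC 1 -> cdiff (fun s => s * lead b / (s - 1) ^ 2)%C s.
Proof.
  intros Hs; apply cdiff_div.
  - apply cdiff_mult; [ apply cdiff_id | apply cdiff_const ].
  - apply cdiff_pow, cdiff_minus; [ apply cdiff_id | apply cdiff_const ].
  - apply Cpow_neq_0; intros E; apply Hs; replace s with (s - 1 + 1)%C by ring; rewrite E; ring.
Qed.

Lemma Fb_cdiff (b : R) (s : C) : 1 < b -> 0 < Re s -> Den b s <> RtoC 0 -> cdiff (Fb b) s.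
Proof.
  intros Hb Hs Hd.
  assert (H1 : s <> RtoC 1) by (intros ->; apply Hd, Den_1).
  apply cdiff_plus.
  - apply cdiff_plus; [ apply regular_part_cdiff; assumption | apply main_double_cdiff, H1 ].
  - apply cdiff_mult; [ apply cdiff_id | apply cdiff_div; [ | apply Den_cdiff | exact Hd ] ].
    apply cdiff_mult; [ apply cdiff_const | apply hper_laplace_cdiff, Hb ].
Qed.

(** * Zeros of the denominator *)

Lemma Cexp_eq_1 (w : C) : Cexp w = RtoC 1 -> exists k : Z, w = ((0, 2 * PI * IZR k) : C).
Proof.
  intros E.
  assert (Er : Re w = 0).
  { assert (Em : Cmod (Cexp w) = 1) by (rewrite E; apply Cmod_1).
    rewrite Cmod_Cexp, <- exp_0 in Em; apply exp_inv, Em. }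
  assert (Es : sin (Im w) = 0).
  { apply (f_equal Im) in E; unfold Cexp in E; cbn [Im snd] in E; rewrite Er, exp_0, im_RtoC in E; lra. }
  destruct (sin_eq_0_0 _ Es) as [k Hk].
  (* A zero sine leaves the multiples of pi, and the odd ones give the value -1. *)
  destruct (Z.Even_or_Odd k) as [[m Hm]|[m Hm]]; subst k.
  - exists m; apply C_ext; cbn [Re Im fst snd]; [ exact Er | rewrite Hk, mult_IZR; ring ].
  - exfalso.
    assert (Ew : w = ((0, (2 * PI * IZR m)%R) + (0, PI))%C).
    { apply C_ext; rewrite ?re_plus, ?im_plus; cbn [Re Im fst snd]; [ lra | rewrite Hk, plus_IZR, mult_IZR; ring ]. }
    rewrite Ew, Cexp_plus, Cexp_2PI, Cmult_1_l in E; apply (f_equal Re) in E; unfold Cexp in E; cbn [Re Im fst snd] in E.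
    rewrite exp_0, cos_PI, re_RtoC in E; lra.
Qed.

Lemma Den_zero (b : R) (s : C) : 1 < b -> Den b s = RtoC 0 -> exists m : Z, s = (1 + tau b m)%C.
Proof.
  intros Hb E; pose proof (ln_gt_0 b Hb) as Hl.
  assert (E1 : Cexp ((1 - s) * ln b) = RtoC 1).
  { change (xpow b (1 - s) = RtoC 1); replace (xpow b (1 - s)) with (1 - Den b s)%C by (unfold Den; ring); rewrite E; ring. }
  destruct (Cexp_eq_1 _ E1) as [k Hk].
  exists (- k)%Z; rewrite tau_val, opp_IZR by exact Hb.
  assert (Hlc : RtoC (ln b) <> RtoC 0) by (intros F; injection F; lra).
  replace s with (1 - ((1 - s) * ln b) * / ln b)%C by (field; exact Hlc).
  rewrite Hk, <- RtoC_inv by lra; apply C_ext; unfold Re, Im; simpl; field; lra.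
Qed.

Lemma Cexp_tau (b : R) (m : Z) : 1 < b -> Cexp (- (tau b m * ln b)) = RtoC 1.
Proof.
  intros Hb; pose proof (ln_gt_0 b Hb) as Hl; rewrite <- (Cexp_2PI (- m)); f_equal.
  rewrite tau_val, opp_IZR by exact Hb; apply C_ext; unfold Re, Im; simpl; field; lra.
Qed.

(** (e^w - 1) / w with its singularity at 0 filled in: as an integral it is visibly holomorphic,
    with value 1 at 0. *)
Definition Eint (w : C) : C := laplace (fun _ => 1) w.

Lemma Eint_0 : Eint 0 = RtoC 1.
Proof.
  unfold Eint, laplace; rewrite (CInt_ext _ (fun _ => RtoC 1)); [ rewrite CInt_const; rewrite Rminus_0_r; ring | lra | ].
  intros u _; replace (RtoC u * 0)%C with (RtoC 0) by ring; rewrite Cexp_0; ring.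
Qed.

(** [tau b m * ln b] is 2 pi i m, so b^(1 - s) depends only on s - (1 + [tau b m]). As [Eint] is 1
    at 0, each zero is simple, with an explicit cofactor. *)
Lemma Den_factor (b : R) (m : Z) (s : C) : 1 < b ->
  Den b s = ((s - (1 + tau b m)) * (ln b * Eint (- ((s - (1 + tau b m)) * ln b))))%C.
Proof.
  intros Hb; set (v := (- ((s - (1 + tau b m)) * ln b))%C).
  assert (E : xpow b (1 - s) = Cexp v).
  { unfold xpow; replace ((1 - s) * ln b)%C with (v + - (tau b m * ln b))%C by (unfold v; ring).
    rewrite Cexp_plus, Cexp_tau by exact Hb; ring. }
  unfold Den; rewrite E; replace (1 - Cexp v)%C with (- (Cexp v - 1))%C by ring.
  rewrite Cexp_sub1_int.
  replace (CInt (fun t => Cexp (RtoC t * v)) 0 1) with (Eint v).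
  - unfold v at 1; ring.
  - unfold Eint, laplace; apply CInt_ext; [ lra | intros; ring ].
Qed.

(** The last term of [Fb] times s - (1 + [tau b m]), in a form that is defined at the pole; its
    factor ln b has cancelled against the one in [Den_factor]. *)
Definition Quo (b : R) (m : Z) (s : C) : C :=
  (s * laplace (hper b) ((1 - s) * ln b) / Eint (- ((s - (1 + tau b m)) * ln b)))%C.

Lemma Eint_shift_cdiff (b : R) (m : Z) (s : C) : cdiff (fun s => Eint (- ((s - (1 + tau b m)) * ln b)))%C s.
Proof.
  apply (cdiff_comp (fun s => - ((s - (1 + tau b m)) * ln b))%C Eint).
  - apply cdiff_opp, cdiff_mult; [ apply cdiff_minus; [ apply cdiff_id | apply cdiff_const ] | apply cdiff_const ].
  - apply (laplace_cdiff (fun _ => 1)); intros; apply continuous_const.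
Qed.

Lemma Quo_near (b : R) (m : Z) : 1 < b -> exists d, 0 < d /\ d <= 1 /\ forall s, Cmod (s - (1 + tau b m)) < d ->
  cdiff (Quo b m) s /\ 0 < Re s /\
  (s <> (1 + tau b m)%C -> (s * (ln b * laplace (hper b) ((1 - s) * ln b) / Den b s))%C = (Quo b m s / (s - (1 + tau b m)))%C).
Proof.
  intros Hb; pose proof (ln_gt_0 b Hb) as Hl; set (z0 := (1 + tau b m)%C).
  assert (Hlc : RtoC (ln b) <> RtoC 0) by (intros F; injection F; lra).
  destruct (ccts_neq_0 (fun s => Eint (- ((s - z0) * ln b)))%C z0) as [d [Pd Hd]].
  - apply cdiff_ccts, Eint_shift_cdiff.
  - replace (- ((z0 - z0) * ln b))%C with (RtoC 0) by ring; rewrite Eint_0; intros E; injection E; lra.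
  (* Radius at most 1 keeps the disc in Re s > 0, where [regular_part] is holomorphic. *)
  - exists (Rmin d 1); split; [ apply Rmin_glb_lt; lra | split; [ apply Rmin_r | intros s Hs ] ].
    pose proof (Rmin_l d 1); pose proof (Rmin_r d 1).
    destruct (Hd s ltac:(lra)) as [_ Hn]; split; [ | split ].
    + apply cdiff_div; [ | apply Eint_shift_cdiff | exact Hn ].
      apply cdiff_mult; [ apply cdiff_id | apply hper_laplace_cdiff, Hb ].
    + assert (Rz : Re z0 = 1) by (unfold z0; rewrite tau_val, re_plus, re_RtoC by exact Hb; simpl; ring).
      pose proof (re_le_Cmod (s - z0)) as T; rewrite re_minus, Rz in T.
      revert T; unfold Rabs; destruct (Rcase_abs (Re s - 1)); lra.
    + intros Hne.
      assert (Hs0 : (s - z0)%C <> RtoC 0) by (intros E; apply Hne; replace s with (s - z0 + z0)%C by ring; rewrite E; ring).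
      rewrite (Den_factor b m s Hb); fold z0; unfold Quo; fold z0; field; repeat split; assumption.
Qed.

(** At the pole the exponent (1 - s) ln b is - 2 pi i m, so the Laplace integral is a Fourier
    coefficient. The factor 1 + [tau b m] is the s in front; for m <> 0 it cancels the inverse
    factor in [c_beta]. *)
Lemma Quo_center (b : R) (m : Z) : 1 < b -> Quo b m (1 + tau b m)%C = ((1 + tau b m) * c_beta b m)%C.
Proof.
  intros Hb; pose proof (ln_gt_0 b Hb) as Hl; unfold Quo.
  replace (- ((1 + tau b m - (1 + tau b m)) * ln b))%C with (RtoC 0) by ring; rewrite Eint_0.
  rewrite <- fcoeff_c_beta by exact Hb.
  replace (laplace (hper b) ((1 - (1 + tau b m)) * ln b)) with (fcoeff b m).
  - field; intros E; injection E; lra.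
  - unfold fcoeff, laplace; apply CInt_ext; [ lra | intros u _; f_equal; unfold char; f_equal ].
    rewrite tau_val by exact Hb; apply C_ext; unfold Re, Im; simpl; field; lra.
Qed.

Lemma tau_0 (b : R) : 1 < b -> (1 + tau b 0)%C = RtoC 1.
Proof. intros Hb; pose proof (ln_gt_0 b Hb); rewrite tau_val by exact Hb; apply C_ext; unfold Re, Im; simpl; field; lra. Qed.

Lemma sub_neq_0 (s z : C) : s <> z -> (s - z)%C <> RtoC 0.
Proof. intros H E; apply H; replace s with (s - z + z)%C by ring; rewrite E; ring. Qed.

(** * Poles, Laurent expansion and residues *)

Lemma Fb_pole_1 (b : R) : 1 < b -> pole_of_order (Fb b) (RtoC 1) 2.
Proof.
  intros Hb; destruct (Quo_near b 0 Hb) as [d [Pd [Qd Hd]]]; rewrite (tau_0 b Hb) in Hd.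
  (* The witness is (s - 1)^2 times F; at 1 only its first term survives, with the value [lead b] >
     0. *)
  split; [ lia | exists (fun s => s * lead b + (s - 1) * Quo b 0 s + (s - 1) ^ 2 * regular_part b s)%C; repeat split ].
  - apply (holomorphic_at_cdiff _ _ d Pd); intros w Hw; destruct (Hd w Hw) as [D1 [D2 _]].
    assert (Dm : cdiff (fun s => s - 1)%C w) by (apply cdiff_minus; [ apply cdiff_id | apply cdiff_const ]).
    apply cdiff_plus; [ apply cdiff_plus; apply cdiff_mult | apply cdiff_mult ].
    + apply cdiff_id.
    + apply cdiff_const.
    + exact Dm.
    + exact D1.
    + apply cdiff_pow, Dm.
    + apply regular_part_cdiff; assumption.
  - replace (1 * lead b + (1 - 1) * Quo b 0 1 + (1 - 1) ^ 2 * regular_part b 1)%C with (RtoC (lead b)) by ring.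
    intros E; injection E; pose proof (lead_pos b Hb); lra.
  - apply locally'_Cmod; exists d; split; [ exact Pd | intros w Hw Hne ].
    destruct (Hd w Hw) as [_ [_ E]]; unfold Fb; rewrite (E Hne).
    field; apply sub_neq_0, Hne.
Qed.

(** The remainder is [regular_part] plus the difference quotient of [Quo b 0] at 1, which extends
    holomorphically and so is bounded near 1. *)
Lemma Fb_laurent_1 (b : R) : 1 < b -> exists M,
  locally' (RtoC 1) (fun s => Cmod (Fb b s - (lead b / (s - 1) ^ 2
    + (lead b * ln (2 * PI) - (b + 1) / 4)%R / (s - 1)))%C <= M).
Proof.
  intros Hb; destruct (Quo_near b 0 Hb) as [d [Pd [Qd Hd]]].
  pose proof (Quo_center b 0 Hb) as Qc; rewrite (tau_0 b Hb) in Hd, Qc.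
  destruct (difference_quotient_cdiff (Quo b 0) (RtoC 1) d Pd ltac:(intros z Hz; apply Hd, Hz)) as [g [G1 G2]].
  destruct (ccts_bounded (fun s => regular_part b s + g s)%C (RtoC 1)) as [e [Pe He]].
  { apply cdiff_ccts, cdiff_plus; [ apply regular_part_cdiff; [ exact Hb | rewrite re_RtoC; lra ] | ].
    apply G1; replace (RtoC 1 - RtoC 1)%C with (RtoC 0) by ring; rewrite Cmod_0; lra. }
  eexists; apply locally'_Cmod; exists (Rmin e (d / 3)); split; [ apply Rmin_glb_lt; lra | intros w Hw Hne ].
  pose proof (Rmin_l e (d / 3)); pose proof (Rmin_r e (d / 3)).
  eapply Rle_trans; [ | apply (He w); lra ].
  apply Req_le; f_equal; rewrite (G2 w) by (assumption || lra).
  destruct (Hd w ltac:(lra)) as [_ [_ E]]; unfold Fb; rewrite (E Hne), Qc.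
  (* With s = 1 + (s - 1), the double pole term s [lead b] / (s - 1)^2 contributes [lead b] to the
     residue; it cancels the - [lead b] in [c_beta b 0]. *)
  replace (c_beta b 0) with (RtoC (lead b * ln (2 * PI) - (b + 1) / 4 - lead b)) by
    (unfold c_beta; simpl; f_equal; unfold lead; ring).
  set (r := lead b * ln (2 * PI) - (b + 1) / 4); rewrite RtoC_minus.
  field; apply sub_neq_0, Hne.
Qed.

Lemma tau_neq_0 (b : R) (m : Z) : 1 < b -> m <> 0%Z -> Im (tau b m) <> 0.
Proof.
  intros Hb Hm; pose proof (ln_gt_0 b Hb) as Hl; pose proof PI_RGT_0; rewrite tau_val by exact Hb; cbn [Im snd]; intros E.
  apply Hm, eq_IZR.
  assert (E' : 2 * PI * IZR m = 0) by (replace (2 * PI * IZR m) with (2 * PI * IZR m / ln b * ln b) by (field; lra); rewrite E; ring).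
  nra.
Qed.

Lemma Quo_residue (b : R) (m : Z) : 1 < b -> m <> 0%Z ->
  Quo b m (1 + tau b m)%C = (- ((b - 1) / (2 * PI * Ci * IZR m)) * riemann_zeta (tau b m))%C.
Proof.
  intros Hb Hm; rewrite Quo_center by exact Hb; unfold c_beta; destruct (Z.eq_dec m 0) as [E|_]; [ contradiction | ].
  assert (T4 : (1 + tau b m)%C <> RtoC 0).
  { intros E; apply (f_equal Im) in E; rewrite im_plus, !im_RtoC in E; apply (tau_neq_0 b m Hb Hm); lra. }
  set (X := (- ((b - 1) / (2 * PI * Ci * IZR m)))%C); field; exact T4.
Qed.

Lemma Fb_residue_neq_0 (b : R) (m : Z) : 1 < b -> m <> 0%Z ->
  (- ((b - 1) / (2 * PI * Ci * IZR m)) * riemann_zeta (tau b m))%C <> RtoC 0.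
Proof.
  intros Hb Hm; pose proof (tau_neq_0 b m Hb Hm) as Ht; pose proof PI_RGT_0.
  apply Cmult_neq_0.
  - intros E.
    assert (E2 : (2 * PI * Ci * IZR m)%C <> RtoC 0).
    { intros F; apply (f_equal Im) in F; revert F; unfold Im; simpl; intros F; apply Hm, eq_IZR; nra. }
    assert (E3 : (RtoC b - 1)%C = RtoC 0).
    { revert E E2; generalize (2 * PI * Ci * IZR m)%C; intros X E E2.
      replace (RtoC b - 1)%C with (- X * - ((b - 1) / X))%C by (field; exact E2); rewrite E; ring. }
    apply (f_equal Re) in E3; rewrite re_minus, !re_RtoC in E3; lra.
  - rewrite riemann_zeta_zeta0 by (try exact Ht; rewrite tau_val by exact Hb; simpl; lra).
    rewrite tau_val in * by exact Hb; apply zeta0_line_zero, Ht.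
Qed.

Lemma Fb_near_tau (b : R) (m : Z) : 1 < b -> m <> 0%Z -> exists d, 0 < d /\ forall s, Cmod (s - (1 + tau b m)) < d ->
  cdiff (Quo b m) s /\ cdiff (fun s => regular_part b s + s * lead b / (s - 1) ^ 2)%C s /\
  (s <> (1 + tau b m)%C ->
   Fb b s = (regular_part b s + s * lead b / (s - 1) ^ 2 + Quo b m s / (s - (1 + tau b m)))%C).
Proof.
  intros Hb Hm; pose proof (tau_neq_0 b m Hb Hm) as Ht.
  destruct (Quo_near b m Hb) as [d [Pd [Qd Hd]]].
  assert (Pt : 0 < Cmod (tau b m)).
  { apply Cmod_gt_0; intros E; apply Ht; rewrite E; apply im_RtoC. }
  (* A radius of at most |[tau b m]| keeps the double pole at 1 out of the disc. *)
  exists (Rmin d (Cmod (tau b m))); split; [ apply Rmin_glb_lt; lra | intros s Hs ].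
  pose proof (Rmin_l d (Cmod (tau b m))); pose proof (Rmin_r d (Cmod (tau b m))).
  destruct (Hd s ltac:(lra)) as [D1 [D2 D3]]; split; [ exact D1 | split ].
  - apply cdiff_plus; [ apply regular_part_cdiff; assumption | apply main_double_cdiff ].
    intros ->; replace (1 - (1 + tau b m))%C with (- tau b m)%C in Hs by ring; rewrite Cmod_opp in Hs; lra.
  - intros Hne; unfold Fb; rewrite (D3 Hne); reflexivity.
Qed.

Lemma Fb_pole_tau (b : R) (m : Z) : 1 < b -> m <> 0%Z -> pole_of_order (Fb b) (1 + tau b m)%C 1.
Proof.
  intros Hb Hm; destruct (Fb_near_tau b m Hb Hm) as [d [Pd Hd]].
  split; [ lia | ].
  (* The witness is F times s - (1 + [tau b m]); its value at the pole is the residue. *)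
  exists (fun s => (s - (1 + tau b m)) * (regular_part b s + s * lead b / (s - 1) ^ 2) + Quo b m s)%C; repeat split.
  - apply (holomorphic_at_cdiff _ _ d Pd); intros w Hw; destruct (Hd w Hw) as [D1 [D2 _]].
    apply cdiff_plus; [ apply cdiff_mult; [ apply cdiff_minus; [ apply cdiff_id | apply cdiff_const ] | exact D2 ] | exact D1 ].
  - match goal with |- (?p * ?q + ?r)%C <> _ => replace (p * q + r)%C with r by ring end.
    rewrite Quo_residue by assumption; apply Fb_residue_neq_0; assumption.
  - apply locally'_Cmod; exists d; split; [ exact Pd | intros w Hw Hne ].
    destruct (Hd w Hw) as [_ [_ E]]; rewrite (E Hne).
    set (X := (regular_part b w + w * lead b / (w - 1) ^ 2)%C); field; apply sub_neq_0, Hne.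
Qed.

Lemma Fb_residue_tau (b : R) (m : Z) : 1 < b -> m <> 0%Z ->
  is_residue (Fb b) (1 + tau b m)%C (- ((b - 1) / (2 * PI * Ci * IZR m)) * riemann_zeta (tau b m))%C.
Proof.
  intros Hb Hm; destruct (Fb_near_tau b m Hb Hm) as [d [Pd Hd]]; rewrite <- Quo_residue by assumption.
  set (z0 := (1 + tau b m)%C) in *.
  destruct (difference_quotient_cdiff (Quo b m) z0 d Pd ltac:(intros z Hz; apply Hd, Hz)) as [g [G1 G2]].
  (* The upper index 0 of [sum_n] leaves the single term j = 0, the simple pole. *)
  exists O, (fun _ => Quo b m z0), (fun s => regular_part b s + s * lead b / (s - 1) ^ 2 + g s)%C; repeat split.
  - apply (holomorphic_at_cdiff _ _ (d / 3)); [ lra | intros w Hw; apply cdiff_plus; [ apply Hd; lra | apply G1, Hw ] ].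
  - apply locally'_Cmod; exists (d / 3); split; [ lra | intros w Hw Hne ].
    destruct (Hd w ltac:(lra)) as [_ [_ E]]; rewrite (E Hne), sum_O, (G2 w Hw Hne).
    set (X := (regular_part b w + w * lead b / (w - 1) ^ 2)%C); simpl; field; apply sub_neq_0, Hne.
Qed.

(** Were z a pole, f w (w - z)^n - g w would be continuous at z and vanish on a punctured
    neighbourhood, although its value at z is - g z <> 0. *)
Lemma ccts_not_pole (f : C -> C) (z : C) : ccts f z -> ~ is_pole f z.
Proof.
  intros Hf [n [Hn [g [Hg [Gz L]]]]].
  apply locally'_Cmod in L; destruct L as [d [Pd Hd]].
  assert (Cg : ccts g z).
  { apply cdiff_ccts, cdiff_C_differentiable; unfold holomorphic_at in Hg; apply locally_Cmod in Hg.
    destruct Hg as [e [Pe He]]; apply He; replace (z - z)%C with (RtoC 0) by ring; rewrite Cmod_0; exact Pe. }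
  set (p := fun w => (f w * (w - z) ^ n + - (1) * g w)%C).
  assert (Cp : ccts p z).
  { apply ccts_plus; apply ccts_mult; [ exact Hf | | apply ccts_const | exact Cg ].
    apply cdiff_ccts, cdiff_pow, cdiff_minus; [ apply cdiff_id | apply cdiff_const ]. }
  assert (Pz : p z = (- g z)%C).
  { unfold p; destruct n as [|n]; [ lia | simpl; ring ]. }
  destruct (ccts_neq_0 p z Cp) as [e [Pe He]].
  { rewrite Pz; intros E; apply Gz; replace (g z) with (- - g z)%C by ring; rewrite E; ring. }
  set (r := Rmin d e / 2); assert (Pr : 0 < r) by (unfold r; assert (0 < Rmin d e) by (apply Rmin_glb_lt; lra); lra).
  assert (Hr : r < d /\ r < e) by (pose proof (Rmin_l d e); pose proof (Rmin_r d e); unfold r in *; lra).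
  set (w := (z + r)%C).
  assert (Ew : (w - z)%C = RtoC r) by (unfold w; ring).
  assert (Mw : Cmod (w - z) = r) by (rewrite Ew, Cmod_R, Rabs_right; lra).
  assert (Rn : RtoC r <> RtoC 0) by (intros E; injection E; lra).
  destruct (He w ltac:(lra)) as [_ N]; apply N; unfold p.
  rewrite (Hd w) by (try lra; intros E; apply Rn; rewrite <- Ew, E; ring).
  rewrite Ew; pose proof (Cpow_neq_0 _ n Rn) as Q; field; exact Q.
Qed.

Lemma Fb_pole_tau_any (b : R) (m : Z) : 1 < b -> is_pole (Fb b) (1 + tau b m)%C.
Proof.
  intros Hb; destruct (Z.eq_dec m 0) as [->|Hm].
  - rewrite tau_0 by exact Hb; exists 2%nat; apply Fb_pole_1, Hb.
  - exists 1%nat; apply Fb_pole_tau; assumption.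
Qed.

Lemma Fb_meromorphic (b : R) : 1 < b -> meromorphic_on (fun s => 0 < Re s) (Fb b).
Proof.
  intros Hb z Hz; destruct (classic (Den b z = RtoC 0)) as [E|N].
  - right; destruct (Den_zero b z Hb E) as [m ->]; apply Fb_pole_tau_any, Hb.
  - left; destruct (ccts_neq_0 (Den b) z (cdiff_ccts _ _ (Den_cdiff b z)) N) as [d [Pd Hd]].
    apply (holomorphic_at_cdiff _ _ (Rmin d (Re z))); [ apply Rmin_glb_lt; assumption | intros w Hw ].
    pose proof (Rmin_l d (Re z)); pose proof (Rmin_r d (Re z)).
    apply Fb_cdiff; [ exact Hb | | apply Hd; lra ].
    pose proof (re_le_Cmod (w - z)) as T; rewrite re_minus in T.
    revert T; unfold Rabs; destruct (Rcase_abs (Re w - Re z)); lra.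
Qed.

Lemma Fb_poles (b : R) (s : C) : 1 < b -> 0 < Re s -> is_pole (Fb b) s -> exists m : Z, s = (1 + tau b m)%C.
Proof.
  intros Hb Hs Hp; apply (Den_zero b s Hb), NNPP; intros N.
  exact (ccts_not_pole _ _ (cdiff_ccts _ _ (Fb_cdiff b s Hb Hs N)) Hp).
Qed.

Theorem theorem1p4 (beta : R) (hbeta : 1 < beta) :
  exists F : C -> C,
    (forall s : C, 1 < Re s -> is_dirichlet_series (d_beta beta) s (F s)) /\
    meromorphic_on (fun s : C => 0 < Re s) F /\
    (forall s : C, 0 < Re s -> is_pole F s ->
       exists m : Z, s = (1 + tau beta m)%C) /\
    pole_of_order F (RtoC 1) 2 /\
    (exists M : R,
       locally' (RtoC 1) (fun s : C =>
         Cmod (F s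
               - (((beta - 1) / (2 * ln beta))%R / (s - 1) ^ 2
                  + ((beta - 1) / (2 * ln beta) * ln (2 * PI)
                     - (beta + 1) / 4)%R / (s - 1)))%C <= M)) /\
    (forall m : Z, m <> 0%Z ->
       pole_of_order F (1 + tau beta m)%C 1 /\
       is_residue F (1 + tau beta m)%C
         (- ((beta - 1) / (2 * PI * Ci * IZR m))
          * riemann_zeta (tau beta m))%C).
Proof.
  exists (Fb beta); repeat split.
  - intros s Hs; apply Fb_dirichlet; assumption.
  - apply Fb_meromorphic, hbeta.
  - intros s Hs Hp; apply Fb_poles; assumption.
  - lia.
  - apply Fb_pole_1, hbeta.
  - exact (Fb_laurent_1 beta hbeta).
  - lia.
  - apply Fb_pole_tau; assumption.
  - apply Fb_residue_tau; assumption.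
Qed.
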